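(* Let $\mathbf{M}=(M_p)_{p\in\mathbb{N}}$ be a weight sequence satisfying (lc) and (dc), with quotients $m_p=M_{p+1}/M_p$, and let $\mathbf{A}=(A_p)_{p\in\mathbb{N}}$ be a weight sequence satisfying (wlc) and (nq). Then the following statements are equivalent: (i) $\displaystyle\sum_{p=0}^\infty \frac{1}{((p+1)m_p)^{1/2}}=\infty$. (ii) The asymptotic Borel mapping $\mathcal{B}:\mathcal{A}_{\mathbf{M}}(\mathbb{H})\to\Lambda_{\mathbf{M}}$ is injective. (iii) The Stieltjes moment mapping $\mathcal{M}:C_{\mathbf{M}}[0,\infty)\to\Lambda_{\mathbf{M}}$ is injective. (iv) $\mathcal{M}:\mathcal{S}_{\mathbf{M}}(0,\infty)\to\Lambda_{\mathbf{M}}$ is injective. (v) $\mathcal{M}:\mathcal{S}_{\mathbf{M}}^{\mathbf{A}}(0,\infty)\to\Lambda_{\mathbf{M}}$ is injective.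
   Context: $\mathbb{N}=\{0,1,2,\dots\}$; $\mathbb{H}$ is the open upper half-plane of $\mathbb{C}$; $\mathcal{O}(\mathbb{H})$ is the space of holomorphic functions on $\mathbb{H}$. A sequence $\mathbf{M}=(M_p)_{p\in\mathbb{N}}$ of positive reals with $M_0=1$ is a weight sequence if $m_p:=M_{p+1}/M_p\to\infty$ as $p\to\infty$. Conditions on a sequence $\mathbf{M}$ of positive reals with $M_0=1$ (applied to $\mathbf{A}$ with $A_p$, $a_p=A_{p+1}/A_p$ in place of $M_p$, $m_p$): (lc) $M_p^2\le M_{p-1}M_{p+1}$ for all $p\ge 1$; (wlc) the sequence $(p!M_p)_{p}$ satisfies (lc); (dc) there are $C_0,H\ge1$ with $M_{p+1}\le C_0H^{p+1}M_p$ for all $p\in\mathbb{N}$; (nq) $\sum_{p=0}^\infty \frac{1}{(p+1)m_p}<\infty$. Spaces: $\mathcal{A}_{\mathbf{M}}(\mathbb{H})$ is the space of $f\in\mathcal{O}(\mathbb{H})$ for which there is $h>0$ with $\sup_{p\in\mathbb{N}}\sup_{z\in\mathbb{H}}\frac{|f^{(p)}(z)|}{h^pp!M_p}<\infty$. For such $f$, the limits $f^{(p)}(x):=\lim_{z\in\mathbb{H},z\to x}f^{(p)}(z)$ exist for all $x\in\mathbb{R}$, $p\in\mathbb{N}$. $\Lambda_{\mathbf{M}}$ is the space of complex sequences $(c_p)_{p\in\mathbb{N}}$ for which there is $h>0$ with $\sup_{p}\frac{|c_p|}{h^pp!M_p}<\infty$. $C_{\mathbf{M}}[0,\infty)$ is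 the space of $\varphi\in C([0,\infty))$ (complex-valued) for which there is $h>0$ with $\sup_{p\in\mathbb{N}}\sup_{x\ge0}\frac{x^p|\varphi(x)|}{h^pp!M_p}<\infty$. $\mathcal{S}_{\mathbf{M}}(0,\infty)$ is the space of $\varphi\in C^\infty(\mathbb{R})$ with $\operatorname{supp}\varphi\subseteq[0,\infty)$ for which there is $h>0$ such that for all $q\in\mathbb{N}$, $\sup_{p\in\mathbb{N}}\sup_{x\in\mathbb{R}}\frac{|x^p\varphi^{(q)}(x)|}{h^pp!M_p}<\infty$. $\mathcal{S}_{\mathbf{M}}^{\mathbf{A}}(0,\infty)$ is the space of $\varphi\in C^\infty(\mathbb{R})$ with $\operatorname{supp}\varphi\subseteq[0,\infty)$ for which there is $h>0$ with $\sup_{p,q\in\mathbb{N}}\sup_{x\in\mathbb{R}}\frac{|x^p\varphi^{(q)}(x)|}{h^{p+q}p!M_pq!A_q}<\infty$. The last two spaces are viewed as subspaces of $C_{\mathbf{M}}[0,\infty)$ by restriction to $[0,\infty)$. Mappings: $\mathcal{B}(f)=(f^{(p)}(0))_{p\in\mathbb{N}}$; $\mathcal{M}(\varphi)=(\mu_p(\varphi))_{p\in\mathbb{N}}$ with $\mu_p(\varphi)=\int_0^\infty x^p\varphi(x)\,dx$. These take values in $\Lambda_{\mathbf{M}}$ (for $\mathcal{M}$, because $\mathbf{M}$ satisfies (dc)). *)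

(* Defs.v *)
From Stdlib Require Import Arith Reals.
From Coquelicot Require Import Coquelicot.

Open Scope R_scope.

(** * Weight sequences *)

Definition quotient (M : nat -> R) (p : nat) : R := M (p + 1)%nat / M p.

Definition weight_sequence (M : nat -> R) : Prop :=
  M 0%nat = 1 /\ (forall p, 0 < M p) /\ is_lim_seq (quotient M) p_infty.

Definition lc (M : nat -> R) : Prop :=
  forall p, (1 <= p)%nat -> M p ^ 2 <= M (p - 1)%nat * M (p + 1)%nat.

Definition wlc (M : nat -> R) : Prop := lc (fun p => INR (fact p) * M p).

Definition dc (M : nat -> R) : Prop :=
  exists C0 H : R, 1 <= C0 /\ 1 <= H /\
    forall p, M (p + 1)%nat <= C0 * H ^ (p + 1) * M p.

Definition nq (M : nat -> R) : Prop :=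
  ex_series (fun p => 1 / ((INR p + 1) * quotient M p)).

(** * Holomorphic functions on the upper half-plane *)

Definition upper_half_plane (z : C) : Prop := 0 < Im z.

(** Elements of O(H) are represented by total functions on [C], of which only
    the values on the open set H matter. *)
Definition holomorphic_on_H (f : C -> C) : Prop :=
  forall z : C, upper_half_plane z ->
    ex_derive (K := C_AbsRing) (V := C_NormedModule) f z.

Fixpoint C_derive_n (f : C -> C) (p : nat) : C -> C :=
  match p with
  | O => f
  | S p => C_derive (C_derive_n f p)
  end.

(** The limit of [g z] as [z] tends to the real point [x] inside H;
    unspecified if there is no such limit. *)
Definition boundary_value (g : C -> C) (x : R) : C :=
  iota (T := C_CompleteNormedModule)
    (fun l : C =>
       filterlim g (within upper_half_plane (locally (RtoC x))) (locally l)).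

(** * Smooth complex-valued functions on the real line *)

Definition smooth (phi : R -> C) : Prop :=
  forall (q : nat) (x : R),
    ex_derive_n (fun t => Re (phi t)) q x /\
    ex_derive_n (fun t => Im (phi t)) q x.

Definition RC_derive_n (phi : R -> C) (q : nat) (x : R) : C :=
  (Derive_n (fun t => Re (phi t)) q x, Derive_n (fun t => Im (phi t)) q x).

(** Closure of the set where [phi] does not vanish. *)
Definition support (phi : R -> C) (x : R) : Prop :=
  forall eps : R, 0 < eps -> exists y, Rabs (y - x) < eps /\ phi y <> RtoC 0.

(** * Function and sequence spaces

    The finiteness of a supremum is written as the existence of an upper
    bound [B]. *)

Definition A_space (M : nat -> R) (f : C -> C) : Prop :=
  holomorphic_on_H f /\
  exists h : R, 0 < h /\ exists B : R,
    forall (p : nat) (z : C), upper_half_plane z ->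
      Cmod (C_derive_n f p z) / (h ^ p * INR (fact p) * M p) <= B.

Definition Lambda (M : nat -> R) (c : nat -> C) : Prop :=
  exists h : R, 0 < h /\ exists B : R,
    forall p : nat, Cmod (c p) / (h ^ p * INR (fact p) * M p) <= B.

(** Elements of C([0,oo)) are represented by total functions on [R], of which
    only the values on [0,oo) matter. *)
Definition C_space (M : nat -> R) (phi : R -> C) : Prop :=
  continuous_on (fun x : R => 0 <= x) phi /\
  exists h : R, 0 < h /\ exists B : R,
    forall (p : nat) (x : R), 0 <= x ->
      x ^ p * Cmod (phi x) / (h ^ p * INR (fact p) * M p) <= B.

Definition S_space (M : nat -> R) (phi : R -> C) : Prop :=
  smooth phi /\ (forall x : R, support phi x -> 0 <= x) /\
  exists h : R, 0 < h /\ forall q : nat, exists B : R,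
    forall (p : nat) (x : R),
      Cmod (RtoC (x ^ p) * RC_derive_n phi q x)%C
        / (h ^ p * INR (fact p) * M p) <= B.

Definition SA_space (M A : nat -> R) (phi : R -> C) : Prop :=
  smooth phi /\ (forall x : R, support phi x -> 0 <= x) /\
  exists h : R, 0 < h /\ exists B : R,
    forall (p q : nat) (x : R),
      Cmod (RtoC (x ^ p) * RC_derive_n phi q x)%C
        / (h ^ (p + q) * INR (fact p) * M p * INR (fact q) * A q) <= B.

(** * The Borel and Stieltjes moment mappings *)

Definition Borel (f : C -> C) (p : nat) : C :=
  boundary_value (C_derive_n f p) 0.

Definition moment (phi : R -> C) (p : nat) : C :=
  RInt_gen (V := C_R_CompleteNormedModule)
    (fun x : R => (RtoC (x ^ p) * phi x)%C)
    (at_point 0) (Rbar_locally p_infty).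

(** [T] maps the space [E] of functions on [D] into the sequence space [L],
    and is injective; two elements of [E] are equal when they agree on [D]. *)
Definition injective_map {X : Type} (D : X -> Prop) (E : (X -> C) -> Prop)
    (L : (nat -> C) -> Prop) (T : (X -> C) -> nat -> C) : Prop :=
  (forall f, E f -> L (T f)) /\
  forall f g, E f -> E g -> (forall p, T f p = T g p) ->
    forall x, D x -> f x = g x.

(* Main.v *)
(** All five statements reduce to the Denjoy-Carleman theorem for the weights
    [N_{2p} = p! M_p], whose quotients are the squares of
    [n_{2p} = n_{2p+1} = ((p + 1) m_p)^(1/2)].

    Suppose that the series (i) diverges. If [phi] in [C_M] has vanishing moments, put
    [psi y = |y| phi (y^2)]; the even function [rho |-> int psi(y) cos(rho y) dy] is flat at [0]
    and its [2p]-th derivative is bounded by [h^p p! M_p], so it vanishes by Bang's argument, and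
    [psi = 0] by uniqueness for the Fourier transform; this is (iii), and (iv), (v) are restrictions
    of it. If [f] in [A_M] is flat at [0], substitute [z = i / v] with [v] in the right half-plane:
    the function [rho |-> int f(i/v) v^(-3/2) exp(rho^2 v / 4) dv] over a vertical line is flat at
    [0], and the heat equation trades two derivatives in [rho] for one derivative of [f], so Bang's
    argument applies again.

    Suppose that the series converges. Iterated averages over intervals of lengths proportional to
    [1 / n_k] give a bump function [g] on [1, 5/2] with [|g^(k)| <= h^k n_0 ... n_{k-1}]. Its sine
    transform at [sqrt x] is a non-zero continuous function of [x >= 0] with vanishing moments and
    the decay of [C_M]; convolving it with a bump function in the class of [A] gives an element of
    [S_M^A], which contradicts (v). Finally [f(z) = int g(u) exp(- i u / z) du] is a non-zero
    element of [A_M] all of whose derivatives vanish at [0], since [d/dz] acts on [g] as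
    [- i (u g)''], which contradicts (ii). *)

Require Import Defs.
From Stdlib Require Import Reals Lra Lia Psatz Classical Arith.
From Coquelicot Require Import Coquelicot.

Open Scope R_scope.

(** * Integration over the real line *)

(** The exponent 1/2 in (i) has one source: in both uniqueness proofs the data control only every
    second derivative of the auxiliary function, each at the price of a factor (p + 1) m_p, so a
    single derivative is worth the square root of that factor. Flatness on the Borel side is
    Cauchy's theorem: at rho = 0 the integrand is O(|v|^(-2)) in the whole right half-plane, and the
    line can be pushed to infinity. The same shift kills the integral against exp(xi v) for xi < 0,
    while xi = rho^2 / 4 reaches xi >= 0; only together do they give the whole Fourier transform
    along the line. In the converse, the moments of the sine transform are, up to constants, the
    Taylor coefficients of the bump at 0, so the bump is supported away from 0. All improper
    integrals are restricted to continuous integrands that are O(1 / (1 + x^2)); for these, tails,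
    exchange of integrals and differentiation in a parameter have explicit constants. *)

Definition decays (K : R) (F : R -> R) : Prop :=
  (forall x, continuous F x) /\ forall x, Rabs (F x) <= K / (1 + x ^ 2).

Definition integrable (F : R -> R) : Prop := exists K, decays K F.

(** Only symmetric integer windows are used. Outside the class [integrable] the value may be a
    default of [Lim_seq] or [real]; inside it, [integral_tail] shows that every other exhausting
    window leads to the same number. *)
Definition integral (F : R -> R) : R :=
  real (Lim_seq (fun n => RInt F (- INR n) (INR n))).

Lemma continuous_ex_RInt (F : R -> R) (a b : R) :
  (forall x, continuous F x) -> ex_RInt F a b.
Proof. intros H; apply (ex_RInt_continuous F); auto. Qed.

Lemma is_derive_atan (x : R) : is_derive atan x (/ (1 + x ^ 2)).
Proof.
  apply is_derive_Reals, derivable_pt_lim_atan.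
Qed.

Lemma sq_pos (x : R) : 0 < 1 + x ^ 2.
Proof. nra. Qed.

Lemma continuous_inv_sq (K x : R) : continuous (fun x => K / (1 + x ^ 2)) x.
Proof.
  apply (ex_derive_continuous (fun x => K / (1 + x ^ 2))). auto_derive.
  generalize (sq_pos x); simpl; lra.
Qed.

Lemma is_RInt_inv_sq (K a b : R) :
  is_RInt (fun x => K / (1 + x ^ 2)) a b (K * atan b - K * atan a).
Proof.
  apply (is_RInt_derive (fun x => K * atan x)).
  - intros x _. unfold Rdiv. apply (is_derive_scal atan x K), is_derive_atan.
  - intros x _; apply continuous_inv_sq.
Qed.

Lemma Rabs_RInt_le (F g : R -> R) (a b l : R) :
  a <= b -> ex_RInt F a b -> is_RInt g a b l ->
  (forall x, a <= x <= b -> Rabs (F x) <= g x) -> Rabs (RInt F a b) <= l.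
Proof.
  intros Hab HF Hg Hle.
  apply (norm_RInt_le F g a b (RInt F a b) l Hab Hle); auto.
  now apply (RInt_correct F).
Qed.

Lemma atan_le (y : R) : 0 <= y -> atan y <= y.
Proof.
  intros Hy. destruct (Req_dec y 0) as [->|Hn]; [rewrite atan_0; lra|].
  destruct (MVT_gen atan 0 y (fun x => / (1 + x ^ 2))) as (c & Hc & E).
  - intros; apply is_derive_atan.
  - intros; apply continuity_pt_filterlim, (ex_derive_continuous atan).
    eexists; apply is_derive_atan.
  - rewrite atan_0 in E. assert (/ (1 + c ^ 2) <= 1).
    { rewrite <- Rinv_1. apply Rinv_le_contravar; nra. }
    nra.
Qed.

(** Comparison with the primitive [K * atan], together with atan b - atan a <= atan (1 / a) <= 1 /
    a. *)
Lemma tail_le (F : R -> R) (K a b : R) :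
  decays K F -> 0 < a -> a <= b ->
  Rabs (RInt F a b) <= K / a /\ Rabs (RInt F (- b) (- a)) <= K / a.
Proof.
  intros [HF HK] Ha Hab.
  assert (HK0 : 0 <= K).
  { specialize (HK 0). generalize (Rabs_pos (F 0)); simpl in HK; lra. }
  assert (E : atan b - atan a <= / a).
  { assert (A : atan (/ a) = PI / 2 - atan a) by (apply atan_inv; lra).
    assert (B : atan (/ b) = PI / 2 - atan b) by (apply atan_inv; lra).
    assert (0 < / a) by (apply Rinv_0_lt_compat; lra).
    assert (0 < / b) by (apply Rinv_0_lt_compat; lra).
    assert (atan (/ a) <= / a) by (apply atan_le; lra).
    assert (0 < atan (/ b)) by (rewrite <- atan_0; apply atan_increasing; lra).
    lra. }
  split.
  - apply Rle_trans with (K * atan b - K * atan a).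
    + apply Rabs_RInt_le with (fun x => K / (1 + x ^ 2)); auto.
      * now apply continuous_ex_RInt.
      * apply is_RInt_inv_sq.
    + unfold Rdiv; nra.
  - apply Rle_trans with (K * atan (- a) - K * atan (- b)).
    + apply Rabs_RInt_le with (fun x => K / (1 + x ^ 2)); auto.
      * lra.
      * now apply continuous_ex_RInt.
      * apply is_RInt_inv_sq.
    + rewrite !atan_opp. unfold Rdiv; nra.
Qed.

Lemma decays_pos (F : R -> R) (K : R) : decays K F -> 0 <= K.
Proof.
  intros [_ HK]. specialize (HK 0). generalize (Rabs_pos (F 0)); simpl in HK; lra.
Qed.

Lemma RInt_cont_Chasles (F : R -> R) (a b c : R) :
  (forall x, continuous F x) -> RInt F a b + RInt F b c = RInt F a c.
Proof.
  intros H. apply (RInt_Chasles F); now apply continuous_ex_RInt.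
Qed.

Lemma integral_lim (F : R -> R) (K : R) : decays K F ->
  is_lim_seq (fun n => RInt F (- INR n) (INR n)) (integral F).
Proof.
  intros HF. unfold integral.
  assert (HK := decays_pos _ _ HF).
  apply Lim_seq_correct', ex_lim_seq_cauchy_corr.
  intros eps.
  destruct (nfloor_ex (4 * K / eps + 1)) as [N [_ HN]].
  { assert (0 <= 4 * K / eps); [|lra]. apply Rdiv_le_0_compat; [lra|apply cond_pos]. }
  assert (H4 : 4 * K / eps < INR N).
  { lra. }
  assert (wlog : forall n m, (N <= n)%nat -> (n <= m)%nat ->
    Rabs (RInt F (- INR n) (INR n) - RInt F (- INR m) (INR m)) < eps).
  { intros n m Hn Hm. apply le_INR in Hn. apply le_INR in Hm.
    assert (Hp := cond_pos eps).
    assert (H0 : 0 <= 4 * K / eps) by (apply Rdiv_le_0_compat; lra).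
    assert (E : RInt F (- INR m) (INR m) =
      RInt F (- INR m) (- INR n) + RInt F (- INR n) (INR n) + RInt F (INR n) (INR m)).
    { rewrite !RInt_cont_Chasles; auto; apply HF. }
    rewrite E.
    destruct (tail_le F K (INR n) (INR m) HF) as [T1 T2]; [lra|lra|].
    assert (K / INR n < eps / 2).
    { apply Rmult_lt_reg_r with (INR n); [lra|]. unfold Rdiv at 1.
      rewrite Rmult_assoc, Rinv_l, Rmult_1_r by lra.
      assert (4 * K / eps * eps = 4 * K) by (field; lra). nra. }
    apply Rle_lt_trans with (Rabs (RInt F (- INR m) (- INR n)) + Rabs (RInt F (INR n) (INR m))).
    - rewrite <- Rabs_Ropp.
      replace (- _) with (RInt F (- INR m) (- INR n) + RInt F (INR n) (INR m)) by ring.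
      apply Rabs_triang.
    - lra. }
  exists N. intros n m Hn Hm. destruct (Nat.le_ge_cases n m) as [H|H].
  - now apply wlog.
  - rewrite Rabs_minus_sym. now apply wlog.
Qed.

Lemma integral_unique (F : R -> R) (l : R) :
  is_lim_seq (fun n => RInt F (- INR n) (INR n)) l -> integral F = l.
Proof. intros H. unfold integral. now rewrite (is_lim_seq_unique _ _ H). Qed.

(** Asymmetric windows are allowed because translating the integrand shifts the window, as in
    [integral_shift]. *)
Lemma integral_tail (F : R -> R) (K a b : R) : decays K F -> 0 < a -> 0 < b ->
  Rabs (RInt F (- a) b - integral F) <= K / a + K / b.
Proof.
  intros HF Ha Hb.
  assert (L := integral_lim F K HF).
  assert (L' : is_lim_seq (fun n => Rabs (RInt F (- a) b - RInt F (- INR n) (INR n)))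
                 (Rabs (RInt F (- a) b - integral F))).
  { apply (is_lim_seq_abs _ (Finite (RInt F (- a) b - integral F))).
    apply is_lim_seq_minus'; auto. apply is_lim_seq_const. }
  destruct (nfloor_ex (a + b)) as [N [_ HN]]; [lra|].
  apply (is_lim_seq_le_loc _ (fun _ => K / a + K / b) _ (K / a + K / b)) in L'; auto.
  - exists (S N). intros n Hn. apply le_INR in Hn. rewrite S_INR in Hn.
    assert (E : RInt F (- INR n) (INR n) =
      RInt F (- INR n) (- a) + RInt F (- a) b + RInt F b (INR n)).
    { rewrite !RInt_cont_Chasles; auto; apply HF. }
    destruct (tail_le F K a (INR n) HF) as [_ T2]; [lra|lra|].
    destruct (tail_le F K b (INR n) HF) as [T1 _]; [lra|lra|].
    rewrite E, <- Rabs_Ropp.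
    replace (- _) with (RInt F (- INR n) (- a) + RInt F b (INR n)) by ring.
    eapply Rle_trans; [apply Rabs_triang|]. lra.
  - apply is_lim_seq_const.
Qed.

Lemma decays_plus (K L : R) (F G : R -> R) :
  decays K F -> decays L G -> decays (K + L) (fun x => F x + G x).
Proof.
  intros [HF HK] [HG HL]; split.
  - intros x; now apply (continuous_plus F G).
  - intros x. eapply Rle_trans; [apply Rabs_triang|].
    specialize (HK x); specialize (HL x). unfold Rdiv in *; lra.
Qed.

Lemma decays_scal (c K : R) (F : R -> R) :
  decays K F -> decays (Rabs c * K) (fun x => c * F x).
Proof.
  intros [HF HK]; split.
  - intros x; now apply (continuous_scal_r c F).
  - intros x. rewrite Rabs_mult. specialize (HK x). unfold Rdiv in *.
    rewrite Rmult_assoc. apply Rmult_le_compat_l; auto. apply Rabs_pos.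
Qed.

Lemma decays_ext (K : R) (F G : R -> R) :
  (forall x, F x = G x) -> decays K F -> decays K G.
Proof.
  intros E [HF HK]; split; intros x.
  - apply (continuous_ext F G); auto.
  - now rewrite <- E.
Qed.

Lemma integrable_plus (F G : R -> R) :
  integrable F -> integrable G -> integrable (fun x => F x + G x).
Proof. intros [K HK] [L HL]. exists (K + L). now apply decays_plus. Qed.

Lemma integrable_scal (c : R) (F : R -> R) :
  integrable F -> integrable (fun x => c * F x).
Proof. intros [K HK]. eexists. now apply decays_scal, HK. Qed.

Lemma integrable_ext (F G : R -> R) :
  (forall x, F x = G x) -> integrable F -> integrable G.
Proof. intros E [K HK]. exists K. now apply (decays_ext K F G). Qed.

Lemma integrable_opp (F : R -> R) : integrable F -> integrable (fun x => - F x).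
Proof.
  intros H. apply (integrable_ext (fun x => (-1) * F x)); [intros; ring|].
  now apply integrable_scal.
Qed.

Lemma integrable_minus (F G : R -> R) :
  integrable F -> integrable G -> integrable (fun x => F x - G x).
Proof. intros HF HG. apply integrable_plus; auto. now apply integrable_opp. Qed.

Lemma integral_ext (F G : R -> R) : (forall x, F x = G x) -> integral F = integral G.
Proof.
  intros E. unfold integral. f_equal. apply Lim_seq_ext. intros n.
  apply (RInt_ext F G). auto.
Qed.

Lemma integral_plus (F G : R -> R) : integrable F -> integrable G ->
  integral (fun x => F x + G x) = integral F + integral G.
Proof.
  intros [K HF] [L HG]. apply integral_unique.
  apply is_lim_seq_ext with
    (fun n => RInt F (- INR n) (INR n) + RInt G (- INR n) (INR n)).
  - intros n. symmetry. apply (RInt_plus F G); apply continuous_ex_RInt; [apply HF|apply HG].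
  - apply is_lim_seq_plus'; eapply integral_lim; eauto.
Qed.

Lemma integral_scal (c : R) (F : R -> R) : integrable F ->
  integral (fun x => c * F x) = c * integral F.
Proof.
  intros [K HF]. apply integral_unique.
  apply is_lim_seq_ext with (fun n => c * RInt F (- INR n) (INR n)).
  - intros n. symmetry. apply (RInt_scal F). apply continuous_ex_RInt; apply HF.
  - apply (is_lim_seq_scal_l _ c (integral F)). eapply integral_lim; eauto.
Qed.

Lemma integral_opp (F : R -> R) : integrable F ->
  integral (fun x => - F x) = - integral F.
Proof.
  intros H. replace (- integral F) with ((-1) * integral F) by ring.
  rewrite <- integral_scal by auto. apply integral_ext; intros; ring.
Qed.

Lemma integral_minus (F G : R -> R) : integrable F -> integrable G ->
  integral (fun x => F x - G x) = integral F - integral G.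
Proof.
  intros HF HG. unfold Rminus. rewrite <- integral_opp by auto.
  apply integral_plus; auto. now apply integrable_opp.
Qed.

Lemma integral_le (F G : R -> R) : integrable F -> integrable G ->
  (forall x, F x <= G x) -> integral F <= integral G.
Proof.
  intros [K HF] [L HG] Hle.
  apply (is_lim_seq_le (fun n => RInt F (- INR n) (INR n))
     (fun n => RInt G (- INR n) (INR n)) (integral F) (integral G)).
  - intros n. assert (H := pos_INR n).
    apply (RInt_le F G); [lra| | |auto]; apply continuous_ex_RInt; [apply HF|apply HG].
  - eapply integral_lim; eauto.
  - eapply integral_lim; eauto.
Qed.

(** The mass of 1 / (1 + x^2) is pi, rounded up to 4. *)
Lemma integral_bound (F : R -> R) (K : R) : decays K F -> Rabs (integral F) <= 4 * K.
Proof.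
  intros HF. assert (L := integral_lim F K HF).
  apply is_lim_seq_abs in L.
  apply (is_lim_seq_le _ (fun _ => 4 * K) _ (4 * K)) in L; auto.
  - intros n. assert (HK := decays_pos _ _ HF). assert (Hn := pos_INR n).
    apply Rle_trans with (K * atan (INR n) - K * atan (- INR n)).
    + apply Rabs_RInt_le with (fun x => K / (1 + x ^ 2)).
      * lra.
      * apply continuous_ex_RInt, HF.
      * apply is_RInt_inv_sq.
      * intros; apply HF.
    + rewrite atan_opp. destruct (atan_bound (INR n)) as [_ B].
      generalize PI_4; intros. nra.
  - apply is_lim_seq_const.
Qed.

Lemma integral_ge0 (F : R -> R) : integrable F -> (forall x, 0 <= F x) -> 0 <= integral F.
Proof.
  intros HF H. replace 0 with (0 * integral F) by ring. rewrite <- integral_scal by auto.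
  apply integral_le; auto.
  - now apply integrable_scal.
  - intros x; specialize (H x); lra.
Qed.

Lemma RInt_ge_window (F : R -> R) (a b x0 d m : R) :
  (forall x, continuous F x) -> 0 < d -> a <= x0 - d -> x0 + d <= b ->
  (forall x, a <= x <= b -> 0 <= F x) ->
  (forall x, Rabs (x - x0) <= d -> m <= F x) -> 2 * d * m <= RInt F a b.
Proof.
  intros HF Hd Ha Hb H0 Hm.
  rewrite <- (RInt_cont_Chasles F a (x0 - d) b) by auto.
  rewrite <- (RInt_cont_Chasles F (x0 - d) (x0 + d) b) by auto.
  assert (0 <= RInt F a (x0 - d)).
  { apply RInt_ge_0; [lra|now apply continuous_ex_RInt|]. intros; apply H0; lra. }
  assert (0 <= RInt F (x0 + d) b).
  { apply RInt_ge_0; [lra|now apply continuous_ex_RInt|]. intros; apply H0; lra. }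
  assert (2 * d * m <= RInt F (x0 - d) (x0 + d)).
  { replace (2 * d * m) with (RInt (fun _ => m) (x0 - d) (x0 + d)).
    - apply RInt_le; [lra|apply ex_RInt_const|now apply continuous_ex_RInt|].
      intros x Hx; apply Hm, Rabs_le; lra.
    - rewrite RInt_const. unfold scal; simpl; unfold mult; simpl; ring. }
  lra.
Qed.

Lemma integral_gt0 (F : R -> R) (x0 : R) : integrable F -> (forall x, 0 <= F x) ->
  0 < F x0 -> 0 < integral F.
Proof.
  intros [K HF] H0 Hx.
  assert (HC := proj1 HF x0).
  assert (Hl : locally x0 (fun x => F x0 / 2 <= F x)).
  { assert (E : 0 < F x0 / 2) by lra.
    generalize (proj1 (filterlim_locally F (F x0)) HC (mkposreal _ E)).
    apply filter_imp. intros x Hb. unfold ball in Hb; simpl in Hb.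
    unfold AbsRing_ball, abs, minus, plus, opp in Hb; simpl in Hb.
    apply Rabs_lt_between in Hb. lra. }
  destruct Hl as [d Hd].
  assert (Hd2 : 0 < d / 2) by (generalize (cond_pos d); lra).
  apply Rlt_le_trans with (2 * (d / 2) * (F x0 / 2)); [nra|].
  apply (is_lim_seq_le_loc (fun _ => 2 * (d / 2) * (F x0 / 2))
     (fun n => RInt F (- INR n) (INR n)) (2 * (d / 2) * (F x0 / 2)) (integral F)).
  - destruct (nfloor_ex (Rabs x0 + d)) as [N [_ HN]].
    { generalize (Rabs_pos x0); lra. }
    exists (S N). intros n Hn. apply le_INR in Hn. rewrite S_INR in Hn.
    assert (A := Rle_abs x0). assert (B := Rle_abs (- x0)). rewrite Rabs_Ropp in B.
    apply RInt_ge_window with x0; auto; try lra.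
    + apply HF.
    + intros x Hx2. apply Hd. unfold ball; simpl.
      unfold AbsRing_ball, abs, minus, plus, opp; simpl.
      replace (x + - x0) with (x - x0) by ring. lra.
  - apply is_lim_seq_const.
  - eapply integral_lim; eauto.
Qed.

Lemma integral_zero (F : R -> R) : (forall x, F x = 0) -> integral F = 0.
Proof.
  intros H. apply integral_unique.
  apply is_lim_seq_ext with (fun _ => 0); [|apply is_lim_seq_const].
  intros n. rewrite (RInt_ext F (fun _ => 0)); [|auto].
  rewrite RInt_const. unfold scal; simpl; unfold mult; simpl; ring.
Qed.

(** Serves as integration by parts on the line: the boundary terms vanish because [G] is O(1 / (1 +
    |x|)). *)
Lemma integral_derive (G F : R -> R) (L : R) : integrable F ->
  (forall x, is_derive G x (F x)) -> (forall x, Rabs (G x) * (1 + Rabs x) <= L) ->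
  integral F = 0.
Proof.
  intros [K HF] HG HL. apply integral_unique.
  apply is_lim_seq_ext with (fun n => G (INR n) - G (- INR n)).
  - intros n. symmetry. apply is_RInt_unique, (is_RInt_derive G).
    + auto.
    + intros; apply HF.
  - assert (Z : forall u : nat -> R, (forall n, Rabs (u n) = INR n) ->
      is_lim_seq (fun n => G (u n)) 0).
    { intros u Hu. apply is_lim_seq_abs_0.
      apply is_lim_seq_le_le with (fun _ => 0) (fun n => L / (1 + INR n)).
      - intros n; split; [apply Rabs_pos|]. specialize (HL (u n)). rewrite Hu in HL.
        apply Rmult_le_reg_r with (1 + INR n); [generalize (pos_INR n); lra|].
        unfold Rdiv. rewrite Rmult_assoc, Rinv_l, Rmult_1_r; auto.
        generalize (pos_INR n); lra.
      - apply is_lim_seq_const.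
      - replace (Finite 0) with (Rbar_mult (Finite L) (Finite 0))
          by (simpl; f_equal; ring).
        apply is_lim_seq_scal_l. replace (Finite 0) with (Rbar_inv p_infty) by reflexivity.
        apply is_lim_seq_inv; [|discriminate].
        apply is_lim_seq_ext with (fun n => INR (S n)).
        + intros n; rewrite S_INR; ring.
        + apply (is_lim_seq_incr_1 INR), is_lim_seq_INR. }
    replace 0 with (0 - 0) by ring.
    apply is_lim_seq_minus'; apply Z; intros n.
    + apply Rabs_pos_eq, pos_INR.
    + rewrite Rabs_Ropp. apply Rabs_pos_eq, pos_INR.
Qed.

Lemma decays_le (K L : R) (F : R -> R) : K <= L -> decays K F -> decays L F.
Proof.
  intros H [HF HK]; split; auto. intros x. eapply Rle_trans; [apply HK|].
  unfold Rdiv. apply Rmult_le_compat_r; auto. left; apply Rinv_0_lt_compat, sq_pos.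
Qed.

Lemma integral_shift (F : R -> R) (t : R) : integrable F ->
  integrable (fun x => F (x + t)) /\ integral (fun x => F (x + t)) = integral F.
Proof.
  intros [K HF].
  assert (HK := decays_pos _ _ HF).
  (* From x = (x + t) - t one gets 1 + x^2 <= 2 (1 + t^2) (1 + (x + t)^2). *)
  assert (HS : decays (2 * (1 + t ^ 2) * K) (fun x => F (x + t))).
  { split; intros x.
    - apply (continuous_comp (fun x => x + t) F); [|apply HF].
      apply (continuous_plus (fun x => x) (fun _ => t)); [apply continuous_id|apply continuous_const].
    - eapply Rle_trans; [apply HF|].
      apply Rmult_le_reg_r with (1 + (x + t) ^ 2); [apply sq_pos|].
      unfold Rdiv. rewrite Rmult_assoc, Rinv_l by (generalize (sq_pos (x + t)); lra).
      apply Rmult_le_reg_r with (1 + x ^ 2); [apply sq_pos|].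
      replace (2 * (1 + t ^ 2) * K * / (1 + x ^ 2) * (1 + (x + t) ^ 2) * (1 + x ^ 2))
        with (K * (2 * (1 + t ^ 2) * (1 + (x + t) ^ 2)))
        by (field; apply Rgt_not_eq, sq_pos).
      rewrite Rmult_1_r. apply Rmult_le_compat_l; auto.
      generalize (pow2_ge_0 (x + t + t)) (pow2_ge_0 ((x + t) * t)); nra. }
  split; [eexists; apply HS|].
  apply integral_unique.
  apply is_lim_seq_ext with (fun n => RInt F (- INR n + t) (INR n + t)).
  - intros n. symmetry.
    assert (E := RInt_comp_lin F 1 t (- INR n) (INR n)). rewrite !Rmult_1_l in E.
    rewrite <- E by (apply continuous_ex_RInt, HF).
    apply RInt_ext. intros x _. unfold scal; simpl; unfold mult; simpl.
    rewrite !Rmult_1_l. reflexivity.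
  - destruct (nfloor_ex (Rabs t)) as [N [_ HN]]; [apply Rabs_pos|].
    assert (A := Rle_abs t). assert (B := Rle_abs (- t)). rewrite Rabs_Ropp in B.
    assert (Lim0 : forall s, is_lim_seq (fun n => K / (INR n + s)) 0).
    { intros s. replace (Finite 0) with (Rbar_mult (Finite K) (Finite 0))
          by (simpl; f_equal; ring).
      apply is_lim_seq_scal_l. replace (Finite 0) with (Rbar_inv p_infty) by reflexivity.
      apply is_lim_seq_inv; [|discriminate].
      apply is_lim_seq_plus with p_infty s; [apply is_lim_seq_INR|apply is_lim_seq_const|].
      reflexivity. }
    apply is_lim_seq_ext with
      (fun n => (RInt F (- INR n + t) (INR n + t) - integral F) + integral F); [intros; ring|].
    replace (Finite (integral F)) with (Finite (0 + integral F)) by (f_equal; ring).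
    apply is_lim_seq_plus'; [|apply is_lim_seq_const].
    apply is_lim_seq_abs_0.
    apply is_lim_seq_le_le_loc with (fun _ => 0)
      (fun n => K / (INR n + - t) + K / (INR n + t)).
    + exists (S N). intros n Hn. apply le_INR in Hn. rewrite S_INR in Hn.
      split; [apply Rabs_pos|].
      replace (- INR n + t) with (- (INR n + - t)) by ring.
      apply integral_tail; auto; lra.
    + apply is_lim_seq_const.
    + replace 0 with (0 + 0) by ring. apply is_lim_seq_plus'; apply Lim0.
Qed.

(** * Epsilon forms, second-order remainders and differentiation under the integral sign *)

Lemma continuous_eps (F : R -> R) (x : R) :
  continuous F x <->
  forall eps, 0 < eps -> exists d, 0 < d /\
    forall y, Rabs (y - x) < d -> Rabs (F y - F x) < eps.
Proof.
  split.
  - intros H eps Heps.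
    destruct (proj1 (filterlim_locally F (F x)) H (mkposreal _ Heps)) as [d Hd].
    exists d; split; [apply cond_pos|]. intros y Hy. apply (Hd y Hy).
  - intros H. apply (filterlim_locally F (F x)). intros eps.
    destruct (H eps (cond_pos eps)) as (d & Hd & Hy).
    exists (mkposreal _ Hd). intros y Hb. apply (Hy y Hb).
Qed.

Lemma is_derive_eps (F : R -> R) (x l : R) :
  is_derive F x l <->
  forall eps, 0 < eps -> exists d, 0 < d /\
    forall y, Rabs (y - x) < d -> Rabs (F y - F x - (y - x) * l) <= eps * Rabs (y - x).
Proof.
  split.
  - intros [_ H] eps Heps.
    destruct (H x (fun P HP => HP) (mkposreal _ Heps)) as [d Hd].
    exists d; split; [apply cond_pos|]. intros y Hy. apply (Hd y Hy).
  - intros H; split; [apply is_linear_scal_l|].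
    intros y Hy eps. rewrite <- (is_filter_lim_locally_unique x y Hy).
    destruct (H eps (cond_pos eps)) as (d & Hd & Hy').
    exists (mkposreal _ Hd). intros z Hz. apply (Hy' z Hz).
Qed.

Lemma mean_value_le (f df : R -> R) (a b L : R) :
  (forall t, Rmin a b <= t <= Rmax a b -> is_derive f t (df t)) ->
  (forall t, Rmin a b <= t <= Rmax a b -> Rabs (df t) <= L) ->
  Rabs (f b - f a) <= L * Rabs (b - a).
Proof.
  intros Hd HL.
  destruct (MVT_gen f a b df) as (c & Hc & E).
  - intros; apply Hd; lra.
  - intros x Hx. apply continuity_pt_filterlim, (ex_derive_continuous f).
    eexists; now apply Hd.
  - rewrite E, Rabs_mult. apply Rmult_le_compat_r; [apply Rabs_pos|auto].
Qed.

Lemma between_abs (a b t : R) : Rmin a b <= t <= Rmax a b -> Rabs (t - a) <= Rabs (b - a).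
Proof.
  unfold Rmin, Rmax; destruct (Rle_dec a b); intros H; unfold Rabs;
  repeat destruct Rcase_abs; lra.
Qed.

(** Two successive mean value estimates; they give the constant 1 instead of 1/2, which is enough
    here. *)
Lemma taylor_order2 (g g1 g2 : R -> R) (r0 r B : R) :
  (forall t, Rabs (t - r0) <= Rabs (r - r0) -> is_derive g t (g1 t)) ->
  (forall t, Rabs (t - r0) <= Rabs (r - r0) -> is_derive g1 t (g2 t)) ->
  (forall t, Rabs (t - r0) <= Rabs (r - r0) -> Rabs (g2 t) <= B) ->
  Rabs (g r - g r0 - (r - r0) * g1 r0) <= (r - r0) ^ 2 * B.
Proof.
  intros H1 H2 HB.
  assert (HB0 : 0 <= B).
  { eapply Rle_trans; [|apply (HB r0)]; [apply Rabs_pos|].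
    rewrite Rminus_diag, Rabs_R0. apply Rabs_pos. }
  replace (g r - g r0 - (r - r0) * g1 r0) with
    ((g r - (r - r0) * g1 r0) - (g r0 - (r0 - r0) * g1 r0)) by ring.
  replace ((r - r0) ^ 2 * B) with (B * Rabs (r - r0) * Rabs (r - r0))
    by (rewrite Rmult_assoc, <- Rabs_mult, Rabs_pos_eq by apply Rle_0_sqr; ring).
  apply (mean_value_le (fun t => g t - (t - r0) * g1 r0) (fun t => g1 t - g1 r0)).
  - intros t Ht. apply between_abs in Ht.
    apply (is_derive_minus g (fun t => (t - r0) * g1 r0)); [now apply H1|].
    auto_derive; auto; ring.
  - intros t Ht. apply between_abs in Ht.
    eapply Rle_trans; [apply (mean_value_le g1 g2 r0 t B)|].
    + intros s Hs. apply between_abs in Hs. apply H2; lra.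
    + intros s Hs. apply between_abs in Hs. apply HB; lra.
    + apply Rmult_le_compat_l; auto.
Qed.

(** A quadratic remainder with an integrable majorant replaces dominated convergence: the error of
    the difference quotient is at most 4 K |r - r0|. *)
Lemma integral_param_derive (F : R -> R -> R) (F1 : R -> R) (r0 K : R) :
  (forall r, integrable (F r)) -> integrable F1 ->
  (forall r x, Rabs (r - r0) <= 1 ->
     Rabs (F r x - F r0 x - (r - r0) * F1 x) <= (r - r0) ^ 2 * (K / (1 + x ^ 2))) ->
  is_derive (fun r => integral (F r)) r0 (integral F1).
Proof.
  intros HF HF1 HK. apply is_derive_eps. intros eps Heps.
  assert (HK0 : 0 <= K).
  { specialize (HK (r0 + 1) 0). replace (r0 + 1 - r0) with 1 in HK by ring.
    rewrite Rabs_R1 in HK. specialize (HK (Rle_refl 1)).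
    eapply Rle_trans; [|eapply Rle_trans; [apply HK|]]; [apply Rabs_pos|].
    simpl. lra. }
  (* 4 K bounds the mass of the majorant; the added eps keeps the denominator positive when K =
     0. *)
  assert (Hd : 0 < eps / (4 * K + eps)).
  { apply Rdiv_lt_0_compat; lra. }
  exists (Rmin 1 (eps / (4 * K + eps))). split; [apply Rmin_pos; lra|].
  intros r Hr.
  assert (Hr1 : Rabs (r - r0) < 1) by (eapply Rlt_le_trans; [apply Hr|apply Rmin_l]).
  assert (Hr2 : Rabs (r - r0) < eps / (4 * K + eps))
    by (eapply Rlt_le_trans; [apply Hr|apply Rmin_r]).
  rewrite <- integral_minus, <- integral_scal, <- integral_minus; auto.
  2: now apply integrable_minus. 2: now apply integrable_scal.
  eapply Rle_trans; [apply (integral_bound _ ((r - r0) ^ 2 * K))|].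
  - assert (HI : integrable (fun x => F r x - F r0 x - (r - r0) * F1 x)).
    { apply integrable_minus; [now apply integrable_minus|now apply integrable_scal]. }
    destruct HI as [L [HL _]]. split; auto.
    intros x. unfold Rdiv. rewrite Rmult_assoc. apply HK. lra.
  - rewrite <- (pow2_abs (r - r0)). apply Rlt_le in Hr2.
    apply (Rmult_le_compat_r (4 * K + eps)) in Hr2; [|lra].
    unfold Rdiv in Hr2. rewrite Rmult_assoc, Rinv_l, Rmult_1_r in Hr2 by lra.
    assert (Hp := Rabs_pos (r - r0)). simpl. nra.
Qed.

Lemma integral_param_derive_taylor (F F1 F2 : R -> R -> R) (r0 K : R) :
  (forall r, integrable (F r)) -> integrable (F1 r0) ->
  (forall r x, is_derive (fun r => F r x) r (F1 r x)) ->
  (forall r x, is_derive (fun r => F1 r x) r (F2 r x)) ->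
  (forall r x, Rabs (r - r0) <= 1 -> Rabs (F2 r x) <= K / (1 + x ^ 2)) ->
  is_derive (fun r => integral (F r)) r0 (integral (F1 r0)).
Proof.
  intros HF HF1 H1 H2 HK. apply integral_param_derive with K; auto.
  intros r x Hr.
  apply (taylor_order2 (fun r => F r x) (fun r => F1 r x) (fun r => F2 r x)); auto.
  intros t Ht. apply HK. lra.
Qed.

(** * Fubini *)

Definition continuous2 (F : R -> R -> R) : Prop := forall x y, continuity_2d_pt F x y.

Lemma continuous2_l (F : R -> R -> R) (y x : R) :
  continuous2 F -> continuous (fun x => F x y) x.
Proof.
  intros H. apply continuous_eps. intros eps He.
  destruct (H x y (mkposreal _ He)) as [d Hd].
  exists d; split; [apply cond_pos|]. intros z Hz. apply Hd; auto.
  rewrite Rminus_diag, Rabs_R0. apply cond_pos.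
Qed.

Lemma continuous2_r (F : R -> R -> R) (x y : R) :
  continuous2 F -> continuous (fun y => F x y) y.
Proof.
  intros H. apply continuous_eps. intros eps He.
  destruct (H x y (mkposreal _ He)) as [d Hd].
  exists d; split; [apply cond_pos|]. intros z Hz. apply Hd; auto.
  rewrite Rminus_diag, Rabs_R0. apply cond_pos.
Qed.

Lemma continuous_RInt_param (F : R -> R -> R) (c d x : R) : c <= d ->
  continuous2 F -> continuous (fun x => RInt (F x) c d) x.
Proof.
  intros Hcd HF. apply continuous_eps. intros eps He.
  assert (He' : 0 < eps / (d - c + 1)) by (apply Rdiv_lt_0_compat; lra).
  destruct (uniform_continuity_2d_1d' F c d x (fun t _ => HF x t) (mkposreal _ He'))
    as [dl Hdl].
  exists dl; split; [apply cond_pos|]. intros y Hy. apply Rabs_lt_between in Hy.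
  assert (E : RInt (F y) c d - RInt (F x) c d = RInt (fun t => F y t - F x t) c d).
  { symmetry. apply (RInt_minus (F y) (F x));
    apply continuous_ex_RInt; intros; now apply continuous2_r. }
  rewrite E. apply Rle_lt_trans with ((d - c) * (eps / (d - c + 1))).
  - apply Rabs_RInt_le with (fun _ => eps / (d - c + 1)); auto.
    + apply (ex_RInt_minus (F y) (F x));
      apply continuous_ex_RInt; intros; now apply continuous2_r.
    + exact (is_RInt_const (V := R_NormedModule) c d (eps / (d - c + 1))).
    + intros t Ht. left. apply Hdl; try lra. rewrite Rminus_diag, Rabs_R0. apply cond_pos.
  - apply Rmult_lt_reg_r with (d - c + 1); [lra|]. unfold Rdiv.
    rewrite !Rmult_assoc, Rinv_l by lra. nra.
Qed.

Lemma continuous2_swap (F : R -> R -> R) :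
  continuous2 F -> continuous2 (fun x y => F y x).
Proof.
  intros H x y eps. destruct (H y x eps) as [d Hd]. exists d. intros; now apply Hd.
Qed.

(** As functions of the upper limit [b], both sides vanish at [a] and have the derivative
    [RInt (F b) c d]; for the right-hand side this is differentiation under the integral sign. *)
Lemma RInt_Fubini (F : R -> R -> R) (a b c d : R) : a <= b -> c <= d -> continuous2 F ->
  RInt (fun x => RInt (F x) c d) a b = RInt (fun y => RInt (fun x => F x y) a b) c d.
Proof.
  intros Hab Hcd HF.
  set (H := fun t => RInt (fun y => RInt (fun x => F x y) a t) c d).
  assert (HD : forall t y, is_derive (fun t => RInt (fun x => F x y) a t) t (F t y)).
  { intros t y. apply (is_derive_RInt (fun x => F x y) _ a).
    - apply filter_forall. intros u. apply (RInt_correct (fun x => F x y)).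
      apply continuous_ex_RInt. intros; now apply continuous2_l.
    - now apply continuous2_l. }
  assert (HE : forall t y, Derive (fun t => RInt (fun x => F x y) a t) t = F t y).
  { intros; apply is_derive_unique, HD. }
  assert (E : is_RInt (fun x => RInt (F x) c d) a b (H b - H a)).
  { apply (is_RInt_derive H).
    - intros t Ht. rewrite Rmin_left, Rmax_right in Ht by auto.
      replace (RInt (F t) c d) with
        (RInt (fun y => Derive (fun u => RInt (fun x => F x y) a u) t) c d).
      2: { apply RInt_ext. intros; apply HE. }
      apply is_derive_RInt_param.
      + apply filter_forall. intros u y _. eexists; apply HD.
      + intros y _. apply (continuity_2d_pt_ext F); [|apply HF].
        intros; symmetry; apply HE.
      + apply filter_forall. intros u. apply continuous_ex_RInt. intros y.
        destruct (Rle_dec a u) as [Hau|Hau].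
        * apply (continuous_RInt_param (fun y x => F x y)); auto.
          now apply continuous2_swap.
        * apply (continuous_ext (fun y => - RInt (fun x => F x y) u a)).
          { intros s. apply (opp_RInt_swap (fun x => F x s)). apply continuous_ex_RInt.
            intros; now apply continuous2_l. }
          apply (continuous_opp (fun y => RInt (fun x => F x y) u a)).
          apply (continuous_RInt_param (fun y x => F x y)); [lra|].
          now apply continuous2_swap.
    - intros. now apply continuous_RInt_param. }
  rewrite (is_RInt_unique _ _ _ _ E).
  unfold H at 2. rewrite (RInt_ext _ (fun _ => 0) c d).
  - rewrite RInt_const. unfold scal; simpl; unfold mult; simpl. unfold H. ring.
  - intros x _. apply (RInt_point a (fun z => F z x)).
Qed.

Definition decays2 (K : R) (F : R -> R -> R) : Prop :=
  continuous2 F /\ forall x y, Rabs (F x y) <= K / (1 + x ^ 2) / (1 + y ^ 2).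

Lemma decays2_swap (K : R) (F : R -> R -> R) :
  decays2 K F -> decays2 K (fun x y => F y x).
Proof.
  intros [HF HK]; split; [now apply continuous2_swap|].
  intros x y. eapply Rle_trans; [apply HK|]. right. field.
  generalize (sq_pos x) (sq_pos y); simpl; lra.
Qed.

Lemma decays2_slice (K : R) (F : R -> R -> R) (x : R) : decays2 K F ->
  decays (K / (1 + x ^ 2)) (F x).
Proof.
  intros [HF HK]; split; auto. intros; now apply continuous2_r.
Qed.

Lemma decays2_pos (K : R) (F : R -> R -> R) : decays2 K F -> 0 <= K.
Proof.
  intros [_ H]. specialize (H 0 0). generalize (Rabs_pos (F 0 0)). simpl in H. lra.
Qed.

(** Truncating the inner integral at N + 1 costs at most 2 K / (N + 1), uniformly in x, so
    continuity passes from the truncations to the full integral. *)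
Lemma decays2_integral (K : R) (F : R -> R -> R) : decays2 K F ->
  decays (4 * K) (fun x => integral (F x)).
Proof.
  intros HF. assert (HK := decays2_pos _ _ HF). split.
  - intros x. apply continuous_eps. intros eps He.
    destruct (nfloor_ex (8 * K / eps)) as [N [_ HN]].
    { apply Rdiv_le_0_compat; lra. }
    assert (Hn : 0 < INR N + 1) by (generalize (pos_INR N); lra).
    assert (HnK : 4 * K / (INR N + 1) < eps / 2).
    { apply Rmult_lt_reg_r with (INR N + 1); auto. unfold Rdiv at 1.
      rewrite Rmult_assoc, Rinv_l by lra.
      assert (8 * K / eps * eps = 8 * K) by (field; lra). nra. }
    assert (HT : forall y, Rabs (RInt (F y) (- (INR N + 1)) (INR N + 1) - integral (F y))
       <= 2 * K / (INR N + 1)).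
    { intros y. eapply Rle_trans.
      - apply (integral_tail (F y) (K / (1 + y ^ 2)) (INR N + 1) (INR N + 1)); auto.
        now apply decays2_slice.
      - assert (K / (1 + y ^ 2) <= K).
        { apply Rmult_le_reg_r with (1 + y ^ 2); [apply sq_pos|]. unfold Rdiv.
          rewrite Rmult_assoc, Rinv_l by (apply Rgt_not_eq, sq_pos). nra. }
        assert (0 < / (INR N + 1)) by (apply Rinv_0_lt_compat; lra).
        set (u := K / (1 + y ^ 2)) in *. unfold Rdiv.
        nra. }
    assert (Hs : - (INR N + 1) <= INR N + 1) by lra.
    destruct (proj1 (continuous_eps _ x)
      (continuous_RInt_param F (- (INR N + 1)) (INR N + 1) x Hs (proj1 HF))
      (eps / 2)) as (d & Hd & HC); [lra|].
    exists d; split; auto. intros y Hy. specialize (HC y Hy).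
    assert (A := HT x). assert (B := HT y).
    apply Rabs_le_between in A. apply Rabs_le_between in B.
    apply Rabs_lt_between in HC. apply Rabs_lt_between.
    unfold Rdiv in *. lra.
  - intros x. eapply Rle_trans; [eapply integral_bound, decays2_slice, HF|].
    right; unfold Rdiv; ring.
Qed.

(** On the square [-n, n]^2 the finite version applies. Cutting the inner integral costs (2 K / n) /
    (1 + x^2), whose mass is at most 4 times 2 K / n; hence the 8 K / n for each order. *)
Lemma integral_Fubini (K : R) (F : R -> R -> R) : decays2 K F ->
  integral (fun x => integral (F x)) = integral (fun y => integral (fun x => F x y)).
Proof.
  intros HF. assert (HF' := decays2_swap _ _ HF).
  assert (HK := decays2_pos _ _ HF).
  assert (L1 := integral_lim _ _ (decays2_integral _ _ HF)).
  assert (L2 := integral_lim _ _ (decays2_integral _ _ HF')).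
  cut (is_lim_seq (fun n => RInt (fun x => integral (F x)) (- INR n) (INR n)
     - RInt (fun y => integral (fun x => F x y)) (- INR n) (INR n)) 0).
  { intros L. assert (L3 := is_lim_seq_minus' _ _ _ _ L1 L2).
    apply is_lim_seq_unique in L. apply is_lim_seq_unique in L3. rewrite L in L3.
    injection L3. simpl. lra. }
  assert (B : forall G, decays2 K G -> forall n, 0 < INR n ->
    Rabs (RInt (fun x => integral (G x)) (- INR n) (INR n)
      - RInt (fun x => RInt (G x) (- INR n) (INR n)) (- INR n) (INR n)) <= 8 * K / INR n).
  { intros G HG n Hn.
    assert (C1 : forall x, continuous (fun x => integral (G x)) x)
      by apply (decays2_integral _ _ HG).
    assert (C2 : forall x, continuous (fun x => RInt (G x) (- INR n) (INR n)) x).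
    { intros; apply continuous_RInt_param; [lra|apply HG]. }
    assert (E : RInt (fun x => integral (G x)) (- INR n) (INR n)
      - RInt (fun x => RInt (G x) (- INR n) (INR n)) (- INR n) (INR n) =
      RInt (fun x => integral (G x) - RInt (G x) (- INR n) (INR n)) (- INR n) (INR n)).
    { symmetry. apply (RInt_minus (fun x => integral (G x))); now apply continuous_ex_RInt. }
    rewrite E.
    eapply Rle_trans.
    - apply Rabs_RInt_le with (fun x => (2 * K / INR n) / (1 + x ^ 2)); [lra| | |].
      + apply continuous_ex_RInt. intros x.
        now apply (continuous_minus (fun x => integral (G x))).
      + apply is_RInt_inv_sq.
      + intros x _. rewrite Rabs_minus_sym. eapply Rle_trans.
        * apply (integral_tail (G x) (K / (1 + x ^ 2)) (INR n) (INR n)); auto.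
          now apply decays2_slice.
        * right. field. generalize (sq_pos x); simpl; lra.
    - rewrite atan_opp. destruct (atan_bound (INR n)) as [_ Hb]. generalize PI_4; intros.
      assert (0 <= K / INR n) by (apply Rdiv_le_0_compat; auto).
      replace (2 * K / INR n) with (2 * (K / INR n)) by (unfold Rdiv; ring).
      replace (8 * K / INR n) with (8 * (K / INR n)) by (unfold Rdiv; ring). nra. }
  apply is_lim_seq_abs_0.
  apply is_lim_seq_le_le_loc with (fun _ => 0) (fun n => 16 * K * / INR n).
  - exists 1%nat. intros n Hn. apply le_INR in Hn. simpl in Hn.
    split; [apply Rabs_pos|].
    assert (B1 := B _ HF n ltac:(lra)). assert (B2 := B _ HF' n ltac:(lra)).
    rewrite (RInt_Fubini F) in B1; [|lra|lra|apply HF].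
    apply Rabs_le_between in B1. apply Rabs_le_between in B2. apply Rabs_le.
    unfold Rdiv in *. lra.
  - apply is_lim_seq_const.
  - replace (Finite 0) with (Rbar_mult (Finite (16 * K)) (Finite 0))
          by (simpl; f_equal; ring).
    apply is_lim_seq_scal_l. replace (Finite 0) with (Rbar_inv p_infty) by reflexivity.
    apply is_lim_seq_inv; [apply is_lim_seq_INR|discriminate].
Qed.

(** * Uniqueness for the Fourier transform *)

(** Fejer's kernel up to normalisation, as a triangular mean of cosines; the integral form also
    covers t = 0, where the closed formula breaks down. *)
Definition Fejer (r t : R) : R := RInt (fun xi => (1 - xi / r) * cos (t * xi)) 0 r.

Lemma Fejer_integrand_continuous (r : R) :
  continuous2 (fun t xi => (1 - xi / r) * cos (t * xi)).
Proof.
  intros x y. apply continuity_2d_pt_mult.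
  - apply continuity_2d_pt_minus; [apply continuity_2d_pt_const|].
    apply continuity_2d_pt_mult; [apply continuity_2d_pt_id2|apply continuity_2d_pt_const].
  - apply (continuity_1d_2d_pt_comp cos (fun t xi => t * xi)); [apply continuity_cos|].
    apply continuity_2d_pt_mult; [apply continuity_2d_pt_id1|apply continuity_2d_pt_id2].
Qed.

Lemma Fejer_formula (r t : R) : 0 < r -> t <> 0 ->
  Fejer r t = (1 - cos (t * r)) / (r * t ^ 2).
Proof.
  intros Hr Ht. apply is_RInt_unique.
  replace ((1 - cos (t * r)) / (r * t ^ 2)) with
    (((1 - r / r) * sin (t * r) / t - cos (t * r) / (r * t ^ 2))
     - ((1 - 0 / r) * sin (t * 0) / t - cos (t * 0) / (r * t ^ 2)))
    by (rewrite Rmult_0_r, sin_0, cos_0; field; lra).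
  apply (is_RInt_derive (fun xi => (1 - xi / r) * sin (t * xi) / t - cos (t * xi) / (r * t ^ 2))).
  - intros x _. auto_derive; [lra|]. field. lra.
  - intros x _. apply (continuous2_r (fun t xi => (1 - xi / r) * cos (t * xi))), Fejer_integrand_continuous.
Qed.

Lemma Fejer_bounds (r t : R) : 0 < r -> t <> 0 -> 0 <= Fejer r t <= 2 / (r * t ^ 2).
Proof.
  intros Hr Ht. rewrite Fejer_formula by auto.
  assert (0 < r * t ^ 2) by (apply Rmult_lt_0_compat; auto; apply pow2_gt_0; auto).
  generalize (COS_bound (t * r)); intros. split.
  - apply Rdiv_le_0_compat; lra.
  - apply Rmult_le_compat_r; [left; now apply Rinv_0_lt_compat|lra].
Qed.

(** On this window every phase t xi is at most 1 in absolute value, and the weight 1 - xi / r has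
    integral r / 2. *)
Lemma Fejer_peak (r t : R) : 0 < r -> Rabs t <= / r -> cos 1 * r / 2 <= Fejer r t.
Proof.
  intros Hr Ht.
  assert (E : is_RInt (fun xi => (1 - xi / r) * cos 1) 0 r (cos 1 * r / 2)).
  { replace (cos 1 * r / 2) with ((r - r ^ 2 / (2 * r)) * cos 1 - (0 - 0 ^ 2 / (2 * r)) * cos 1)
      by (field; lra).
    apply (is_RInt_derive (fun xi => (xi - xi ^ 2 / (2 * r)) * cos 1)).
    - intros; auto_derive; [lra|]. field; lra.
    - intros. apply (ex_derive_continuous (fun xi => (1 - xi / r) * cos 1)). auto_derive. auto. }
  rewrite <- (is_RInt_unique _ _ _ _ E). apply RInt_le; [lra|eexists; apply E| |].
  - apply continuous_ex_RInt. intros x.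
    apply (continuous2_r (fun t xi => (1 - xi / r) * cos (t * xi))), Fejer_integrand_continuous.
  - intros x Hx. apply Rmult_le_compat_l.
    + assert (x / r <= 1); [|lra]. apply Rmult_le_reg_r with r; auto.
      unfold Rdiv; rewrite Rmult_assoc, Rinv_l; lra.
    + assert (Rabs (t * x) <= 1).
      { rewrite Rabs_mult, (Rabs_pos_eq x) by lra.
        replace 1 with (/ r * r) by (field; lra).
        apply Rmult_le_compat; try lra. apply Rabs_pos. }
      generalize PI2_1; intros.
      replace (cos (t * x)) with (cos (Rabs (t * x)))
        by (unfold Rabs; destruct Rcase_abs; [apply cos_neg|auto]).
      apply cos_decr_1; generalize (Rabs_pos (t * x)); lra.
Qed.

Lemma Fejer_continuous (r t : R) : 0 < r -> continuous (Fejer r) t.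
Proof.
  intros Hr. apply (continuous_RInt_param (fun t xi => (1 - xi / r) * cos (t * xi))); [lra|].
  apply Fejer_integrand_continuous.
Qed.

Lemma continuous2_of_r (F : R -> R) : (forall y, continuous F y) -> continuous2 (fun _ y => F y).
Proof.
  intros HF x y. apply (continuity_1d_2d_pt_comp F (fun _ y => y)).
  - apply continuity_pt_filterlim, HF.
  - apply continuity_2d_pt_id2.
Qed.

Lemma continuous2_of_l (F : R -> R) : (forall y, continuous F y) -> continuous2 (fun x _ => F x).
Proof. intros HF. now apply (continuous2_swap (fun _ y => F y)), continuous2_of_r. Qed.

(** After the integrals are exchanged, each inner integral is the truncation of a vanishing one,
    hence at most 2 K / n, and xi runs over an interval of length r. *)
Lemma cosine_Fejer_small (Psi : R -> R) (K y0 r : R) (n : nat) :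
  decays K Psi -> (forall xi, integral (fun y => Psi y * cos ((y - y0) * xi)) = 0) ->
  0 < r -> 0 < INR n ->
  Rabs (RInt (fun y => Psi y * Fejer r (y - y0)) (- INR n) (INR n)) <= r * (2 * K / INR n).
Proof.
  intros HP H0 Hr Hn.
  assert (HK := decays_pos _ _ HP).
  set (F := fun xi y => (1 - xi / r) * (Psi y * cos ((y - y0) * xi))).
  assert (HC : continuous2 F).
  { intros x y. apply continuity_2d_pt_mult.
    - apply continuity_2d_pt_minus; [apply continuity_2d_pt_const|].
      apply continuity_2d_pt_mult; [apply continuity_2d_pt_id1|apply continuity_2d_pt_const].
    - apply continuity_2d_pt_mult; [apply continuous2_of_r, HP|].
      apply (continuity_1d_2d_pt_comp cos (fun xi y => (y - y0) * xi)); [apply continuity_cos|].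
      apply continuity_2d_pt_mult; [|apply continuity_2d_pt_id1].
      apply continuity_2d_pt_minus; [apply continuity_2d_pt_id2|apply continuity_2d_pt_const]. }
  assert (Hc : forall xi y, continuous (fun y => Psi y * cos ((y - y0) * xi)) y).
  { intros xi y. apply (continuous_mult Psi); [apply HP|].
    apply (ex_derive_continuous (fun y => cos ((y - y0) * xi))). auto_derive; auto. }
  assert (E : RInt (fun y => Psi y * Fejer r (y - y0)) (- INR n) (INR n) =
              RInt (fun xi => RInt (F xi) (- INR n) (INR n)) 0 r).
  { rewrite (RInt_Fubini F); [|lra|lra|auto]. apply RInt_ext. intros y _.
    unfold Fejer. rewrite <- (RInt_scal (V := R_CompleteNormedModule)).
    - apply RInt_ext. intros x _. unfold F, scal; simpl; unfold mult; simpl. ring.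
    - apply continuous_ex_RInt. intros z.
      apply (continuous2_r (fun t xi => (1 - xi / r) * cos (t * xi))), Fejer_integrand_continuous. }
  rewrite E.
  replace (r * (2 * K / INR n)) with ((r - 0) * (2 * K / INR n)) by ring.
  apply Rabs_RInt_le with (fun _ => 2 * K / INR n); [lra| | |].
  - apply continuous_ex_RInt. intros; apply continuous_RInt_param; auto. lra.
  - exact (is_RInt_const (V := R_NormedModule) 0 r (2 * K / INR n)).
  - intros x Hx.
    assert (E2 : RInt (F x) (- INR n) (INR n) =
      (1 - x / r) * RInt (fun y => Psi y * cos ((y - y0) * x)) (- INR n) (INR n)).
    { apply (RInt_scal (V := R_CompleteNormedModule)).
      now apply continuous_ex_RInt. }
    rewrite E2, Rabs_mult.
    assert (T : Rabs (RInt (fun y => Psi y * cos ((y - y0) * x)) (- INR n) (INR n) - 0)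
                <= K / INR n + K / INR n).
    { rewrite <- (H0 x). apply integral_tail; auto. split; auto.
      intros y. rewrite Rabs_mult.
      apply Rle_trans with (K / (1 + y ^ 2) * 1); [|lra].
      apply Rmult_le_compat; try apply Rabs_pos; [apply HP|].
      apply Rabs_le, COS_bound. }
    rewrite Rminus_0_r in T.
    assert (0 <= x / r <= 1).
    { split; [apply Rdiv_le_0_compat; lra|]. apply Rmult_le_reg_r with r; auto.
      unfold Rdiv; rewrite Rmult_assoc, Rinv_l; lra. }
    replace (2 * K / INR n) with (1 * (K / INR n + K / INR n)) by (field; lra).
    apply Rmult_le_compat; auto; try apply Rabs_pos.
    apply Rabs_le; lra.
Qed.

(** If Psi y0 > 0, the Fejer mean of [Psi] around y0 is bounded below: the peak contributes at least
    [dl * cos 1], the rest of the neighbourhood is nonnegative and the far part is O(1 / r). By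
    [cosine_Fejer_small] the same mean is small once the window is large. *)
Lemma cosine_uniqueness_le (Psi : R -> R) (K y0 : R) :
  decays K Psi -> (forall xi, integral (fun y => Psi y * cos ((y - y0) * xi)) = 0) ->
  Psi y0 <= 0.
Proof.
  intros HP H0. apply Rnot_lt_le. intros Hpos.
  assert (HK := decays_pos _ _ HP).
  destruct (proj1 (continuous_eps Psi y0) (proj1 HP y0) (Psi y0 / 2)) as (eta & Heta & Hn); [lra|].
  set (dl := Psi y0 / 2) in *.
  assert (Hdl : 0 < dl) by (unfold dl; lra).
  assert (Hc1 : 0 < cos 1) by (generalize PI2_1; intros; apply cos_gt_0; lra).
  set (e2 := eta / 2). assert (He2 : 0 < e2) by (unfold e2; lra).
  (* The first summand puts the peak inside the neighbourhood; the second makes the two far parts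
     together smaller than [dl * cos 1 / 2]. *)
  set (r := / e2 + 32 * K / (e2 ^ 2 * (dl * cos 1)) + 1).
  assert (Hdc : 0 < dl * cos 1) by (apply Rmult_lt_0_compat; unfold dl; lra).
  assert (Hie : 0 < / e2) by now apply Rinv_0_lt_compat.
  assert (Hq : 0 <= 32 * K / (e2 ^ 2 * (dl * cos 1))).
  { apply Rdiv_le_0_compat; [lra|]. apply Rmult_lt_0_compat; auto. apply pow_lt; auto. }
  assert (Hr : 0 < r) by (unfold r; lra).
  assert (Hre : / r <= e2).
  { rewrite <- (Rinv_inv e2). apply Rinv_le_contravar; auto. unfold r; lra. }
  assert (Hfar : 16 * K / (r * e2 ^ 2) < dl * cos 1 / 2).
  { assert (He22 : 0 < e2 ^ 2) by now apply pow_lt.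
    apply Rmult_lt_reg_r with (r * e2 ^ 2); [now apply Rmult_lt_0_compat|].
    unfold Rdiv at 1. rewrite Rmult_assoc, Rinv_l, Rmult_1_r
      by (apply Rgt_not_eq; now apply Rmult_lt_0_compat).
    replace (16 * K) with (dl * cos 1 / 2 * (32 * K / (e2 ^ 2 * (dl * cos 1)) * e2 ^ 2))
      by (field; lra).
    apply Rmult_lt_compat_l; [lra|]. apply Rmult_lt_compat_r; auto. unfold r; lra. }
  assert (Hrk : 0 <= 4 * r * K / (dl * cos 1)) by (apply Rdiv_le_0_compat; [apply Rmult_le_pos; lra|auto]).
  (* The window [-n, n] then contains the neighbourhood, and the bound r * 2 K / n of the whole mean
     is below [dl * cos 1 / 2]. *)
  destruct (nfloor_ex (Rabs y0 + e2 + 4 * r * K / (dl * cos 1))) as [N [_ HN]].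
  { generalize (Rabs_pos y0); lra. }
  rewrite <- S_INR in HN. set (n := S N) in *.
  assert (A := Rle_abs y0). assert (B := Rle_abs (- y0)). rewrite Rabs_Ropp in B.
  assert (Hn0 : 0 < INR n) by (generalize (Rabs_pos y0); lra).
  assert (S := cosine_Fejer_small Psi K y0 r n HP H0 Hr Hn0).
  assert (Htail : r * (2 * K / INR n) < dl * cos 1 / 2).
  { apply Rmult_lt_reg_r with (INR n); auto.
    replace (r * (2 * K / INR n) * INR n)
      with (dl * cos 1 / 2 * (4 * r * K / (dl * cos 1))) by (field; lra).
    apply Rmult_lt_compat_l; [lra|]. generalize (Rabs_pos y0); lra. }
  set (P := fun y => Psi y * Fejer r (y - y0)) in *.
  assert (HPc : forall y, continuous P y).
  { intros y. apply (continuous_mult Psi); [apply HP|].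
    apply (continuous_comp (fun y => y - y0) (Fejer r)); [|now apply Fejer_continuous].
    apply (ex_derive_continuous (fun y => y - y0)). auto_derive; auto. }
  rewrite <- (RInt_cont_Chasles P (- INR n) (y0 - e2) (INR n)) in S by auto.
  rewrite <- (RInt_cont_Chasles P (y0 - e2) (y0 + e2) (INR n)) in S by auto.
  assert (Mid : dl * cos 1 <= RInt P (y0 - e2) (y0 + e2)).
  (* Width 2 / r times height cos 1 * r / 2: the contribution of the peak does not depend on r. *)
  { replace (dl * cos 1) with (2 * / r * (dl * (cos 1 * r / 2))) by (field; lra).
    apply RInt_ge_window with y0; auto; try lra.
    - now apply Rinv_0_lt_compat.
    - intros x Hx. destruct (Req_dec x y0) as [->|Hne].
      + apply Rmult_le_pos; [lra|].
        eapply Rle_trans; [|apply Fejer_peak]; auto.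
        * apply Rmult_le_pos; [apply Rmult_le_pos; lra|lra].
        * rewrite Rminus_diag, Rabs_R0. left; now apply Rinv_0_lt_compat.
      + apply Rmult_le_pos.
        * assert (Rabs (x - y0) < eta) by (apply Rabs_lt_between; unfold e2 in Hx; lra).
          specialize (Hn x H). apply Rabs_lt_between in Hn. unfold dl in Hn. lra.
        * apply Fejer_bounds; auto. lra.
    - intros x Hx. apply Rmult_le_compat.
      + unfold dl; lra.
      + apply Rmult_le_pos; [apply Rmult_le_pos; lra|lra].
      + assert (Rabs (x - y0) < eta) by (unfold e2 in Hre; lra).
        specialize (Hn x H). apply Rabs_lt_between in Hn. unfold dl in Hn |- *. lra.
      + now apply Fejer_peak. }
  assert (Far : forall a b, a <= b -> (forall x, a <= x <= b -> e2 <= Rabs (x - y0)) ->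
     Rabs (RInt P a b) <= 8 * K / (r * e2 ^ 2)).
  { intros a b Hab Hx. apply Rle_trans with
      (2 * K / (r * e2 ^ 2) * atan b - 2 * K / (r * e2 ^ 2) * atan a).
    - apply Rabs_RInt_le with (fun x => 2 * K / (r * e2 ^ 2) / (1 + x ^ 2)); auto.
      + now apply continuous_ex_RInt.
      + apply is_RInt_inv_sq.
      + intros x Hxab. specialize (Hx x Hxab). unfold P. rewrite Rabs_mult.
        assert (Hne : x - y0 <> 0).
        { intros E. rewrite E, Rabs_R0 in Hx. lra. }
        assert (Hb := Fejer_bounds r (x - y0) Hr Hne).
        replace (2 * K / (r * e2 ^ 2) / (1 + x ^ 2)) with
          (K / (1 + x ^ 2) * (2 / (r * e2 ^ 2)))
          by (field; generalize (sq_pos x); simpl; lra).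
        apply Rmult_le_compat; try apply Rabs_pos; [apply HP|].
        rewrite Rabs_pos_eq by lra. eapply Rle_trans; [apply Hb|].
        apply Rmult_le_compat_l; [lra|]. apply Rinv_le_contravar.
        * apply Rmult_lt_0_compat; auto. now apply pow_lt.
        * apply Rmult_le_compat_l; [lra|]. rewrite <- (pow2_abs (x - y0)).
          apply pow_incr. lra.
    - assert (HQ : 0 <= K / (r * e2 ^ 2)).
      { apply Rdiv_le_0_compat; auto. apply Rmult_lt_0_compat; auto. now apply pow_lt. }
      replace (2 * K / (r * e2 ^ 2)) with (2 * (K / (r * e2 ^ 2))) by (unfold Rdiv; ring).
      replace (8 * K / (r * e2 ^ 2)) with (8 * (K / (r * e2 ^ 2))) by (unfold Rdiv; ring).
      destruct (atan_bound b) as [_ B1]. destruct (atan_bound a) as [B2 _].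
      generalize PI_4; intros. nra. }
  assert (F1 := Far (- INR n) (y0 - e2) ltac:(lra)).
  assert (F2 := Far (y0 + e2) (INR n) ltac:(lra)).
  assert (G1 : forall x, - INR n <= x <= y0 - e2 -> e2 <= Rabs (x - y0)).
  { intros x Hx. rewrite Rabs_minus_sym. eapply Rle_trans; [|apply Rle_abs]. lra. }
  assert (G2 : forall x, y0 + e2 <= x <= INR n -> e2 <= Rabs (x - y0)).
  { intros x Hx. eapply Rle_trans; [|apply Rle_abs]. lra. }
  specialize (F1 G1). specialize (F2 G2).
  apply Rabs_le_between in F1. apply Rabs_le_between in F2. apply Rabs_le_between in S.
  unfold Rdiv in *. lra.
Qed.

Lemma cosine_uniqueness (Psi : R -> R) (y0 : R) :
  integrable Psi -> (forall xi, integral (fun y => Psi y * cos ((y - y0) * xi)) = 0) ->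
  Psi y0 = 0.
Proof.
  intros [K HK] H. apply Rle_antisym.
  - eapply cosine_uniqueness_le; eauto.
  - assert (H' : - Psi y0 <= 0); [|lra].
    assert (HK' : decays (Rabs (-1) * K) (fun x => - Psi x)).
    { apply (decays_ext _ (fun x => -1 * Psi x)); [intros; ring|]. now apply decays_scal. }
    apply (cosine_uniqueness_le (fun x => - Psi x) _ y0 HK').
    intros xi. rewrite (integral_ext _ (fun y => -1 * (Psi y * cos ((y - y0) * xi))))
      by (intros; ring).
    rewrite integral_scal, H; [ring|].
    exists K. split.
    + intros y. apply (continuous_mult Psi); [apply HK|].
      apply (ex_derive_continuous (fun y => cos ((y - y0) * xi))). auto_derive; auto.
    + intros y. rewrite Rabs_mult.
      apply Rle_trans with (K / (1 + y ^ 2) * 1); [|lra].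
      apply Rmult_le_compat; try apply Rabs_pos; [apply HK|].
      apply Rabs_le, COS_bound.
Qed.

(** * Bang's form of the Denjoy-Carleman theorem *)

(** A smooth function given together with all its derivatives, so that explicit formulas for them
    can take the place of [Derive_n]. *)
Definition derivative_chain (G : nat -> R -> R) : Prop :=
  forall k x, is_derive (G k) x (G (S k) x).

Lemma derivative_chain_Derive_n (G : nat -> R -> R) (k m : nat) (x : R) :
  derivative_chain G -> is_derive_n (G k) m x (G (k + m)%nat x).
Proof.
  intros HG. revert x. induction m as [|m IH]; intros x.
  - simpl. now rewrite Nat.add_0_r.
  - simpl. apply (is_derive_ext (G (k + m)%nat)).
    + intros t. symmetry. now apply is_derive_n_unique.
    + rewrite Nat.add_succ_r. apply HG.
Qed.

Lemma exp_partial_sum_le (y : R) (n : nat) : 0 <= y ->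
  sum_f_R0 (fun m => y ^ m / INR (fact m)) n <= exp y.
Proof.
  intros Hy. eapply Rle_trans; [|apply (sum_incr _ n _ (E1_cvg y))].
  - right. apply sum_eq. intros; unfold Rdiv; ring.
  - intros m. apply Rmult_le_pos; [|now apply pow_le].
    left. apply Rinv_0_lt_compat, INR_fact_lt_0.
Qed.

Lemma quotients_pow (K : nat -> R) (k j m : nat) :
  (forall i, 0 < K i) -> (forall i, K (S i) / K i <= K (S (S i)) / K (S i)) ->
  (k + j <= S m)%nat -> K (k + j)%nat <= K k * (K (S m) / K m) ^ j.
Proof.
  intros HK Hn.
  assert (Hmon : forall a b, (a <= b)%nat -> K (S a) / K a <= K (S b) / K b).
  { intros a b Hab. induction Hab; [lra|]. eapply Rle_trans; [apply IHHab|apply Hn]. }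
  induction j as [|j IH]; intros Hj.
  - rewrite Nat.add_0_r. simpl. lra.
  - rewrite Nat.add_succ_r. simpl.
    assert (IH' := IH ltac:(lia)).
    assert (Hq : K (S (k + j)) / K (k + j)%nat <= K (S m) / K m) by (apply Hmon; lia).
    replace (K (S (k + j))) with (K (S (k + j)) / K (k + j)%nat * K (k + j)%nat)
      by (field; apply Rgt_not_eq, HK).
    replace (K k * (K (S m) / K m * (K (S m) / K m) ^ j)) with
      (K (S m) / K m * (K k * (K (S m) / K m) ^ j)) by ring.
    apply Rmult_le_compat; auto.
    + left. apply Rdiv_lt_0_compat; apply HK.
    + left; apply HK.
Qed.

(** The recursion at the left end matches the descent in [small_window], which spends one term per
    level. *)
Fixpoint window_sum (u : nat -> R) (m d : nat) : R :=
  match d with O => 0 | S d => u m + window_sum u (S m) d end.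

Lemma window_sum_add (u : nat -> R) (m a b : nat) :
  window_sum u m (a + b) = window_sum u m a + window_sum u (m + a) b.
Proof.
  revert m. induction a as [|a IH]; intros m; simpl.
  - rewrite Nat.add_0_r. ring.
  - rewrite IH. replace (S m + a)%nat with (m + S a)%nat by lia. ring.
Qed.

Lemma window_sum_sum_n (u : nat -> R) (n : nat) : window_sum u 0 (S n) = sum_n u n.
Proof.
  induction n as [|n IH].
  - rewrite sum_O. simpl. ring.
  - replace (S (S n)) with (S n + 1)%nat by lia.
    rewrite window_sum_add, IH, sum_Sn. simpl. unfold plus; simpl. ring.
Qed.

Section Bang.

Variables (G : nat -> R -> R) (K : nat -> R) (T : R).
Hypothesis HG : derivative_chain G.
Hypothesis HK : forall k, 0 < K k.
Hypothesis Hn : forall i, K (S i) / K i <= K (S (S i)) / K (S i).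
Hypothesis HB : forall k x, 0 <= x <= T -> Rabs (G k x) <= K k.
Hypothesis H0 : forall k, G k 0 = 0.

(** Bang's measure of smallness at a point: the supremum over k of |G_k(x)| / (e^k K_k) is at most
    e^(-m). *)
Let small (x : R) (m : nat) : Prop :=
  forall k, Rabs (G k x) <= exp (INR k - INR m) * K k.

(** Moving by [h] costs one level. In the Taylor expansion of [G k] up to order m + 1 every term is
    at most e^(k - m - 1) K_k y^j / j! with y <= 1, so the sum loses at most a factor e^y <= e. *)
Lemma small_step (x h : R) (m : nat) :
  0 <= x -> 0 < h -> x + h <= T -> h <= K m / (exp 1 * K (S m)) ->
  small x (S m) -> small (x + h) m.
Proof.
  intros Hx Hh HT Hhm Hs k.
  (* For k > m the exponential factor is at least 1, and the global bound [HB] suffices. *)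
  destruct (le_lt_dec (S m) k) as [Hk|Hk].
  - eapply Rle_trans; [apply HB; lra|].
    assert (1 <= exp (INR k - INR m)).
    { rewrite <- exp_0 at 1. apply le_INR in Hk. rewrite S_INR in Hk.
      left; apply exp_increasing. lra. }
    specialize (HK k). nra.
  - destruct (Taylor_Lagrange (G k) (m - k) x (x + h)) as (z & Hz & E); [lra| |].
    { intros t _ j _. apply (ex_derive_n_ext (G k)); [auto|].
      destruct j; [exact I|]. eexists. apply (derivative_chain_Derive_n G k (S j) t HG). }
    rewrite E. replace (x + h - x) with h by ring.
    set (y := exp 1 * (K (S m) / K m) * h).
    assert (He : 0 < exp 1) by apply exp_pos.
    assert (Hq : 0 < K (S m) / K m) by (apply Rdiv_lt_0_compat; apply HK).
    assert (Hy : 0 <= y) by (unfold y; apply Rmult_le_pos; [apply Rmult_le_pos|]; lra).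
    assert (Hy1 : y <= 1).
    { unfold y.
      apply Rle_trans with (exp 1 * (K (S m) / K m) * (K m / (exp 1 * K (S m)))).
      - apply Rmult_le_compat_l; auto. apply Rmult_le_pos; lra.
      - right. field. repeat split; try lra; apply Rgt_not_eq, HK. }
    assert (Hterm : forall j g, (k + j <= S m)%nat ->
       Rabs g <= exp (INR (k + j) - INR (S m)) * K (k + j)%nat ->
       Rabs (h ^ j / INR (fact j) * g) <=
       exp (INR k - INR (S m)) * K k * (y ^ j / INR (fact j))).
    { intros j g Hj Hg.
      rewrite Rabs_mult, Rabs_pos_eq.
      2: { apply Rmult_le_pos; [apply pow_le; lra|left; apply Rinv_0_lt_compat, INR_fact_lt_0]. }
      assert (Hexp : exp (INR (k + j) - INR (S m)) = exp (INR k - INR (S m)) * exp 1 ^ j).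
      { replace (exp 1 ^ j) with (exp (INR j)).
        - rewrite <- exp_plus. f_equal. rewrite plus_INR. ring.
        - clear. induction j as [|j IH]; [apply exp_0|].
          rewrite S_INR, exp_plus, IH. simpl. ring. }
      rewrite Hexp in Hg.
      assert (HKj := quotients_pow K k j m HK Hn Hj).
      unfold y. rewrite !Rpow_mult_distr.
      replace (exp (INR k - INR (S m)) * K k * (exp 1 ^ j * (K (S m) / K m) ^ j * h ^ j / INR (fact j)))
        with (h ^ j / INR (fact j) * (exp (INR k - INR (S m)) * exp 1 ^ j * (K k * (K (S m) / K m) ^ j)))
        by (unfold Rdiv; ring).
      apply Rmult_le_compat_l.
      - apply Rmult_le_pos; [apply pow_le; lra|left; apply Rinv_0_lt_compat, INR_fact_lt_0].
      - eapply Rle_trans; [apply Hg|]. apply Rmult_le_compat_l; auto.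
        apply Rmult_le_pos; [left; apply exp_pos|apply pow_le; lra]. }
    assert (Hsum : Rabs (sum_f_R0 (fun j => h ^ j / INR (fact j) * Derive_n (G k) j x) (m - k)) <=
       exp (INR k - INR (S m)) * K k * sum_f_R0 (fun j => y ^ j / INR (fact j)) (m - k)).
    { eapply Rle_trans; [apply Rsum_abs|]. rewrite scal_sum.
      apply sum_Rle. intros j Hj. rewrite (Rmult_comm (y ^ j / _)).
      apply Hterm; [lia|].
      rewrite (is_derive_n_unique _ _ _ _ (derivative_chain_Derive_n G k j x HG)). apply Hs. }
    assert (Hrem : Rabs (h ^ S (m - k) / INR (fact (S (m - k))) * Derive_n (G k) (S (m - k)) z) <=
       exp (INR k - INR (S m)) * K k * (y ^ S (m - k) / INR (fact (S (m - k))))).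
    { apply Hterm; [lia|].
      rewrite (is_derive_n_unique _ _ _ _ (derivative_chain_Derive_n G k (S (m - k)) z HG)).
      replace (k + S (m - k))%nat with (S m) by lia.
      (* At order m + 1 the exponent is 0, so the global bound at the intermediate point has the
         same form as the bounds at x. *)
      rewrite Rminus_diag, exp_0, Rmult_1_l. apply HB; lra. }
    eapply Rle_trans; [apply Rabs_triang|].
    eapply Rle_trans; [apply Rplus_le_compat; [apply Hsum|apply Hrem]|].
    rewrite <- Rmult_plus_distr_l.
    change (exp (INR k - INR (S m)) * K k * sum_f_R0 (fun j => y ^ j / INR (fact j)) (S (m - k))
       <= exp (INR k - INR m) * K k).
    replace (exp (INR k - INR m)) with (exp (INR k - INR (S m)) * exp 1)
      by (rewrite <- exp_plus; f_equal; rewrite S_INR; ring).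
    rewrite !Rmult_assoc. apply Rmult_le_compat_l; [left; apply exp_pos|].
    rewrite (Rmult_comm (exp 1)). apply Rmult_le_compat_l; [left; apply HK|].
    eapply Rle_trans; [now apply exp_partial_sum_le|].
    destruct Hy1 as [Hy1|Hy1]; [left; now apply exp_increasing|rewrite Hy1; lra].
Qed.

Lemma small_weaken (x : R) (m : nat) : small x (S m) -> small x m.
Proof.
  intros Hs k. eapply Rle_trans; [apply Hs|]. apply Rmult_le_compat_r; [left; apply HK|].
  left; apply exp_increasing. rewrite S_INR. lra.
Qed.

(** At 0 every level is available. Starting there at level m + d, each step uses one term of the sum
    as its length and descends one level. *)
Lemma small_window (d m : nat) (x : R) :
  0 <= x <= T -> x <= window_sum (fun j => K j / (exp 1 * K (S j))) m d -> small x m.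
Proof.
  revert m x. induction d as [|d IH]; intros m x HT Hx.
  - simpl in Hx. replace x with 0 by lra. intros k. rewrite H0, Rabs_R0.
    apply Rmult_le_pos; [left; apply exp_pos|left; apply HK].
  - simpl in Hx. set (s := window_sum _ (S m) d) in Hx.
    assert (Hs : 0 <= s).
    { unfold s. generalize (S m). clear -HK. induction d as [|d IH]; intros m; simpl; [lra|].
      apply Rplus_le_le_0_compat; auto. left. apply Rdiv_lt_0_compat; auto.
      apply Rmult_lt_0_compat; auto. apply exp_pos. }
    destruct (Rle_dec x s) as [Hxs|Hxs].
    + apply small_weaken, IH; auto.
    + replace x with (s + (x - s)) by ring. apply small_step; try lra.
      apply IH; [lra|unfold s; lra].
Qed.

(** Divergence makes every tail of the sum reach [x], so |G_0(x)| <= e^(-m) K_0 for every m. *)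
Lemma Bang_uniqueness :
  (forall B, exists d, B <= window_sum (fun j => K j / K (S j)) 0 d) ->
  forall x, 0 <= x <= T -> G 0 x = 0.
Proof.
  intros Hdiv x Hx.
  assert (He : 0 < exp 1) by apply exp_pos.
  assert (Hall : forall m, small x m).
  { intros m.
    (* The first m terms are added so that the terms from m on still cover e x. *)
    destruct (Hdiv (exp 1 * x + window_sum (fun j => K j / K (S j)) 0 m)) as [d Hd].
    assert (Hscal : forall d a, window_sum (fun j => K j / (exp 1 * K (S j))) a d
       = / exp 1 * window_sum (fun j => K j / K (S j)) a d).
    { clear -HK He. induction d as [|d IH]; intros a; simpl; [ring|]. rewrite IH.
      field. split; [apply Rgt_not_eq, HK|lra]. }
    assert (Hpos : forall d a, 0 <= window_sum (fun j => K j / K (S j)) a d).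
    { clear -HK. induction d as [|d IH]; intros m; simpl; [lra|].
      apply Rplus_le_le_0_compat; auto. left. apply Rdiv_lt_0_compat; auto. }
    apply (small_window d); auto. rewrite Hscal.
    assert (E : window_sum (fun j => K j / K (S j)) 0 m + window_sum (fun j => K j / K (S j)) m d
       >= window_sum (fun j => K j / K (S j)) 0 d).
    { assert (A := window_sum_add (fun j => K j / K (S j)) 0 m d).
      assert (B := window_sum_add (fun j => K j / K (S j)) 0 d m).
      rewrite Nat.add_comm in B. simpl in A, B. assert (C := Hpos m d). lra. }
    apply Rmult_le_reg_l with (exp 1); auto. rewrite <- Rmult_assoc, Rinv_r by lra. lra. }
  destruct (Req_dec (G 0%nat x) 0) as [|Hne]; auto. exfalso.
  assert (Hp : 0 < Rabs (G 0%nat x)) by now apply Rabs_pos_lt.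
  destruct (nfloor_ex (K 0%nat / Rabs (G 0%nat x))) as [m [_ Hm]].
  { left; apply Rdiv_lt_0_compat; auto. }
  specialize (Hall m 0%nat). rewrite Rminus_0_l, exp_Ropp in Hall.
  assert (E := exp_ineq1_le (INR m)).
  assert (Hm2 : K 0%nat < Rabs (G 0%nat x) * exp (INR m)).
  { apply Rlt_le_trans with (Rabs (G 0%nat x) * (INR m + 1)).
    - apply (Rmult_lt_compat_l (Rabs (G 0%nat x))) in Hm; auto.
      replace (Rabs (G 0%nat x) * (K 0%nat / Rabs (G 0%nat x))) with (K 0%nat) in Hm
        by (field; lra). lra.
    - apply Rmult_le_compat_l; lra. }
  apply (Rmult_le_compat_r (exp (INR m))) in Hall; [|left; apply exp_pos].
  rewrite (Rmult_comm (/ _)), Rmult_assoc, Rinv_l in Hall by apply Rgt_not_eq, exp_pos.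
  lra.
Qed.

End Bang.

(** The odd derivatives are controlled by the even ones through
    [|g'| <= 2 sup |g| / d + d sup |g''|] with [d = (N p / N (p+1)) ^ (1/2)]. *)
Lemma Bang_uniqueness_even (G : nat -> R -> R) (N : nat -> R) (T : R) :
  derivative_chain G -> (forall p, 0 < N p) ->
  (forall p x, Rabs x <= T + 1 -> Rabs (G (2 * p)%nat x) <= N p) ->
  (forall p, 1 <= N (S p) / N p) ->
  (forall p, N (S p) / N p <= N (S (S p)) / N (S p)) ->
  (forall B, exists d, B <= sum_n (fun p => 1 / sqrt (N (S p) / N p)) d) ->
  (forall k, G k 0 = 0) ->
  forall x, 0 <= x <= T -> G 0%nat x = 0.
Proof.
  intros HG HN HB H1 Hn Hdiv H0.
  set (q := fun p => N (S p) / N p).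
  assert (Hq : forall p, 1 <= sqrt (q p)).
  { intros p. rewrite <- sqrt_1. apply sqrt_le_1_alt, H1. }
  (* The quotients before and after index 2 p + 1 both equal sqrt (q p), so the sum of reciprocal
     quotients is twice the given one. The factor 3 comes from the interpolation: 2 from the values
     and 1 from the second derivative. *)
  set (K := fun k => 3 * (if Nat.even k then N (Nat.div2 k)
                          else N (Nat.div2 k) * sqrt (q (Nat.div2 k)))).
  assert (K0 : forall p, K (2 * p)%nat = 3 * N p).
  { intros p. unfold K. now rewrite Nat.even_mul, Nat.div2_double. }
  assert (K1 : forall p, K (S (2 * p)) = 3 * (N p * sqrt (q p))).
  { intros p. unfold K.
    rewrite Nat.even_succ, <- Nat.negb_even, Nat.even_mul, Nat.div2_succ_double. reflexivity. }
  assert (Hsq : forall p, sqrt (q p) * sqrt (q p) = N (S p) / N p).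
  { intros p. apply sqrt_sqrt. specialize (H1 p). unfold q. lra. }
  assert (Kq0 : forall p, K (S (2 * p)) / K (2 * p)%nat = sqrt (q p)).
  { intros p. rewrite K0, K1. field. apply Rgt_not_eq, HN. }
  assert (Kq1 : forall p, K (S (S (2 * p))) / K (S (2 * p)) = sqrt (q p)).
  { intros p. replace (S (S (2 * p))) with (2 * (S p))%nat by lia. rewrite K0, K1.
    replace (N (S p)) with (N p * (sqrt (q p) * sqrt (q p)))
      by (rewrite Hsq; field; apply Rgt_not_eq, HN).
    field. split; [specialize (Hq p); lra|apply Rgt_not_eq, HN]. }
  assert (HK : forall k, 0 < K k).
  { intros k. unfold K. destruct (Nat.even k).
    - apply Rmult_lt_0_compat; [lra|apply HN].
    - apply Rmult_lt_0_compat; [lra|]. apply Rmult_lt_0_compat; [apply HN|].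
      specialize (Hq (Nat.div2 k)). lra. }
  assert (par : forall k, exists p, k = (2 * p)%nat \/ k = S (2 * p)).
  { intros k. destruct (Nat.Even_or_Odd k) as [[p Hp]|[p Hp]]; exists p; lia. }
  apply (Bang_uniqueness G K T); auto.
  - intros i. destruct (par i) as [p [->| ->]].
    + rewrite Kq0, Kq1. lra.
    + rewrite Kq1. replace (S (S (2 * p))) with (2 * S p)%nat by lia. rewrite Kq0.
      apply sqrt_le_1_alt, Hn.
  - intros k x Hx. destruct (par k) as [p [->| ->]].
    + rewrite K0. assert (P := HN p).
      eapply Rle_trans; [apply HB; rewrite Rabs_pos_eq; lra|]. lra.
    + rewrite K1.
      set (s := sqrt (q p)) in *. assert (Hs1 := Hq p). fold s in Hs1.
      assert (Hs : 0 < s) by lra.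
      assert (Hd : 0 < / s <= 1).
      { split; [now apply Rinv_0_lt_compat|]. rewrite <- Rinv_1. apply Rinv_le_contravar; lra. }
      (* The step 1 / s balances the two terms of the interpolation; as it is at most 1, it stays
         where [HB] holds, which is why [HB] reaches up to T + 1. *)
      assert (HT := taylor_order2 (G (2 * p)%nat) (G (S (2 * p))) (G (2 * S p)%nat)
        x (x + / s) (N (S p))).
      replace (x + / s - x) with (/ s) in HT by ring.
      rewrite (Rabs_pos_eq (/ s)) in HT by lra.
      assert (C : Rabs (G (2 * p)%nat (x + / s) - G (2 * p)%nat x - / s * G (S (2 * p)) x)
         <= (/ s) ^ 2 * N (S p)).
      { apply HT.
        - intros; apply HG.
        - intros t _. replace (2 * S p)%nat with (S (S (2 * p))) by lia. apply HG.
        - intros t Ht. apply HB. apply Rabs_le_between in Ht. apply Rabs_le. lra. }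
      assert (B1 : Rabs (G (2 * p)%nat x) <= N p) by (apply HB; rewrite Rabs_pos_eq; lra).
      assert (B2 : Rabs (G (2 * p)%nat (x + / s)) <= N p) by (apply HB; rewrite Rabs_pos_eq; lra).
      replace ((/ s) ^ 2 * N (S p)) with (N p) in C.
      2: { replace (N (S p)) with (N p * (s * s))
             by (unfold s; rewrite Hsq; field; apply Rgt_not_eq, HN). field. lra. }
      assert (D : / s * Rabs (G (S (2 * p)) x) <= 3 * N p).
      { replace (/ s * Rabs (G (S (2 * p)) x)) with (Rabs (/ s * G (S (2 * p)) x))
          by (rewrite Rabs_mult, (Rabs_pos_eq (/ s)); lra).
        apply Rabs_le_between in B1. apply Rabs_le_between in B2. apply Rabs_le_between in C.
        apply Rabs_le. lra. }
      apply Rmult_le_reg_l with (/ s); [lra|].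
      replace (/ s * (3 * (N p * s))) with (3 * N p) by (field; lra). auto.
  - intros B. destruct (Hdiv (B / 2)) as [d Hd].
    exists (2 * S d)%nat.
    assert (E : forall d, window_sum (fun j => K j / K (S j)) 0 (2 * d) =
      2 * window_sum (fun p => 1 / sqrt (q p)) 0 d).
    { induction d0 as [|e IH]; [simpl; ring|].
      replace (2 * S e)%nat with (2 * e + 2)%nat by lia.
      replace (S e) with (e + 1)%nat by lia.
      rewrite !window_sum_add, IH. cbn [window_sum Nat.add].
      replace (e + (e + 0))%nat with (2 * e)%nat by lia.
      assert (A1 := Kq0 e). assert (A2 := Kq1 e).
      assert (B1 : forall a b s, 0 < a -> 0 < b -> a / b = s -> b / a = 1 / s).
      { intros a b s Ha Hb <-. field. lra. }
      rewrite (B1 _ _ _ (HK _) (HK _) A1), (B1 _ _ _ (HK _) (HK _) A2). ring. }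
    rewrite E, window_sum_sum_n. fold q in Hd. unfold q in *. lra.
Qed.

(** * Complex differentiation *)

Lemma Cmod_le_sum (z : C) : Cmod z <= Rabs (Re z) + Rabs (Im z).
Proof.
  destruct z as [x y]. replace (x, y) with (RtoC x + Ci * RtoC y)%C
    by (unfold RtoC, Ci, Cplus, Cmult; simpl; f_equal; ring).
  eapply Rle_trans; [apply Cmod_triangle|].
  rewrite Cmod_mult, !Cmod_R, Cmod_Ci. simpl. right. f_equal; [f_equal; ring|].
  rewrite Rmult_1_l. f_equal. ring.
Qed.

Lemma im_le_Cmod (z : C) : Rabs (Im z) <= Cmod z.
Proof. eapply Rle_trans; [apply Rmax_r|apply Rmax_Cmod]. Qed.

Lemma Ceq_components (z w : C) : Re z = Re w -> Im z = Im w -> z = w.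
Proof. destruct z, w; simpl; intros; congruence. Qed.

Definition complex_derivative (f : C -> C) (z l : C) : Prop :=
  forall eps, 0 < eps -> exists d, 0 < d /\ forall z', Cmod (z' - z)%C < d ->
    Cmod (f z' - f z - (z' - z) * l)%C <= eps * Cmod (z' - z)%C.

Definition continuous_C (q : C -> C) (z : C) : Prop :=
  forall eps, 0 < eps -> exists d, 0 < d /\ forall z', Cmod (z' - z)%C < d ->
    Cmod (q z' - q z)%C < eps.

Lemma complex_derivative_is_derive (f : C -> C) (z l : C) :
  complex_derivative f z l <-> is_derive (K := C_AbsRing) (V := C_NormedModule) f z l.
Proof.
  split.
  - intros H; split; [apply is_linear_scal_l|].
    intros y Hy eps. rewrite <- (is_filter_lim_locally_unique (V := AbsRing_NormedModule C_AbsRing) z y Hy).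
    destruct (H eps (cond_pos eps)) as (d & Hd & Hy').
    exists (mkposreal _ Hd). intros w Hw. apply (Hy' w Hw).
  - intros [_ H] eps Heps.
    destruct (H z (fun P HP => HP) (mkposreal _ Heps)) as [d Hd].
    exists d; split; [apply cond_pos|]. intros y Hy. apply (Hd y Hy).
Qed.

Lemma complex_derivative_unique (f : C -> C) (z l : C) :
  complex_derivative f z l -> C_derive f z = l.
Proof. intros H. now apply is_C_derive_unique, complex_derivative_is_derive. Qed.

Lemma continuous_C_const (c z : C) : continuous_C (fun _ => c) z.
Proof.
  intros eps He. exists 1; split; [lra|]. intros z' _.
  replace (c - c)%C with (RtoC 0) by ring. now rewrite Cmod_0.
Qed.

Lemma continuous_C_id (z : C) : continuous_C (fun z => z) z.
Proof. intros eps He. exists eps; split; auto. Qed.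

Lemma continuous_C_plus (p q : C -> C) (z : C) :
  continuous_C p z -> continuous_C q z -> continuous_C (fun z => p z + q z)%C z.
Proof.
  intros Hp Hq eps He.
  destruct (Hp (eps / 2)) as (d1 & Hd1 & H1); [lra|].
  destruct (Hq (eps / 2)) as (d2 & Hd2 & H2); [lra|].
  exists (Rmin d1 d2); split; [now apply Rmin_pos|]. intros z' Hz.
  specialize (H1 z' (Rlt_le_trans _ _ _ Hz (Rmin_l _ _))).
  specialize (H2 z' (Rlt_le_trans _ _ _ Hz (Rmin_r _ _))).
  replace (p z' + q z' - (p z + q z))%C with ((p z' - p z) + (q z' - q z))%C by ring.
  eapply Rle_lt_trans; [apply Cmod_triangle|]. lra.
Qed.

Lemma continuous_C_mult (p q : C -> C) (z : C) :
  continuous_C p z -> continuous_C q z -> continuous_C (fun z => p z * q z)%C z.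
Proof.
  intros Hp Hq eps He.
  set (A := Cmod (p z) + 1). set (B := Cmod (q z) + 1).
  assert (HA : 0 < A) by (generalize (Cmod_ge_0 (p z)); unfold A; lra).
  assert (HB : 0 < B) by (generalize (Cmod_ge_0 (q z)); unfold B; lra).
  destruct (Hp (eps / (2 * B))) as (d1 & Hd1 & H1); [apply Rdiv_lt_0_compat; lra|].
  destruct (Hq (Rmin 1 (eps / (2 * A)))) as (d2 & Hd2 & H2).
  { apply Rmin_pos; [lra|]. apply Rdiv_lt_0_compat; lra. }
  exists (Rmin d1 d2); split; [now apply Rmin_pos|]. intros z' Hz.
  specialize (H1 z' (Rlt_le_trans _ _ _ Hz (Rmin_l _ _))).
  specialize (H2 z' (Rlt_le_trans _ _ _ Hz (Rmin_r _ _))).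
  assert (H3 := Rlt_le_trans _ _ _ H2 (Rmin_l _ _)).
  assert (H4 := Rlt_le_trans _ _ _ H2 (Rmin_r _ _)).
  replace (p z' * q z' - p z * q z)%C with
    ((p z' - p z) * (q z + (q z' - q z)) + p z * (q z' - q z))%C by ring.
  eapply Rle_lt_trans; [apply Cmod_triangle|]. rewrite !Cmod_mult.
  assert (H5 : Cmod (q z + (q z' - q z))%C <= B).
  { eapply Rle_trans; [apply Cmod_triangle|]. unfold B; lra. }
  assert (P1 := Cmod_ge_0 (p z' - p z)%C). assert (P2 := Cmod_ge_0 (q z' - q z)%C).
  assert (P3 := Cmod_ge_0 (p z)).
  assert (E1 : Cmod (p z' - p z)%C * Cmod (q z + (q z' - q z))%C < eps / 2).
  { apply Rle_lt_trans with (Cmod (p z' - p z)%C * B); [now apply Rmult_le_compat_l|].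
    replace (eps / 2) with (eps / (2 * B) * B) by (field; lra).
    now apply Rmult_lt_compat_r. }
  assert (E2 : Cmod (p z) * Cmod (q z' - q z)%C <= eps / 2).
  { replace (eps / 2) with (A * (eps / (2 * A))) by (field; lra).
    apply Rmult_le_compat; unfold A in *; lra. }
  lra.
Qed.

Lemma continuous_C_comp (p q : C -> C) (z : C) :
  continuous_C q z -> continuous_C p (q z) -> continuous_C (fun z => p (q z)) z.
Proof.
  intros Hq Hp eps He. destruct (Hp eps He) as (d1 & Hd1 & H1).
  destruct (Hq d1 Hd1) as (d2 & Hd2 & H2). exists d2; split; auto.
Qed.

Lemma Cminus_eq_0 (z w : C) : (z - w = 0 -> z = w)%C.
Proof.
  intros H. replace z with ((z - w) + w)%C by ring. rewrite H. ring.
Qed.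

Lemma continuous_C_inv (z : C) : z <> RtoC 0 -> continuous_C Cinv z.
Proof.
  intros Hz eps He. assert (Hm := proj1 (Cmod_gt_0 z) Hz).
  assert (Hs : 0 < Cmod z / 2) by lra.
  assert (Ht : 0 < eps * (Cmod z * (Cmod z / 2))).
  { apply Rmult_lt_0_compat; auto. apply Rmult_lt_0_compat; auto. }
  exists (Rmin (Cmod z / 2) (eps * (Cmod z * (Cmod z / 2)))). split; [now apply Rmin_pos|].
  intros w Hw.
  assert (H1 := Rlt_le_trans _ _ _ Hw (Rmin_l _ _)).
  assert (H2 := Rlt_le_trans _ _ _ Hw (Rmin_r _ _)).
  assert (Hwm : Cmod z / 2 < Cmod w).
  { assert (T := Cmod_triangle w (- (w - z))%C). rewrite Cmod_opp in T.
    replace (w + - (w - z))%C with z in T by ring. lra. }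
  assert (Hw0 : w <> RtoC 0) by (apply Cmod_gt_0; lra).
  replace (/ w - / z)%C with (- (w - z) * / (z * w))%C by (field; auto).
  rewrite Cmod_mult, Cmod_opp, Cmod_inv, Cmod_mult by now apply Cmult_neq_0.
  assert (Hp : 0 < Cmod z * Cmod w) by (apply Rmult_lt_0_compat; lra).
  apply Rmult_lt_reg_r with (Cmod z * Cmod w); auto.
  rewrite Rmult_assoc, Rinv_l, Rmult_1_r by lra.
  eapply Rlt_le_trans; [apply H2|]. apply Rmult_le_compat_l; [lra|].
  apply Rmult_le_compat_l; lra.
Qed.

(** Caratheodory's form of the derivative: with a continuous slope, the rules for sums, products and
    compositions reduce to algebra. *)
Lemma complex_derivative_slope (f : C -> C) (z l : C) :
  complex_derivative f z l <->
  exists q, (forall z', f z' = (f z + (z' - z) * q z')%C) /\ q z = l /\ continuous_C q z.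
Proof.
  split.
  - intros H.
    exists (fun w => if Ceq_dec w z then l else ((f w - f z) / (w - z))%C).
    split; [|split].
    + intros w. destruct (Ceq_dec w z) as [->|Hn]; [ring|]. field.
      intros E; apply Hn; now apply Cminus_eq_0.
    + destruct (Ceq_dec z z); congruence.
    + intros eps He. destruct (H (eps / 2)) as (d & Hd & Hf); [lra|].
      exists d; split; auto. intros w Hw.
      destruct (Ceq_dec z z) as [_|]; [|congruence].
      destruct (Ceq_dec w z) as [->|Hn].
      * replace (l - l)%C with (RtoC 0) by ring. now rewrite Cmod_0.
      * assert (Hne : (w - z)%C <> RtoC 0) by (intros E; apply Hn; now apply Cminus_eq_0).
        specialize (Hf w Hw).
        replace ((f w - f z) / (w - z) - l)%C with ((f w - f z - (w - z) * l) / (w - z))%C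
          by (field; auto).
        assert (Hm := proj1 (Cmod_gt_0 _) Hne).
        rewrite Cmod_div by auto. apply Rle_lt_trans with (eps / 2); [|lra].
        apply Rmult_le_reg_r with (Cmod (w - z)%C); auto. unfold Rdiv at 1.
        rewrite Rmult_assoc, Rinv_l; lra.
  - intros (q & Hf & Hq & Hc) eps He. destruct (Hc eps He) as (d & Hd & Hq').
    exists d; split; auto. intros w Hw. rewrite (Hf w), <- Hq.
    replace (f z + (w - z) * q w - f z - (w - z) * q z)%C with ((q w - q z) * (w - z))%C by ring.
    rewrite Cmod_mult. apply Rmult_le_compat_r; [apply Cmod_ge_0|]. left; auto.
Qed.

Lemma complex_derivative_continuous (f : C -> C) (z l : C) :
  complex_derivative f z l -> continuous_C f z.
Proof.
  intros H. apply complex_derivative_slope in H. destruct H as (q & Hf & Hq & Hc).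
  assert (H1 : continuous_C (fun w => f z + (w + - z) * q w)%C z).
  { apply continuous_C_plus; [apply continuous_C_const|].
    apply continuous_C_mult; auto.
    apply continuous_C_plus; [apply continuous_C_id|apply continuous_C_const]. }
  intros eps He. destruct (H1 eps He) as (d & Hd & H2). exists d; split; auto.
  intros w Hw. specialize (H2 w Hw). rewrite (Hf w).
  eapply Rle_lt_trans; [|apply H2]. right. f_equal. ring.
Qed.

Lemma complex_derivative_const (c z : C) : complex_derivative (fun _ => c) z (RtoC 0).
Proof.
  apply complex_derivative_slope. exists (fun _ => RtoC 0).
  repeat split; [intros; ring|apply continuous_C_const].
Qed.

Lemma complex_derivative_id (z : C) : complex_derivative (fun z => z) z (RtoC 1).
Proof.
  apply complex_derivative_slope. exists (fun _ => RtoC 1).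
  repeat split; [intros; ring|apply continuous_C_const].
Qed.

Lemma complex_derivative_plus (f g : C -> C) (z l m : C) :
  complex_derivative f z l -> complex_derivative g z m ->
  complex_derivative (fun z => f z + g z)%C z (l + m)%C.
Proof.
  rewrite !complex_derivative_slope.
  intros (p & Hf & <- & Hp) (q & Hg & <- & Hq). exists (fun w => p w + q w)%C.
  repeat split; [|now apply continuous_C_plus]. intros w. rewrite (Hf w), (Hg w). ring.
Qed.

Lemma complex_derivative_mult (f g : C -> C) (z l m : C) :
  complex_derivative f z l -> complex_derivative g z m ->
  complex_derivative (fun z => f z * g z)%C z (l * g z + f z * m)%C.
Proof.
  intros H H'. assert (Hc := complex_derivative_continuous g z m H'). revert H H'.
  rewrite !complex_derivative_slope.
  intros (p & Hf & <- & Hp) (q & Hg & <- & Hq). exists (fun w => p w * g w + f z * q w)%C.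
  repeat split.
  - intros w. rewrite (Hf w). rewrite (Hg w). ring.
  - apply continuous_C_plus; apply continuous_C_mult; auto. apply continuous_C_const.
Qed.

Lemma complex_derivative_comp (f g : C -> C) (z l m : C) :
  complex_derivative f (g z) l -> complex_derivative g z m ->
  complex_derivative (fun z => f (g z)) z (l * m)%C.
Proof.
  intros H H'. assert (Hc := complex_derivative_continuous g z m H'). revert H H'.
  rewrite !complex_derivative_slope.
  intros (p & Hf & <- & Hp) (q & Hg & <- & Hq). exists (fun w => p (g w) * q w)%C.
  repeat split.
  - intros w. rewrite (Hf (g w)).
    replace (g w - g z)%C with ((w - z) * q w)%C by (rewrite (Hg w); ring). ring.
  - apply continuous_C_mult; auto. now apply continuous_C_comp.
Qed.

Lemma complex_derivative_ext_loc (f g : C -> C) (z l : C) (d : R) : 0 < d ->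
  (forall w, Cmod (w - z)%C < d -> f w = g w) ->
  complex_derivative f z l -> complex_derivative g z l.
Proof.
  intros Hd E H eps He. destruct (H eps He) as (d' & Hd' & H').
  exists (Rmin d d'). split; [now apply Rmin_pos|]. intros w Hw.
  rewrite <- !E.
  - apply H'. eapply Rlt_le_trans; [apply Hw|apply Rmin_r].
  - replace (z - z)%C with (RtoC 0) by ring. now rewrite Cmod_0.
  - eapply Rlt_le_trans; [apply Hw|apply Rmin_l].
Qed.

Lemma complex_derivative_ext (f g : C -> C) (z l : C) :
  (forall w, f w = g w) -> complex_derivative f z l -> complex_derivative g z l.
Proof. intros E. apply (complex_derivative_ext_loc f g z l 1); [lra|auto]. Qed.

Lemma complex_derivative_scal (c : C) (f : C -> C) (z l : C) :
  complex_derivative f z l -> complex_derivative (fun z => c * f z)%C z (c * l)%C.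
Proof.
  intros H. replace (c * l)%C with (RtoC 0 * f z + c * l)%C by ring.
  apply (complex_derivative_mult (fun _ => c) f); auto. apply complex_derivative_const.
Qed.

Lemma complex_derivative_inv (z : C) : z <> RtoC 0 ->
  complex_derivative Cinv z (- / (z * z))%C.
Proof.
  intros Hz. assert (Hm := proj1 (Cmod_gt_0 z) Hz).
  (* The slope - 1 / (z w) is of no use at w = 0, where [Cinv] has a default value; the function is
     changed there, outside the disc of radius |z| around z. *)
  apply (complex_derivative_ext_loc
    (fun w => if Ceq_dec w 0 then (/ z + (w - z) * (- (/ z * / w)))%C else (/ w)%C) _ _ _ (Cmod z)); auto.
  - intros w Hw. destruct (Ceq_dec w 0) as [->|]; auto.
    exfalso. replace (0 - z)%C with (- z)%C in Hw by ring. rewrite Cmod_opp in Hw. lra.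
  - apply complex_derivative_slope. exists (fun w => - (/ z * / w))%C. repeat split.
    + intros w. destruct (Ceq_dec z 0); [congruence|].
      destruct (Ceq_dec w 0); auto. field. auto.
    + field. auto.
    + intros eps He.
      assert (Hc : continuous_C (fun w => (- / z) * / w)%C z).
      { apply continuous_C_mult; [apply continuous_C_const|now apply continuous_C_inv]. }
      destruct (Hc eps He) as (d & Hd & H). exists d; split; auto. intros w Hw.
      specialize (H w Hw). eapply Rle_lt_trans; [|apply H]. right. f_equal. ring.
Qed.

Lemma complex_derivative_line (f : C -> C) (z u l : C) (t : R) :
  complex_derivative f (z + RtoC t * u)%C l ->
  is_derive (fun t => Re (f (z + RtoC t * u)%C)) t (Re (l * u)%C) /\
  is_derive (fun t => Im (f (z + RtoC t * u)%C)) t (Im (l * u)%C).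
Proof.
  intros H.
  assert (Hu : 0 < Cmod u + 1) by (generalize (Cmod_ge_0 u); lra).
  assert (K : forall eps, 0 < eps -> exists d, 0 < d /\ forall s, Rabs (s - t) < d ->
    Cmod (f (z + RtoC s * u) - f (z + RtoC t * u) - RtoC (s - t) * (l * u))%C
      <= eps * Rabs (s - t)).
  { intros eps He.
    destruct (H (eps / (Cmod u + 1))) as (d & Hd & Hf); [now apply Rdiv_lt_0_compat|].
    exists (d / (Cmod u + 1)). split; [now apply Rdiv_lt_0_compat|].
    intros s Hs. specialize (Hf (z + RtoC s * u)%C).
    replace (z + RtoC s * u - (z + RtoC t * u))%C with (RtoC (s - t) * u)%C in Hf
      by (rewrite RtoC_minus; ring).
    rewrite Cmod_mult, Cmod_R in Hf.
    replace (RtoC (s - t) * u * l)%C with (RtoC (s - t) * (l * u))%C in Hf by ring.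
    assert (P := Rabs_pos (s - t)). assert (P' := Cmod_ge_0 u).
    eapply Rle_trans; [apply Hf|].
    - apply Rle_lt_trans with (Rabs (s - t) * (Cmod u + 1)); [nra|].
      replace d with (d / (Cmod u + 1) * (Cmod u + 1)) by (field; lra).
      now apply Rmult_lt_compat_r.
    - replace (eps * Rabs (s - t)) with
        (eps / (Cmod u + 1) * (Rabs (s - t) * (Cmod u + 1))) by (field; lra).
      apply Rmult_le_compat_l; [left; now apply Rdiv_lt_0_compat|nra]. }
  split; apply is_derive_eps; intros eps He; destruct (K eps He) as (d & Hd & Hf);
    exists d; split; auto; intros s Hs; (eapply Rle_trans; [|apply (Hf s Hs)]).
  - eapply Rle_trans; [|apply re_le_Cmod]. right. f_equal.
    unfold Re, Cminus, Cplus, Copp, Cmult, RtoC; simpl. ring.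
  - eapply Rle_trans; [|apply im_le_Cmod]. right. f_equal.
    unfold Im, Cminus, Cplus, Copp, Cmult, RtoC; simpl. ring.
Qed.

(** Real and imaginary parts are estimated separately along the segment, whence the factor 2. *)
Lemma complex_mean_value (f df : C -> C) (z w : C) (L : R) :
  (forall t, 0 <= t <= 1 -> complex_derivative f (z + RtoC t * (w - z))%C (df (z + RtoC t * (w - z))%C)) ->
  (forall t, 0 <= t <= 1 -> Cmod (df (z + RtoC t * (w - z))%C) <= L) ->
  Cmod (f w - f z)%C <= 2 * L * Cmod (w - z)%C.
Proof.
  intros Hd HL. eapply Rle_trans; [apply Cmod_le_sum|].
  assert (E1 : (z + RtoC 1 * (w - z))%C = w) by ring.
  assert (E0 : (z + RtoC 0 * (w - z))%C = z) by ring.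
  assert (HB : forall t, 0 <= t <= 1 ->
     Cmod (df (z + RtoC t * (w - z))%C * (w - z))%C <= L * Cmod (w - z)%C).
  { intros t Ht. rewrite Cmod_mult. apply Rmult_le_compat_r; [apply Cmod_ge_0|auto]. }
  assert (M : forall t, Rmin 0 1 <= t <= Rmax 0 1 -> 0 <= t <= 1).
  { intros t. rewrite Rmin_left, Rmax_right by lra. auto. }
  assert (A : Rabs (Re (f w) - Re (f z)) <= L * Cmod (w - z)%C).
  { assert (V := mean_value_le (fun t => Re (f (z + RtoC t * (w - z))%C))
      (fun t => Re (df (z + RtoC t * (w - z))%C * (w - z))%C) 0 1 (L * Cmod (w - z)%C)).
    cbv beta in V. rewrite E1, E0, Rminus_0_r, Rabs_R1, Rmult_1_r in V. apply V; intros t Ht; apply M in Ht.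
    - now apply (complex_derivative_line f z (w - z)%C _ t), Hd.
    - eapply Rle_trans; [apply re_le_Cmod|auto]. }
  assert (B : Rabs (Im (f w) - Im (f z)) <= L * Cmod (w - z)%C).
  { assert (V := mean_value_le (fun t => Im (f (z + RtoC t * (w - z))%C))
      (fun t => Im (df (z + RtoC t * (w - z))%C * (w - z))%C) 0 1 (L * Cmod (w - z)%C)).
    cbv beta in V. rewrite E1, E0, Rminus_0_r, Rabs_R1, Rmult_1_r in V. apply V; intros t Ht; apply M in Ht.
    - now apply (complex_derivative_line f z (w - z)%C _ t), Hd.
    - eapply Rle_trans; [apply im_le_Cmod|auto]. }
  replace (Re (f w - f z)%C) with (Re (f w) - Re (f z)) by (unfold Re; simpl; ring).
  replace (Im (f w - f z)%C) with (Im (f w) - Im (f z)) by (unfold Im; simpl; ring).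
  lra.
Qed.

(** Two applications of [complex_mean_value], each with its factor 2. *)
Lemma complex_taylor_order2 (f f1 f2 : C -> C) (z w : C) (B : R) :
  (forall t, 0 <= t <= 1 -> complex_derivative f (z + RtoC t * (w - z))%C (f1 (z + RtoC t * (w - z))%C)) ->
  (forall t, 0 <= t <= 1 -> complex_derivative f1 (z + RtoC t * (w - z))%C (f2 (z + RtoC t * (w - z))%C)) ->
  (forall t, 0 <= t <= 1 -> Cmod (f2 (z + RtoC t * (w - z))%C) <= B) ->
  Cmod (f w - f z - (w - z) * f1 z)%C <= 4 * B * Cmod (w - z)%C ^ 2.
Proof.
  intros H1 H2 HB.
  replace (f w - f z - (w - z) * f1 z)%C with
    ((f w + (- f1 z) * w) - (f z + (- f1 z) * z))%C by ring.
  replace (4 * B * Cmod (w - z)%C ^ 2) with (2 * (2 * B * Cmod (w - z)%C) * Cmod (w - z)%C) by ring.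
  apply (complex_mean_value (fun z' => f z' + (- f1 z) * z')%C (fun z' => f1 z' - f1 z)%C).
  - intros t Ht. replace (f1 (z + RtoC t * (w - z)) - f1 z)%C with
      (f1 (z + RtoC t * (w - z)) + (- f1 z) * RtoC 1)%C by ring.
    apply (complex_derivative_plus f (fun z' => (- f1 z) * z')%C); [now apply H1|].
    apply (complex_derivative_scal (- f1 z) (fun z => z)), complex_derivative_id.
  - intros t Ht.
    assert (HB0 : 0 <= B) by (eapply Rle_trans; [apply Cmod_ge_0|apply (HB t Ht)]).
    assert (Et : Cmod (z + RtoC t * (w - z) - z)%C <= Cmod (w - z)%C).
    { replace (z + RtoC t * (w - z) - z)%C with (RtoC t * (w - z))%C by ring.
      rewrite Cmod_mult, Cmod_R, Rabs_pos_eq by lra.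
      generalize (Cmod_ge_0 (w - z)%C); nra. }
    apply Rle_trans with (2 * B * Cmod (z + RtoC t * (w - z) - z)%C).
    + apply (complex_mean_value f1 f2 z (z + RtoC t * (w - z))%C B);
        intros s Hs;
        replace (z + RtoC s * (z + RtoC t * (w - z) - z))%C with (z + RtoC (s * t) * (w - z))%C
          by (rewrite RtoC_mult; ring); [apply H2|apply HB]; nra.
    + apply Rmult_le_compat_l; lra.
Qed.

Lemma complex_derivative_quadratic (f : C -> C) (z l : C) (d K : R) : 0 < d ->
  (forall w, Cmod (w - z)%C < d ->
    Cmod (f w - f z - (w - z) * l)%C <= K * Cmod (w - z)%C ^ 2) ->
  complex_derivative f z l.
Proof.
  intros Hd H eps He.
  assert (HK : 0 < Rabs K + 1) by (generalize (Rabs_pos K); lra).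
  exists (Rmin d (eps / (Rabs K + 1))). split.
  { apply Rmin_pos; auto. now apply Rdiv_lt_0_compat. }
  intros w Hw. assert (H1 := Rlt_le_trans _ _ _ Hw (Rmin_l _ _)).
  assert (H2 := Rlt_le_trans _ _ _ Hw (Rmin_r _ _)).
  eapply Rle_trans; [now apply H|]. simpl. rewrite Rmult_1_r, <- Rmult_assoc.
  apply Rmult_le_compat_r; [apply Cmod_ge_0|].
  apply Rle_trans with ((Rabs K + 1) * Cmod (w - z)%C).
  - apply Rmult_le_compat_r; [apply Cmod_ge_0|]. generalize (Rle_abs K); lra.
  - replace eps with ((Rabs K + 1) * (eps / (Rabs K + 1))) at 1 by (field; lra).
    apply Rmult_le_compat_l; lra.
Qed.

(** * The complex exponential *)

Definition Cexp (z : C) : C := (exp (Re z) * cos (Im z), exp (Re z) * sin (Im z)).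

Lemma Cexp_plus (z w : C) : Cexp (z + w)%C = (Cexp z * Cexp w)%C.
Proof.
  unfold Cexp, Cmult, Re, Im; simpl. rewrite exp_plus, cos_plus, sin_plus.
  f_equal; ring.
Qed.

Lemma Cmod_Cexp (z : C) : Cmod (Cexp z) = exp (Re z).
Proof.
  unfold Cmod, Cexp; simpl.
  replace (_ + _) with (exp (Re z) ^ 2 * (sin (Im z) * sin (Im z) + cos (Im z) * cos (Im z)))
    by ring.
  replace (sin (Im z) * sin (Im z) + cos (Im z) * cos (Im z)) with 1
    by (generalize (sin2_cos2 (Im z)); unfold Rsqr; lra).
  rewrite Rmult_1_r. apply sqrt_pow2. left; apply exp_pos.
Qed.

Lemma Cexp_0 : Cexp 0 = RtoC 1.
Proof. unfold Cexp; simpl. rewrite exp_0, cos_0, sin_0. unfold RtoC. f_equal; ring. Qed.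

(** An expansion at 0 is enough because [Cexp] is multiplicative; 12 is a crude outcome of the real
    expansions of exp, cos and sin. *)
Lemma Cexp_small (h : C) : Cmod h < 1 ->
  Cmod (Cexp h - Cexp 0 - h * RtoC 1)%C <= 12 * Cmod h ^ 2.
Proof.
  intros Hh. destruct h as [x y].
  assert (Hx := re_le_Cmod (x, y)). assert (Hy := im_le_Cmod (x, y)). simpl in Hx, Hy.
  assert (E : exp 1 <= 3) by apply exp_le_3.
  assert (R1 : Rabs (exp x - 1 - x) <= 3 * x ^ 2).
  { rewrite <- exp_0 at 1. replace (3 * x ^ 2) with ((x - 0) ^ 2 * 3) by ring.
    replace x with ((x - 0) * exp 0) at 2 by (rewrite exp_0; ring).
    apply (taylor_order2 exp exp exp).
    - intros; apply is_derive_exp.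
    - intros; apply is_derive_exp.
    - intros t Ht. rewrite Rabs_pos_eq by (left; apply exp_pos).
      apply Rle_trans with (exp 1); auto. rewrite !Rminus_0_r in Ht.
      apply Rabs_le_between in Ht. assert (t < 1) by lra. left; now apply exp_increasing. }
  assert (R2 : Rabs (cos y - 1) <= y ^ 2).
  { replace (cos y - 1) with (cos y - cos 0 - (y - 0) * (- sin 0)) by (rewrite cos_0, sin_0; ring).
    replace (y ^ 2) with ((y - 0) ^ 2 * 1) by ring.
    apply (taylor_order2 cos (fun t => - sin t) (fun t => - cos t)).
    - intros; auto_derive; auto; ring.
    - intros; auto_derive; auto; ring.
    - intros t _. rewrite Rabs_Ropp. apply Rabs_le, COS_bound. }
  assert (R3 : Rabs (sin y - y) <= y ^ 2).
  { replace (sin y - y) with (sin y - sin 0 - (y - 0) * cos 0) by (rewrite cos_0, sin_0; ring).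
    replace (y ^ 2) with ((y - 0) ^ 2 * 1) by ring.
    apply (taylor_order2 sin cos (fun t => - sin t)).
    - intros; auto_derive; auto; ring.
    - intros; auto_derive; auto; ring.
    - intros t _. rewrite Rabs_Ropp. apply Rabs_le, SIN_bound. }
  assert (E0 : 0 < exp x) by apply exp_pos.
  assert (Ex : exp x <= 3).
  { apply Rle_trans with (exp 1); auto. apply Rabs_le_between in Hx.
    left; apply exp_increasing; lra. }
  rewrite Cexp_0. replace (Cmod (x, y) ^ 2) with (x ^ 2 + y ^ 2) by (rewrite Cmod2_alt; simpl; ring).
  eapply Rle_trans; [apply Cmod_le_sum|].
  assert (A1 : Rabs (Re (Cexp (x, y) - 1 - (x, y) * 1)%C) <= 3 * x ^ 2 + 3 * y ^ 2).
  { replace (Re (Cexp (x, y) - 1 - (x, y) * 1)%C) with ((exp x - 1 - x) + exp x * (cos y - 1))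
      by (unfold Re; simpl; ring).
    eapply Rle_trans; [apply Rabs_triang|]. apply Rplus_le_compat; auto.
    rewrite Rabs_mult, Rabs_pos_eq by lra. apply Rmult_le_compat; auto; [lra|apply Rabs_pos]. }
  assert (A2 : Rabs (Im (Cexp (x, y) - 1 - (x, y) * 1)%C) <= 4 * Rabs x * Rabs y + 3 * y ^ 2).
  { replace (Im (Cexp (x, y) - 1 - (x, y) * 1)%C) with
      ((exp x - 1 - x) * y + x * y + exp x * (sin y - y))
      by (unfold Im; simpl; ring).
    eapply Rle_trans; [apply Rabs_triang|]. apply Rplus_le_compat.
    - eapply Rle_trans; [apply Rabs_triang|]. rewrite !Rabs_mult.
      assert (3 * x ^ 2 <= 3 * Rabs x).
      { rewrite <- (pow2_abs x). generalize (Rabs_pos x); simpl; nra. }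
      generalize (Rabs_pos x) (Rabs_pos y); intros. nra.
    - rewrite Rabs_mult, (Rabs_pos_eq (exp x)) by lra.
      apply Rmult_le_compat; auto; [lra|apply Rabs_pos]. }
  assert (A3 : 2 * Rabs x * Rabs y <= x ^ 2 + y ^ 2).
  { rewrite <- (pow2_abs x), <- (pow2_abs y). generalize (pow2_ge_0 (Rabs x - Rabs y)). nra. }
  generalize (pow2_ge_0 x) (pow2_ge_0 y). lra.
Qed.

Lemma complex_derivative_Cexp (z : C) : complex_derivative Cexp z (Cexp z).
Proof.
  apply (complex_derivative_quadratic _ _ _ 1 (12 * exp (Re z))); [lra|].
  intros w Hw.
  replace (Cexp w - Cexp z - (w - z) * Cexp z)%C with
    (Cexp z * (Cexp (w - z) - Cexp 0 - (w - z) * RtoC 1))%C.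
  - rewrite Cmod_mult, Cmod_Cexp. rewrite (Rmult_comm 12), Rmult_assoc.
    apply Rmult_le_compat_l; [left; apply exp_pos|]. now apply Cexp_small.
  - rewrite Cexp_0. replace (Cexp w) with (Cexp z * Cexp (w - z))%C by (rewrite <- Cexp_plus; f_equal; ring).
    ring.
Qed.

Lemma complex_derivative_Cexp_comp (f : C -> C) (z l : C) :
  complex_derivative f z l -> complex_derivative (fun z => Cexp (f z)) z (Cexp (f z) * l)%C.
Proof. intros H. apply (complex_derivative_comp Cexp f); auto. apply complex_derivative_Cexp. Qed.

(** * The square root on the right half-plane *)

(** Half-angle formula for the principal branch. *)
Definition Csqrt (z : C) : C :=
  (sqrt ((Cmod z + Re z) / 2), Im z / (2 * sqrt ((Cmod z + Re z) / 2))).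

Lemma Csqrt_spec (z : C) : 0 < Re z -> (Csqrt z * Csqrt z)%C = z /\ 0 < Re (Csqrt z).
Proof.
  intros Hz. assert (H := re_le_Cmod z). rewrite Rabs_pos_eq in H by lra.
  set (s := sqrt ((Cmod z + Re z) / 2)).
  assert (Hs : 0 < s) by (apply sqrt_lt_R0; lra).
  assert (Hs2 : s * s = (Cmod z + Re z) / 2) by (apply sqrt_sqrt; lra).
  assert (HM := Cmod2_alt z).
  split; auto. apply Ceq_components; unfold Csqrt; fold s; simpl.
  - assert (E : (Im z / (2 * s)) * (Im z / (2 * s)) = (Cmod z - Re z) / 2).
    { replace ((Im z / (2 * s)) * (Im z / (2 * s))) with (Im z ^ 2 / (4 * (s * s)))
        by (field; lra).
      rewrite Hs2. replace (Im z ^ 2) with ((Cmod z - Re z) * (Cmod z + Re z)) by lra.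
      field. lra. }
    rewrite E, Hs2. lra.
  - field. lra.
Qed.

Lemma Cmod_Csqrt (z : C) : 0 < Re z -> Cmod (Csqrt z) ^ 2 = Cmod z.
Proof.
  intros Hz. destruct (Csqrt_spec z Hz) as [E _]. rewrite <- E at 2. rewrite Cmod_mult. ring.
Qed.

Lemma Csqrt_neq_0 (z : C) : 0 < Re z -> Csqrt z <> RtoC 0.
Proof.
  intros Hz E. destruct (Csqrt_spec z Hz) as [_ H]. rewrite E in H. simpl in H. lra.
Qed.

(** The identity sqrt w - sqrt z = (w - z) / (sqrt w + sqrt z) gives first the continuity, since the
    denominator has real part at least Re (sqrt z), and then the slope. *)
Lemma complex_derivative_Csqrt (z : C) : 0 < Re z ->
  complex_derivative Csqrt z (/ (RtoC 2 * Csqrt z))%C.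
Proof.
  intros Hz. destruct (Csqrt_spec z Hz) as [Ez Pz].
  assert (Hn : forall w, 0 < Re w -> (Csqrt w + Csqrt z)%C <> RtoC 0).
  { intros w Hw E. destruct (Csqrt_spec w Hw) as [_ P].
    assert (Re (Csqrt w + Csqrt z)%C = 0) by (rewrite E; auto).
    unfold Re in *; simpl in *. lra. }
  assert (Hloc : forall w, Cmod (w - z)%C < Re z -> 0 < Re w).
  { intros w Hw. assert (H := re_le_Cmod (w - z)%C).
    replace (Re (w - z)%C) with (Re w - Re z) in H by (unfold Re; simpl; ring).
    apply Rabs_le_between in H. lra. }
  assert (Hdiff : forall w, 0 < Re w -> (Csqrt w = Csqrt z + (w - z) * / (Csqrt w + Csqrt z))%C).
  { intros w Hw. destruct (Csqrt_spec w Hw) as [Ew _].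
    replace (w - z)%C with ((Csqrt w - Csqrt z) * (Csqrt w + Csqrt z))%C.
    - field. auto.
    - rewrite <- Ew at 3. rewrite <- Ez at 3. ring. }
  assert (Hc : continuous_C Csqrt z).
  { intros eps He. set (d := Rmin (Re z) (eps * Re (Csqrt z))).
    exists d. split; [apply Rmin_pos; auto; now apply Rmult_lt_0_compat|]. intros w Hw.
    assert (H1 := Rlt_le_trans _ _ _ Hw (Rmin_l _ _)).
    assert (H2 := Rlt_le_trans _ _ _ Hw (Rmin_r _ _)).
    assert (Hw0 := Hloc w H1).
    rewrite (Hdiff w Hw0).
    replace (Csqrt z + (w - z) * / (Csqrt w + Csqrt z) - Csqrt z)%C with
      ((w - z) * / (Csqrt w + Csqrt z))%C by ring.
    rewrite Cmod_mult, Cmod_inv by auto.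
    assert (HM : Re (Csqrt z) <= Cmod (Csqrt w + Csqrt z)%C).
    { destruct (Csqrt_spec w Hw0) as [_ P].
      eapply Rle_trans; [|apply re_le_Cmod]. eapply Rle_trans; [|apply Rle_abs].
      unfold Re in *; simpl in *; lra. }
    apply Rmult_lt_reg_r with (Cmod (Csqrt w + Csqrt z)%C); [lra|].
    rewrite Rmult_assoc, Rinv_l, Rmult_1_r by lra.
    eapply Rlt_le_trans; [apply H2|]. apply Rmult_le_compat_l; lra. }
  apply (complex_derivative_ext_loc
    (fun w => Csqrt z + (w - z) * (/ (Csqrt w + Csqrt z)))%C _ _ _ (Re z)); auto.
  { intros w Hw. symmetry. apply Hdiff; auto. }
  apply complex_derivative_slope. exists (fun w => / (Csqrt w + Csqrt z))%C.
  split; [|split].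
  - intros w. ring.
  - f_equal. ring.
  - apply (continuous_C_comp Cinv (fun w => Csqrt w + Csqrt z)%C).
    + apply continuous_C_plus; auto. apply continuous_C_const.
    + apply continuous_C_inv. auto.
Qed.

(** * Goursat's theorem *)

(** The integral of P dx + Q dy counterclockwise around [a, b] x [c, d]. *)
Definition loop_integral (P Q : R -> R -> R) (a b c d : R) : R :=
  RInt (fun x => P x c - P x d) a b + RInt (fun y => Q b y - Q a y) c d.

(** The shared [p2] says that [P dx + Q dy] is closed at the point. *)
Definition closed_form_at (P Q : R -> R -> R) (x0 y0 : R) : Prop :=
  exists p1 p2 q2 : R, forall eps, 0 < eps -> exists dl, 0 < dl /\
    forall x y, Rabs (x - x0) < dl -> Rabs (y - y0) < dl ->
      Rabs (P x y - P x0 y0 - p1 * (x - x0) - p2 * (y - y0))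
        <= eps * (Rabs (x - x0) + Rabs (y - y0)) /\
      Rabs (Q x y - Q x0 y0 - p2 * (x - x0) - q2 * (y - y0))
        <= eps * (Rabs (x - x0) + Rabs (y - y0)).

Definition closed_form_on (P Q : R -> R -> R) (a b c d : R) : Prop :=
  forall x y, a <= x <= b -> c <= y <= d -> closed_form_at P Q x y.

Lemma affine_error_continuous (f : R -> R) (x0 p dl : R) : 0 < dl ->
  (forall x, Rabs (x - x0) < dl -> Rabs (f x - f x0 - p * (x - x0)) <= 1 * Rabs (x - x0)) ->
  continuous f x0.
Proof.
  intros Hdl H. apply continuous_eps. intros eps He.
  assert (Hp : 0 < Rabs p + 2) by (generalize (Rabs_pos p); lra).
  exists (Rmin dl (eps / (Rabs p + 2))). split.
  { apply Rmin_pos; auto. now apply Rdiv_lt_0_compat. }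
  intros x Hx. assert (H1 := Rlt_le_trans _ _ _ Hx (Rmin_l _ _)).
  assert (H2 := Rlt_le_trans _ _ _ Hx (Rmin_r _ _)).
  specialize (H x H1).
  replace (f x - f x0) with ((f x - f x0 - p * (x - x0)) + p * (x - x0)) by ring.
  eapply Rle_lt_trans; [apply Rabs_triang|]. rewrite (Rabs_mult p).
  apply (Rmult_lt_compat_l (Rabs p + 2)) in H2; auto.
  replace ((Rabs p + 2) * (eps / (Rabs p + 2))) with eps in H2 by (field; lra).
  generalize (Rabs_pos (x - x0)); lra.
Qed.

Lemma closed_form_continuous (P Q : R -> R -> R) (x0 y0 : R) : closed_form_at P Q x0 y0 ->
  continuous (fun x => P x y0) x0 /\ continuous (fun y => Q x0 y) y0.
Proof.
  intros (p1 & p2 & q2 & H). destruct (H 1) as (dl & Hdl & HPQ); [lra|].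
  assert (Z : forall z, Rabs (z - z) < dl) by (intros; rewrite Rminus_diag, Rabs_R0; auto).
  split.
  - apply (affine_error_continuous _ _ p1 dl Hdl). intros x Hx.
    destruct (HPQ x y0 Hx (Z y0)) as [A _].
    rewrite !Rminus_diag, Rabs_R0, Rmult_0_r, Rminus_0_r, Rplus_0_r in A. auto.
  - apply (affine_error_continuous _ _ q2 dl Hdl). intros y Hy.
    destruct (HPQ x0 y (Z x0) Hy) as [_ A].
    rewrite !Rminus_diag, Rabs_R0, Rmult_0_r, Rminus_0_r, Rplus_0_l in A. auto.
Qed.

Lemma closed_form_ex_RInt (P Q : R -> R -> R) (a b c d : R) : closed_form_on P Q a b c d ->
  (forall u v y, a <= u -> u <= v -> v <= b -> c <= y <= d -> ex_RInt (fun x => P x y) u v) /\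
  (forall u v x, c <= u -> u <= v -> v <= d -> a <= x <= b -> ex_RInt (fun y => Q x y) u v).
Proof.
  intros H. split.
  - intros u v y Hu Huv Hv Hy. apply (ex_RInt_continuous (fun x => P x y)).
    rewrite Rmin_left, Rmax_right by auto. intros z Hz.
    apply (closed_form_continuous P Q z y), H; auto. lra.
  - intros u v x Hu Huv Hv Hx. apply (ex_RInt_continuous (fun y => Q x y)).
    rewrite Rmin_left, Rmax_right by auto. intros z Hz.
    apply (closed_form_continuous P Q x z), H; auto. lra.
Qed.

Lemma RInt_minus_R (f g : R -> R) (a b : R) : ex_RInt f a b -> ex_RInt g a b ->
  RInt (fun x => f x - g x) a b = RInt f a b - RInt g a b.
Proof. intros. apply (RInt_minus f g); auto. Qed.

Lemma RInt_Chasles_R (f : R -> R) (a b c : R) : ex_RInt f a b -> ex_RInt f b c ->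
  RInt f a c = RInt f a b + RInt f b c.
Proof. intros. symmetry. apply (RInt_Chasles f); auto. Qed.

Lemma loop_integral_split (P Q : R -> R -> R) (a b c d m k : R) :
  closed_form_on P Q a b c d -> a <= m <= b -> c <= k <= d ->
  loop_integral P Q a b c d =
    (loop_integral P Q a m c k + loop_integral P Q m b c k) +
    (loop_integral P Q a m k d + loop_integral P Q m b k d).
Proof.
  intros H Hm Hk. destruct (closed_form_ex_RInt P Q a b c d H) as [EP EQ].
  unfold loop_integral.
  assert (XP : forall u v y z, a <= u -> u <= v -> v <= b -> c <= y <= d -> c <= z <= d ->
    RInt (fun x => P x y - P x z) u v = RInt (fun x => P x y) u v - RInt (fun x => P x z) u v).
  { intros. apply (RInt_minus_R (fun x => P x y) (fun x => P x z)); apply EP; auto. }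
  assert (XQ : forall u v x z, c <= u -> u <= v -> v <= d -> a <= x <= b -> a <= z <= b ->
    RInt (fun y => Q x y - Q z y) u v = RInt (fun y => Q x y) u v - RInt (fun y => Q z y) u v).
  { intros. apply (RInt_minus_R (fun y => Q x y) (fun y => Q z y)); apply EQ; auto. }
  rewrite (XP a b c d), (XP a m c k), (XP m b c k), (XP a m k d), (XP m b k d) by lra.
  rewrite (XQ c d b a), (XQ c k m a), (XQ c k b m), (XQ k d m a), (XQ k d b m) by lra.
  rewrite (RInt_Chasles_R (fun x => P x c) a m b), (RInt_Chasles_R (fun x => P x d) a m b)
    by (apply EP; lra).
  rewrite (RInt_Chasles_R (fun y => Q b y) c k d), (RInt_Chasles_R (fun y => Q a y) c k d)
    by (apply EQ; lra).
  ring.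
Qed.

(** The affine parts contribute p2 (c - d) (b - a) + p2 (b - a) (d - c) = 0, which is where
    closedness enters; only the error terms remain. *)
Lemma loop_integral_small (P Q : R -> R -> R) (a b c d x0 y0 p1 p2 q2 eps dl : R) :
  closed_form_on P Q a b c d -> a <= x0 <= b -> c <= y0 <= d -> 0 < eps ->
  b - a < dl -> d - c < dl ->
  (forall x y, Rabs (x - x0) < dl -> Rabs (y - y0) < dl ->
      Rabs (P x y - P x0 y0 - p1 * (x - x0) - p2 * (y - y0))
        <= eps * (Rabs (x - x0) + Rabs (y - y0)) /\
      Rabs (Q x y - Q x0 y0 - p2 * (x - x0) - q2 * (y - y0))
        <= eps * (Rabs (x - x0) + Rabs (y - y0))) ->
  Rabs (loop_integral P Q a b c d) <= 2 * eps * ((b - a) + (d - c)) ^ 2.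
Proof.
  intros H Hx Hy He Hba Hdc HPQ.
  destruct (closed_form_ex_RInt P Q a b c d H) as [EP EQ].
  assert (B : forall x y, a <= x <= b -> c <= y <= d ->
     Rabs (P x y - P x0 y0 - p1 * (x - x0) - p2 * (y - y0)) <= eps * ((b - a) + (d - c)) /\
     Rabs (Q x y - Q x0 y0 - p2 * (x - x0) - q2 * (y - y0)) <= eps * ((b - a) + (d - c))).
  { intros x y Hxx Hyy.
    assert (A1 : Rabs (x - x0) <= b - a) by (apply Rabs_le; lra).
    assert (A2 : Rabs (y - y0) <= d - c) by (apply Rabs_le; lra).
    destruct (HPQ x y) as [R1 R2]; [lra|lra|].
    assert (eps * (Rabs (x - x0) + Rabs (y - y0)) <= eps * ((b - a) + (d - c)))
      by (apply Rmult_le_compat_l; lra). lra. }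
  assert (EPm : ex_RInt (fun x => P x c - P x d) a b).
  { apply (ex_RInt_minus (fun x => P x c) (fun x => P x d)); apply EP; lra. }
  assert (EQm : ex_RInt (fun y => Q b y - Q a y) c d).
  { apply (ex_RInt_minus (fun y => Q b y) (fun y => Q a y)); apply EQ; lra. }
  assert (E : loop_integral P Q a b c d =
     RInt (fun x => (P x c - P x d) - p2 * (c - d)) a b
     + RInt (fun y => (Q b y - Q a y) - p2 * (b - a)) c d).
  { unfold loop_integral.
    rewrite (RInt_minus_R (fun x => P x c - P x d) (fun _ => p2 * (c - d))),
      (RInt_minus_R (fun y => Q b y - Q a y) (fun _ => p2 * (b - a))); auto;
      try apply ex_RInt_const.
    rewrite !RInt_const. unfold scal; simpl; unfold mult; simpl. ring. }
  rewrite E. eapply Rle_trans; [apply Rabs_triang|].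
  replace (2 * eps * (b - a + (d - c)) ^ 2) with
    ((b - a) * (2 * eps * (b - a + (d - c))) + (d - c) * (2 * eps * (b - a + (d - c)))) by ring.
  apply Rplus_le_compat.
  - apply Rabs_RInt_le with (fun _ => 2 * eps * (b - a + (d - c))); [lra| | |].
    + apply (ex_RInt_minus (fun x => P x c - P x d) (fun _ => p2 * (c - d))); auto.
      apply ex_RInt_const.
    + exact (is_RInt_const (V := R_NormedModule) a b _).
    + intros x Hxx. destruct (B x c) as [B1 _]; [lra|lra|].
      destruct (B x d) as [B2 _]; [lra|lra|].
      apply Rabs_le_between in B1. apply Rabs_le_between in B2. apply Rabs_le. lra.
  - apply Rabs_RInt_le with (fun _ => 2 * eps * (b - a + (d - c))); [lra| | |].
    + apply (ex_RInt_minus (fun y => Q b y - Q a y) (fun _ => p2 * (b - a))); auto.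
      apply ex_RInt_const.
    + exact (is_RInt_const (V := R_NormedModule) c d _).
    + intros y Hyy. destruct (B b y) as [_ B1]; [lra|lra|].
      destruct (B a y) as [_ B2]; [lra|lra|].
      apply Rabs_le_between in B1. apply Rabs_le_between in B2. apply Rabs_le. lra.
Qed.

Record rectangle := Rect { left_ : R; right_ : R; bottom_ : R; top_ : R }.

Definition rect_loop (P Q : R -> R -> R) (r : rectangle) : R :=
  loop_integral P Q (left_ r) (right_ r) (bottom_ r) (top_ r).

(** A quarter that keeps at least a fourth of the loop integral. The last one is the default: by the
    triangle inequality it qualifies when the other three fail. *)
Definition quarter (P Q : R -> R -> R) (r : rectangle) : rectangle :=
  let (a, b, c, d) := r in
  let m := (a + b) / 2 in let k := (c + d) / 2 in
  let big s := Rle_dec (Rabs (rect_loop P Q r) / 4) (Rabs (rect_loop P Q s)) in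
  if big (Rect a m c k) then Rect a m c k else
  if big (Rect m b c k) then Rect m b c k else
  if big (Rect a m k d) then Rect a m k d else Rect m b k d.

Lemma quarter_spec (P Q : R -> R -> R) (r : rectangle) :
  left_ r <= right_ r -> bottom_ r <= top_ r ->
  closed_form_on P Q (left_ r) (right_ r) (bottom_ r) (top_ r) ->
  let s := quarter P Q r in
  left_ r <= left_ s /\ left_ s <= right_ s /\ right_ s <= right_ r /\
  bottom_ r <= bottom_ s /\ bottom_ s <= top_ s /\ top_ s <= top_ r /\
  right_ s - left_ s = (right_ r - left_ r) / 2 /\
  top_ s - bottom_ s = (top_ r - bottom_ r) / 2 /\
  Rabs (rect_loop P Q r) / 4 <= Rabs (rect_loop P Q s).
Proof.
  destruct r as [a b c d]. simpl. intros Hab Hcd H.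
  assert (E := loop_integral_split P Q a b c d ((a + b) / 2) ((c + d) / 2) H
    ltac:(lra) ltac:(lra)).
  unfold rect_loop; simpl.
  destruct Rle_dec as [H1|H1]; simpl; [repeat split; lra|].
  destruct Rle_dec as [H2|H2]; simpl; [repeat split; lra|].
  destruct Rle_dec as [H3|H3]; simpl; [repeat split; lra|].
  repeat split; try lra.
  apply Rnot_lt_le. intros H4.
  assert (T : Rabs (loop_integral P Q a b c d) <=
     (Rabs (loop_integral P Q a ((a + b) / 2) c ((c + d) / 2)) +
      Rabs (loop_integral P Q ((a + b) / 2) b c ((c + d) / 2))) +
     (Rabs (loop_integral P Q a ((a + b) / 2) ((c + d) / 2) d) +
      Rabs (loop_integral P Q ((a + b) / 2) b ((c + d) / 2) d))).
  { rewrite E at 1. eapply Rle_trans; [apply Rabs_triang|].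
    apply Rplus_le_compat; apply Rabs_triang. }
  lra.
Qed.

Lemma nested_intervals (a b : nat -> R) :
  (forall n, a n <= a (S n)) -> (forall n, b (S n) <= b n) -> (forall n, a n <= b n) ->
  exists x, forall n, a n <= x <= b n.
Proof.
  intros Ha Hb Hab.
  assert (Hbm : forall n m, a n <= b m).
  { assert (Ham : forall n m, (n <= m)%nat -> a n <= a m).
    { intros n m Hnm; induction Hnm; [lra|]. eapply Rle_trans; [apply IHHnm|apply Ha]. }
    assert (Hbmm : forall n m, (n <= m)%nat -> b m <= b n).
    { intros n m Hnm; induction Hnm; [lra|]. eapply Rle_trans; [apply Hb|apply IHHnm]. }
    intros n m. destruct (Nat.le_ge_cases n m) as [H|H].
    - eapply Rle_trans; [apply (Ham n m H)|apply Hab].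
    - eapply Rle_trans; [apply Hab|apply (Hbmm m n H)]. }
  destruct (ex_finite_lim_seq_incr a (b 0%nat) Ha) as [x Hx]; [intros; apply Hbm|].
  exists x. intros n. split.
  - now apply (is_lim_seq_incr_compare a x).
  - apply (is_lim_seq_le a (fun _ => b n) x (b n)); auto. apply is_lim_seq_const.
Qed.

(** Bisection: after n steps the loop integral is still at least 4^(-n) times the original one,
    while differentiability at the common point of the rectangles bounds it by 2 eps W^2 4^(-n). *)
Lemma Goursat (P Q : R -> R -> R) (a b c d : R) : a <= b -> c <= d ->
  closed_form_on P Q a b c d -> loop_integral P Q a b c d = 0.
Proof.
  intros Hab Hcd H.
  set (r := fix r n := match n with O => Rect a b c d | S n => quarter P Q (r n) end).
  assert (Inv : forall n, a <= left_ (r n) /\ right_ (r n) <= b /\ c <= bottom_ (r n) /\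
     top_ (r n) <= d /\ left_ (r n) <= right_ (r n) /\ bottom_ (r n) <= top_ (r n) /\
     right_ (r n) - left_ (r n) = (b - a) * (/ 2) ^ n /\
     top_ (r n) - bottom_ (r n) = (d - c) * (/ 2) ^ n /\
     Rabs (loop_integral P Q a b c d) * (/ 4) ^ n <= Rabs (rect_loop P Q (r n))).
  { induction n as [|n IH].
    - simpl. unfold rect_loop; simpl. repeat split; try lra.
    - destruct IH as (I1 & I2 & I3 & I4 & I5 & I6 & I7 & I8 & I9).
      destruct (quarter_spec P Q (r n)) as (J1 & J2 & J3 & J4 & J5 & J6 & J7 & J8 & J9); auto.
      { intros x y Hx Hy. apply H; lra. }
      simpl. repeat split; try lra. }
  assert (Step : forall n, left_ (r n) <= left_ (r (S n)) /\ right_ (r (S n)) <= right_ (r n) /\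
     bottom_ (r n) <= bottom_ (r (S n)) /\ top_ (r (S n)) <= top_ (r n)).
  { intros n. destruct (Inv n) as (I1 & I2 & I3 & I4 & I5 & I6 & _).
    destruct (quarter_spec P Q (r n)) as (J1 & J2 & J3 & J4 & J5 & J6 & _); auto.
    intros x y Hx Hy. apply H; lra. }
  destruct (nested_intervals (fun n => left_ (r n)) (fun n => right_ (r n))) as [x0 Hx0];
    try (intros n; first [apply (Step n)|apply (Inv n)]).
  destruct (nested_intervals (fun n => bottom_ (r n)) (fun n => top_ (r n))) as [y0 Hy0];
    try (intros n; first [apply (Step n)|apply (Inv n)]).
  assert (HC : closed_form_at P Q x0 y0).
  { apply H; [apply (Hx0 0%nat)|apply (Hy0 0%nat)]. }
  destruct HC as (p1 & p2 & q2 & HC).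
  destruct (Req_dec (loop_integral P Q a b c d) 0) as [|Hne]; auto. exfalso.
  assert (Hpos := Rabs_pos_lt _ Hne).
  set (W := (b - a) + (d - c)) in *.
  (* Chosen so that eps (2 W^2 + 1) is half of the absolute value of the loop integral, which
     contradicts the bound 2 eps W^2. *)
  set (eps := Rabs (loop_integral P Q a b c d) / (2 * W ^ 2 + 1) / 2).
  assert (HW : 0 < 2 * W ^ 2 + 1) by (generalize (pow2_ge_0 W); lra).
  assert (He : 0 < eps).
  { unfold eps. apply Rdiv_lt_0_compat; [now apply Rdiv_lt_0_compat|lra]. }
  destruct (HC eps He) as (dl & Hdl & HPQ).
  assert (Hh : Rabs (/ 2) < 1) by (rewrite Rabs_pos_eq; lra).
  destruct (pow_lt_1_zero (/ 2) Hh (dl / (W + 1))) as [n Hn].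
  { apply Rdiv_lt_0_compat; unfold W; lra. }
  specialize (Hn n (le_n n)). rewrite Rabs_pos_eq in Hn by (apply pow_le; lra).
  destruct (Inv n) as (I1 & I2 & I3 & I4 & I5 & I6 & I7 & I8 & I9).
  assert (Hp2 : 0 < (/ 2) ^ n) by (apply pow_lt; lra).
  assert (Hsm : W * (/ 2) ^ n < dl).
  { apply Rle_lt_trans with ((W + 1) * (/ 2) ^ n); [nra|].
    apply (Rmult_lt_compat_l (W + 1)) in Hn; [|unfold W; lra].
    replace ((W + 1) * (dl / (W + 1))) with dl in Hn by (field; unfold W; lra). auto. }
  assert (S := loop_integral_small P Q (left_ (r n)) (right_ (r n)) (bottom_ (r n)) (top_ (r n))
    x0 y0 p1 p2 q2 eps dl).
  assert (Hl : Rabs (rect_loop P Q (r n)) <=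
     2 * eps * (right_ (r n) - left_ (r n) + (top_ (r n) - bottom_ (r n))) ^ 2).
  { apply S; auto.
    - intros x y Hx Hy. apply H; lra.
    - rewrite I7. unfold W in Hsm. nra.
    - rewrite I8. unfold W in Hsm. nra. }
  rewrite I7, I8 in Hl.
  replace (2 * eps * ((b - a) * (/ 2) ^ n + (d - c) * (/ 2) ^ n) ^ 2) with
    (2 * eps * W ^ 2 * (/ 4) ^ n) in Hl.
  2: { replace (/ 4) with (/ 2 * / 2) by field. rewrite Rpow_mult_distr. unfold W. ring. }
  assert (Hp4 : 0 < (/ 4) ^ n) by (apply pow_lt; lra).
  assert (F : Rabs (loop_integral P Q a b c d) <= 2 * eps * W ^ 2).
  { apply Rmult_le_reg_r with ((/ 4) ^ n); auto. lra. }
  assert (G : eps * (2 * W ^ 2 + 1) = Rabs (loop_integral P Q a b c d) / 2).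
  { unfold eps. field. lra. }
  lra.
Qed.

(** * Paths in the complex plane *)

Definition continuous_RC (F : R -> C) (t : R) : Prop :=
  continuous (fun t => Re (F t)) t /\ continuous (fun t => Im (F t)) t.

Lemma continuous_RC_eps (F : R -> C) (t : R) : continuous_RC F t <->
  forall eps, 0 < eps -> exists d, 0 < d /\
    forall s, Rabs (s - t) < d -> Cmod (F s - F t)%C < eps.
Proof.
  assert (ER : forall z w, Re (z - w)%C = Re z - Re w) by (intros; unfold Re; simpl; ring).
  assert (EI : forall z w, Im (z - w)%C = Im z - Im w) by (intros; unfold Im; simpl; ring).
  unfold continuous_RC. rewrite !continuous_eps. split.
  - intros [HR HI] eps He.
    destruct (HR (eps / 2)) as (d1 & Hd1 & H1); [lra|].
    destruct (HI (eps / 2)) as (d2 & Hd2 & H2); [lra|].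
    exists (Rmin d1 d2); split; [now apply Rmin_pos|]. intros s Hs.
    specialize (H1 s (Rlt_le_trans _ _ _ Hs (Rmin_l _ _))).
    specialize (H2 s (Rlt_le_trans _ _ _ Hs (Rmin_r _ _))).
    eapply Rle_lt_trans; [apply Cmod_le_sum|]. rewrite ER, EI. lra.
  - intros H. split; intros eps He; destruct (H eps He) as (d & Hd & Hs);
      exists d; split; auto; intros s Hss; (eapply Rle_lt_trans; [|apply (Hs s Hss)]).
    + rewrite <- ER. apply re_le_Cmod.
    + rewrite <- EI. apply im_le_Cmod.
Qed.

Lemma continuous_RC_comp (f : C -> C) (F : R -> C) (t : R) :
  continuous_RC F t -> continuous_C f (F t) -> continuous_RC (fun t => f (F t)) t.
Proof.
  rewrite !continuous_RC_eps. intros HF Hf eps He.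
  destruct (Hf eps He) as (d & Hd & H). destruct (HF d Hd) as (d' & Hd' & H').
  exists d'; split; auto.
Qed.

Lemma continuous_RC_const (c : C) (t : R) : continuous_RC (fun _ => c) t.
Proof. split; apply continuous_const. Qed.

Lemma continuous_RC_RtoC (f : R -> R) (t : R) :
  continuous f t -> continuous_RC (fun t => RtoC (f t)) t.
Proof. intros H; split; [exact H|apply continuous_const]. Qed.

Lemma continuous_RC_plus (F G : R -> C) (t : R) :
  continuous_RC F t -> continuous_RC G t -> continuous_RC (fun t => F t + G t)%C t.
Proof.
  intros [A B] [A' B']; split.
  - apply (continuous_plus (fun t => Re (F t)) (fun t => Re (G t))); auto.
  - apply (continuous_plus (fun t => Im (F t)) (fun t => Im (G t))); auto.
Qed.

Lemma continuous_RC_mult (F G : R -> C) (t : R) :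
  continuous_RC F t -> continuous_RC G t -> continuous_RC (fun t => F t * G t)%C t.
Proof.
  intros [A B] [A' B']; split.
  - apply (continuous_minus (fun t => Re (F t) * Re (G t)) (fun t => Im (F t) * Im (G t)));
    apply (continuous_mult (K := R_AbsRing)); auto.
  - apply (continuous_plus (fun t => Re (F t) * Im (G t)) (fun t => Im (F t) * Re (G t)));
    apply (continuous_mult (K := R_AbsRing)); auto.
Qed.

Lemma continuous_RC_ext (F G : R -> C) (t : R) :
  (forall s, F s = G s) -> continuous_RC F t -> continuous_RC G t.
Proof.
  intros E [A B]; split; [apply (continuous_ext (fun t => Re (F t)))|
    apply (continuous_ext (fun t => Im (F t)))]; auto; intros; now rewrite E.
Qed.

Definition C_RInt (F : R -> C) (a b : R) : C :=
  (RInt (fun t => Re (F t)) a b, RInt (fun t => Im (F t)) a b).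

Definition path_continuous (F : R -> C) (a b : R) : Prop :=
  forall t, a <= t <= b -> continuous_RC F t.

Lemma path_continuous_ex_RInt (F : R -> C) (a b : R) : a <= b -> path_continuous F a b ->
  ex_RInt (fun t => Re (F t)) a b /\ ex_RInt (fun t => Im (F t)) a b.
Proof.
  intros Hab H; split.
  - apply (ex_RInt_continuous (fun t => Re (F t))).
    rewrite Rmin_left, Rmax_right by auto. intros z Hz. exact (proj1 (H z Hz)).
  - apply (ex_RInt_continuous (fun t => Im (F t))).
    rewrite Rmin_left, Rmax_right by auto. intros z Hz. exact (proj2 (H z Hz)).
Qed.

Lemma C_RInt_plus (F G : R -> C) (a b : R) : a <= b ->
  path_continuous F a b -> path_continuous G a b ->
  C_RInt (fun t => F t + G t)%C a b = (C_RInt F a b + C_RInt G a b)%C.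
Proof.
  intros Hab HF HG. destruct (path_continuous_ex_RInt F a b Hab HF).
  destruct (path_continuous_ex_RInt G a b Hab HG).
  unfold C_RInt, Cplus; simpl. f_equal.
  - apply (RInt_plus (fun t => Re (F t)) (fun t => Re (G t))); auto.
  - apply (RInt_plus (fun t => Im (F t)) (fun t => Im (G t))); auto.
Qed.

Lemma RInt_scal_R (c : R) (f : R -> R) (a b : R) : ex_RInt f a b ->
  RInt (fun x => c * f x) a b = c * RInt f a b.
Proof. intros. apply (RInt_scal f); auto. Qed.

Lemma C_RInt_scal (c : C) (F : R -> C) (a b : R) : a <= b -> path_continuous F a b ->
  C_RInt (fun t => c * F t)%C a b = (c * C_RInt F a b)%C.
Proof.
  intros Hab HF. destruct (path_continuous_ex_RInt F a b Hab HF) as [E1 E2].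
  apply Ceq_components; unfold C_RInt; simpl.
  - rewrite <- !RInt_scal_R by auto.
    apply (RInt_minus (fun t => fst c * Re (F t)) (fun t => snd c * Im (F t)));
    apply (ex_RInt_scal (V := R_NormedModule)); auto.
  - rewrite <- !RInt_scal_R by auto.
    apply (RInt_plus (fun t => fst c * Im (F t)) (fun t => snd c * Re (F t)));
    apply (ex_RInt_scal (V := R_NormedModule)); auto.
Qed.

Lemma Cmod_C_RInt_le (F : R -> C) (a b K : R) : a <= b -> path_continuous F a b ->
  (forall t, a <= t <= b -> Cmod (F t) <= K) -> Cmod (C_RInt F a b) <= 2 * ((b - a) * K).
Proof.
  intros Hab HF HK. destruct (path_continuous_ex_RInt F a b Hab HF) as [E1 E2].
  eapply Rle_trans; [apply Cmod_le_sum|]. unfold C_RInt; simpl.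
  assert (Rabs (RInt (fun t => Re (F t)) a b) <= (b - a) * K).
  { apply Rabs_RInt_le with (fun _ => K); auto.
    - exact (is_RInt_const (V := R_NormedModule) a b K).
    - intros; eapply Rle_trans; [apply re_le_Cmod|auto]. }
  assert (Rabs (RInt (fun t => Im (F t)) a b) <= (b - a) * K).
  { apply Rabs_RInt_le with (fun _ => K); auto.
    - exact (is_RInt_const (V := R_NormedModule) a b K).
    - intros; eapply Rle_trans; [apply im_le_Cmod|auto]. }
  lra.
Qed.

(** f dz = (u dx - v dy) + i (v dx + u dy), and the Cauchy-Riemann equations say that both forms are
    closed. *)
Lemma holomorphic_closed_form (f : C -> C) (x y : R) (l : C) :
  complex_derivative f (x, y) l ->
  closed_form_at (fun x y => Re (f (x, y))) (fun x y => - Im (f (x, y))) x y /\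
  closed_form_at (fun x y => Im (f (x, y))) (fun x y => Re (f (x, y))) x y.
Proof.
  intros H.
  assert (K : forall eps, 0 < eps -> exists d, 0 < d /\ forall s t,
     Rabs (s - x) < d -> Rabs (t - y) < d ->
     Rabs (Re (f (s, t)) - Re (f (x, y)) - Re l * (s - x) - (- Im l) * (t - y))
        <= eps * (Rabs (s - x) + Rabs (t - y)) /\
     Rabs (Im (f (s, t)) - Im (f (x, y)) - Im l * (s - x) - Re l * (t - y))
        <= eps * (Rabs (s - x) + Rabs (t - y))).
  { intros eps He. destruct (H eps He) as (d & Hd & Hf).
    exists (d / 2). split; [lra|]. intros s t Hs Ht. specialize (Hf (s, t)).
    assert (E : Cmod ((s, t) - (x, y))%C <= Rabs (s - x) + Rabs (t - y)).
    { eapply Rle_trans; [apply Cmod_le_sum|]. right. reflexivity. }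
    assert (Hf' : Cmod (f (s, t) - f (x, y) - ((s, t) - (x, y)) * l)%C
       <= eps * (Rabs (s - x) + Rabs (t - y))).
    { eapply Rle_trans; [apply Hf; lra|]. apply Rmult_le_compat_l; lra. }
    split; (eapply Rle_trans; [|apply Hf']).
    - eapply Rle_trans; [|apply re_le_Cmod]. right. f_equal.
      unfold Re, Im, Cminus, Cplus, Copp, Cmult; simpl. ring.
    - eapply Rle_trans; [|apply im_le_Cmod]. right. f_equal.
      unfold Re, Im, Cminus, Cplus, Copp, Cmult; simpl. ring. }
  split.
  - exists (Re l), (- Im l), (- Re l). intros eps He. destruct (K eps He) as (d & Hd & Hf).
    exists d; split; auto. intros s t Hs Ht. destruct (Hf s t Hs Ht) as [A B]. split; auto.
    rewrite <- Rabs_Ropp. eapply Rle_trans; [|apply B]. right. f_equal. ring.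
  - exists (Im l), (Re l), (- Im l). intros eps He. destruct (K eps He) as (d & Hd & Hf).
    exists d; split; auto. intros s t Hs Ht. destruct (Hf s t Hs Ht) as [A B]. split; auto.
Qed.

(** The real part is Goursat's theorem for v dx + u dy, the imaginary part the one for u dx - v
    dy. *)
Lemma Cauchy_rectangle (f df : C -> C) (a b c d : R) : a <= b -> c <= d ->
  (forall x y, a <= x <= b -> c <= y <= d -> complex_derivative f (x, y) (df (x, y))) ->
  C_RInt (fun y => f (b, y) - f (a, y))%C c d =
  (Ci * C_RInt (fun x => f (x, c) - f (x, d))%C a b)%C.
Proof.
  intros Hab Hcd H.
  assert (G1 := Goursat (fun x y => Re (f (x, y))) (fun x y => - Im (f (x, y))) a b c d Hab Hcd).
  assert (G2 := Goursat (fun x y => Im (f (x, y))) (fun x y => Re (f (x, y))) a b c d Hab Hcd).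
  unfold loop_integral in *.
  assert (C1 : closed_form_on (fun x y => Re (f (x, y))) (fun x y => - Im (f (x, y))) a b c d).
  { intros x y Hx Hy. eapply holomorphic_closed_form, H; auto. }
  assert (C2 : closed_form_on (fun x y => Im (f (x, y))) (fun x y => Re (f (x, y))) a b c d).
  { intros x y Hx Hy. eapply holomorphic_closed_form, H; auto. }
  specialize (G1 C1). specialize (G2 C2).
  assert (E : RInt (fun y => - Im (f (b, y)) - - Im (f (a, y))) c d
     = - RInt (fun y => Im (f (b, y)) - Im (f (a, y))) c d).
  { rewrite <- (RInt_opp (V := R_CompleteNormedModule)).
    - apply RInt_ext. intros. unfold opp; simpl. ring.
    - destruct (closed_form_ex_RInt _ _ _ _ _ _ C1) as [_ EQ].
      apply (ex_RInt_minus (fun y => Im (f (b, y))) (fun y => Im (f (a, y)))).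
      + apply (ex_RInt_ext (fun y => - - Im (f (b, y)))); [intros; apply Ropp_involutive|].
        apply (ex_RInt_opp (fun y => - Im (f (b, y)))), EQ; lra.
      + apply (ex_RInt_ext (fun y => - - Im (f (a, y)))); [intros; apply Ropp_involutive|].
        apply (ex_RInt_opp (fun y => - Im (f (a, y)))), EQ; lra. }
  rewrite E in G1.
  unfold C_RInt. apply Ceq_components; simpl; unfold Re, Im, Cminus, Cplus, Copp in *; simpl in *;
  unfold Rminus in *; lra.
Qed.

(** * Complex integrals over the real line *)

Definition Cdecays (K : R) (F : R -> C) : Prop :=
  (forall t, continuous_RC F t) /\ forall t, Cmod (F t) <= K / (1 + t ^ 2).

Definition Cintegral (F : R -> C) : C :=
  (integral (fun t => Re (F t)), integral (fun t => Im (F t))).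

Lemma Cdecays_components (K : R) (F : R -> C) : Cdecays K F ->
  decays K (fun t => Re (F t)) /\ decays K (fun t => Im (F t)).
Proof.
  intros [HF HK]. split; split; intros t.
  - exact (proj1 (HF t)).
  - eapply Rle_trans; [apply re_le_Cmod|apply HK].
  - exact (proj2 (HF t)).
  - eapply Rle_trans; [apply im_le_Cmod|apply HK].
Qed.

Lemma Cdecays_integrable (K : R) (F : R -> C) : Cdecays K F ->
  integrable (fun t => Re (F t)) /\ integrable (fun t => Im (F t)).
Proof. intros H. destruct (Cdecays_components K F H). split; eexists; eauto. Qed.

Lemma Cintegral_bound (K : R) (F : R -> C) : Cdecays K F -> Cmod (Cintegral F) <= 8 * K.
Proof.
  intros H. destruct (Cdecays_components K F H) as [H1 H2].
  eapply Rle_trans; [apply Cmod_le_sum|]. simpl.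
  apply integral_bound in H1. apply integral_bound in H2. lra.
Qed.

Lemma Cintegral_ext (F G : R -> C) : (forall t, F t = G t) -> Cintegral F = Cintegral G.
Proof.
  intros E. unfold Cintegral. f_equal; apply integral_ext; intros; now rewrite E.
Qed.

Lemma Cintegral_plus (K L : R) (F G : R -> C) : Cdecays K F -> Cdecays L G ->
  Cintegral (fun t => F t + G t)%C = (Cintegral F + Cintegral G)%C.
Proof.
  intros HF HG. destruct (Cdecays_integrable _ _ HF). destruct (Cdecays_integrable _ _ HG).
  apply Ceq_components; simpl; apply integral_plus; auto.
Qed.

Lemma Cintegral_scal (K : R) (c : C) (F : R -> C) : Cdecays K F ->
  Cintegral (fun t => c * F t)%C = (c * Cintegral F)%C.
Proof.
  intros HF. destruct (Cdecays_integrable _ _ HF) as [A B].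
  apply Ceq_components; simpl.
  - rewrite <- !integral_scal by auto.
    rewrite <- integral_minus by now apply integrable_scal. reflexivity.
  - rewrite <- !integral_scal by auto.
    rewrite <- integral_plus by now apply integrable_scal. reflexivity.
Qed.

Lemma Cdecays_plus (K L : R) (F G : R -> C) : Cdecays K F -> Cdecays L G ->
  Cdecays (K + L) (fun t => F t + G t)%C.
Proof.
  intros [HF HK] [HG HL]; split; intros t.
  - now apply continuous_RC_plus.
  - eapply Rle_trans; [apply Cmod_triangle|]. specialize (HK t). specialize (HL t).
    unfold Rdiv in *; lra.
Qed.

Lemma Cdecays_scal (K : R) (c : C) (F : R -> C) : Cdecays K F ->
  Cdecays (Cmod c * K) (fun t => c * F t)%C.
Proof.
  intros [HF HK]; split; intros t.
  - apply continuous_RC_mult; auto. apply continuous_RC_const.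
  - rewrite Cmod_mult. unfold Rdiv. rewrite Rmult_assoc.
    apply Rmult_le_compat_l; [apply Cmod_ge_0|apply HK].
Qed.

Lemma Cdecays_ext (K : R) (F G : R -> C) : (forall t, F t = G t) -> Cdecays K F -> Cdecays K G.
Proof.
  intros E [HF HK]; split; intros t.
  - apply (continuous_RC_ext F); auto.
  - rewrite <- E. apply HK.
Qed.

Lemma Cintegral_zero_of_small (K L : R) (F : R -> C) : Cdecays K F ->
  (exists T0, forall T, T0 <= T -> 0 < T -> Cmod (C_RInt F (- T) T) <= L / T) ->
  Cintegral F = 0.
Proof.
  intros HF [T0 HT]. destruct (Cdecays_components _ _ HF) as [H1 H2].
  assert (Z : forall f, decays K f ->
    (forall T, T0 <= T -> 0 < T -> Rabs (RInt f (- T) T) <= L / T) -> integral f = 0).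
  { intros f Hf Hs. apply integral_unique, is_lim_seq_abs_0.
    destruct (nfloor_ex (Rabs T0)) as [N [_ HN]]; [apply Rabs_pos|].
    apply is_lim_seq_le_le_loc with (fun _ => 0) (fun n => L * / INR n).
    - exists (S N). intros n Hn. apply le_INR in Hn. rewrite S_INR in Hn.
      split; [apply Rabs_pos|]. apply Hs.
      + generalize (Rle_abs T0); lra.
      + generalize (pos_INR N); lra.
    - apply is_lim_seq_const.
    - replace (Finite 0) with (Rbar_mult (Finite L) (Finite 0)) by (simpl; f_equal; ring).
      apply is_lim_seq_scal_l. replace (Finite 0) with (Rbar_inv p_infty) by reflexivity.
      apply is_lim_seq_inv; [apply is_lim_seq_INR|discriminate]. }
  unfold Cintegral. rewrite !Z; auto; intros T HT0 HTp.
  - eapply Rle_trans; [|apply HT; auto]. apply (im_le_Cmod (C_RInt F (- T) T)).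
  - eapply Rle_trans; [|apply HT; auto]. apply (re_le_Cmod (C_RInt F (- T) T)).
Qed.

Lemma Cintegral_derive (K L : R) (F G : R -> C) : Cdecays K F ->
  (forall t, is_derive (fun t => Re (G t)) t (Re (F t)) /\
             is_derive (fun t => Im (G t)) t (Im (F t))) ->
  (forall t, Cmod (G t) * (1 + Rabs t) <= L) -> Cintegral F = 0.
Proof.
  intros HF HG HL. destruct (Cdecays_integrable _ _ HF) as [H1 H2].
  assert (P : forall t, 0 <= 1 + Rabs t) by (intros t; generalize (Rabs_pos t); lra).
  apply Ceq_components; simpl.
  - apply (integral_derive (fun t => Re (G t)) _ L); auto; intros t; [apply HG|].
    eapply Rle_trans; [|apply (HL t)]. apply Rmult_le_compat_r; auto. apply re_le_Cmod.
  - apply (integral_derive (fun t => Im (G t)) _ L); auto; intros t; [apply HG|].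
    eapply Rle_trans; [|apply (HL t)]. apply Rmult_le_compat_r; auto. apply im_le_Cmod.
Qed.

Lemma continuous_RC_vertical (c t : R) : continuous_RC (fun t => (c, t)) t.
Proof. split; [apply continuous_const|apply continuous_id]. Qed.

Lemma continuous_RC_horizontal (c t : R) : continuous_RC (fun t => (t, c)) t.
Proof. split; [apply continuous_id|apply continuous_const]. Qed.

(** On the line, min(1, c^2) (1 + t^2) <= c^2 + t^2 = |v|^2. *)
Lemma vertical_line_decays (h : C -> C) (K c : R) : 0 < c ->
  (forall t, continuous_C h (c, t)) ->
  (forall t, Cmod (h (c, t)) <= K / Cmod (c, t) ^ 2) ->
  Cdecays (K / Rmin 1 (c ^ 2)) (fun t => h (c, t)).
Proof.
  intros Hc Hcont HK.
  assert (Hc2 : 0 < c ^ 2) by now apply pow_lt.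
  assert (Hm : 0 < Rmin 1 (c ^ 2)) by (apply Rmin_pos; lra).
  assert (Hv : forall t, Cmod (c, t) ^ 2 = c ^ 2 + t ^ 2).
  { intros t. rewrite Cmod2_alt. reflexivity. }
  assert (HK0 : 0 <= K).
  { specialize (HK 0). rewrite Hv in HK. assert (P := Cmod_ge_0 (h (c, 0))).
    apply Rnot_lt_le. intros Hn.
    assert (K / (c ^ 2 + 0 ^ 2) < 0); [|lra].
    unfold Rdiv. assert (0 < / (c ^ 2 + 0 ^ 2)) by (apply Rinv_0_lt_compat; simpl in *; lra). nra. }
  split.
  - intros t. apply (continuous_RC_comp h (fun t => (c, t))); auto.
    apply continuous_RC_vertical.
  - intros t. assert (P := pow2_ge_0 t).
    eapply Rle_trans; [apply HK|]. rewrite Hv.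
    replace (K / Rmin 1 (c ^ 2) / (1 + t ^ 2)) with (K * / (Rmin 1 (c ^ 2) * (1 + t ^ 2)))
      by (field; lra).
    apply Rmult_le_compat_l; auto. apply Rinv_le_contravar.
    + apply Rmult_lt_0_compat; lra.
    + assert (A := Rmin_l 1 (c ^ 2)). assert (B := Rmin_r 1 (c ^ 2)). nra.
Qed.

(** Cauchy's theorem on [c, T] x [-T, T]: the three other sides have length at most 2 T and |h| <= K
    / T^2 there, so the integral up to height T is O(1 / T). *)
Lemma halfplane_line_integral (h : C -> C) (K c : R) : 0 < c ->
  (forall v, 0 < Re v -> exists l, complex_derivative h v l) ->
  (forall v, c <= Re v -> Cmod (h v) <= K / Cmod v ^ 2) ->
  Cintegral (fun t => h (c, t)) = 0.
Proof.
  intros Hc Hex HK.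
  set (dh := C_derive h).
  assert (Hh : forall v, 0 < Re v -> complex_derivative h v (dh v)).
  { intros v Hv. destruct (Hex v Hv) as [l Hl].
    unfold dh. now rewrite (complex_derivative_unique _ _ _ Hl). }
  assert (HK0 : 0 <= K).
  { specialize (HK (c, 0) (Rle_refl c)). assert (P := Cmod_ge_0 (h (c, 0))).
    assert (Hc2 : 0 < c ^ 2) by now apply pow_lt.
    assert (0 < Cmod (c, 0) ^ 2).
    { rewrite Cmod2_alt. simpl in *. lra. }
    apply Rnot_lt_le. intros Hn.
    assert (K / Cmod (c, 0) ^ 2 < 0); [|lra].
    unfold Rdiv. assert (0 < / Cmod (c, 0) ^ 2) by now apply Rinv_0_lt_compat. nra. }
  assert (Hcont : forall v, 0 < Re v -> continuous_C h v).
  { intros v Hv. eapply complex_derivative_continuous, Hh; auto. }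
  assert (Hmod : forall x y, c <= x -> 0 < x ^ 2 + y ^ 2 -> Cmod (h (x, y)) <= K / (x ^ 2 + y ^ 2)).
  { intros x y Hx Hxy. eapply Rle_trans; [apply HK; auto|]. rewrite Cmod2_alt. simpl. right. f_equal. }
  assert (D : Cdecays (K / Rmin 1 (c ^ 2)) (fun t => h (c, t))).
  { apply vertical_line_decays; auto. intros t; apply HK. simpl; lra. }
  apply (Cintegral_zero_of_small _ (8 * K) _ D). exists c. intros T HT HT0.
  assert (HTT : - T <= T) by lra.
  assert (PV : forall x, c <= x -> path_continuous (fun y => h (x, y)) (- T) T).
  { intros x Hx t _. apply (continuous_RC_comp h (fun t => (x, t))).
    - apply continuous_RC_vertical.
    - apply Hcont. simpl. lra. }
  assert (PH : forall y, path_continuous (fun x => h (x, y)) c T).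
  { intros y t Ht. apply (continuous_RC_comp h (fun t => (t, y))).
    - apply continuous_RC_horizontal.
    - apply Hcont. simpl. lra. }
  assert (PO : forall F a b, path_continuous F a b -> path_continuous (fun t => - (1) * F t)%C a b).
  { intros F a b HF t Ht. apply continuous_RC_mult; [apply continuous_RC_const|auto]. }
  assert (E := Cauchy_rectangle h dh c T (- T) T HT HTT).
  assert (E1 : C_RInt (fun y => h (T, y) - h (c, y))%C (- T) T =
    (C_RInt (fun y => h (T, y)) (- T) T + - (1) * C_RInt (fun y => h (c, y)) (- T) T)%C).
  { rewrite <- C_RInt_scal by (auto; apply PV; lra).
    rewrite <- C_RInt_plus; auto; try (apply PO); try (apply PV; lra).
    unfold C_RInt. f_equal; apply RInt_ext; intros; f_equal; ring. }
  rewrite E1 in E.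
  assert (B1 : Cmod (C_RInt (fun y => h (T, y)) (- T) T) <= 2 * ((T - - T) * (K / T ^ 2))).
  { apply Cmod_C_RInt_le; auto. intros t _. eapply Rle_trans; [apply Hmod; auto|].
    - generalize (pow2_ge_0 t) (pow_lt T 2 HT0). lra.
    - apply Rmult_le_compat_l; auto. apply Rinv_le_contravar; [now apply pow_lt|].
      generalize (pow2_ge_0 t); lra. }
  assert (B2 : Cmod (C_RInt (fun x => h (x, (- T)%R) - h (x, T))%C c T) <= 2 * ((T - c) * (2 * (K / T ^ 2)))).
  { apply Cmod_C_RInt_le; auto.
    - intros t Ht. apply (continuous_RC_plus (fun x => h (x, (- T)%R)) (fun x => - h (x, T))%C).
      + now apply PH.
      + apply (continuous_RC_ext (fun x => - (1) * h (x, T))%C); [intros; ring|].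
        apply (PO (fun x => h (x, T)) c T); auto.
    - intros t Ht. unfold Cminus. eapply Rle_trans; [apply Cmod_triangle|]. rewrite Cmod_opp.
      assert (Q : forall s, s ^ 2 = T ^ 2 -> Cmod (h (t, s)) <= K / T ^ 2).
      { intros s Hs. eapply Rle_trans; [apply Hmod; [lra|]|].
        - rewrite Hs. generalize (pow2_ge_0 t) (pow_lt T 2 HT0). lra.
        - rewrite Hs. apply Rmult_le_compat_l; auto. apply Rinv_le_contravar; [now apply pow_lt|].
          generalize (pow2_ge_0 t); lra. }
      assert (Q1 := Q (- T) ltac:(ring)). assert (Q2 := Q T eq_refl). lra. }
  assert (E2 : C_RInt (fun y => h (c, y)) (- T) T =
    (C_RInt (fun y => h (T, y)) (- T) T +
     - (Ci * C_RInt (fun x => h (x, (- T)%R) - h (x, T))%C c T))%C).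
  { rewrite <- E; [ring|]. intros x y Hx Hy. apply Hh. simpl. lra. }
  rewrite E2. eapply Rle_trans; [apply Cmod_triangle|].
  rewrite Cmod_opp, Cmod_mult, Cmod_Ci, Rmult_1_l.
  assert (HKT : 0 <= K / T ^ 2) by (apply Rdiv_le_0_compat; auto; now apply pow_lt).
  assert (EQ : 8 * K / T = 2 * ((T - - T) * (K / T ^ 2)) + 2 * (T * (2 * (K / T ^ 2))))
    by (field; lra).
  rewrite EQ. apply Rplus_le_compat; auto. eapply Rle_trans; [apply B2|].
  apply Rmult_le_compat_l; [lra|]. apply Rmult_le_compat_r; lra.
Qed.

(** * Derivatives of holomorphic functions *)

Definition cis (y : R) : C := (cos y, sin y).

Definition circle_point (z : C) (r y : R) : C := (z + RtoC r * cis y)%C.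

Lemma Cexp_polar (x y : R) : Cexp (x, y) = (RtoC (exp x) * cis y)%C.
Proof. unfold Cexp, cis, Cmult, RtoC; simpl. f_equal; ring. Qed.

Lemma cis_Cexp (y : R) : cis y = Cexp (0, y).
Proof. rewrite Cexp_polar, exp_0. ring. Qed.

Lemma Cmod_cis (y : R) : Cmod (cis y) = 1.
Proof. rewrite cis_Cexp, Cmod_Cexp. apply exp_0. Qed.

Lemma cis_period (y : R) : cis (y + 2 * PI) = cis y.
Proof.
  unfold cis. rewrite cos_plus, sin_plus, cos_2PI, sin_2PI. f_equal; ring.
Qed.

Lemma cis_opp (y : R) : (cis y * cis (- y))%C = RtoC 1.
Proof.
  unfold cis, Cmult, RtoC; simpl. rewrite cos_neg, sin_neg.
  generalize (sin2_cos2 y); unfold Rsqr; intros. f_equal; lra.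
Qed.

Lemma Im_circle_point (z : C) (r y : R) : 0 <= r -> Im z - r <= Im (circle_point z r y).
Proof.
  intros Hr. unfold circle_point.
  assert (H := im_le_Cmod (RtoC r * cis y)%C).
  rewrite Cmod_mult, Cmod_cis, Cmod_R, Rmult_1_r, (Rabs_pos_eq r) in H by auto.
  apply Rabs_le_between in H.
  replace (Im (z + RtoC r * cis y)%C) with (Im z + Im (RtoC r * cis y)%C)
    by (unfold Im; simpl; ring).
  lra.
Qed.

Lemma continuous_RC_cis (c t : R) : continuous_RC (fun y => cis (c * y)) t.
Proof.
  split.
  - apply (ex_derive_continuous (fun y => cos (c * y))). auto_derive; auto.
  - apply (ex_derive_continuous (fun y => sin (c * y))). auto_derive; auto.
Qed.

Lemma continuous_RC_cis_opp (t : R) : continuous_RC (fun y => cis (- y)) t.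
Proof.
  apply (continuous_RC_ext (fun y => cis ((-1) * y))); [intros; f_equal; ring|].
  apply continuous_RC_cis.
Qed.

Lemma continuous_RC_circle (g : C -> C) (z : C) (r t : R) :
  continuous_C g (circle_point z r t) ->
  continuous_RC (fun y => g (circle_point z r y) * cis (- y))%C t.
Proof.
  intros Hg. apply continuous_RC_mult.
  - apply (continuous_RC_comp g (circle_point z r)); auto.
    apply continuous_RC_plus; [apply continuous_RC_const|].
    apply continuous_RC_mult; [apply continuous_RC_const|].
    apply (continuous_RC_ext (fun y => cis (1 * y))); [intros; now rewrite Rmult_1_l|].
    apply continuous_RC_cis.
  - apply continuous_RC_cis_opp.
Qed.

Lemma C_RInt_const (c : C) (a b : R) : C_RInt (fun _ => c) a b = (RtoC (b - a) * c)%C.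
Proof.
  unfold C_RInt. rewrite !RInt_const. apply Ceq_components; simpl;
  unfold scal, mult; simpl; unfold mult; simpl; unfold Re, Im; simpl; ring.
Qed.

Lemma C_RInt_ext (F G : R -> C) (a b : R) : a <= b ->
  (forall t, a <= t <= b -> F t = G t) -> C_RInt F a b = C_RInt G a b.
Proof.
  intros Hab E. unfold C_RInt. f_equal; apply RInt_ext;
    rewrite Rmin_left, Rmax_right by auto; intros; rewrite E; auto; lra.
Qed.

Lemma C_RInt_full_turn : C_RInt (fun y => cis (- y)) 0 (2 * PI) = 0.
Proof.
  apply Ceq_components; unfold C_RInt, cis; simpl; apply is_RInt_unique.
  - replace 0 with (sin (2 * PI) - sin 0) at 2 by (rewrite sin_2PI, sin_0; ring).
    apply (is_RInt_derive sin (fun t => cos (- t))).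
    + intros; auto_derive; auto. rewrite cos_neg. ring.
    + intros; apply (ex_derive_continuous (fun t => cos (- t))). auto_derive; auto.
  - replace 0 with (cos (2 * PI) - cos 0) at 2 by (rewrite cos_2PI, cos_0; ring).
    apply (is_RInt_derive cos (fun t => sin (- t))).
    + intros; auto_derive; auto. rewrite sin_neg. ring.
    + intros; apply (ex_derive_continuous (fun t => sin (- t))). auto_derive; auto.
Qed.

(** The integral of [f (z + exp w) exp (- w)] over a vertical segment of length [2 PI]
    does not depend on the segment, and tends to [2 PI f' z] as [Re w] tends to [-oo]. *)
Lemma Cauchy_derivative (f df : C -> C) (z : C) (r : R) :
  (forall w, upper_half_plane w -> complex_derivative f w (df w)) -> 0 < r < Im z ->
  C_RInt (fun y => f (circle_point z r y) * cis (- y))%C 0 (2 * PI) =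
  (RtoC (2 * PI * r) * df z)%C.
Proof.
  intros Hf Hr. assert (HPI := PI_RGT_0).
  set (F := fun w => (f (z + Cexp w) * Cexp (- w))%C).
  set (dF := fun w => ((df (z + Cexp w) * (RtoC 0 + Cexp w)) * Cexp (- w)
     + f (z + Cexp w) * (Cexp (- w) * (- (1) * RtoC 1)))%C).
  assert (HF : forall x y, x <= ln r -> complex_derivative F (x, y) (dF (x, y))).
  { intros x y Hx. apply (complex_derivative_mult (fun w => f (z + Cexp w)) (fun w => Cexp (- w)))%C.
    - apply (complex_derivative_comp f (fun w => z + Cexp w)%C).
      + apply Hf. red. rewrite Cexp_polar.
        assert (He : exp x <= r).
        { rewrite <- (exp_ln r) by lra. destruct Hx as [Hx|Hx];
          [left; now apply exp_increasing|right; now rewrite Hx]. }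
        assert (P := Im_circle_point z (exp x) y (Rlt_le _ _ (exp_pos x))).
        unfold circle_point in P. lra.
      + apply (complex_derivative_plus (fun _ => z) Cexp);
          [apply complex_derivative_const|apply complex_derivative_Cexp].
    - apply (complex_derivative_Cexp_comp (fun w => - w)%C).
      apply (complex_derivative_ext (fun w => - (1) * w)%C); [intros; ring|].
      apply (complex_derivative_scal _ (fun w => w)), complex_derivative_id. }
  assert (FE : forall x y, F (x, y) =
    (RtoC (exp (- x)) * (f (circle_point z (exp x) y) * cis (- y)))%C).
  { intros x y. unfold F. rewrite Cexp_polar.
    replace (- (x, y))%C with ((- x)%R, (- y)%R) by reflexivity.
    rewrite (Cexp_polar (- x)). fold (circle_point z (exp x) y). ring. }
  assert (FP : forall x, x <= ln r -> path_continuous (fun y => F (x, y)) 0 (2 * PI)).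
  { intros x Hx t _. apply (continuous_RC_comp F (fun y => (x, y))).
    - apply continuous_RC_vertical.
    - eapply complex_derivative_continuous, HF; auto. }
  assert (PO : forall F a b, path_continuous F a b -> path_continuous (fun t => - (1) * F t)%C a b).
  { intros G a b HG t Ht. apply continuous_RC_mult; [apply continuous_RC_const|auto]. }
  assert (H2PI : 0 <= 2 * PI) by lra.
  assert (J : forall a, a <= ln r ->
    C_RInt (fun y => F (ln r, y)) 0 (2 * PI) = C_RInt (fun y => F (a, y)) 0 (2 * PI)).
  { intros a Ha. apply Cminus_eq_0.
    assert (E := Cauchy_rectangle F dF a (ln r) 0 (2 * PI) Ha H2PI).
    (* The horizontal sides are one period of the integrand apart and cancel. *)
    assert (E0 : C_RInt (fun x => F (x, 0%R) - F (x, (2 * PI)%R))%C a (ln r) = 0).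
    { rewrite (C_RInt_ext _ (fun _ => RtoC 0)); auto.
      - rewrite C_RInt_const. ring.
      - intros t _. rewrite !FE. unfold circle_point.
        rewrite <- (cis_period 0), <- (cis_period (- (2 * PI))).
        replace (0 + 2 * PI) with (2 * PI) by ring.
        replace (- (2 * PI) + 2 * PI) with (- 0) by ring. ring. }
    rewrite E0, Cmult_0_r in E. rewrite <- E.
    - replace (C_RInt (fun y => F (ln r, y)) 0 (2 * PI) - C_RInt (fun y => F (a, y)) 0 (2 * PI))%C
        with (C_RInt (fun y => F (ln r, y)) 0 (2 * PI) + - (1) * C_RInt (fun y => F (a, y)) 0 (2 * PI))%C
        by ring.
      rewrite <- C_RInt_scal by (auto; apply FP; lra).
      rewrite <- (C_RInt_plus (fun y => F (ln r, y)) (fun y => - (1) * F (a, y))%C 0 (2 * PI) H2PI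
        (FP _ (Rle_refl _)) (PO _ _ _ (FP _ Ha))).
      apply C_RInt_ext; auto. intros; ring.
    - intros x y Hx _. apply HF. lra. }
  assert (L : C_RInt (fun y => F (ln r, y)) 0 (2 * PI) = (RtoC (2 * PI) * df z)%C).
  { apply Cminus_eq_0, Cmod_eq_0. apply Rle_antisym; [|apply Cmod_ge_0].
    apply le_epsilon. intros eps He. rewrite Rplus_0_l.
    assert (Hz : upper_half_plane z) by (red; lra).
    destruct (Hf z Hz (eps / (4 * PI))) as (d & Hd & Hdf).
    { apply Rdiv_lt_0_compat; lra. }
    set (s := Rmin (d / 2) r). assert (Hs : 0 < s) by (apply Rmin_pos; lra).
    assert (Hsd : s < d) by (apply Rle_lt_trans with (d / 2); [apply Rmin_l|lra]).
    assert (Hsr : s <= r) by apply Rmin_r.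
    assert (Hls : ln s <= ln r).
    { destruct Hsr as [H| ->]; [left; now apply ln_increasing|lra]. }
    rewrite (J (ln s) Hls).
    (* [cis (- y)] has mean 0 and [df z] is constant, so both can be brought under the integral; the
       integrand becomes the first-order remainder of [f] on a circle of radius s, divided by s. *)
    assert (E : (C_RInt (fun y => F (ln s, y)) 0 (2 * PI) - RtoC (2 * PI) * df z)%C =
      C_RInt (fun y => F (ln s, y) + (- (f z * RtoC (/ s)) * cis (- y) + - (1) * df z))%C 0 (2 * PI)).
    { assert (PC : path_continuous (fun y => cis (- y)) 0 (2 * PI)).
      { intros t _. apply continuous_RC_cis_opp. }
      assert (PM : path_continuous (fun y => - (f z * RtoC (/ s)) * cis (- y))%C 0 (2 * PI)).
      { intros t Ht. apply continuous_RC_mult; [apply continuous_RC_const|auto]. }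
      assert (PK : path_continuous (fun _ => - (1) * df z)%C 0 (2 * PI)).
      { intros t Ht. apply continuous_RC_const. }
      rewrite C_RInt_plus; auto.
      - rewrite C_RInt_plus; auto. rewrite C_RInt_scal, C_RInt_full_turn, C_RInt_const; auto.
        rewrite Rminus_0_r. ring.
      - intros t Ht. apply continuous_RC_plus; auto. }
    rewrite E. replace eps with (2 * ((2 * PI - 0) * (eps / (4 * PI)))) by (field; lra).
    apply Cmod_C_RInt_le; auto.
    - intros t Ht. apply continuous_RC_plus; [now apply FP|].
      apply continuous_RC_plus; [|apply continuous_RC_const].
      apply continuous_RC_mult; [apply continuous_RC_const|].
      apply continuous_RC_cis_opp.
    - intros t _. rewrite FE, exp_Ropp, exp_ln by auto.
      assert (Q : Cmod (circle_point z s t - z)%C = s).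
      { unfold circle_point. replace (z + RtoC s * cis t - z)%C with (RtoC s * cis t)%C by ring.
        rewrite Cmod_mult, Cmod_cis, Cmod_R, Rabs_pos_eq; lra. }
      assert (B := Hdf (circle_point z s t)). rewrite Q in B. specialize (B Hsd).
      replace (RtoC (/ s) * (f (circle_point z s t) * cis (- t)) +
         (- (f z * RtoC (/ s)) * cis (- t) + - (1) * df z))%C with
        (RtoC (/ s) * cis (- t) * (f (circle_point z s t) - f z - (circle_point z s t - z) * df z))%C.
      + rewrite !Cmod_mult, Cmod_R, Cmod_cis, Rabs_pos_eq
          by (left; now apply Rinv_0_lt_compat).
        apply Rmult_le_reg_l with s; auto.
        replace (s * (/ s * 1 * Cmod (f (circle_point z s t) - f z - (circle_point z s t - z) * df z)%C))
          with (Cmod (f (circle_point z s t) - f z - (circle_point z s t - z) * df z)%C) by (field; lra).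
        lra.
      + assert (X : (RtoC (/ s) * cis (- t) * (circle_point z s t - z))%C = RtoC 1).
        { unfold circle_point.
          assert (Y := cis_opp t).
          replace (RtoC (/ s) * cis (- t) * (z + RtoC s * cis t - z))%C with
            (RtoC (/ s * s) * (cis t * cis (- t)))%C by (rewrite RtoC_mult; ring).
          rewrite Y, Rinv_l by lra. ring. }
        replace (RtoC (/ s) * cis (- t) * (f (circle_point z s t) - f z - (circle_point z s t - z) * df z))%C
          with (RtoC (/ s) * cis (- t) * (f (circle_point z s t) - f z)
            - (RtoC (/ s) * cis (- t) * (circle_point z s t - z)) * df z)%C by ring.
        rewrite X. ring. }
  assert (E : C_RInt (fun y => F (ln r, y)) 0 (2 * PI) =
    (RtoC (/ r) * C_RInt (fun y => f (circle_point z r y) * cis (- y))%C 0 (2 * PI))%C).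
  { rewrite <- C_RInt_scal; auto.
    - apply C_RInt_ext; auto. intros t _. rewrite FE, exp_Ropp, exp_ln by lra. reflexivity.
    - intros t _. apply continuous_RC_circle.
      eapply complex_derivative_continuous, Hf. red.
      generalize (Im_circle_point z r t); lra. }
  rewrite L in E.
  replace (RtoC (2 * PI * r) * df z)%C with (RtoC r * (RtoC (2 * PI) * df z))%C
    by (rewrite (RtoC_mult (2 * PI)); ring).
  rewrite E, Cmult_assoc, <- RtoC_mult, Rinv_r by lra. ring.
Qed.

(** Cauchy's formula on circles of one fixed radius writes [df] as a mean of values of [f] on
    translated circles. The bound on [df] makes [f] Lipschitz, hence [df] Lipschitz ([Lip]). By
    [Lip] the first-order remainder of [f] is quadratic, and its mean is the first-order remainder
    of [df], with the mean of [df] as derivative. *)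
Lemma holomorphic_derivative (f df : C -> C) (B : R) :
  (forall w, upper_half_plane w -> complex_derivative f w (df w)) ->
  (forall w, upper_half_plane w -> Cmod (df w) <= B) ->
  forall z, upper_half_plane z -> exists l, complex_derivative df z l.
Proof.
  intros Hf HB z Hz. red in Hz. assert (HPI := PI_RGT_0).
  (* For |w - z| < r the circles of radius r around z and w stay in the region Im > 2 r, where
     Cauchy's formula and [Lip] apply. *)
  set (r := Im z / 4). assert (Hr : 0 < r) by (unfold r; lra).
  assert (H2PI : 0 <= 2 * PI) by lra.
  assert (Im_segment : forall u v t m, 0 <= t <= 1 -> m < Im u -> m < Im v ->
     m < Im (u + RtoC t * (v - u))%C).
  { intros u v t m Ht Hu Hv.
    replace (Im (u + RtoC t * (v - u))%C) with ((1 - t) * Im u + t * Im v)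
      by (unfold Im; simpl; ring).
    destruct (Req_dec t 0) as [->|]; [lra|]. nra. }
  assert (PC : forall g w, (forall v, upper_half_plane v -> continuous_C g v) -> r < Im w ->
     path_continuous (fun y => g (circle_point w r y) * cis (- y))%C 0 (2 * PI)).
  { intros g w Hg Hw t _. apply continuous_RC_circle, Hg. red.
    generalize (Im_circle_point w r t); lra. }
  assert (Hfc : forall v, upper_half_plane v -> continuous_C f v).
  { intros v Hv. eapply complex_derivative_continuous; eauto. }
  assert (Hinv : forall X Y K, (RtoC (2 * PI * r) * X)%C = Y -> Cmod Y <= 2 * ((2 * PI - 0) * K) ->
     Cmod X <= 2 * K / r).
  { intros X Y K HX HY. rewrite <- HX, Cmod_mult, Cmod_R, Rabs_pos_eq in HY by nra.
    apply Rmult_le_reg_l with (2 * PI * r); [nra|].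
    replace (2 * PI * r * (2 * K / r)) with (2 * ((2 * PI - 0) * K)) by (field; lra). auto. }
  assert (Lip : forall u v, r < Im u -> r < Im v ->
     Cmod (df v - df u)%C <= 2 * (2 * B * Cmod (v - u)%C) / r).
  { intros u v Hu Hv.
    apply (Hinv _ (C_RInt (fun y => f (circle_point v r y) * cis (- y)
       + - (1) * (f (circle_point u r y) * cis (- y)))%C 0 (2 * PI))).
    - rewrite C_RInt_plus; auto.
      + rewrite C_RInt_scal by auto.
        rewrite (Cauchy_derivative f df v r Hf), (Cauchy_derivative f df u r Hf) by lra. ring.
      + intros t Ht. apply continuous_RC_mult; [apply continuous_RC_const|].
        apply (PC f u); auto.
    - apply Cmod_C_RInt_le; auto.
      + intros t Ht. apply continuous_RC_plus; [now apply (PC f v)|].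
        apply continuous_RC_mult; [apply continuous_RC_const|]. apply (PC f u); auto.
      + intros t _.
        replace (f (circle_point v r t) * cis (- t) + - (1) * (f (circle_point u r t) * cis (- t)))%C
          with ((f (circle_point v r t) - f (circle_point u r t)) * cis (- t))%C by ring.
        rewrite Cmod_mult, Cmod_cis, Rmult_1_r.
        replace (v - u)%C with (circle_point v r t - circle_point u r t)%C
          by (unfold circle_point; ring).
        assert (I1 := Im_circle_point u r t). assert (I2 := Im_circle_point v r t).
        apply (complex_mean_value f df); intros s Hs; [apply Hf|apply HB]; red;
          apply Im_segment; auto; lra. }
  assert (HB0 : 0 <= B).
  { eapply Rle_trans; [apply Cmod_ge_0|apply (HB z Hz)]. }
  assert (Hdfc : forall v, r < Im v -> continuous_C df v).
  { intros v Hv eps He. set (K := 2 * (2 * B) / r + 1).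
    assert (HK : 0 < K) by (unfold K; assert (0 <= 2 * (2 * B) / r) by (apply Rdiv_le_0_compat; lra); lra).
    exists (Rmin (Im v - r) (eps / K)). split.
    { apply Rmin_pos; [lra|now apply Rdiv_lt_0_compat]. }
    intros w Hw. assert (H1 := Rlt_le_trans _ _ _ Hw (Rmin_l _ _)).
    assert (H2 := Rlt_le_trans _ _ _ Hw (Rmin_r _ _)).
    assert (Hwi : r < Im w).
    { assert (P := im_le_Cmod (w - v)%C). apply Rabs_le_between in P.
      replace (Im (w - v)%C) with (Im w - Im v) in P by (unfold Im; simpl; ring). lra. }
    eapply Rle_lt_trans; [apply Lip; auto|].
    replace (2 * (2 * B * Cmod (w - v)%C) / r) with (2 * (2 * B) / r * Cmod (w - v)%C) by (field; lra).
    apply Rle_lt_trans with (K * Cmod (w - v)%C).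
    - apply Rmult_le_compat_r; [apply Cmod_ge_0|unfold K; lra].
    - apply (Rmult_lt_compat_l K) in H2; auto.
      replace (K * (eps / K)) with eps in H2 by (field; lra). auto. }
  set (I2 := C_RInt (fun y => df (circle_point z r y) * cis (- y))%C 0 (2 * PI)).
  exists (RtoC (/ (2 * PI * r)) * I2)%C.
  apply (complex_derivative_quadratic _ _ _ r (2 * (2 * (2 * (2 * B) / r)) / r)); auto.
  intros w Hw.
  assert (Hwi : 3 * r < Im w).
  { assert (P := im_le_Cmod (w - z)%C). apply Rabs_le_between in P.
    replace (Im (w - z)%C) with (Im w - Im z) in P by (unfold Im; simpl; ring).
    unfold r in *. lra. }
  assert (Hzi : 3 * r < Im z) by (unfold r; lra).
  set (K := 2 * (2 * (2 * B * Cmod (w - z)%C) / r) * Cmod (w - z)%C).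
  replace (2 * (2 * (2 * (2 * B) / r)) / r * Cmod (w - z)%C ^ 2) with (2 * K / r)
    by (unfold K; field; lra).
  assert (PD : path_continuous (fun y => df (circle_point z r y) * cis (- y))%C 0 (2 * PI)).
  { intros t _. apply continuous_RC_circle, Hdfc. generalize (Im_circle_point z r t); lra. }
  assert (PF : forall u, r < Im u -> forall c, path_continuous (fun y => c * (f (circle_point u r y) * cis (- y)))%C 0 (2 * PI)).
  { intros u Hu c t Ht. apply continuous_RC_mult; [apply continuous_RC_const|]. apply (PC f u); auto. }
  assert (PD' : forall c, path_continuous (fun y => c * (df (circle_point z r y) * cis (- y)))%C 0 (2 * PI)).
  { intros c t Ht. apply continuous_RC_mult; [apply continuous_RC_const|]. now apply PD. }
  apply (Hinv _ (C_RInt (fun y => f (circle_point w r y) * cis (- y)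
     + (- (1) * (f (circle_point z r y) * cis (- y))
     + - (w - z) * (df (circle_point z r y) * cis (- y))))%C 0 (2 * PI))).
  - rewrite C_RInt_plus; auto.
    + rewrite C_RInt_plus; auto; [|apply PF; lra].
      rewrite !C_RInt_scal; auto; [|apply (PC f z); auto; lra].
      rewrite (Cauchy_derivative f df w r Hf), (Cauchy_derivative f df z r Hf) by lra.
      fold I2.
      replace (RtoC (2 * PI * r) * (df w - df z - (w - z) * (RtoC (/ (2 * PI * r)) * I2)))%C with
        (RtoC (2 * PI * r) * df w + (- (1) * (RtoC (2 * PI * r) * df z)
        + - (w - z) * (RtoC (2 * PI * r * / (2 * PI * r)) * I2)))%C
        by (rewrite (RtoC_mult (2 * PI * r) (/ _)); ring).
      rewrite Rinv_r by nra. ring.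
    + apply (PC f w); auto. lra.
    + intros t Ht. apply continuous_RC_plus; [apply (PF z); auto; lra|now apply PD'].
  - apply Cmod_C_RInt_le; auto.
    + intros t Ht. apply continuous_RC_plus; [apply (PC f w); auto; lra|].
      apply continuous_RC_plus; [apply (PF z); auto; lra|now apply PD'].
    + intros t _. set (u := circle_point z r t).
      assert (Ew : circle_point w r t = (u + (w - z))%C) by (unfold u, circle_point; ring).
      rewrite Ew.
      replace (f (u + (w - z)) * cis (- t) + (- (1) * (f u * cis (- t))
          + - (w - z) * (df u * cis (- t))))%C with
        (((f (u + (w - z)) + (- df u) * (u + (w - z))) - (f u + (- df u) * u)) * cis (- t))%C by ring.
      rewrite Cmod_mult, Cmod_cis, Rmult_1_r.
      assert (I3 := Im_circle_point z r t). fold u in I3.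
      assert (I4 := Im_circle_point w r t). rewrite Ew in I4.
      unfold K. replace (Cmod (w - z)%C) with (Cmod (u + (w - z) - u)%C) at 2 by (f_equal; ring).
      apply (complex_mean_value (fun v => f v + (- df u) * v)%C (fun v => df v + (- df u) * 1)%C).
      * intros s Hs.
        apply (complex_derivative_plus f (fun v => (- df u) * v)%C).
        -- apply Hf. red. apply Im_segment; auto; lra.
        -- apply (complex_derivative_scal _ (fun v => v)), complex_derivative_id.
      * intros s Hs.
        replace (df (u + RtoC s * (u + (w - z) - u)) + - df u * 1)%C with
          (df (u + RtoC s * (u + (w - z) - u)) - df u)%C by ring.
        eapply Rle_trans; [apply Lip; [lra|apply Im_segment; auto; lra]|].
        replace (u + RtoC s * (u + (w - z) - u) - u)%C with (RtoC s * (w - z))%C by ring.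
        rewrite Cmod_mult, Cmod_R, Rabs_pos_eq by lra.
        apply Rmult_le_compat_r; [left; now apply Rinv_0_lt_compat|].
        apply Rmult_le_compat_l; [lra|]. apply Rmult_le_compat_l; [lra|].
        generalize (Cmod_ge_0 (w - z)%C). nra.
Qed.

(** * Weights *)

Definition weight (M : nat -> R) (h : R) (p : nat) : R := h ^ p * INR (fact p) * M p.

Lemma weight_pos (M : nat -> R) (h : R) (p : nat) :
  (forall p, 0 < M p) -> 0 < h -> 0 < weight M h p.
Proof.
  intros HM Hh. unfold weight. apply Rmult_lt_0_compat; auto.
  apply Rmult_lt_0_compat; [now apply pow_lt|apply INR_fact_lt_0].
Qed.

Lemma weight_le (M : nat -> R) (h k : R) (p : nat) :
  (forall p, 0 < M p) -> 0 < h -> h <= k -> weight M h p <= weight M k p.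
Proof.
  intros HM Hh Hk. unfold weight. apply Rmult_le_compat_r; [left; auto|].
  apply Rmult_le_compat_r; [left; apply INR_fact_lt_0|]. apply pow_incr; lra.
Qed.

(** One shift of the index costs H^(p+1) by (dc) and p + 1 <= 2^p from the factorial; a larger [h]
    absorbs both. *)
Lemma weight_shift (M : nat -> R) (h : R) (j : nat) :
  (forall p, 0 < M p) -> dc M -> 0 < h ->
  exists K k, 0 < K /\ h <= k /\ forall p, weight M h (p + j) <= K * weight M k p.
Proof.
  intros HM (C0 & H & HC0 & HH & Hdc) Hh. induction j as [|j IH].
  - exists 1, h. split; [lra|]. split; [lra|]. intros p. rewrite Nat.add_0_r. lra.
  - destruct IH as (K & k & HK & Hk & IH).
    exists (K * (k * C0 * H)), (2 * H * k).
    assert (0 < k * C0 * H) by (repeat apply Rmult_lt_0_compat; lra).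
    split; [now apply Rmult_lt_0_compat|]. split; [assert (1 * k <= 2 * H * k) by (apply Rmult_le_compat_r; lra); lra|].
    intros p. replace (p + S j)%nat with (S p + j)%nat by lia.
    eapply Rle_trans; [apply IH|]. rewrite Rmult_assoc. apply Rmult_le_compat_l; [lra|].
    unfold weight. specialize (Hdc p). replace (p + 1)%nat with (S p) in Hdc by lia.
    rewrite fact_simpl, mult_INR. simpl pow in *.
    assert (E : INR (S p) <= 2 ^ p).
    { clear. induction p as [|p IH]; [simpl; lra|].
      rewrite S_INR. change (2 ^ S p) with (2 * 2 ^ p).
      assert (1 <= 2 ^ p) by (apply pow_R1_Rle; lra). lra. }
    assert (F := INR_fact_lt_0 p). assert (Kp : 0 < k ^ p) by (apply pow_lt; lra).
    assert (P : 0 < k * k ^ p * INR (fact p)).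
    { repeat apply Rmult_lt_0_compat; lra. }
    replace (k * k ^ p * (INR (S p) * INR (fact p)) * M (S p)) with
      ((k * k ^ p * INR (fact p)) * (INR (S p) * M (S p))) by ring.
    replace (k * C0 * H * ((2 * H * k) ^ p * INR (fact p) * M p)) with
      ((k * k ^ p * INR (fact p)) * (2 ^ p * (C0 * (H * H ^ p) * M p)))
      by (rewrite !Rpow_mult_distr; ring).
    apply Rmult_le_compat_l; [lra|].
    apply Rmult_le_compat; auto; [apply pos_INR|left; apply HM].
Qed.

Lemma ratio_le_iff (x B W : R) : 0 < W -> (x / W <= B <-> x <= B * W).
Proof.
  intros HW. split; intros H.
  - replace x with (x / W * W) by (field; lra). apply Rmult_le_compat_r; lra.
  - apply Rmult_le_reg_r with W; auto. unfold Rdiv. rewrite Rmult_assoc, Rinv_l; lra.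
Qed.

Lemma Lambda_iff (M : nat -> R) (c : nat -> C) : (forall p, 0 < M p) ->
  (Lambda M c <-> exists h, 0 < h /\ exists B, forall p, Cmod (c p) <= B * weight M h p).
Proof.
  intros HM. split; intros (h & Hh & B & HB); exists h; split; auto; exists B; intros p;
    apply (ratio_le_iff _ _ (weight M h p)); auto; now apply weight_pos.
Qed.

Lemma lc_quotient_mono (M : nat -> R) (p : nat) :
  (forall p, 0 < M p) -> lc M -> quotient M p <= quotient M (S p).
Proof.
  intros HM Hlc. specialize (Hlc (S p) ltac:(lia)). unfold quotient.
  replace (S p - 1)%nat with p in Hlc by lia.
  replace (p + 1)%nat with (S p) by lia.
  apply Rmult_le_reg_r with (M p * M (S p)); [now apply Rmult_lt_0_compat|].
  replace (M (S p) / M p * (M p * M (S p))) with (M (S p) ^ 2)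
    by (field; apply Rgt_not_eq, HM).
  replace (M (S p + 1)%nat / M (S p) * (M p * M (S p))) with (M p * M (S p + 1)%nat)
    by (field; apply Rgt_not_eq, HM).
  auto.
Qed.

Lemma lc_quotient_le (M : nat -> R) (p q : nat) :
  (forall p, 0 < M p) -> lc M -> (p <= q)%nat -> quotient M p <= quotient M q.
Proof.
  intros HM Hlc Hpq. induction Hpq; [lra|].
  eapply Rle_trans; [apply IHHpq|now apply lc_quotient_mono].
Qed.

Lemma quotient_pos (M : nat -> R) (p : nat) : (forall p, 0 < M p) -> 0 < quotient M p.
Proof. intros HM. now apply Rdiv_lt_0_compat. Qed.

Lemma weight_quotient (M : nat -> R) (K h : R) (p : nat) :
  (forall p, 0 < M p) -> 0 < K -> 0 < h ->
  K * weight M h (S p) / (K * weight M h p) = h * ((INR p + 1) * quotient M p).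
Proof.
  intros HM HK Hh. unfold weight, quotient. rewrite fact_simpl, mult_INR, S_INR.
  replace (p + 1)%nat with (S p) by lia. simpl pow. field.
  repeat split; apply Rgt_not_eq; first [apply INR_fact_lt_0|now apply pow_lt|exact (HM p)|exact HK].
Qed.

(** * Uniqueness of the moment problem *)

Lemma Bang_uniqueness_weight (M : nat -> R) (G : nat -> R -> R) (T : R) :
  (forall p, 0 < M p) -> lc M ->
  is_lim_seq (sum_n (fun p => 1 / sqrt ((INR p + 1) * quotient M p))) p_infty ->
  derivative_chain G ->
  (exists h K, 0 < h /\ forall p x, Rabs x <= T + 1 -> Rabs (G (2 * p)%nat x) <= K * weight M h p) ->
  (forall k, G k 0 = 0) ->
  forall x, 0 <= x <= T -> G 0%nat x = 0.
Proof.
  intros HM Hlc Hdiv HG (h & K & Hh & HB) H0.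
  (* The enlarged parameter makes the first quotient r m_0 at least 1, hence by (lc) all of them, as
     [Bang_uniqueness_even] requires. *)
  set (r := h + / quotient M 0).
  assert (Q0 := quotient_pos M 0 HM).
  assert (Hi : 0 < / quotient M 0) by now apply Rinv_0_lt_compat.
  assert (Hr : 0 < r) by (unfold r; lra).
  set (L := Rabs K + 1). assert (HL : 0 < L) by (unfold L; generalize (Rabs_pos K); lra).
  set (N := fun p => L * weight M r p).
  assert (HN : forall p, 0 < N p).
  { intros p. apply Rmult_lt_0_compat; auto. now apply weight_pos. }
  assert (EN : forall p, N (S p) / N p = r * ((INR p + 1) * quotient M p)).
  { intros p. now apply weight_quotient. }
  apply (Bang_uniqueness_even G N T); auto.
  - intros p x Hx. eapply Rle_trans; [now apply HB|]. unfold N.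
    assert (W := weight_pos M h p HM Hh).
    assert (W2 := weight_le M h r p HM Hh ltac:(unfold r; lra)).
    apply Rle_trans with (L * weight M h p).
    + apply Rmult_le_compat_r; [lra|]. unfold L. generalize (Rle_abs K); lra.
    + apply Rmult_le_compat_l; lra.
  - intros p. rewrite EN.
    assert (A := lc_quotient_le M 0 p HM Hlc ltac:(lia)).
    assert (B := pos_INR p).
    replace 1 with (/ quotient M 0 * quotient M 0) at 1 by (field; lra).
    apply Rmult_le_compat; try lra; [unfold r; lra|]. nra.
  - intros p. rewrite !EN. apply Rmult_le_compat_l; [lra|].
    rewrite S_INR. assert (A := lc_quotient_mono M p HM Hlc).
    assert (B := pos_INR p). assert (C := quotient_pos M p HM).
    apply Rmult_le_compat; lra.
  - intros B.
    apply is_lim_seq_spec in Hdiv. destruct (Hdiv (sqrt r * B)) as [d Hd].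
    exists d. specialize (Hd d (le_n d)).
    rewrite (sum_n_ext _ (fun p => scal (/ sqrt r) (1 / sqrt ((INR p + 1) * quotient M p)))).
    + rewrite (sum_n_scal_l (/ sqrt r) (fun p => 1 / sqrt ((INR p + 1) * quotient M p))).
      unfold scal; simpl; unfold mult; simpl.
      assert (S : 0 < sqrt r) by now apply sqrt_lt_R0.
      apply Rmult_le_reg_l with (sqrt r); auto.
      rewrite <- Rmult_assoc, Rinv_r by lra. rewrite Rmult_1_l. left. exact Hd.
    + intros p. rewrite EN. unfold scal; simpl; unfold mult; simpl.
      assert (B1 := pos_INR p). assert (B2 := quotient_pos M p HM).
      rewrite sqrt_mult by (try lra; apply Rmult_le_pos; lra).
      field. split; apply Rgt_not_eq, sqrt_lt_R0; auto. apply Rmult_lt_0_compat; lra.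
Qed.

(** * Even and odd integrands, and the substitution x = y^2 *)

Lemma RInt_reflect (F : R -> R) (a b : R) : (forall x, continuous F x) ->
  RInt (fun x => F (- x)) a b = RInt F (- b) (- a).
Proof.
  intros HF.
  assert (E := RInt_comp_lin F (-1) 0 a b).
  assert (E2 : RInt (fun y => scal (-1) (F (-1 * y + 0))) a b = - RInt (fun x => F (- x)) a b).
  { rewrite <- (RInt_opp (V := R_CompleteNormedModule)).
    - apply RInt_ext. intros x _. unfold scal, opp; simpl; unfold mult; simpl.
      replace (-1 * x + 0) with (- x) by ring. ring.
    - apply continuous_ex_RInt. intros x. apply (continuous_comp (fun x => - x) F); auto.
      apply (ex_derive_continuous (fun x => - x)). auto_derive; auto. }
  assert (HR : ex_RInt F (-1 * a + 0) (-1 * b + 0)) by now apply continuous_ex_RInt.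
  specialize (E HR). apply (eq_trans (eq_sym E2)) in E.
  replace (-1 * a + 0) with (- a) in E by ring. replace (-1 * b + 0) with (- b) in E by ring.
  assert (E3 : RInt F (- b) (- a) = - RInt F (- a) (- b)).
  { symmetry. apply (opp_RInt_swap F). now apply continuous_ex_RInt. }
  lra.
Qed.

Lemma integral_reflect (F : R -> R) : integrable F ->
  integral (fun x => F (- x)) = integral F.
Proof.
  intros [K HF]. apply integral_unique.
  apply is_lim_seq_ext with (fun n => RInt F (- INR n) (INR n)).
  - intros n. rewrite RInt_reflect by apply HF. now rewrite Ropp_involutive.
  - eapply integral_lim; eauto.
Qed.

Lemma integral_odd (F : R -> R) : integrable F -> (forall x, F (- x) = - F x) -> integral F = 0.
Proof.
  intros HF Ho. assert (E := integral_reflect F HF).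
  rewrite (integral_ext _ (fun x => - F x)) in E by auto.
  rewrite integral_opp in E by auto. lra.
Qed.

(** [Rabs] expresses continuity on [0,oo) without using the values of [u] at negative arguments. *)
Definition moment_class (M : nat -> R) (u : R -> R) : Prop :=
  (forall x, continuous (fun x => u (Rabs x)) x) /\
  exists h, 0 < h /\ exists B, forall p x, 0 <= x -> x ^ p * Rabs (u x) <= B * weight M h p.

(** The substitution [x = y ^ 2] turns a moment on the half-line into one on the line. *)
Definition even_lift (u : R -> R) (y : R) : R := Rabs y * u (y ^ 2).

Lemma even_lift_opp (u : R -> R) (y : R) : even_lift u (- y) = even_lift u y.
Proof. unfold even_lift. rewrite Rabs_Ropp. f_equal. f_equal. ring. Qed.

Lemma even_lift_continuous (u : R -> R) (y : R) :
  (forall x, continuous (fun x => u (Rabs x)) x) -> continuous (even_lift u) y.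
Proof.
  intros Hu. apply (continuous_mult Rabs); [apply continuous_Rabs|].
  apply (continuous_ext (fun y => u (Rabs (y ^ 2)))).
  - intros x. f_equal. apply Rabs_pos_eq, pow2_ge_0.
  - apply (continuous_comp (fun y => y ^ 2) (fun x => u (Rabs x))); auto.
    apply (ex_derive_continuous (fun y => y ^ 2)). auto_derive; auto.
Qed.

Lemma sq_abs (y : R) : y ^ 2 = Rabs y ^ 2.
Proof. symmetry. apply pow2_abs. Qed.

(** (1 + x)^2 is expanded, and (dc) absorbs the shifts of [p] by 1 and 2. *)
Lemma moment_class_weighted (M : nat -> R) (u : R -> R) :
  (forall p, 0 < M p) -> dc M -> moment_class M u ->
  exists h, 0 < h /\ exists B, forall p x, 0 <= x ->
    (1 + x) ^ 2 * (x ^ p * Rabs (u x)) <= B * weight M h p.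
Proof.
  intros HM Hdc [_ (h & Hh & B & HB)].
  destruct (weight_shift M h 1 HM Hdc Hh) as (K1 & h1 & HK1 & Hh1 & S1).
  destruct (weight_shift M h 2 HM Hdc Hh) as (K2 & h2 & HK2 & Hh2 & S2).
  assert (HB0 : 0 <= B).
  { specialize (HB 0%nat 0 (Rle_refl 0)). assert (W := weight_pos M h 0 HM Hh).
    assert (0 <= 0 ^ 0 * Rabs (u 0)) by (simpl; generalize (Rabs_pos (u 0)); lra).
    apply Rnot_lt_le. intros Hn. nra. }
  exists (h1 + h2). split; [lra|]. exists (B * (1 + 2 * K1 + K2)). intros p x Hx.
  assert (E0 := HB p x Hx). assert (E1 := HB (p + 1)%nat x Hx). assert (E2 := HB (p + 2)%nat x Hx).
  assert (T0 := weight_le M h (h1 + h2) p HM Hh ltac:(lra)).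
  assert (T1 := weight_le M h1 (h1 + h2) p HM ltac:(lra) ltac:(lra)).
  assert (T2 := weight_le M h2 (h1 + h2) p HM ltac:(lra) ltac:(lra)).
  specialize (S1 p). specialize (S2 p).
  replace ((1 + x) ^ 2 * (x ^ p * Rabs (u x))) with
    (x ^ p * Rabs (u x) + 2 * (x ^ (p + 1) * Rabs (u x)) + x ^ (p + 2) * Rabs (u x))
    by (rewrite !pow_add; ring).
  set (W := weight M (h1 + h2) p) in *.
  assert (F0 : x ^ p * Rabs (u x) <= B * W).
  { eapply Rle_trans; [apply E0|]. now apply Rmult_le_compat_l. }
  assert (F1 : x ^ (p + 1) * Rabs (u x) <= B * (K1 * W)).
  { eapply Rle_trans; [apply E1|]. apply Rmult_le_compat_l; auto.
    eapply Rle_trans; [apply S1|]. apply Rmult_le_compat_l; lra. }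
  assert (F2 : x ^ (p + 2) * Rabs (u x) <= B * (K2 * W)).
  { eapply Rle_trans; [apply E2|]. apply Rmult_le_compat_l; auto.
    eapply Rle_trans; [apply S2|]. apply Rmult_le_compat_l; lra. }
  lra.
Qed.

(** At x = y^2, one of the two spare factors 1 + y^2 absorbs |y| and the other gives the decay. *)
Lemma even_lift_decays (M : nat -> R) (u : R -> R) :
  (forall p, 0 < M p) -> dc M -> moment_class M u ->
  exists h, 0 < h /\ exists B, forall p,
    decays (B * weight M h p) (fun y => even_lift u y * y ^ (2 * p)).
Proof.
  intros HM Hdc Hu. destruct (moment_class_weighted M u HM Hdc Hu) as (h & Hh & B & HB).
  exists h; split; auto. exists B. intros p. split.
  - intros y. apply (continuous_mult (even_lift u)).
    + apply even_lift_continuous, Hu.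
    + apply (ex_derive_continuous (fun y => y ^ (2 * p))). auto_derive; auto.
  - intros y. apply Rmult_le_reg_r with (1 + y ^ 2); [apply sq_pos|].
    unfold Rdiv. rewrite (Rmult_assoc (B * _)), Rinv_l, Rmult_1_r
      by (apply Rgt_not_eq, sq_pos).
    eapply Rle_trans; [|apply (HB p (y ^ 2)), pow2_ge_0].
    unfold even_lift. rewrite !Rabs_mult, Rabs_Rabsolu.
    rewrite pow_mult, (Rabs_pos_eq ((y ^ 2) ^ p)) by (apply pow_le, pow2_ge_0).
    assert (A : Rabs y <= 1 + y ^ 2).
    { rewrite sq_abs. generalize (pow2_ge_0 (Rabs y - 1)) (Rabs_pos y). nra. }
    assert (P : 0 <= Rabs (u (y ^ 2)) * (y ^ 2) ^ p).
    { apply Rmult_le_pos; [apply Rabs_pos|apply pow_le, pow2_ge_0]. }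
    assert (Q := sq_pos y).
    replace ((1 + y ^ 2) ^ 2 * ((y ^ 2) ^ p * Rabs (u (y ^ 2)))) with
      ((1 + y ^ 2) * (Rabs (u (y ^ 2)) * (y ^ 2) ^ p) * (1 + y ^ 2)) by ring.
    apply Rmult_le_compat_r; [lra|]. rewrite Rmult_assoc. apply Rmult_le_compat_r; auto.
Qed.

(** |y|^k <= 1 + |y|^(2 k), so odd powers follow from even ones. *)
Lemma even_lift_rapid (M : nat -> R) (u : R -> R) (k : nat) :
  (forall p, 0 < M p) -> dc M -> moment_class M u ->
  exists K, decays K (fun y => even_lift u y * y ^ k).
Proof.
  intros HM Hdc Hu. destruct (even_lift_decays M u HM Hdc Hu) as (h & Hh & B & HB).
  exists (B * weight M h 0 + B * weight M h k). split.
  - intros y. apply (continuous_mult (even_lift u)).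
    + apply even_lift_continuous, Hu.
    + apply (ex_derive_continuous (fun y => y ^ k)). auto_derive; auto.
  - intros y. destruct (HB 0%nat) as [_ H0]. destruct (HB k) as [_ H1].
    specialize (H0 y). specialize (H1 y). rewrite !Rabs_mult in *.
    rewrite Nat.mul_0_r in H0. simpl pow in H0. rewrite Rabs_R1 in H0.
    rewrite <- !RPow_abs in *. unfold Rdiv in *. rewrite Rmult_plus_distr_r.
    eapply Rle_trans; [|apply Rplus_le_compat; [apply H0|apply H1]].
    rewrite <- Rmult_plus_distr_l. apply Rmult_le_compat_l; [apply Rabs_pos|].
    destruct (Rle_dec (Rabs y) 1) as [Hy|Hy].
    + assert (Rabs y ^ k <= 1) by (rewrite <- (pow1 k); apply pow_incr; split; auto; apply Rabs_pos).
      assert (0 <= Rabs y ^ (2 * k)) by (apply pow_le, Rabs_pos). lra.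
    + assert (Rabs y ^ k <= Rabs y ^ (2 * k)) by (apply Rle_pow; [lra|lia]). lra.
Qed.

Lemma decays_mult_bounded (K : R) (F g : R -> R) : decays K F ->
  (forall x, continuous g x) -> (forall x, Rabs (g x) <= 1) -> decays K (fun x => F x * g x).
Proof.
  intros [HF HK] Hg H1. split; intros x.
  - apply (continuous_mult F); auto.
  - rewrite Rabs_mult. apply Rle_trans with (K / (1 + x ^ 2) * 1); [|lra].
    apply Rmult_le_compat; auto; apply Rabs_pos.
Qed.

Lemma moment_uniqueness (M : nat -> R) (u : R -> R) :
  (forall p, 0 < M p) -> lc M -> dc M ->
  is_lim_seq (sum_n (fun p => 1 / sqrt ((INR p + 1) * quotient M p))) p_infty ->
  moment_class M u ->
  (forall p, integral (fun y => even_lift u y * y ^ (2 * p)) = 0) ->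
  forall x, 0 <= x -> u x = 0.
Proof.
  intros HM Hlc Hdc Hdiv Hu Hmom.
  set (Psi := even_lift u).
  (* The phase k pi / 2 lets one formula cover all derivatives of the cosine transform. *)
  set (G := fun k xi => integral (fun y => Psi y * y ^ k * cos (y * xi + INR k * (PI / 2)))).
  assert (Ht : forall k xi, exists K, forall r, r = xi -> decays K (fun y => Psi y * y ^ k * cos (y * r + INR k * (PI / 2)))).
  { intros k xi. destruct (even_lift_rapid M u k HM Hdc Hu) as [K HK].
    exists K. intros r _. apply (decays_mult_bounded K (fun y => Psi y * y ^ k)); auto.
    - intros y. apply (ex_derive_continuous (fun y => cos (y * r + INR k * (PI / 2)))). auto_derive; auto.
    - intros y. apply Rabs_le, COS_bound. }
  assert (Hi : forall k xi, integrable (fun y => Psi y * y ^ k * cos (y * xi + INR k * (PI / 2)))).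
  { intros k xi. destruct (Ht k xi) as [K HK]. exists K. now apply HK. }
  assert (HG : derivative_chain G).
  { intros k xi. destruct (even_lift_rapid M u (S (S k)) HM Hdc Hu) as [K HK].
    assert (D : forall k r y, is_derive (fun r => Psi y * y ^ k * cos (y * r + INR k * (PI / 2))) r
       (Psi y * y ^ (S k) * cos (y * r + INR (S k) * (PI / 2)))).
    { intros j r y. rewrite S_INR.
      replace (y * r + (INR j + 1) * (PI / 2)) with (PI / 2 + (y * r + INR j * (PI / 2))) by ring.

      replace (cos (PI / 2 + (y * r + INR j * (PI / 2)))) with (- sin (y * r + INR j * (PI / 2)))
        by (rewrite cos_plus, cos_PI2, sin_PI2; ring).
      auto_derive; auto. simpl. ring. }
    apply (integral_param_derive_taylor
      (fun r y => Psi y * y ^ k * cos (y * r + INR k * (PI / 2)))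
      (fun r y => Psi y * y ^ (S k) * cos (y * r + INR (S k) * (PI / 2)))
      (fun r y => Psi y * y ^ (S (S k)) * cos (y * r + INR (S (S k)) * (PI / 2))) xi K); auto.
    intros r y _. rewrite Rabs_mult.
    apply Rle_trans with (K / (1 + y ^ 2) * 1); [|lra].
    apply Rmult_le_compat; try apply Rabs_pos; [apply HK|apply Rabs_le, COS_bound]. }
  assert (HG0 : forall k, G k 0 = 0).
  (* At 0 the derivatives of even order are moments up to sign, and those of odd order are integrals
     of odd functions. *)
  { intros k. destruct (Nat.Even_or_Odd k) as [[p ->]|[p ->]].
    - unfold G. rewrite (integral_ext _ (fun y => cos (INR (2 * p) * (PI / 2)) * (Psi y * y ^ (2 * p)))).
      + rewrite integral_scal; [unfold Psi; rewrite Hmom; ring|].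
        destruct (even_lift_rapid M u (2 * p) HM Hdc Hu) as [K HK]. now exists K.
      + intros y. rewrite Rmult_0_r, Rplus_0_l. ring.
    - apply integral_odd; auto. intros y. unfold Psi. rewrite even_lift_opp, !Rmult_0_r, !Rplus_0_l.
      replace ((- y) ^ (2 * p + 1)) with (- y ^ (2 * p + 1)); [ring|].
      rewrite !pow_add, !pow_mult. replace ((- y) ^ 2) with (y ^ 2) by ring. ring. }
  assert (HB : exists h K, 0 < h /\ forall p x, Rabs (G (2 * p)%nat x) <= K * weight M h p).
  { destruct (even_lift_decays M u HM Hdc Hu) as (h & Hh & B & HB).
    exists h, (4 * B). split; auto. intros p x. rewrite Rmult_assoc. apply integral_bound.
    apply (decays_mult_bounded _ (fun y => Psi y * y ^ (2 * p))); [apply HB| |].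
    - intros y. apply (ex_derive_continuous (fun y => cos (y * x + INR (2 * p) * (PI / 2)))). auto_derive; auto.
    - intros y. apply Rabs_le, COS_bound. }
  assert (Hcos : forall xi, integral (fun y => Psi y * cos (y * xi)) = 0).
  { assert (Hp : forall xi, 0 <= xi -> integral (fun y => Psi y * cos (y * xi)) = 0).
    { intros xi Hxi.
      rewrite <- (Bang_uniqueness_weight M G xi HM Hlc Hdiv HG) with (x := xi); auto; [| |lra].
      - apply integral_ext. intros y. simpl. rewrite Rmult_0_l, Rplus_0_r. ring.
      - destruct HB as (h & K & Hh & HB). exists h, K; auto. }
    intros xi. destruct (Rle_dec 0 xi) as [Hxi|Hxi]; auto.
    rewrite <- (Hp (- xi)) by lra. apply integral_ext. intros y.
    replace (y * - xi) with (- (y * xi)) by ring. now rewrite cos_neg. }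
  destruct (even_lift_rapid M u 0 HM Hdc Hu) as [K0 HK0].
  assert (HP : decays K0 Psi).
  { apply (decays_ext _ (fun y => Psi y * y ^ 0)); auto. intros; simpl; ring. }
  assert (Hbd : forall g, (forall y, continuous g y) -> (forall y, Rabs (g y) <= 1) ->
     integrable (fun y => Psi y * g y)).
  { intros g Hg H1. exists K0. now apply decays_mult_bounded. }
  assert (Hsc : forall xi, (forall y, continuous (fun y => sin (y * xi)) y)).
  { intros xi y. apply (ex_derive_continuous (fun y => sin (y * xi))). auto_derive; auto. }
  assert (Hcc : forall xi, (forall y, continuous (fun y => cos (y * xi)) y)).
  { intros xi y. apply (ex_derive_continuous (fun y => cos (y * xi))). auto_derive; auto. }
  assert (Hs1 : forall xi y, Rabs (sin (y * xi)) <= 1) by (intros; apply Rabs_le, SIN_bound).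
  assert (Hc1 : forall xi y, Rabs (cos (y * xi)) <= 1) by (intros; apply Rabs_le, COS_bound).
  assert (Hsin : forall xi, integral (fun y => Psi y * sin (y * xi)) = 0).
  { intros xi. apply integral_odd; auto. intros y. unfold Psi. rewrite even_lift_opp.
    replace (- y * xi) with (- (y * xi)) by ring. rewrite sin_neg. ring. }
  (* The addition formula for cos ((y - y0) xi) leaves the cosine transform and the sine transform;
     the latter vanishes because [Psi] is even. *)
  assert (HZ : forall y, Psi y = 0).
  { intros y0. apply cosine_uniqueness; [now exists K0|]. intros xi.
    rewrite (integral_ext _ (fun y => cos (y0 * xi) * (Psi y * cos (y * xi))
       + sin (y0 * xi) * (Psi y * sin (y * xi)))).
    - rewrite integral_plus, !integral_scal, Hcos, Hsin; auto; try ring; apply integrable_scal; auto.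
    - intros y. replace ((y - y0) * xi) with (y * xi - y0 * xi) by ring. rewrite cos_minus. ring. }
  assert (Hpos : forall x, 0 < x -> u x = 0).
  { intros x Hx. specialize (HZ (sqrt x)). unfold Psi, even_lift in HZ.
    rewrite pow2_sqrt in HZ by lra. apply Rmult_integral in HZ. destruct HZ as [HZ|]; auto.
    rewrite Rabs_pos_eq in HZ by apply sqrt_pos. generalize (sqrt_lt_R0 x Hx); lra. }
  (* The factor |y| hides the value of [u] at 0, which is recovered by continuity. *)
  intros x [Hx|<-]; auto.
  destruct Hu as [Hc _].
  destruct (Req_dec (u 0) 0) as [|Hn]; auto. exfalso.
  destruct (proj1 (continuous_eps _ 0) (Hc 0) (Rabs (u 0))) as (d & Hd & H).
  { now apply Rabs_pos_lt. }
  specialize (H (d / 2)). rewrite Rminus_0_r, Rabs_R0, (Rabs_pos_eq (d / 2)) in H by lra.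
  rewrite (Hpos (d / 2)), Rminus_0_l, Rabs_Ropp in H by lra.
  assert (d / 2 < d) by lra. specialize (H H0). lra.
Qed.

(** * The moment mapping *)

(** The even integrand over [-sqrt X, sqrt X] counts the half-line twice, which supplies the 2 of dx
    = 2 y dy; this is why [even_lift] carries |y| without a 2. *)
Lemma half_line_integral (u : R -> R) (K X : R) :
  (forall x, continuous (fun x => u (Rabs x)) x) -> decays K (even_lift u) -> 0 < X ->
  ex_RInt u 0 X /\ Rabs (RInt u 0 X - integral (even_lift u)) <= 2 * K / sqrt X.
Proof.
  intros Hc HK HX. set (Y := sqrt X). assert (HY : 0 < Y) by now apply sqrt_lt_R0.
  assert (HYX : Y ^ 2 = X) by (apply pow2_sqrt; lra).
  assert (EX : ex_RInt u 0 X).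
  { apply (ex_RInt_ext (fun x => u (Rabs x))).
    - rewrite Rmin_left, Rmax_right by lra. intros x Hx. now rewrite Rabs_pos_eq by lra.
    - now apply continuous_ex_RInt. }
  split; auto.
  assert (E1 : RInt u 0 X = RInt (fun x => u (Rabs x)) (0 ^ 2) (Y ^ 2)).
  { replace (0 ^ 2) with 0 by ring. rewrite HYX. apply RInt_ext.
    rewrite Rmin_left, Rmax_right by lra. intros x Hx. now rewrite Rabs_pos_eq by lra. }
  assert (E2 : is_RInt (fun y => 2 * y * u (Rabs (y ^ 2))) 0 Y
     (RInt (fun x => u (Rabs x)) (0 ^ 2) (Y ^ 2))).
  { apply (is_RInt_comp (fun x => u (Rabs x)) (fun y => y ^ 2) (fun y => 2 * y)).
    - intros; auto.
    - intros x _. split.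
      { assert (D : is_derive (fun y : R => y ^ 2) x (2 * x)) by (auto_derive; auto; ring). exact D. }
      apply (ex_derive_continuous (fun y => 2 * y)). auto_derive; auto. }
  assert (HE : forall y, continuous (even_lift u) y) by apply HK.
  assert (E3 : RInt (even_lift u) (- Y) Y = RInt u 0 X).
  { rewrite <- (RInt_cont_Chasles _ (- Y) 0 Y) by auto.
    replace (RInt (even_lift u) (- Y) 0) with (RInt (even_lift u) 0 Y).
    2: { rewrite <- Ropp_0 at 2. rewrite <- RInt_reflect by auto.
         apply RInt_ext. intros; symmetry; apply even_lift_opp. }
    rewrite E1, <- (is_RInt_unique _ _ _ _ E2).
    rewrite (RInt_ext (fun y => 2 * y * u (Rabs (y ^ 2))) (fun y => 2 * even_lift u y)).
    - rewrite RInt_scal_R by now apply continuous_ex_RInt. apply Rplus_diag.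
    - rewrite Rmin_left, Rmax_right by lra. intros y Hy. unfold even_lift.
      rewrite !Rabs_pos_eq; try lra. apply pow2_ge_0. }
  rewrite <- E3. eapply Rle_trans; [now apply (integral_tail _ K)|]. right. field. lra.
Qed.

Lemma is_RInt_gen_half_line (u : R -> R) (v : R -> R) (K : R) :
  (forall x, continuous (fun x => u (Rabs x)) x) -> decays K (even_lift u) ->
  (forall x, continuous (fun x => v (Rabs x)) x) -> decays K (even_lift v) ->
  is_RInt_gen (V := C_R_NormedModule) (fun x => (u x, v x)) (at_point 0) (Rbar_locally p_infty)
    (integral (even_lift u), integral (even_lift v)).
Proof.
  intros Hu HKu Hv HKv P [d Hd].
  assert (HK := decays_pos _ _ HKu). assert (Hdp := cond_pos d).
  (* Beyond this threshold sqrt X > 2 K / d, so the error 2 K / sqrt X is below d. *)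
  exists (fun x => x = 0) (fun X => (2 * K / d + 1) ^ 2 < X).
  - reflexivity.
  - exists ((2 * K / d + 1) ^ 2). auto.
  - intros x X -> HX. simpl.
    assert (H0 : 0 <= 2 * K / d) by (apply Rdiv_le_0_compat; lra).
    assert (HX0 : 0 < X) by (generalize (pow2_ge_0 (2 * K / d + 1)); lra).
    destruct (half_line_integral u K X Hu HKu HX0) as [EU BU].
    destruct (half_line_integral v K X Hv HKv HX0) as [EV BV].
    exists (RInt u 0 X, RInt v 0 X). split.
    + apply (is_RInt_fct_extend_pair (U := R_NormedModule) (V := R_NormedModule) (fun x => (u x, v x)));
        simpl; now apply (RInt_correct (V := R_CompleteNormedModule)).
    + assert (HS : 2 * K / sqrt X < d).
      { assert (S : 2 * K / d + 1 < sqrt X).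
        { rewrite <- (sqrt_pow2 (2 * K / d + 1)) by lra. apply sqrt_lt_1_alt. split; auto.
          apply pow2_ge_0. }
        apply Rmult_lt_reg_r with (sqrt X); [lra|]. unfold Rdiv at 1.
        rewrite Rmult_assoc, Rinv_l, Rmult_1_r by lra.
        apply (Rmult_lt_compat_l d) in S; auto.
        replace (d * (2 * K / d + 1)) with (2 * K + d) in S by (field; lra). lra. }
      apply Hd. split; (eapply Rle_lt_trans; [|apply HS]); [apply BU|apply BV].
Qed.

Lemma RtoC_mult_components (a : R) (z : C) : (RtoC a * z)%C = (a * Re z, a * Im z).
Proof. apply Ceq_components; unfold Re, Im; simpl; ring. Qed.

Lemma moment_class_pow_continuous (u : R -> R) (p : nat) :
  (forall x, continuous (fun x => u (Rabs x)) x) ->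
  forall x, continuous (fun x => Rabs x ^ p * u (Rabs x)) x.
Proof.
  intros Hu x. apply (continuous_mult (fun x => Rabs x ^ p)); auto.
  apply (continuous_comp Rabs (fun y => y ^ p)); [apply continuous_Rabs|].
  apply (ex_derive_continuous (fun y => y ^ p)). auto_derive; auto.
Qed.

Lemma even_lift_pow (u : R -> R) (p : nat) (y : R) :
  even_lift (fun x => x ^ p * u x) y = even_lift u y * y ^ (2 * p).
Proof. unfold even_lift. rewrite pow_mult. ring. Qed.

Lemma moment_even_lift (M : nat -> R) (phi : R -> C) (p : nat) :
  (forall p, 0 < M p) -> dc M ->
  moment_class M (fun x => Re (phi x)) -> moment_class M (fun x => Im (phi x)) ->
  moment phi p = (integral (fun y => even_lift (fun x => Re (phi x)) y * y ^ (2 * p)),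
                  integral (fun y => even_lift (fun x => Im (phi x)) y * y ^ (2 * p))).
Proof.
  intros HM Hdc HR HI. unfold moment.
  set (u := fun x => x ^ p * Re (phi x)). set (v := fun x => x ^ p * Im (phi x)).
  destruct (even_lift_rapid M _ (2 * p) HM Hdc HR) as [K1 H1].
  destruct (even_lift_rapid M _ (2 * p) HM Hdc HI) as [K2 H2].
  assert (Hu : decays K1 (even_lift u)).
  { eapply decays_ext; [|apply H1]. intros; symmetry; apply even_lift_pow. }
  assert (Hv : decays K2 (even_lift v)).
  { eapply decays_ext; [|apply H2]. intros; symmetry; apply even_lift_pow. }
  rewrite (RInt_gen_ext_eq (V := C_R_CompleteNormedModule) _ (fun x => (u x, v x))).
  - apply (is_RInt_gen_unique (V := C_R_CompleteNormedModule)).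
    rewrite <- (integral_ext (even_lift u) _ (even_lift_pow (fun x => Re (phi x)) p)).
    rewrite <- (integral_ext (even_lift v) _ (even_lift_pow (fun x => Im (phi x)) p)).
    apply (is_RInt_gen_half_line u v (Rmax K1 K2)).
    + apply (moment_class_pow_continuous (fun x => Re (phi x))), HR.
    + eapply decays_le; [apply Rmax_l|apply Hu].
    + apply (moment_class_pow_continuous (fun x => Im (phi x))), HI.
    + eapply decays_le; [apply Rmax_r|apply Hv].
  - intros x. apply RtoC_mult_components.
  - exists (integral (even_lift u), integral (even_lift v)).
    apply (is_RInt_gen_ext (V := C_R_NormedModule) (fun x => (u x, v x))).
    + apply filter_forall. intros ab x _. symmetry. apply RtoC_mult_components.
    + apply (is_RInt_gen_half_line u v (Rmax K1 K2)).
      * apply (moment_class_pow_continuous (fun x => Re (phi x))), HR.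
      * eapply decays_le; [apply Rmax_l|apply Hu].
      * apply (moment_class_pow_continuous (fun x => Im (phi x))), HI.
      * eapply decays_le; [apply Rmax_r|apply Hv].
Qed.

Lemma C_space_moment_class (M : nat -> R) (phi : R -> C) :
  (forall p, 0 < M p) -> C_space M phi ->
  moment_class M (fun x => Re (phi x)) /\ moment_class M (fun x => Im (phi x)).
Proof.
  intros HM [Hc (h & Hh & B & HB)].
  assert (C : forall x eps, 0 < eps -> exists d, 0 < d /\ forall y, Rabs (y - x) < d ->
    Rabs (Re (phi (Rabs y)) - Re (phi (Rabs x))) < eps /\
    Rabs (Im (phi (Rabs y)) - Im (phi (Rabs x))) < eps).
  { intros x eps He.
    destruct (proj1 (filterlim_locally _ _) (Hc (Rabs x) (Rabs_pos x)) (mkposreal _ He)) as [d Hd].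
    exists d; split; [apply cond_pos|]. intros y Hy.
    destruct (Hd (Rabs y)) as [A1 A2].
    - eapply Rle_lt_trans; [apply Rabs_triang_inv2|apply Hy].
    - apply Rabs_pos.
    - split; [apply A1|apply A2]. }
  split; (split; [intros x; apply continuous_eps; intros eps He;
      destruct (C x eps He) as (d & Hd & H); exists d; split; auto; intros y Hy; now apply H|];
    exists h; split; auto; exists B; intros p x Hx; specialize (HB p x Hx);
    apply (ratio_le_iff _ _ (weight M h p)) in HB; [|now apply weight_pos];
    eapply Rle_trans; [|apply HB]; apply Rmult_le_compat_l; [now apply pow_le|]);
    [apply re_le_Cmod|apply im_le_Cmod].
Qed.

Lemma moment_Lambda (M : nat -> R) (phi : R -> C) :
  (forall p, 0 < M p) -> dc M -> C_space M phi -> Lambda M (moment phi).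
Proof.
  intros HM Hdc Hphi. destruct (C_space_moment_class M phi HM Hphi) as [HR HI].
  apply Lambda_iff; auto.
  destruct (even_lift_decays M _ HM Hdc HR) as (h1 & Hh1 & B1 & D1).
  destruct (even_lift_decays M _ HM Hdc HI) as (h2 & Hh2 & B2 & D2).
  exists (h1 + h2). split; [lra|]. exists (4 * Rabs B1 + 4 * Rabs B2). intros p.
  rewrite (moment_even_lift M phi p HM Hdc HR HI).
  eapply Rle_trans; [apply Cmod_le_sum|]. simpl.
  assert (E1 := integral_bound _ _ (D1 p)). assert (E2 := integral_bound _ _ (D2 p)).
  assert (W : forall h B, 0 < h -> h <= h1 + h2 -> B * weight M h p <= Rabs B * weight M (h1 + h2) p).
  { intros h B Hh Hle. apply Rle_trans with (Rabs B * weight M h p).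
    - apply Rmult_le_compat_r; [left; now apply weight_pos|apply Rle_abs].
    - apply Rmult_le_compat_l; [apply Rabs_pos|now apply weight_le]. }
  assert (W1 := W h1 B1 Hh1 ltac:(lra)). assert (W2 := W h2 B2 Hh2 ltac:(lra)). simpl in *. lra.
Qed.

Lemma moment_class_minus (M : nat -> R) (u v : R -> R) : (forall p, 0 < M p) ->
  moment_class M u -> moment_class M v -> moment_class M (fun x => u x - v x).
Proof.
  intros HM [Hu (h & Hh & B & HB)] [Hv (k & Hk & L & HL)]. split.
  - intros x. apply (continuous_minus (fun x => u (Rabs x)) (fun x => v (Rabs x))); auto.
  - exists (h + k). split; [lra|]. exists (Rabs B + Rabs L). intros p x Hx.
    assert (W1 := weight_le M h (h + k) p HM Hh ltac:(lra)).
    assert (W2 := weight_le M k (h + k) p HM Hk ltac:(lra)).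
    assert (P1 := weight_pos M h p HM Hh). assert (P2 := weight_pos M k p HM Hk).
    apply Rle_trans with (x ^ p * Rabs (u x) + x ^ p * Rabs (v x)).
    + rewrite <- Rmult_plus_distr_l. apply Rmult_le_compat_l; [now apply pow_le|].
      unfold Rminus. eapply Rle_trans; [apply Rabs_triang|]. rewrite Rabs_Ropp. lra.
    + specialize (HB p x Hx). specialize (HL p x Hx).
      assert (B * weight M h p <= Rabs B * weight M (h + k) p).
      { apply Rle_trans with (Rabs B * weight M h p).
        - apply Rmult_le_compat_r; [lra|apply Rle_abs].
        - apply Rmult_le_compat_l; [apply Rabs_pos|auto]. }
      assert (L * weight M k p <= Rabs L * weight M (h + k) p).
      { apply Rle_trans with (Rabs L * weight M k p).
        - apply Rmult_le_compat_r; [lra|apply Rle_abs].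
        - apply Rmult_le_compat_l; [apply Rabs_pos|auto]. }
      lra.
Qed.

Lemma C_space_injective (M : nat -> R) :
  (forall p, 0 < M p) -> lc M -> dc M ->
  is_lim_seq (sum_n (fun p => 1 / sqrt ((INR p + 1) * quotient M p))) p_infty ->
  injective_map (fun x => 0 <= x) (C_space M) (Lambda M) moment.
Proof.
  intros HM Hlc Hdc Hdiv. split; [intros; now apply moment_Lambda|].
  intros f g Hf Hg Hfg x Hx.
  destruct (C_space_moment_class M f HM Hf) as [HfR HfI].
  destruct (C_space_moment_class M g HM Hg) as [HgR HgI].
  assert (U : forall u v, moment_class M u -> moment_class M v ->
    (forall p, integral (fun y => even_lift u y * y ^ (2 * p)) =
               integral (fun y => even_lift v y * y ^ (2 * p))) -> u x = v x).
  { intros u v Hu Hv E. apply Rminus_diag_uniq.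
    apply (moment_uniqueness M (fun x => u x - v x)); auto; [now apply moment_class_minus|].
    intros p.
    rewrite (integral_ext _ (fun y => even_lift u y * y ^ (2 * p) - even_lift v y * y ^ (2 * p)))
      by (intros; unfold even_lift; ring).
    rewrite integral_minus, E; [ring| |]; now apply (even_lift_rapid M). }
  apply Ceq_components.
  - apply (U (fun x => Re (f x)) (fun x => Re (g x))); auto. intros p. specialize (Hfg p).
    rewrite (moment_even_lift M f), (moment_even_lift M g) in Hfg; auto. congruence.
  - apply (U (fun x => Im (f x)) (fun x => Im (g x))); auto. intros p. specialize (Hfg p).
    rewrite (moment_even_lift M f), (moment_even_lift M g) in Hfg; auto. congruence.
Qed.

(** * Inclusions between the function spaces *)

Lemma smooth_continuous_on (phi : R -> C) (D : R -> Prop) : smooth phi -> continuous_on D phi.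
Proof.
  intros Hs x _.
  assert (C : filterlim phi (locally x) (locally (phi x))).
  { destruct (Hs 1%nat x) as [HR HI]. simpl in HR, HI.
    assert (CR := ex_derive_continuous (fun t => Re (phi t)) x HR).
    assert (CI := ex_derive_continuous (fun t => Im (phi t)) x HI).
    apply filterlim_locally. intros eps.
    generalize (proj1 (filterlim_locally _ _) CR eps) (proj1 (filterlim_locally _ _) CI eps).
    intros A B. generalize (filter_and _ _ A B). apply filter_imp.
    intros y [H1 H2]. split; auto. }
  intros P HP. specialize (C P HP). unfold filtermap, within in *.
  revert C. apply filter_imp. auto.
Qed.

Lemma RC_derive_n_0 (phi : R -> C) (x : R) : RC_derive_n phi 0 x = phi x.
Proof. unfold RC_derive_n. simpl. destruct (phi x); reflexivity. Qed.

Lemma S_space_C_space (M : nat -> R) (phi : R -> C) : S_space M phi -> C_space M phi.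
Proof.
  intros (Hs & _ & h & Hh & HB). split; [now apply smooth_continuous_on|].
  exists h; split; auto. destruct (HB 0%nat) as [B HB0]. exists B. intros p x Hx.
  specialize (HB0 p x). rewrite RC_derive_n_0, Cmod_mult, Cmod_R, Rabs_pos_eq in HB0; auto.
  now apply pow_le.
Qed.

Lemma SA_space_S_space (M A : nat -> R) (phi : R -> C) :
  (forall p, 0 < M p) -> (forall p, 0 < A p) -> SA_space M A phi -> S_space M phi.
Proof.
  intros HM HA (Hs & Hsupp & h & Hh & B & HB). split; auto. split; auto.
  exists h; split; auto. intros q. exists (B * weight A h q). intros p x.
  specialize (HB p q x).
  assert (PM := weight_pos M h p HM Hh). assert (PA := weight_pos A h q HA Hh).
  apply (ratio_le_iff _ _ (weight M h p)); auto.
  replace (h ^ (p + q) * INR (fact p) * M p * INR (fact q) * A q)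
    with (weight M h p * weight A h q) in HB by (unfold weight; rewrite pow_add; ring).
  apply ratio_le_iff in HB; [|now apply Rmult_lt_0_compat]. lra.
Qed.

Lemma injective_map_sub {X : Type} (D : X -> Prop) (E E' : (X -> C) -> Prop) (L : (nat -> C) -> Prop)
    (T : (X -> C) -> nat -> C) :
  (forall f, E' f -> E f) -> injective_map D E L T -> injective_map D E' L T.
Proof. intros H [H1 H2]. split; intros; auto. Qed.

(** * The Borel mapping *)

(** [C_derive] is unspecified where no derivative exists, so the iterates have to be shown
    differentiable. The bound of order p + 1 in [A_space] is the one that [holomorphic_derivative]
    asks for. *)
Lemma A_space_derivatives (M : nat -> R) (f : C -> C) : (forall p, 0 < M p) -> A_space M f ->
  (forall p z, upper_half_plane z ->
     complex_derivative (C_derive_n f p) z (C_derive_n f (S p) z)) /\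
  exists h K, 0 < h /\ forall p z, upper_half_plane z ->
     Cmod (C_derive_n f p z) <= K * weight M h p.
Proof.
  intros HM [Hf (h & Hh & B & HB)].
  assert (HB' : forall p z, upper_half_plane z -> Cmod (C_derive_n f p z) <= B * weight M h p).
  { intros p z Hz. apply (ratio_le_iff _ _ (weight M h p)); [now apply weight_pos|].
    now apply HB. }
  split; [|now exists h, B].
  induction p as [|p IH]; intros z Hz.
  - destruct (Hf z Hz) as [l Hl]. apply complex_derivative_is_derive in Hl.
    simpl. now rewrite (complex_derivative_unique _ _ _ Hl).
  - destruct (holomorphic_derivative (C_derive_n f p) (C_derive_n f (S p)) (B * weight M h (S p))
      IH (HB' (S p)) z Hz) as [l Hl].
    change (C_derive_n f (S (S p)) z) with (C_derive (C_derive_n f (S p)) z).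
    now rewrite (complex_derivative_unique _ _ _ Hl).
Qed.

(** * Limits at the boundary point 0 and flatness there *)

Definition boundary_limit (g : C -> C) (l : C) : Prop :=
  forall eps, 0 < eps -> exists d, 0 < d /\
    forall z, upper_half_plane z -> Cmod z < d -> Cmod (g z - l)%C < eps.

Lemma upper_half_plane_near_0 (d : R) : 0 < d -> upper_half_plane (0, d / 2) /\ Cmod (0, d / 2) < d.
Proof.
  intros Hd. split; [red; simpl; lra|].
  eapply Rle_lt_trans; [apply Cmod_le_sum|]. simpl. rewrite Rabs_R0, Rabs_pos_eq; lra.
Qed.

Lemma within_upper_half_plane_proper :
  ProperFilter (within upper_half_plane (locally (T := C_UniformSpace) (RtoC 0))).
Proof.
  split.
  - intros P [d Hd]. destruct (upper_half_plane_near_0 d (cond_pos d)) as [H1 H2].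
    exists (0, d / 2). apply Hd; auto. split; simpl.
    + apply ball_center.
    + red; simpl. unfold AbsRing_ball, abs, minus, plus, opp; simpl.
      rewrite Ropp_0, Rplus_0_r, Rabs_pos_eq; generalize (cond_pos d); lra.
  - apply within_filter, locally_filter.
Qed.

Lemma Cmod_lt_ball_0 (z : C) (d : R) : Cmod z < d -> ball (M := C_UniformSpace) (RtoC 0) d z.
Proof.
  intros Hz. split; simpl; red; simpl; unfold AbsRing_ball, abs, minus, plus, opp; simpl;
    rewrite Ropp_0, Rplus_0_r; (eapply Rle_lt_trans; [|apply Hz]);
    [apply re_le_Cmod|apply im_le_Cmod].
Qed.

Lemma boundary_limit_filterlim (g : C -> C) (l : C) : boundary_limit g l <->
  filterlim g (within upper_half_plane (locally (T := C_UniformSpace) (RtoC 0)))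
    (locally (T := C_CompleteNormedModule) l).
Proof.
  split.
  - intros H. apply (filterlim_locally_ball_norm (K := C_AbsRing) (U := C_NormedModule)).
    intros eps. destruct (H eps (cond_pos eps)) as (d & Hd & Hg).
    assert (Hd2 : 0 < d / 2) by lra.
    exists (mkposreal _ Hd2). intros z [H1 H2] Hz. apply (Hg z Hz).
    eapply Rle_lt_trans; [apply Cmod_le_sum|].
    red in H1, H2; simpl in H1, H2. unfold AbsRing_ball, abs, minus, plus, opp in H1, H2.
    simpl in H1, H2. rewrite Ropp_0, Rplus_0_r in H1, H2. unfold Re, Im. lra.
  - intros H eps He.
    destruct (proj1 (filterlim_locally_ball_norm (K := C_AbsRing) (U := C_NormedModule) g l) H
      (mkposreal _ He)) as [d Hd].
    exists d. split; [apply cond_pos|]. intros z Hz Hzd. apply (Hd z); auto.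
    now apply Cmod_lt_ball_0.
Qed.

Lemma boundary_limit_value (g : C -> C) (l : C) : boundary_limit g l -> boundary_value g 0 = l.
Proof.
  intros H. assert (FF := Proper_StrongProper _ within_upper_half_plane_proper).
  apply (iota_filterlim_locally (K := C_AbsRing) (V := C_CompleteNormedModule) g).
  now apply boundary_limit_filterlim.
Qed.

Lemma Im_segment (u v : C) (t : R) : 0 <= t <= 1 -> upper_half_plane u -> upper_half_plane v ->
  upper_half_plane (u + RtoC t * (v - u))%C.
Proof.
  unfold upper_half_plane. intros Ht Hu Hv.
  replace (Im (u + RtoC t * (v - u))%C) with ((1 - t) * Im u + t * Im v)
    by (unfold Im; simpl; ring).
  destruct (Req_dec t 0) as [->|]; [lra|]. nra.
Qed.

(** A bounded derivative makes [g] Lipschitz on the convex half-plane, so the Cauchy criterion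
    applies at 0. *)
Lemma boundary_limit_exists (g dg : C -> C) (L : R) :
  (forall z, upper_half_plane z -> complex_derivative g z (dg z)) ->
  (forall z, upper_half_plane z -> Cmod (dg z) <= L) ->
  exists l, boundary_limit g l.
Proof.
  intros Hg HL.
  assert (Lip : forall z w, upper_half_plane z -> upper_half_plane w ->
    Cmod (g w - g z)%C <= 2 * L * Cmod (w - z)%C).
  { intros z w Hz Hw. apply (complex_mean_value g dg); intros t Ht; [apply Hg|apply HL];
      now apply Im_segment. }
  assert (HL0 : 0 <= L).
  { destruct (upper_half_plane_near_0 1 Rlt_0_1) as [H _].
    eapply Rle_trans; [apply Cmod_ge_0|apply (HL _ H)]. }
  assert (FF := within_upper_half_plane_proper).
  destruct (proj1 (filterlim_locally_cauchy (U := C_CompleteNormedModule) g)) as [l Hl].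
  - intros eps.
    (* Two points with modulus below 2 d are at distance at most 4 d, and the Lipschitz constant is
       2 L. *)
    set (d := eps / (8 * L + 1)).
    assert (Hd : 0 < d) by (apply Rdiv_lt_0_compat; [apply cond_pos|lra]).
    exists (fun z => upper_half_plane z /\ Cmod z < 2 * d). split.
    + exists (mkposreal _ Hd). intros z [H1 H2] Hz. split; auto.
      eapply Rle_lt_trans; [apply Cmod_le_sum|].
      red in H1, H2; simpl in H1, H2. unfold AbsRing_ball, abs, minus, plus, opp in H1, H2.
      simpl in H1, H2. rewrite Ropp_0, Rplus_0_r in H1, H2. unfold Re, Im. lra.
    + intros u v [Hu Hud] [Hv Hvd].
      assert (E : Cmod (g v - g u)%C < eps).
      { eapply Rle_lt_trans; [now apply Lip|].
        assert (T : Cmod (v - u)%C <= 4 * d).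
        { unfold Cminus. eapply Rle_trans; [apply Cmod_triangle|]. rewrite Cmod_opp. lra. }
        apply Rle_lt_trans with (2 * L * (4 * d)); [apply Rmult_le_compat_l; lra|].
        replace (pos eps) with (d * (8 * L + 1)) by (unfold d; field; lra). lra. }
      split; simpl; red; simpl; (eapply Rle_lt_trans; [|apply E]);
        [apply (re_le_Cmod (g v - g u)%C)|apply (im_le_Cmod (g v - g u)%C)].
  - exists l. now apply boundary_limit_filterlim.
Qed.

Lemma boundary_limit_bound (g : C -> C) (l : C) (B : R) : boundary_limit g l ->
  (forall z, upper_half_plane z -> Cmod (g z) <= B) -> Cmod l <= B.
Proof.
  intros Hl HB. apply le_epsilon. intros eps He.
  destruct (Hl eps He) as (d & Hd & H). destruct (upper_half_plane_near_0 d Hd) as [H1 H2].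
  specialize (H _ H1 H2). specialize (HB _ H1).
  set (w := (0, d / 2) : C) in *. replace l with (g w + - (g w - l))%C by ring.
  eapply Rle_trans; [apply Cmod_triangle|]. rewrite Cmod_opp. lra.
Qed.

Lemma A_space_boundary_limit (M : nat -> R) (f : C -> C) (p : nat) : (forall p, 0 < M p) ->
  A_space M f -> boundary_limit (C_derive_n f p) (Borel f p).
Proof.
  intros HM Hf. destruct (A_space_derivatives M f HM Hf) as [Hd (h & K & Hh & HK)].
  destruct (boundary_limit_exists _ _ _ (Hd p) (HK (S p))) as [l Hl].
  unfold Borel. now rewrite (boundary_limit_value _ l).
Qed.

Lemma Borel_Lambda (M : nat -> R) (f : C -> C) : (forall p, 0 < M p) ->
  A_space M f -> Lambda M (Borel f).
Proof.
  intros HM Hf. destruct (A_space_derivatives M f HM Hf) as [_ (h & K & Hh & HK)].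
  apply Lambda_iff; auto. exists h; split; auto. exists K. intros p.
  apply (boundary_limit_bound (C_derive_n f p)); auto. now apply A_space_boundary_limit with M.
Qed.

(** Each step bounds [F p] by [F (S p)] along a segment that starts near 0, where [F p] is small:
    this gains a factor |z| and costs one derivative. The 2^k is the constant of
    [complex_mean_value]. *)
Lemma flat_power_bound (F : nat -> C -> C) (B : nat -> R) :
  (forall p z, upper_half_plane z -> complex_derivative (F p) z (F (S p) z)) ->
  (forall p z, upper_half_plane z -> Cmod (F p z) <= B p) ->
  (forall p, boundary_limit (F p) 0) ->
  forall k p z, upper_half_plane z -> Cmod (F p z) <= 2 ^ k * B (p + k)%nat * Cmod z ^ k.
Proof.
  intros HF HB H0. induction k as [|k IH]; intros p z Hz.
  - rewrite Nat.add_0_r. simpl. rewrite Rmult_1_l, Rmult_1_r. auto.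
  - assert (HBp : forall p, 0 <= B p).
    { intros q. eapply Rle_trans; [apply Cmod_ge_0|apply (HB q z Hz)]. }
    apply le_epsilon. intros eps He.
    destruct (H0 p eps He) as (d & Hd & Hl).
    assert (Hzm : 0 < Cmod z).
    { eapply Rlt_le_trans; [apply Hz|]. eapply Rle_trans; [apply Rle_abs|apply im_le_Cmod]. }
    (* The lower end w = s z of the segment satisfies |w| <= d / 2, so [F p w] is within eps of its
       limit 0. *)
    set (s := Rmin 1 (d / (2 * Cmod z))).
    assert (Hs : 0 < s <= 1).
    { split; [apply Rmin_pos; [lra|apply Rdiv_lt_0_compat; lra]|apply Rmin_l]. }
    set (w := (RtoC s * z)%C).
    assert (Hw : upper_half_plane w).
    { unfold upper_half_plane, w in *. replace (Im (RtoC s * z)%C) with (s * Im z)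
        by (unfold Im; simpl; ring). apply Rmult_lt_0_compat; lra. }
    assert (Hwd : Cmod w < d).
    { unfold w. rewrite Cmod_mult, Cmod_R, Rabs_pos_eq by lra.
      assert (s <= d / (2 * Cmod z)) by apply Rmin_r.
      apply Rle_lt_trans with (d / (2 * Cmod z) * Cmod z); [apply Rmult_le_compat_r; lra|].
      replace (d / (2 * Cmod z) * Cmod z) with (d / 2) by (field; lra). lra. }
    specialize (Hl w Hw Hwd).
    replace (F p z) with ((F p z - F p w) + (F p w - 0))%C by ring.
    eapply Rle_trans; [apply Cmod_triangle|]. apply Rplus_le_compat; [|lra].
    assert (Hzw : forall t, 0 <= t <= 1 -> Cmod (w + RtoC t * (z - w))%C <= Cmod z).
    { intros t Ht. unfold w.
      replace (RtoC s * z + RtoC t * (z - RtoC s * z))%C with (RtoC (s + t * (1 - s)) * z)%C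
        by (rewrite RtoC_plus, RtoC_mult, RtoC_minus; ring).
      rewrite Cmod_mult, Cmod_R, Rabs_pos_eq by nra.
      rewrite <- (Rmult_1_l (Cmod z)) at 2. apply Rmult_le_compat_r; nra. }
    eapply Rle_trans; [apply (complex_mean_value (F p) (F (S p)) w z (2 ^ k * B (S p + k)%nat * Cmod z ^ k))|].
    + intros t Ht. apply HF. now apply Im_segment.
    + intros t Ht. eapply Rle_trans; [apply IH; now apply Im_segment|].
      apply Rmult_le_compat_l; [apply Rmult_le_pos; [apply pow_le; lra|auto]|].
      apply pow_incr. split; [apply Cmod_ge_0|auto].
    + replace (p + S k)%nat with (S p + k)%nat by lia. simpl pow.
      replace (2 * 2 ^ k * B (S p + k)%nat * (Cmod z * Cmod z ^ k)) with
        (2 * (2 ^ k * B (S p + k)%nat * Cmod z ^ k) * Cmod z) by ring.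
      apply Rmult_le_compat_l.
      * apply Rmult_le_pos; [lra|]. apply Rmult_le_pos; [apply Rmult_le_pos; auto; apply pow_le; lra|].
        apply pow_le; lra.
      * unfold w. replace (z - RtoC s * z)%C with (RtoC (1 - s) * z)%C by (rewrite RtoC_minus; ring).
        rewrite Cmod_mult, Cmod_R, Rabs_pos_eq by lra. nra.
Qed.

(** * Uniqueness for the Borel mapping *)

Definition complex_differentiable (f : C -> C) (z : C) : Prop :=
  exists l, complex_derivative f z l.

Lemma complex_differentiable_mult (f g : C -> C) (z : C) :
  complex_differentiable f z -> complex_differentiable g z ->
  complex_differentiable (fun z => f z * g z)%C z.
Proof. intros [l Hl] [m Hm]. eexists. now apply complex_derivative_mult; eauto. Qed.

Lemma complex_differentiable_plus (f g : C -> C) (z : C) :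
  complex_differentiable f z -> complex_differentiable g z ->
  complex_differentiable (fun z => f z + g z)%C z.
Proof. intros [l Hl] [m Hm]. eexists. now apply complex_derivative_plus; eauto. Qed.

Lemma complex_differentiable_const (c z : C) : complex_differentiable (fun _ => c) z.
Proof. eexists. apply complex_derivative_const. Qed.

Lemma complex_differentiable_id (z : C) : complex_differentiable (fun z => z) z.
Proof. eexists. apply complex_derivative_id. Qed.

Lemma complex_differentiable_inv (f : C -> C) (z : C) : complex_differentiable f z ->
  f z <> RtoC 0 -> complex_differentiable (fun z => / f z)%C z.
Proof.
  intros [l Hl] Hz. eexists. apply (complex_derivative_comp Cinv f); eauto.
  now apply complex_derivative_inv.
Qed.

Lemma complex_differentiable_Cexp (f : C -> C) (z : C) : complex_differentiable f z ->
  complex_differentiable (fun z => Cexp (f z)) z.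
Proof. intros [l Hl]. eexists. apply complex_derivative_Cexp_comp; eauto. Qed.

Lemma complex_differentiable_continuous (f : C -> C) (z : C) :
  complex_differentiable f z -> continuous_C f z.
Proof. intros [l Hl]. eapply complex_derivative_continuous; eauto. Qed.

Lemma complex_derivative_vertical (f : C -> C) (c t : R) (l : C) :
  complex_derivative f (c, t) l ->
  is_derive (fun t => Re (f (c, t))) t (Re (l * Ci)%C) /\
  is_derive (fun t => Im (f (c, t))) t (Im (l * Ci)%C).
Proof.
  intros H.
  assert (E : forall s, (RtoC c + RtoC s * Ci)%C = (c, s))
    by (intros; apply Ceq_components; simpl; ring).
  destruct (complex_derivative_line f (RtoC c) Ci l t) as [A B]; [now rewrite E|].
  split; [apply (is_derive_ext (fun t => Re (f (RtoC c + RtoC t * Ci)%C)))|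
          apply (is_derive_ext (fun t => Im (f (RtoC c + RtoC t * Ci)%C)))]; auto;
    intros; now rewrite E.
Qed.

Lemma complex_derivative_real (f : C -> C) (r : R) (l : C) :
  complex_derivative f (RtoC r) l ->
  is_derive (fun r => Re (f (RtoC r))) r (Re l) /\
  is_derive (fun r => Im (f (RtoC r))) r (Im l).
Proof.
  intros H.
  assert (E : forall s, (RtoC 0 + RtoC s * RtoC 1)%C = RtoC s) by (intros; ring).
  destruct (complex_derivative_line f (RtoC 0) (RtoC 1) l r) as [A B]; [now rewrite E|].
  rewrite Cmult_1_r in A, B.
  split; [apply (is_derive_ext (fun t => Re (f (RtoC 0 + RtoC t * RtoC 1)%C)))|
          apply (is_derive_ext (fun t => Im (f (RtoC 0 + RtoC t * RtoC 1)%C)))]; auto;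
    intros; now rewrite E.
Qed.

Lemma Cintegral_param_derive (F F1 F2 : R -> R -> C) (r0 K : R) :
  (forall r, exists K, Cdecays K (F r)) -> (exists K, Cdecays K (F1 r0)) ->
  (forall r t, is_derive (fun r => Re (F r t)) r (Re (F1 r t)) /\
               is_derive (fun r => Im (F r t)) r (Im (F1 r t))) ->
  (forall r t, is_derive (fun r => Re (F1 r t)) r (Re (F2 r t)) /\
               is_derive (fun r => Im (F1 r t)) r (Im (F2 r t))) ->
  (forall r t, Rabs (r - r0) <= 1 -> Cmod (F2 r t) <= K / (1 + t ^ 2)) ->
  is_derive (fun r => Re (Cintegral (F r))) r0 (Re (Cintegral (F1 r0))) /\
  is_derive (fun r => Im (Cintegral (F r))) r0 (Im (Cintegral (F1 r0))).
Proof.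
  intros HF [K1 HF1] H1 H2 HK. split.
  - apply (integral_param_derive_taylor (fun r t => Re (F r t)) (fun r t => Re (F1 r t))
      (fun r t => Re (F2 r t)) r0 K).
    + intros r. destruct (HF r) as [L HL]. exact (proj1 (Cdecays_integrable L _ HL)).
    + exact (proj1 (Cdecays_integrable K1 _ HF1)).
    + intros; apply H1.
    + intros; apply H2.
    + intros r t Hr. eapply Rle_trans; [apply re_le_Cmod|auto].
  - apply (integral_param_derive_taylor (fun r t => Im (F r t)) (fun r t => Im (F1 r t))
      (fun r t => Im (F2 r t)) r0 K).
    + intros r. destruct (HF r) as [L HL]. exact (proj2 (Cdecays_integrable L _ HL)).
    + exact (proj2 (Cdecays_integrable K1 _ HF1)).
    + intros; apply H1.
    + intros; apply H2.
    + intros r t Hr. eapply Rle_trans; [apply im_le_Cmod|auto].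
Qed.

Lemma Re_neq_0 (v : C) : 0 < Re v -> v <> RtoC 0.
Proof. intros H E. rewrite E in H. simpl in H. lra. Qed.

Lemma Ci_div_half_plane (v : C) : 0 < Re v -> upper_half_plane (Ci * / v)%C.
Proof.
  intros H. unfold upper_half_plane.
  replace (Im (Ci * / v)%C) with (Re v / (Re v ^ 2 + Im v ^ 2))
    by (unfold Im, Re; simpl; unfold Rdiv; ring).
  apply Rdiv_lt_0_compat; auto. generalize (pow_lt _ 2 H) (pow2_ge_0 (Im v)). lra.
Qed.

Lemma Csqrt_bounds (v : C) (c : R) : 0 < c <= Re v ->
  Cmod (/ Csqrt v)%C <= 1 + / c /\ Cmod (Csqrt v) <= 1 + Cmod v.
Proof.
  intros Hc. assert (Hv : 0 < Re v) by lra.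
  assert (Hn := Csqrt_neq_0 v Hv). assert (Hm := Cmod_Csqrt v Hv).
  rewrite Cmod_inv by auto. assert (Hp := proj1 (Cmod_gt_0 _) Hn).
  assert (Hcv : c <= Cmod v).
  { eapply Rle_trans; [|apply re_le_Cmod]. rewrite Rabs_pos_eq; lra. }
  assert (Hi : 0 < / c) by (apply Rinv_0_lt_compat; lra).
  set (s := Cmod (Csqrt v)) in *. rewrite <- Hm in *. split; [|nra].
  destruct (Rle_dec 1 s) as [H1|H1].
  - apply Rle_trans with (/ 1); [apply Rinv_le_contravar; lra|rewrite Rinv_1; lra].
  - apply Rle_trans with (/ c); [apply Rinv_le_contravar; nra|lra].
Qed.

Lemma Cmod_inv_mult (v w : C) : v <> RtoC 0 -> w <> RtoC 0 ->
  Cmod (/ (v * w))%C = / Cmod v * Cmod (/ w)%C.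
Proof.
  intros Hv Hw. rewrite !Cmod_inv, Cmod_mult, Rinv_mult; auto. now apply Cmult_neq_0.
Qed.

Definition kernel (rho v : C) : C := Cexp (rho * rho / RtoC 4 * v)%C.

Lemma Cmod_kernel (r : R) (v : C) : Cmod (kernel (RtoC r) v) = exp (r ^ 2 / 4 * Re v).
Proof.
  unfold kernel. rewrite Cmod_Cexp. f_equal.
  rewrite <- RtoC_mult, <- RtoC_div by lra. unfold Re; simpl. field.
Qed.

Lemma kernel_derivative_r (rho v : C) :
  complex_derivative (fun rho => kernel rho v) rho (kernel rho v * (rho / RtoC 2 * v))%C.
Proof.
  apply (complex_derivative_Cexp_comp (fun rho => rho * rho / RtoC 4 * v)%C).
  assert (H := complex_derivative_scal (v / RtoC 4)%C (fun z => z * z)%C rho _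
    (complex_derivative_mult (fun z => z) (fun z => z) rho _ _
       (complex_derivative_id rho) (complex_derivative_id rho))).
  replace (rho / RtoC 2 * v)%C with (v / RtoC 4 * (1 * rho + rho * 1))%C.
  - refine (complex_derivative_ext _ _ _ _ _ H). intros w. unfold Cdiv. ring.
  - replace (RtoC 4) with (RtoC 2 * RtoC 2)%C by (rewrite <- RtoC_mult; f_equal; ring).
    field.
Qed.

Lemma kernel_derivative_v (rho v : C) :
  complex_derivative (kernel rho) v (kernel rho v * (rho * rho / RtoC 4))%C.
Proof.
  apply (complex_derivative_Cexp_comp (fun v => rho * rho / RtoC 4 * v)%C).
  assert (H := complex_derivative_scal (rho * rho / RtoC 4)%C (fun v => v) v _
    (complex_derivative_id v)).
  rewrite Cmult_1_r in H. exact H.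
Qed.

Section Borel_uniqueness.

Variables (M : nat -> R) (F : nat -> C -> C) (h0 K0 c : R).
Hypothesis HM : forall p, 0 < M p.
Hypothesis Hh0 : 0 < h0.
Hypothesis Hc : 0 < c.
Hypothesis HF : forall p z, upper_half_plane z -> complex_derivative (F p) z (F (S p) z).
Hypothesis HB : forall p z, upper_half_plane z -> Cmod (F p z) <= K0 * weight M h0 p.
Hypothesis Hflat : forall p, boundary_limit (F p) 0.

(** The power of i absorbs the i from differentiating i / v, which leaves the recursion a_p' = -
    a_(p+1) / v^2. *)
Let a (p : nat) (v : C) : C := (Ci ^ p * F p (Ci * / v))%C.

Let a_derivative (p : nat) (v : C) : 0 < Re v ->
  complex_derivative (a p) v (- (a (S p) v * / (v * v)))%C.
Proof.
  intros Hv.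
  replace (- (a (S p) v * / (v * v)))%C with
    (Ci ^ p * (F (S p) (Ci * / v) * (Ci * (- / (v * v)))))%C
    by (unfold a; rewrite Cpow_S; ring).
  apply (complex_derivative_scal (Ci ^ p)%C (fun v => F p (Ci * / v))%C).
  apply (complex_derivative_comp (F p) (fun v => Ci * / v)%C).
  - apply HF. now apply Ci_div_half_plane.
  - apply complex_derivative_scal, complex_derivative_inv. now apply Re_neq_0.
Qed.

Let Cmod_Ci_pow (p : nat) : Cmod (Ci ^ p)%C = 1.
Proof. rewrite Cmod_pow, Cmod_Ci. apply pow1. Qed.

(** As |i / v| = 1 / |v|, flatness at 0 turns into decay of every order at infinity; each order
    shifts the weight by one. *)
Let a_bound (p k : nat) (v : C) : 0 < Re v ->
  Cmod (a p v) <= 2 ^ k * (K0 * weight M h0 (p + k)) / Cmod v ^ k.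
Proof.
  intros Hv. unfold a. rewrite Cmod_mult, Cmod_Ci_pow, Rmult_1_l.
  eapply Rle_trans; [apply (flat_power_bound F _ HF HB Hflat k p); now apply Ci_div_half_plane|].
  rewrite Cmod_mult, Cmod_Ci, Rmult_1_l, Cmod_inv by now apply Re_neq_0.
  rewrite pow_inv. right. reflexivity.
Qed.

(* Integrated over a vertical line in [v], [X0 p] is the [2 p]-th derivative in [rho] of [X0 0];
   [X1], [X2], [X3] are derivatives of [X0] in [rho]. *)
Let X0 (p : nat) (rho v : C) : C := (a p v * / (v * Csqrt v) * kernel rho v)%C.
Let X1 (p : nat) (rho v : C) : C := (a p v * / Csqrt v * (rho / RtoC 2) * kernel rho v)%C.
Let X2 (p : nat) (rho v : C) : C :=
  (a p v * / Csqrt v * (/ RtoC 2 + rho * rho / RtoC 4 * v) * kernel rho v)%C.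
Let X3 (p : nat) (rho v : C) : C :=
  (a p v * / Csqrt v * (RtoC 3 * rho * v / RtoC 4 + rho * rho * rho * v * v / RtoC 8)
   * kernel rho v)%C.

(** These equations reduce the numerals to 1 and 2, so that [field] can prove the identities
    below. *)
Let four_eq : RtoC 4 = (RtoC 2 * RtoC 2)%C.
Proof. rewrite <- RtoC_mult. f_equal; ring. Qed.

Let eight_eq : RtoC 8 = (RtoC 2 * (RtoC 2 * RtoC 2))%C.
Proof. rewrite <- !RtoC_mult. f_equal; ring. Qed.

Let three_eq : RtoC 3 = (RtoC 1 + RtoC 2)%C.
Proof. rewrite <- RtoC_plus. f_equal; ring. Qed.

Let X0_derivative (p : nat) (rho v : C) : 0 < Re v ->
  complex_derivative (fun rho => X0 p rho v) rho (X1 p rho v).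
Proof.
  intros Hv.
  assert (H := complex_derivative_scal (a p v * / (v * Csqrt v))%C _ rho _ (kernel_derivative_r rho v)).
  replace (X1 p rho v) with (a p v * / (v * Csqrt v) * (kernel rho v * (rho / RtoC 2 * v)))%C; auto.
  unfold X1. field. repeat split; auto; [now apply Csqrt_neq_0|now apply Re_neq_0].
Qed.

Let X1_derivative (p : nat) (rho v : C) : 0 < Re v ->
  complex_derivative (fun rho => X1 p rho v) rho (X2 p rho v).
Proof.
  intros Hv.
  assert (H := complex_derivative_scal (a p v * / Csqrt v / RtoC 2)%C _ rho _
    (complex_derivative_mult (fun z => z) _ rho _ _ (complex_derivative_id rho) (kernel_derivative_r rho v))).
  replace (X2 p rho v) with (a p v * / Csqrt v / RtoC 2 *
    (1 * kernel rho v + rho * (kernel rho v * (rho / RtoC 2 * v))))%C.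
  { refine (complex_derivative_ext _ _ _ _ _ H). intros w. unfold X1, Cdiv. ring. }
  unfold X2. rewrite four_eq. field. repeat split; auto; now apply Csqrt_neq_0.
Qed.

Let X2_derivative (p : nat) (rho v : C) : 0 < Re v ->
  complex_derivative (fun rho => X2 p rho v) rho (X3 p rho v).
Proof.
  intros Hv.
  assert (H1 : complex_derivative (fun rho => / RtoC 2 + v / RtoC 4 * (rho * rho))%C rho
     (0 + v / RtoC 4 * (1 * rho + rho * 1))%C).
  { apply (complex_derivative_plus (fun _ => / RtoC 2)%C); [apply complex_derivative_const|].
    apply (complex_derivative_scal (v / RtoC 4)%C (fun z => z * z)%C).
    apply (complex_derivative_mult (fun z => z) (fun z => z)); apply complex_derivative_id. }
  assert (H := complex_derivative_scal (a p v * / Csqrt v)%C _ rho _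
    (complex_derivative_mult _ _ rho _ _ H1 (kernel_derivative_r rho v))).
  replace (X3 p rho v) with (a p v * / Csqrt v *
    ((0 + v / RtoC 4 * (1 * rho + rho * 1)) * kernel rho v +
     (/ RtoC 2 + v / RtoC 4 * (rho * rho)) * (kernel rho v * (rho / RtoC 2 * v))))%C.
  { refine (complex_derivative_ext _ _ _ _ _ H). intros w. unfold X2, Cdiv. ring. }
  unfold X3. rewrite eight_eq, four_eq, three_eq. field. repeat split; auto; now apply Csqrt_neq_0.
Qed.

(** The difference of the two kernels is a total derivative; this is the heat equation
    for [v ^ (- 3 / 2) exp (rho ^ 2 v / 4)] in the variable [1 / v]. *)
Let heat_derivative (p : nat) (rho v : C) : 0 < Re v ->
  complex_derivative (fun v => a p v * Csqrt v * kernel rho v)%C v (X2 p rho v - X0 (S p) rho v)%C.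
Proof.
  intros Hv. assert (Hs := Csqrt_neq_0 v Hv). destruct (Csqrt_spec v Hv) as [Es _].
  assert (H := complex_derivative_mult _ _ v _ _
    (complex_derivative_mult _ _ v _ _ (a_derivative p v Hv) (complex_derivative_Csqrt v Hv))
    (kernel_derivative_v rho v)).
  cbv beta in H.
  replace (X2 p rho v - X0 (S p) rho v)%C with
    ((- (a (S p) v * / (v * v)) * Csqrt v + a p v * / (RtoC 2 * Csqrt v)) * kernel rho v +
      a p v * Csqrt v * (kernel rho v * (rho * rho / RtoC 4)))%C; auto.
  unfold X2, X0. rewrite four_eq.
  set (k := kernel rho v). set (a0 := a p v). set (a1 := a (S p) v). set (s := Csqrt v) in *.
  rewrite <- Es. field. auto.
Qed.

Let X_differentiable (p : nat) (rho v : C) : 0 < Re v ->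
  complex_differentiable (X0 p rho) v /\ complex_differentiable (X1 p rho) v /\
  complex_differentiable (X2 p rho) v.
Proof.
  intros Hv.
  assert (Ha : complex_differentiable (a p) v) by (eexists; now apply a_derivative).
  assert (Hs : complex_differentiable Csqrt v) by (eexists; now apply complex_derivative_Csqrt).
  assert (Hk : complex_differentiable (kernel rho) v) by (eexists; apply kernel_derivative_v).
  assert (Hsn := Csqrt_neq_0 v Hv). assert (Hvn := Re_neq_0 v Hv).
  assert (H1 : complex_differentiable (fun v => / (v * Csqrt v))%C v).
  { apply (complex_differentiable_inv (fun v => v * Csqrt v)%C); [|now apply Cmult_neq_0].
    exact (complex_differentiable_mult _ _ v (complex_differentiable_id v) Hs). }
  assert (H2 : complex_differentiable (fun v => a p v * / Csqrt v)%C v).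
  { exact (complex_differentiable_mult _ _ v Ha (complex_differentiable_inv _ v Hs Hsn)). }
  split; [|split].
  - exact (complex_differentiable_mult _ _ v (complex_differentiable_mult _ _ v Ha H1) Hk).
  - exact (complex_differentiable_mult _ _ v (complex_differentiable_mult _ _ v H2
      (complex_differentiable_const _ v)) Hk).
  - refine (complex_differentiable_mult _ _ v (complex_differentiable_mult _ _ v H2 _) Hk).
    exact (complex_differentiable_plus _ _ v (complex_differentiable_const _ v)
      (complex_differentiable_mult _ _ v (complex_differentiable_const _ v) (complex_differentiable_id v))).
Qed.

Let Cmod_line_ge (t : R) : c <= Cmod (c, t).
Proof. eapply Rle_trans; [|apply re_le_Cmod]. simpl. rewrite Rabs_pos_eq; lra. Qed.

(** Decay of order 4 leaves |v|^(-2) beside a factor of quadratic growth, which is enough for [X0]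
    to [X3] and for the boundary terms of the heat identity. *)
Let rapid_line (p : nat) (L : R) (Y : C -> C) :
  (forall t, Cmod (Y (c, t)) <= L * (1 + Cmod (c, t)) ^ 2) ->
  exists K, forall t, Cmod (a p (c, t) * Y (c, t))%C <= K / Cmod (c, t) ^ 2.
Proof.
  intros HY.
  set (A := 2 ^ 4 * (K0 * weight M h0 (p + 4))).
  assert (HA : 0 <= A).
  { assert (B := a_bound p 4 (c, 0) Hc). fold A in B.
    assert (P := Cmod_ge_0 (a p (c, 0))). assert (N := Cmod_line_ge 0).
    assert (Q : 0 < Cmod (c, 0) ^ 4) by (apply pow_lt; lra).
    apply Rnot_lt_le. intros Hn. assert (A / Cmod (c, 0) ^ 4 < 0); [|lra].
    unfold Rdiv. assert (0 < / Cmod (c, 0) ^ 4) by now apply Rinv_0_lt_compat. nra. }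
  exists (A * (Rabs L * (1 + / c) ^ 2)). intros t.
  assert (N := Cmod_line_ge t). set (n := Cmod (c, t)) in *.
  assert (B := a_bound p 4 (c, t) Hc). fold A n in B.
  specialize (HY t). fold n in HY.
  rewrite Cmod_mult.
  assert (Hn4 : 0 < n ^ 4) by (apply pow_lt; lra).
  assert (Hn2 : 0 < n ^ 2) by (apply pow_lt; lra).
  apply Rle_trans with (A / n ^ 4 * (Rabs L * ((1 + / c) * n) ^ 2)).
  - apply Rmult_le_compat; try apply Cmod_ge_0; auto.
    eapply Rle_trans; [apply HY|].
    apply Rle_trans with (Rabs L * (1 + n) ^ 2).
    + apply Rmult_le_compat_r; [apply pow2_ge_0|apply Rle_abs].
    + apply Rmult_le_compat_l; [apply Rabs_pos|]. apply pow_incr. split; [lra|].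
      assert (1 <= / c * n); [|lra].
      replace 1 with (/ c * c) by (field; lra). apply Rmult_le_compat_l; auto.
      left; now apply Rinv_0_lt_compat.
  - right. field. lra.
Qed.

Let X_line_bound (p : nat) (R0 : R) : exists K, forall r t, Rabs r <= R0 ->
  Cmod (X0 p (RtoC r) (c, t)) <= K / (1 + t ^ 2) /\
  Cmod (X1 p (RtoC r) (c, t)) <= K / (1 + t ^ 2) /\
  Cmod (X2 p (RtoC r) (c, t)) <= K / (1 + t ^ 2) /\
  Cmod (X3 p (RtoC r) (c, t)) <= K / (1 + t ^ 2).
Proof.
  destruct (rapid_line p ((1 + / c) ^ 2 * (1 + Rabs R0) ^ 3 * exp (R0 ^ 2 / 4 * c))
    (fun v => RtoC ((1 + / c) ^ 2 * (1 + Rabs R0) ^ 3 * exp (R0 ^ 2 / 4 * c) * (1 + Cmod v) ^ 2)))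
    as [K HK].
  { intros t. rewrite Cmod_R, Rabs_pos_eq; [lra|].
    assert (0 < / c) by now apply Rinv_0_lt_compat.
    assert (P := exp_pos (R0 ^ 2 / 4 * c)). assert (Q := Rabs_pos R0). assert (S := Cmod_ge_0 (c, t)).
    repeat apply Rmult_le_pos; try apply pow_le; lra. }
  assert (HC2 : 0 < c ^ 2) by now apply pow_lt.
  assert (Hm : 0 < Rmin 1 (c ^ 2)) by (apply Rmin_pos; lra).
  exists (Rabs K / Rmin 1 (c ^ 2)). intros r t Hr.
  assert (Ht : K / Cmod (c, t) ^ 2 <= Rabs K / Rmin 1 (c ^ 2) / (1 + t ^ 2)).
  { rewrite Cmod2_alt; simpl Re; simpl Im.
    assert (P := pow2_ge_0 t).
    apply Rle_trans with (Rabs K / (c ^ 2 + t ^ 2)).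
    - apply Rmult_le_compat_r; [left; apply Rinv_0_lt_compat; lra|apply Rle_abs].
    - replace (Rabs K / Rmin 1 (c ^ 2) / (1 + t ^ 2)) with (Rabs K * / (Rmin 1 (c ^ 2) * (1 + t ^ 2)))
        by (field; lra).
      apply Rmult_le_compat_l; [apply Rabs_pos|]. apply Rinv_le_contravar.
      + apply Rmult_lt_0_compat; lra.
      + assert (A := Rmin_l 1 (c ^ 2)). assert (B := Rmin_r 1 (c ^ 2)). nra. }
  specialize (HK t). rewrite Cmod_mult, Cmod_R in HK.
  set (n := Cmod (c, t)) in *. assert (N := Cmod_line_ge t). fold n in N.
  set (k := Cmod (kernel (RtoC r) (c, t))).
  assert (Hk : 0 <= k <= exp (R0 ^ 2 / 4 * c)).
  { split; [apply Cmod_ge_0|]. unfold k. rewrite Cmod_kernel. simpl Re.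
    assert (r ^ 2 <= R0 ^ 2).
    { rewrite <- (pow2_abs r). apply pow_incr. split; auto. apply Rabs_pos. }
    assert (E : r ^ 2 / 4 * c <= R0 ^ 2 / 4 * c) by (apply Rmult_le_compat_r; lra).
    destruct E as [E|E]; [left; now apply exp_increasing|rewrite E; lra]. }
  destruct (Csqrt_bounds (c, t) c) as [Hs _]; [simpl; lra|].
  set (w := Cmod (/ Csqrt (c, t))%C) in *.
  assert (Hw : 0 <= w) by apply Cmod_ge_0.
  assert (Hic : 0 < / c) by now apply Rinv_0_lt_compat.
  set (R1 := Rabs R0) in *. assert (HR1 : Rabs r <= R1) by (unfold R1; eapply Rle_trans; [apply Hr|apply Rle_abs]).
  assert (HR0 : 0 <= Rabs r) by apply Rabs_pos.
  set (A := Cmod (a p (c, t))) in *. assert (HA : 0 <= A) by apply Cmod_ge_0.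
  set (e := exp (R0 ^ 2 / 4 * c)) in *.
  rewrite Rabs_pos_eq in HK.
  2: { repeat apply Rmult_le_pos; try apply pow_le; lra. }
  (* The four integrands differ only in the factor beside a_p, 1 / sqrt v and the kernel; [y] is the
     modulus of that factor. *)
  assert (Main : forall y, 0 <= y <= (1 + / c) * (1 + R1) ^ 3 * (1 + n) ^ 2 ->
     A * w * y * k <= Rabs K / Rmin 1 (c ^ 2) / (1 + t ^ 2)).
  { intros y Hy. eapply Rle_trans; [|apply Ht]. eapply Rle_trans; [|apply HK].
    replace (A * ((1 + / c) ^ 2 * (1 + R1) ^ 3 * e * (1 + n) ^ 2)) with
      (A * (1 + / c) * ((1 + / c) * (1 + R1) ^ 3 * (1 + n) ^ 2) * e) by ring.
    apply Rmult_le_compat; try lra.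
    - repeat apply Rmult_le_pos; lra.
    - apply Rmult_le_compat; try lra.
      + now apply Rmult_le_pos.
      + now apply Rmult_le_compat_l. }
  assert (HP3 : 1 <= (1 + R1) ^ 3) by (apply pow_R1_Rle; lra).
  assert (Hn1 : 1 <= 1 + n) by lra.
  assert (Hn2 : 1 + n <= (1 + n) ^ 2) by nra.
  assert (P0 : forall y, 0 <= y -> y <= (1 + R1) ^ 3 * (1 + n) ^ 2 ->
     0 <= y <= (1 + / c) * (1 + R1) ^ 3 * (1 + n) ^ 2).
  { intros y Hy Hy2. split; auto. eapply Rle_trans; [apply Hy2|].
    rewrite Rmult_assoc. rewrite <- (Rmult_1_l ((1 + R1) ^ 3 * (1 + n) ^ 2)) at 1.
    apply Rmult_le_compat_r; lra. }
  assert (Hr2 : Rabs r * Rabs r <= R1 * R1) by (apply Rmult_le_compat; lra).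
  assert (Hr3 : Rabs r * Rabs r * Rabs r <= R1 * R1 * R1).
  { apply Rmult_le_compat; try lra. now apply Rmult_le_pos. }
  assert (C1 : Rabs r <= (1 + R1) ^ 3) by (simpl; nra).
  assert (M2 : Cmod (RtoC r * RtoC r / RtoC 4 * (c, t))%C = Rabs r * Rabs r / 4 * n).
  { unfold Cdiv. rewrite !Cmod_mult, !Cmod_R, <- RtoC_inv, Cmod_R by lra. fold n.
    rewrite (Rabs_pos_eq (/ 4)) by lra. unfold Rdiv. ring. }
  assert (I2 : Cmod (/ RtoC 2)%C = / 2).
  { rewrite <- RtoC_inv, Cmod_R, Rabs_pos_eq by lra. auto. }
  repeat split.
  - unfold X0. rewrite !Cmod_mult, Cmod_inv_mult
      by (first [now apply Re_neq_0|now apply Csqrt_neq_0]). fold A k w n.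
    replace (A * (/ n * w) * k) with (A * w * / n * k) by ring. apply Main.
    assert (0 < / n <= / c).
    { split; [apply Rinv_0_lt_compat; lra|apply Rinv_le_contravar; lra]. }
    split; [lra|]. apply Rle_trans with ((1 + / c) * 1 * 1); [lra|].
    apply Rmult_le_compat; try lra. apply Rmult_le_compat; lra.
  - unfold X1. rewrite !Cmod_mult. fold A k w.
    assert (E : Cmod (RtoC r / RtoC 2)%C = Rabs r / 2).
    { unfold Cdiv. rewrite Cmod_mult, I2, Cmod_R. reflexivity. }
    rewrite E. apply Main, P0; [lra|]. apply Rle_trans with ((1 + R1) ^ 3 * 1); [lra|].
    apply Rmult_le_compat_l; lra.
  - unfold X2. rewrite !Cmod_mult. fold A k w. apply Main, P0; [apply Cmod_ge_0|].
    eapply Rle_trans; [apply Cmod_triangle|]. rewrite M2, I2.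
    apply Rle_trans with ((1 + R1) ^ 3 * (1 + n)); [|apply Rmult_le_compat_l; lra].
    apply Rle_trans with ((1 + R1 * R1) * (1 + n)).
    + assert (Rabs r * Rabs r / 4 * n <= R1 * R1 * n).
      { apply Rmult_le_compat_r; [lra|]. assert (0 <= Rabs r * Rabs r) by nra. lra. }
      nra.
    + apply Rmult_le_compat_r; [lra|]. simpl. nra.
  - unfold X3. rewrite !Cmod_mult. fold A k w. apply Main, P0; [apply Cmod_ge_0|].
    eapply Rle_trans; [apply Cmod_triangle|].
    assert (E1 : Cmod (RtoC 3 * RtoC r * (c, t) / RtoC 4)%C = 3 * Rabs r * n / 4).
    { unfold Cdiv. rewrite !Cmod_mult, !Cmod_R, <- RtoC_inv, Cmod_R by lra. fold n.
      rewrite (Rabs_pos_eq (/ 4)), (Rabs_pos_eq 3) by lra. unfold Rdiv. ring. }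
    assert (E2 : Cmod (RtoC r * RtoC r * RtoC r * (c, t) * (c, t) / RtoC 8)%C
       = Rabs r * Rabs r * Rabs r * n * n / 8).
    { unfold Cdiv. rewrite !Cmod_mult, !Cmod_R, <- RtoC_inv, Cmod_R by lra. fold n.
      rewrite (Rabs_pos_eq (/ 8)) by lra. unfold Rdiv. ring. }
    rewrite E1, E2.
    assert (Q1 : 3 * Rabs r * n / 4 <= R1 * n) by nra.
    assert (Q2 : Rabs r * Rabs r * Rabs r * n * n / 8 <= R1 * R1 * R1 * (n * n)).
    { assert (0 <= n * n) by nra.
      assert (0 <= Rabs r * Rabs r * Rabs r) by (repeat apply Rmult_le_pos; lra).
      assert (Rabs r * Rabs r * Rabs r * (n * n) <= R1 * R1 * R1 * (n * n))
        by (apply Rmult_le_compat_r; lra).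
      assert (0 <= Rabs r * Rabs r * Rabs r * (n * n)) by now apply Rmult_le_pos. lra. }
    apply Rle_trans with (R1 * (1 + n) ^ 2 + R1 * R1 * R1 * (1 + n) ^ 2).
    + apply Rplus_le_compat.
      * eapply Rle_trans; [apply Q1|]. apply Rmult_le_compat_l; [lra|]. nra.
      * eapply Rle_trans; [apply Q2|]. apply Rmult_le_compat_l; [|nra].
        repeat apply Rmult_le_pos; lra.
    + rewrite <- Rmult_plus_distr_r. apply Rmult_le_compat_r; [apply pow2_ge_0|].
      simpl. nra.
Qed.

Let X_line_decays (p : nat) (r : R) :
  (exists K, Cdecays K (fun t => X0 p (RtoC r) (c, t))) /\
  (exists K, Cdecays K (fun t => X1 p (RtoC r) (c, t))) /\
  (exists K, Cdecays K (fun t => X2 p (RtoC r) (c, t))).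
Proof.
  destruct (X_line_bound p (Rabs r)) as [K HK].
  assert (C : forall X, (forall v, 0 < Re v -> complex_differentiable X v) ->
     forall t, continuous_RC (fun t => X (c, t)) t).
  { intros X HX t. apply (continuous_RC_comp X (fun t => (c, t))).
    - apply continuous_RC_vertical.
    - apply complex_differentiable_continuous, HX. exact Hc. }
  split; [|split]; exists K.
  - split; [apply C; intros v Hv; exact (proj1 (X_differentiable p (RtoC r) v Hv))|].
    intros t. exact (proj1 (HK r t (Rle_refl _))).
  - split; [apply C; intros v Hv; exact (proj1 (proj2 (X_differentiable p (RtoC r) v Hv)))|].
    intros t. exact (proj1 (proj2 (HK r t (Rle_refl _)))).
  - split; [apply C; intros v Hv; exact (proj2 (proj2 (X_differentiable p (RtoC r) v Hv)))|].
    intros t. exact (proj1 (proj2 (proj2 (HK r t (Rle_refl _))))).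
Qed.

Let X_integral_step (p : nat) (r : R) :
  Cintegral (fun t => X2 p (RtoC r) (c, t)) = Cintegral (fun t => X0 (S p) (RtoC r) (c, t)).
Proof.
  destruct (X_line_decays p r) as (_ & _ & K2 & D2).
  destruct (X_line_decays (S p) r) as ((K1 & D1) & _ & _).
  set (D := fun t => (X2 p (RtoC r) (c, t) + - (1) * X0 (S p) (RtoC r) (c, t))%C).
  assert (HD := Cdecays_plus _ _ _ _ D2 (Cdecays_scal _ (- (1))%C _ D1)). fold D in HD.
  (* Along the line dv = i dt, so the total derivative carries a factor [Ci], removed afterwards. *)
  assert (Z : Cintegral (fun t => Ci * D t)%C = 0).
  { destruct (rapid_line p (exp (r ^ 2 / 4 * c) * 1)
      (fun v => RtoC (1 + Cmod v) * (Csqrt v * kernel (RtoC r) v))%C) as [K HK].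
    - intros t. rewrite !Cmod_mult, Cmod_kernel, Cmod_R. simpl Re.
      destruct (Csqrt_bounds (c, t) c) as [_ Hs]; [simpl; lra|].
      assert (P := exp_pos (r ^ 2 / 4 * c)). assert (N := Cmod_ge_0 (c, t)).
      rewrite Rabs_pos_eq by lra. rewrite Rmult_1_r.
      replace (exp (r ^ 2 / 4 * c) * (1 + Cmod (c, t)) ^ 2) with
        ((1 + Cmod (c, t)) * ((1 + Cmod (c, t)) * exp (r ^ 2 / 4 * c))) by ring.
      apply Rmult_le_compat_l; [lra|]. apply Rmult_le_compat_r; lra.
    - apply (Cintegral_derive _ (Rabs K / c ^ 2) _
        (fun t => a p (c, t) * Csqrt (c, t) * kernel (RtoC r) (c, t))%C (Cdecays_scal _ Ci _ HD)).
      + intros t.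
        destruct (complex_derivative_vertical _ c t _ (heat_derivative p (RtoC r) (c, t) Hc)) as [A B].
        assert (E : ((X2 p (RtoC r) (c, t) - X0 (S p) (RtoC r) (c, t)) * Ci)%C = (Ci * D t)%C)
          by (change (D t) with (X2 p (RtoC r) (c, t) + - (1) * X0 (S p) (RtoC r) (c, t))%C;
              generalize (X2 p (RtoC r) (c, t)) (X0 (S p) (RtoC r) (c, t)); intros; ring).
        rewrite E in A, B. split; [exact A|exact B].
      + intros t. specialize (HK t). assert (N := Cmod_line_ge t).
        apply Rle_trans with (Cmod (a p (c, t) * (RtoC (1 + Cmod (c, t)) * (Csqrt (c, t) * kernel (RtoC r) (c, t))))%C).
        * rewrite !Cmod_mult, Cmod_R, (Rabs_pos_eq (1 + Cmod (c, t))) by lra.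
          replace (Cmod (a p (c, t)) * ((1 + Cmod (c, t)) * (Cmod (Csqrt (c, t)) * Cmod (kernel (RtoC r) (c, t)))))
            with (Cmod (a p (c, t)) * Cmod (Csqrt (c, t)) * Cmod (kernel (RtoC r) (c, t)) * (1 + Cmod (c, t))) by ring.
          apply Rmult_le_compat_l.
          -- repeat apply Rmult_le_pos; apply Cmod_ge_0.
          -- assert (Q := im_le_Cmod (c, t)). simpl in Q. lra.
        * eapply Rle_trans; [apply HK|]. unfold Rdiv. apply Rle_trans with (Rabs K * / Cmod (c, t) ^ 2).
          -- apply Rmult_le_compat_r; [left; apply Rinv_0_lt_compat, pow_lt; lra|apply Rle_abs].
          -- apply Rmult_le_compat_l; [apply Rabs_pos|]. apply Rinv_le_contravar; [now apply pow_lt|].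
             apply pow_incr; lra. }
  rewrite (Cintegral_scal _ _ _ HD) in Z. change (Ci * Cintegral D = 0)%C in Z.
  assert (Z' : Cintegral D = 0).
  { replace (Cintegral D) with (- Ci * (Ci * Cintegral D))%C.
    - rewrite Z. ring.
    - replace (- Ci * (Ci * Cintegral D))%C with (- (Ci * Ci) * Cintegral D)%C by ring.
      replace (Ci * Ci)%C with (- (1))%C by (apply Ceq_components; simpl; ring). ring. }
  unfold D in Z'.
  rewrite (Cintegral_plus _ _ _ _ D2 (Cdecays_scal _ (- (1))%C _ D1)) in Z'.
  rewrite (Cintegral_scal _ _ _ D1) in Z'.
  apply Cminus_eq_0. rewrite <- Z'. ring.
Qed.

(** One derivative in rho leads from [X0] to [X1] and the next to [X2], whose integral
    [X_integral_step] turns back into that of [X0] at p + 1; hence the split by parity. *)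
Let G (k : nat) (r : R) : C :=
  if Nat.even k then Cintegral (fun t => X0 (Nat.div2 k) (RtoC r) (c, t))
  else Cintegral (fun t => X1 (Nat.div2 k) (RtoC r) (c, t)).

Let G_even (p : nat) (r : R) : G (2 * p) r = Cintegral (fun t => X0 p (RtoC r) (c, t)).
Proof. unfold G. now rewrite Nat.even_mul, Nat.div2_double. Qed.

Let G_odd (p : nat) (r : R) : G (S (2 * p)) r = Cintegral (fun t => X1 p (RtoC r) (c, t)).
Proof.
  unfold G. rewrite Nat.even_succ, <- Nat.negb_even, Nat.even_mul, Nat.div2_succ_double. reflexivity.
Qed.

Let X_bound_near (p : nat) (r0 : R) : exists K, forall r t, Rabs (r - r0) <= 1 ->
  Cmod (X2 p (RtoC r) (c, t)) <= K / (1 + t ^ 2) /\ Cmod (X3 p (RtoC r) (c, t)) <= K / (1 + t ^ 2).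
Proof.
  destruct (X_line_bound p (Rabs r0 + 1)) as [K HK]. exists K. intros r t Hr.
  assert (H : Rabs r <= Rabs r0 + 1).
  { replace r with (r0 + (r - r0)) by ring. eapply Rle_trans; [apply Rabs_triang|lra]. }
  destruct (HK r t H) as (_ & _ & A & B). auto.
Qed.

Let G_derivative (k : nat) (r : R) :
  is_derive (fun r => Re (G k r)) r (Re (G (S k) r)) /\
  is_derive (fun r => Im (G k r)) r (Im (G (S k) r)).
Proof.
  destruct (Nat.Even_or_Odd k) as [[p Hp]|[p Hp]].
  - destruct (X_bound_near p r) as [K HK].
    destruct (Cintegral_param_derive (fun r t => X0 p (RtoC r) (c, t)) (fun r t => X1 p (RtoC r) (c, t))
      (fun r t => X2 p (RtoC r) (c, t)) r K) as [A B].
    + intros s. exact (proj1 (X_line_decays p s)).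
    + exact (proj1 (proj2 (X_line_decays p r))).
    + intros s t. apply (complex_derivative_real (fun rho => X0 p rho (c, t))). exact (X0_derivative p (RtoC s) (c, t) Hc).
    + intros s t. apply (complex_derivative_real (fun rho => X1 p rho (c, t))). exact (X1_derivative p (RtoC s) (c, t) Hc).
    + intros s t Hs. exact (proj1 (HK s t Hs)).
    + subst k. rewrite G_odd.
      split; [apply (is_derive_ext (fun r => Re (Cintegral (fun t => X0 p (RtoC r) (c, t)))))|
              apply (is_derive_ext (fun r => Im (Cintegral (fun t => X0 p (RtoC r) (c, t)))))]; auto;
        intros; now rewrite G_even.
  - destruct (X_bound_near p r) as [K HK].
    destruct (Cintegral_param_derive (fun r t => X1 p (RtoC r) (c, t)) (fun r t => X2 p (RtoC r) (c, t))
      (fun r t => X3 p (RtoC r) (c, t)) r K) as [A B].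
    + intros s. exact (proj1 (proj2 (X_line_decays p s))).
    + exact (proj2 (proj2 (X_line_decays p r))).
    + intros s t. apply (complex_derivative_real (fun rho => X1 p rho (c, t))). exact (X1_derivative p (RtoC s) (c, t) Hc).
    + intros s t. apply (complex_derivative_real (fun rho => X2 p rho (c, t))). exact (X2_derivative p (RtoC s) (c, t) Hc).
    + intros s t Hs. exact (proj2 (HK s t Hs)).
    + replace (2 * p + 1)%nat with (S (2 * p)) in Hp by lia. subst k.
      replace (S (S (2 * p))) with (2 * S p)%nat by lia. rewrite G_even, <- X_integral_step.
      split; [apply (is_derive_ext (fun r => Re (Cintegral (fun t => X1 p (RtoC r) (c, t)))))|
              apply (is_derive_ext (fun r => Im (Cintegral (fun t => X1 p (RtoC r) (c, t)))))]; auto;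
        intros; now rewrite G_odd.
Qed.

(** Only one order of flatness is spent, so the weight is shifted by 1 and (dc) keeps the class.
    With the factor 1 / |v| this already gives |v|^(-2), in the whole half-plane and not only on the
    line. *)
Let halfplane_bound (p : nat) (v : C) (y L : R) : c <= Re v -> 0 <= y <= L ->
  Cmod (a p v) * / (Cmod v) * Cmod (/ Csqrt v)%C * y <=
  2 * (K0 * weight M h0 (p + 1)) * (1 + / c) * L / Cmod v ^ 2.
Proof.
  intros Hv Hy. assert (Hv0 : 0 < Re v) by lra.
  assert (B := a_bound p 1 v Hv0). rewrite !pow_1 in B.
  destruct (Csqrt_bounds v c) as [Hs _]; [lra|].
  assert (Hn : 0 < Cmod v) by now apply Cmod_gt_0, Re_neq_0.
  replace (2 * (K0 * weight M h0 (p + 1)) * (1 + / c) * L / Cmod v ^ 2) with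
    (2 * (K0 * weight M h0 (p + 1)) / Cmod v * / Cmod v * (1 + / c) * L) by (field; lra).
  assert (Hi : 0 < / Cmod v) by now apply Rinv_0_lt_compat.
  apply Rmult_le_compat; try lra.
  - repeat apply Rmult_le_pos; try apply Cmod_ge_0; lra.
  - apply Rmult_le_compat; auto; try apply Cmod_ge_0.
    + apply Rmult_le_pos; [apply Cmod_ge_0|lra].
    + apply Rmult_le_compat_r; lra.
Qed.

Let Cmod_X0_factor (p : nat) (v y : C) : 0 < Re v ->
  Cmod (a p v * / (v * Csqrt v) * y)%C = Cmod (a p v) * / Cmod v * Cmod (/ Csqrt v)%C * Cmod y.
Proof.
  intros Hv. rewrite !Cmod_mult, Cmod_inv_mult
    by (first [now apply Re_neq_0|now apply Csqrt_neq_0]). ring.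
Qed.

(** [f] will be the kernel at rho = 0, for the flatness of [G], and exp(xi v) with xi < 0, for one
    half of the Fourier transform. *)
Let halfplane_zero (p : nat) (f : C -> C) :
  (forall v, 0 < Re v -> complex_differentiable f v) ->
  (forall v, 0 < Re v -> Cmod (f v) <= 1) ->
  Cintegral (fun t => a p (c, t) * / ((c, t) * Csqrt (c, t)) * f (c, t))%C = 0.
Proof.
  intros Hf H1.
  apply (halfplane_line_integral (fun v => a p v * / (v * Csqrt v) * f v)%C
    (2 * (K0 * weight M h0 (p + 1)) * (1 + / c) * 1)); auto.
  - intros v Hv.
    apply (complex_differentiable_mult (fun v => a p v * / (v * Csqrt v))%C f); auto.
    apply (complex_differentiable_mult (a p)).
    + eexists; now apply a_derivative.
    + apply (complex_differentiable_inv (fun v => v * Csqrt v)%C).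
      * apply (complex_differentiable_mult (fun v => v)); [apply complex_differentiable_id|].
        eexists; now apply complex_derivative_Csqrt.
      * apply Cmult_neq_0; [now apply Re_neq_0|now apply Csqrt_neq_0].
  - intros v Hv. rewrite Cmod_X0_factor by lra. apply halfplane_bound; auto.
    split; [apply Cmod_ge_0|]. apply H1; lra.
Qed.

Let G_flat (k : nat) : G k 0 = 0.
Proof.
  destruct (Nat.Even_or_Odd k) as [[p Hp]|[p Hp]].
  - subst k. rewrite G_even. unfold X0.
    apply (halfplane_zero p (kernel (RtoC 0))).
    + intros v _. eexists. apply kernel_derivative_v.
    + intros v _. rewrite Cmod_kernel. replace (0 ^ 2 / 4 * Re v) with 0 by field.
      rewrite exp_0; lra.
  - replace (2 * p + 1)%nat with (S (2 * p)) in Hp by lia. subst k. rewrite G_odd.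
    rewrite (Cintegral_ext _ (fun _ => RtoC 0)).
    + apply Ceq_components; simpl; apply integral_zero; auto.
    + intros t. unfold X1. replace (RtoC 0 / RtoC 2)%C with (RtoC 0) by (field; auto). ring.
Qed.

Let G_bound (T : R) : dc M -> exists h K, 0 < h /\ forall p r, Rabs r <= T + 1 ->
  Cmod (G (2 * p) r) <= K * weight M h p.
Proof.
  intros Hdc. destruct (weight_shift M h0 1 HM Hdc Hh0) as (K1 & h1 & HK1 & Hh1 & S1).
  set (m := Rmin 1 (c ^ 2)). assert (Hm : 0 < m) by (apply Rmin_pos; [lra|now apply pow_lt]).
  set (e := exp ((T + 1) ^ 2 / 4 * c)). assert (He : 0 < e) by apply exp_pos.
  assert (HK0 : 0 <= K0).
  { assert (B := HB 0 _ (Ci_div_half_plane (RtoC 1) Rlt_0_1)).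
    assert (P := Cmod_ge_0 (F 0 (Ci * / RtoC 1))). assert (W := weight_pos M h0 0 HM Hh0).
    apply Rnot_lt_le. intros Hn. nra. }
  assert (Hic : 0 < / c) by now apply Rinv_0_lt_compat.
  exists h1, (8 * (2 * K0 * (1 + / c) * e / m) * K1). split; [lra|].
  intros p r Hr. rewrite G_even.
  assert (D : Cdecays (2 * (K0 * weight M h0 (p + 1)) * (1 + / c) * e / m) (fun t => X0 p (RtoC r) (c, t))).
  { apply vertical_line_decays; auto.
    - intros t. apply complex_differentiable_continuous. exact (proj1 (X_differentiable p (RtoC r) (c, t) Hc)).
    - intros t. unfold X0. rewrite Cmod_X0_factor by exact Hc. apply halfplane_bound; [simpl; lra|].
      split; [apply Cmod_ge_0|]. rewrite Cmod_kernel. simpl Re. unfold e.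
      assert (r ^ 2 <= (T + 1) ^ 2).
      { rewrite <- (pow2_abs r). apply pow_incr. split; auto. apply Rabs_pos. }
      assert (E : r ^ 2 / 4 * c <= (T + 1) ^ 2 / 4 * c) by (apply Rmult_le_compat_r; lra).
      destruct E as [E|E]; [left; now apply exp_increasing|rewrite E; lra]. }
  eapply Rle_trans; [apply (Cintegral_bound _ _ D)|].
  replace (8 * (2 * (K0 * weight M h0 (p + 1)) * (1 + / c) * e / m)) with
    (8 * (2 * K0 * (1 + / c) * e / m) * weight M h0 (p + 1)) by (field; lra).
  rewrite Rmult_assoc. rewrite (Rmult_assoc (8 * _)). rewrite <- (Rmult_assoc 8).
  rewrite (Rmult_assoc 8). rewrite <- (Rmult_assoc 8).
  apply Rmult_le_compat_l; [|apply S1].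
  apply Rmult_le_pos; [lra|]. apply Rdiv_le_0_compat; auto.
  repeat apply Rmult_le_pos; lra.
Qed.

(** The integral of [Psi] against exp(xi v) along the line is 0 for xi < 0 by [halfplane_zero], and
    for xi >= 0 because it is [G 0] at rho = 2 sqrt xi. As |exp(xi v)| is constant on the line, the
    Fourier transform of [Psi] vanishes. *)
Lemma flat_vertical_line : lc M -> dc M ->
  is_lim_seq (sum_n (fun p => 1 / sqrt ((INR p + 1) * quotient M p))) p_infty ->
  forall t, F 0 (Ci * / (c, t))%C = 0.
Proof.
  intros Hlc Hdc Hdiv.
  assert (HG0 : forall r, 0 <= r -> G 0 r = 0).
  { intros r Hr. destruct (G_bound r Hdc) as (h & K & Hh & HK).
    apply Ceq_components.
    - apply (Bang_uniqueness_weight M (fun k r => Re (G k r)) r HM Hlc Hdiv); [| | |lra].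
      + intros k s. apply G_derivative.
      + exists h, K. split; auto. intros p x Hx. eapply Rle_trans; [apply re_le_Cmod|auto].
      + intros k. now rewrite G_flat.
    - apply (Bang_uniqueness_weight M (fun k r => Im (G k r)) r HM Hlc Hdiv); [| | |lra].
      + intros k s. apply G_derivative.
      + exists h, K. split; auto. intros p x Hx. eapply Rle_trans; [apply im_le_Cmod|auto].
      + intros k. now rewrite G_flat. }
  set (Psi := fun t => (a 0 (c, t) * / ((c, t) * Csqrt (c, t)))%C).
  assert (Hexp : forall xi, Cintegral (fun t => Psi t * Cexp (RtoC xi * (c, t)))%C = 0).
  { intros xi. destruct (Rle_dec 0 xi) as [Hxi|Hxi].
    - rewrite <- (HG0 (2 * sqrt xi)) by (generalize (sqrt_pos xi); lra).
      change (G 0) with (G (2 * 0)). rewrite G_even. apply Cintegral_ext. intros t.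
      unfold X0, Psi, kernel. do 2 f_equal.
      rewrite <- !RtoC_mult, <- RtoC_div by lra. do 2 f_equal.
      replace (2 * sqrt xi * (2 * sqrt xi) / 4) with (sqrt xi * sqrt xi) by field.
      symmetry. now apply sqrt_sqrt.
    - apply (halfplane_zero 0 (fun v => Cexp (RtoC xi * v)%C)).
      + intros v _. apply (complex_differentiable_Cexp (fun v => RtoC xi * v)%C).
        apply (complex_differentiable_mult (fun _ => RtoC xi) (fun v => v));
          [apply complex_differentiable_const|apply complex_differentiable_id].
      + intros v Hv. rewrite Cmod_Cexp. rewrite <- exp_0.
        replace (Re (RtoC xi * v)%C) with (xi * Re v) by (unfold Re; simpl; ring).
        left. apply exp_increasing. nra. }
  destruct (X_line_decays 0 0) as ((K & HPK) & _ & _).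
  assert (HPsi : Cdecays K Psi).
  { apply (Cdecays_ext K (fun t => X0 0 (RtoC 0) (c, t))); auto. intros t. unfold X0, Psi, kernel.
    replace (RtoC 0 * RtoC 0 / RtoC 4 * (c, t))%C with (RtoC 0).
    - rewrite Cexp_0. ring.
    - unfold Cdiv. ring. }
  assert (Hcis : forall xi, Cintegral (fun t => Psi t * cis (xi * t))%C = 0).
  { intros xi.
    assert (D : Cdecays K (fun t => Psi t * cis (xi * t))%C).
    { split.
      - intros t. apply continuous_RC_mult; [apply HPsi|apply continuous_RC_cis].
      - intros t. rewrite Cmod_mult, Cmod_cis, Rmult_1_r. apply HPsi. }
    assert (E := Hexp xi).
    rewrite (Cintegral_ext _ (fun t => RtoC (exp (xi * c)) * (Psi t * cis (xi * t)))%C) in E.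
    - rewrite (Cintegral_scal _ _ _ D) in E.
      replace (Cintegral (fun t => Psi t * cis (xi * t))%C) with
        (RtoC (/ exp (xi * c)) * (RtoC (exp (xi * c)) * Cintegral (fun t => Psi t * cis (xi * t))))%C.
      + rewrite E. ring.
      + rewrite Cmult_assoc, <- RtoC_mult, Rinv_l by apply Rgt_not_eq, exp_pos. ring.
    - intros t. replace (RtoC xi * (c, t))%C with ((xi * c)%R, (xi * t)%R)
        by (apply Ceq_components; simpl; ring).
      rewrite Cexp_polar. ring. }
  destruct (Cdecays_integrable _ _ HPsi) as [IR II].
  destruct (Cdecays_components _ _ HPsi) as [DR DI].
  assert (Hb : forall u g, decays K u -> (forall y, continuous g y) -> (forall y, Rabs (g y) <= 1) ->
     integrable (fun y => u y * g y)).
  { intros u g Hu Hg H1. exists K. now apply decays_mult_bounded. }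
  assert (Hcc : forall xi y, continuous (fun y => cos (xi * y)) y).
  { intros xi y. apply (ex_derive_continuous (fun y => cos (xi * y))). auto_derive; auto. }
  assert (Hsc : forall xi y, continuous (fun y => sin (xi * y)) y).
  { intros xi y. apply (ex_derive_continuous (fun y => sin (xi * y))). auto_derive; auto. }
  assert (Hc1 : forall xi y, Rabs (cos (xi * y)) <= 1) by (intros; apply Rabs_le, COS_bound).
  assert (Hs1 : forall xi y, Rabs (sin (xi * y)) <= 1) by (intros; apply Rabs_le, SIN_bound).
  set (u := fun t => Re (Psi t)) in *. set (w := fun t => Im (Psi t)) in *.
  assert (Comp : forall xi,
    integral (fun t => u t * cos (xi * t)) - integral (fun t => w t * sin (xi * t)) = 0 /\
    integral (fun t => u t * sin (xi * t)) + integral (fun t => w t * cos (xi * t)) = 0).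
  { intros xi. specialize (Hcis xi). split.
    - rewrite <- integral_minus by auto. change 0 with (Re (RtoC 0)). rewrite <- Hcis. reflexivity.
    - rewrite <- integral_plus by auto. change 0 with (Im (RtoC 0)). rewrite <- Hcis. reflexivity. }
  assert (Sym : forall v xi, decays K v ->
    integral (fun t => v t * cos (- xi * t)) = integral (fun t => v t * cos (xi * t)) /\
    integral (fun t => v t * sin (- xi * t)) = - integral (fun t => v t * sin (xi * t))).
  { intros v xi Hv. split.
    - apply integral_ext. intros t. replace (- xi * t) with (- (xi * t)) by ring. now rewrite cos_neg.
    - rewrite <- integral_opp by auto. apply integral_ext. intros t.
      replace (- xi * t) with (- (xi * t)) by ring. rewrite sin_neg. ring. }
  (* The relations for xi and - xi differ in the sign of the sine integrals, so their sums and
     differences separate the four integrals. *)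
  assert (Zero : forall xi, integral (fun t => u t * cos (xi * t)) = 0 /\
     integral (fun t => u t * sin (xi * t)) = 0 /\ integral (fun t => w t * cos (xi * t)) = 0 /\
     integral (fun t => w t * sin (xi * t)) = 0).
  { intros xi. destruct (Comp xi) as [A1 A2]. destruct (Comp (- xi)) as [B1 B2].
    destruct (Sym u xi DR) as [E1 E2]. destruct (Sym w xi DI) as [E3 E4].
    rewrite E1, E4 in B1. rewrite E2, E3 in B2. lra. }
  assert (Uniq : forall v, decays K v -> (forall xi, integral (fun t => v t * cos (xi * t)) = 0 /\
     integral (fun t => v t * sin (xi * t)) = 0) -> forall t, v t = 0).
  { intros v Hv Hz t0. apply cosine_uniqueness; [now exists K|]. intros xi.
    destruct (Hz xi) as [Z1 Z2].
    rewrite (integral_ext _ (fun t => cos (xi * t0) * (v t * cos (xi * t))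
       + sin (xi * t0) * (v t * sin (xi * t)))).
    - rewrite integral_plus, !integral_scal, Z1, Z2; auto; try ring; apply integrable_scal; auto.
    - intros t. replace ((t - t0) * xi) with (xi * t - xi * t0) by ring. rewrite cos_minus. ring. }
  intros t.
  assert (HP0 : Psi t = 0).
  { assert (ZU : u t = 0).
    { refine (Uniq u DR _ t). intros xi. destruct (Zero xi) as (Z1 & Z2 & _). exact (conj Z1 Z2). }
    assert (ZW : w t = 0).
    { refine (Uniq w DI _ t). intros xi. destruct (Zero xi) as (_ & _ & Z1 & Z2). exact (conj Z1 Z2). }
    apply Ceq_components; [exact ZU|exact ZW]. }
  assert (Hv : 0 < Re (c, t)) by exact Hc.
  assert (E : F 0 (Ci * / (c, t))%C = (Psi t * ((c, t) * Csqrt (c, t)))%C).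
  { unfold Psi, a. simpl Cpow. field. split; [now apply Csqrt_neq_0|now apply Re_neq_0]. }
  rewrite E, HP0. ring.
Qed.

End Borel_uniqueness.

Lemma A_space_injective (M : nat -> R) :
  (forall p, 0 < M p) -> lc M -> dc M ->
  is_lim_seq (sum_n (fun p => 1 / sqrt ((INR p + 1) * quotient M p))) p_infty ->
  injective_map upper_half_plane (A_space M) (Lambda M) Borel.
Proof.
  intros HM Hlc Hdc Hdiv. split; [intros; now apply Borel_Lambda|].
  intros f g Hf Hg Hfg z Hz.
  destruct (A_space_derivatives M f HM Hf) as [Df (h & K & Hh & HK)].
  destruct (A_space_derivatives M g HM Hg) as [Dg (k & L & Hk & HL)].
  set (F := fun p z => (C_derive_n f p z + - (1) * C_derive_n g p z)%C).
  (* Re v = Im z / |z|^2 > 0: the line is chosen for each z so that it passes through v. *)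
  set (v := (Ci * / z)%C).
  assert (Hzm : 0 < Re z ^ 2 + Im z ^ 2).
  { red in Hz. generalize (pow2_ge_0 (Re z)) (pow_lt _ 2 Hz). lra. }
  assert (Hv : 0 < Re v).
  { replace (Re v) with (Im z / (Re z ^ 2 + Im z ^ 2)).
    - now apply Rdiv_lt_0_compat.
    - unfold v, Im, Re; simpl. unfold Rdiv. ring. }
  assert (HW : forall p, 0 <= weight M h p <= weight M (h + k) p /\
     0 <= weight M k p <= weight M (h + k) p).
  { intros p. generalize (weight_pos M h p HM Hh) (weight_pos M k p HM Hk)
      (weight_le M h (h + k) p HM Hh ltac:(lra)) (weight_le M k (h + k) p HM Hk ltac:(lra)). lra. }
  assert (E := flat_vertical_line M F (h + k) (Rabs K + Rabs L) (Re v) HM ltac:(lra) Hv).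
  apply Cminus_eq_0. rewrite <- (E) with (t := Im v); auto.
  - unfold F. change (C_derive_n f 0) with f. change (C_derive_n g 0) with g.
    replace (Ci * / (Re v, Im v))%C with z; [unfold Cminus; ring|].
    replace (Re v, Im v) with v by (now destruct v).
    unfold v. field. split.
    + intros Ez. rewrite Ez in Hz. red in Hz. simpl in Hz. lra.
    + intros Ez. assert (A := Cmod_Ci). rewrite Ez, Cmod_0 in A. lra.
  - intros p w Hw. apply complex_derivative_plus; [now apply Df|].
    apply complex_derivative_scal. now apply Dg.
  - intros p w Hw. unfold F. eapply Rle_trans; [apply Cmod_triangle|].
    rewrite Cmod_mult, Cmod_m1, Rmult_1_l, Rmult_plus_distr_r.
    destruct (HW p) as [W1 W2]. apply Rplus_le_compat.
    + eapply Rle_trans; [now apply HK|]. apply Rle_trans with (Rabs K * weight M h p).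
      * apply Rmult_le_compat_r; [lra|apply Rle_abs].
      * apply Rmult_le_compat_l; [apply Rabs_pos|lra].
    + eapply Rle_trans; [now apply HL|]. apply Rle_trans with (Rabs L * weight M k p).
      * apply Rmult_le_compat_r; [lra|apply Rle_abs].
      * apply Rmult_le_compat_l; [apply Rabs_pos|lra].
  - intros p eps He.
    destruct (A_space_boundary_limit M f p HM Hf (eps / 2)) as (d1 & Hd1 & H1); [lra|].
    destruct (A_space_boundary_limit M g p HM Hg (eps / 2)) as (d2 & Hd2 & H2); [lra|].
    exists (Rmin d1 d2). split; [now apply Rmin_pos|]. intros w Hw Hwd.
    specialize (H1 w Hw (Rlt_le_trans _ _ _ Hwd (Rmin_l _ _))).
    specialize (H2 w Hw (Rlt_le_trans _ _ _ Hwd (Rmin_r _ _))).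
    unfold F. rewrite (Hfg p) in H1.
    replace (C_derive_n f p w + - (1) * C_derive_n g p w - 0)%C with
      ((C_derive_n f p w - Borel g p) + - (C_derive_n g p w - Borel g p))%C by ring.
    eapply Rle_lt_trans; [apply Cmod_triangle|]. rewrite Cmod_opp. lra.
Qed.

(** * Compactly supported functions in non-quasianalytic classes *)

(** The mean of [u] over [x - l, x], rescaled to [0, 1] so that comparisons need no division by
    [l]. *)
Definition average (l : R) (u : R -> R) (x : R) : R := RInt (fun s => u (x - l * s)) 0 1.

Definition lipschitz1 (u : R -> R) : Prop := forall x y, Rabs (u x - u y) <= Rabs (x - y).

Lemma lipschitz1_continuous (u : R -> R) (x : R) : lipschitz1 u -> continuous u x.
Proof.
  intros Hu. apply continuous_eps. intros eps He. exists eps; split; auto.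
  intros y Hy. eapply Rle_lt_trans; [apply Hu|auto].
Qed.

Lemma average_ex_RInt (l x : R) (u : R -> R) : lipschitz1 u ->
  ex_RInt (fun s => u (x - l * s)) 0 1.
Proof.
  intros Hu. apply continuous_ex_RInt. intros s.
  apply (continuous_comp (fun s => x - l * s) u); [|now apply lipschitz1_continuous].
  apply (ex_derive_continuous (fun s => x - l * s)). auto_derive; auto.
Qed.

Lemma average_between (l x a b : R) (u : R -> R) : lipschitz1 u ->
  (forall s, 0 <= s <= 1 -> a <= u (x - l * s) <= b) -> a <= average l u x <= b.
Proof.
  intros Hu H. unfold average.
  assert (E : forall c : R, RInt (fun _ => c) 0 1 = c).
  { intros c. rewrite RInt_const. unfold scal; simpl; unfold mult; simpl; ring. }
  split.
  - rewrite <- (E a). apply RInt_le; [lra|apply ex_RInt_const|now apply average_ex_RInt|].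
    intros s Hs. apply H; lra.
  - rewrite <- (E b). apply RInt_le; [lra|now apply average_ex_RInt|apply ex_RInt_const|].
    intros s Hs. apply H; lra.
Qed.

Lemma average_minus (l m x y : R) (u v : R -> R) (e : R) : lipschitz1 u -> lipschitz1 v ->
  (forall s, 0 <= s <= 1 -> Rabs (u (x - l * s) - v (y - m * s)) <= e) ->
  Rabs (average l u x - average m v y) <= e.
Proof.
  intros Hu Hv H. unfold average.
  rewrite <- (RInt_minus_R (fun s => u (x - l * s)) (fun s => v (y - m * s)))
    by now apply average_ex_RInt.
  replace e with ((1 - 0) * e) by ring.
  apply Rabs_RInt_le with (fun _ => e); [lra| | |auto].
  - apply (ex_RInt_minus (fun s => u (x - l * s)) (fun s => v (y - m * s)));
      now apply average_ex_RInt.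
  - exact (is_RInt_const (V := R_NormedModule) 0 1 e).
Qed.

Lemma average_lipschitz1 (l : R) (u : R -> R) : lipschitz1 u -> lipschitz1 (average l u).
Proof.
  intros Hu x y. apply average_minus; auto. intros s _.
  replace (x - y) with ((x - l * s) - (y - l * s)) by ring. apply Hu.
Qed.

Lemma average_close (l x : R) (u : R -> R) : lipschitz1 u -> 0 <= l ->
  Rabs (average l u x - u x) <= l.
Proof.
  intros Hu Hl.
  assert (E : average 0 u x = u x).
  { unfold average. rewrite (RInt_ext _ (fun _ => u x)).
    - rewrite RInt_const. unfold scal; simpl; unfold mult; simpl; ring.
    - intros s _. f_equal. ring. }
  rewrite <- E. apply average_minus; auto. intros s Hs.
  eapply Rle_trans; [apply Hu|].
  replace (x - l * s - (x - 0 * s)) with (- (l * s)) by ring.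
  rewrite Rabs_Ropp, Rabs_pos_eq; nra.
Qed.

Lemma is_derive_translate (g : R -> R) (x l d : R) :
  is_derive g (x - l) d -> is_derive (fun x => g (x - l)) x d.
Proof.
  rewrite !is_derive_eps. intros H eps He. destruct (H eps He) as (r & Hr & Hg).
  exists r; split; auto. intros y Hy. specialize (Hg (y - l)).
  replace (y - l - (x - l)) with (y - x) in Hg by ring. auto.
Qed.

(** Differentiation removes an average and leaves a difference quotient, which costs at most 2 / l
    in the supremum norm. *)
Lemma average_derive (l x : R) (u : R -> R) : lipschitz1 u -> 0 < l ->
  is_derive (average l u) x ((u x - u (x - l)) / l).
Proof.
  intros Hu Hl.
  assert (Hc : forall x, continuous u x) by (intros; now apply lipschitz1_continuous).
  set (U := fun x => RInt u 0 x).
  assert (HU : forall x, is_derive U x (u x)).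
  { intros y. apply (is_derive_RInt u U 0).
    - apply filter_forall. intros z. apply (RInt_correct u). now apply continuous_ex_RInt.
    - apply Hc. }
  assert (HD : forall y : R, (U y - U (y - l)) / l = average l u y).
  { intros y. assert (E := RInt_comp_lin u (- l) y 0 1).
    assert (HR : ex_RInt u (- l * 0 + y) (- l * 1 + y)) by now apply continuous_ex_RInt.
    specialize (E HR).
    assert (E2 : RInt (fun s => scal (- l) (u (- l * s + y))) 0 1 = - l * average l u y).
    { unfold average. rewrite <- (RInt_scal_R (- l) (fun s => u (y - l * s)))
        by now apply average_ex_RInt.
      apply RInt_ext. intros s _. unfold scal; simpl; unfold mult; simpl.
      f_equal. f_equal. change (- l * s + y = y - l * s). ring. }
    apply (eq_trans (eq_sym E2)) in E.
    replace (- l * 0 + y) with y in E by ring. replace (- l * 1 + y) with (y - l) in E by ring.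
    assert (F := RInt_cont_Chasles u 0 y (y - l) Hc).
    assert (F2 : U y - U (y - l) = - RInt u y (y - l)) by (unfold U; lra).
    rewrite F2. apply Rmult_eq_reg_l with (- l); [|lra]. rewrite E. field. lra. }
  apply (is_derive_ext (fun x => (U x - U (x - l)) / l)); [exact HD|].
  assert (D1 := HU x). assert (D2 := HU (x - l)).
    assert (D3 := is_derive_translate U x l _ D2).
    assert (D4 := is_derive_minus U (fun x => U (x - l)) x _ _ D1 D3).
    apply (is_derive_scal_l _ x _ (/ l)) in D4. exact D4.
Qed.

(** * Bump functions as limits of iterated averages *)

Fixpoint rising_product (n : nat -> R) (k : nat) : R :=
  match k with O => 1 | S k => rising_product n k * n k end.

(** Starting from a Lipschitz function, all iterated averages keep its Lipschitz constant, and one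
    average of length [l] moves them by at most [l]. *)
Definition tent (x : R) : R := Rmax 0 (1 / 2 - Rabs (x - 3 / 2)).

Lemma tent_lipschitz1 : lipschitz1 tent.
Proof.
  intros x y. unfold tent.
  assert (A : Rabs (x - 3 / 2) <= Rabs (y - 3 / 2) + Rabs (x - y)).
  { replace (x - 3 / 2) with ((y - 3 / 2) + (x - y)) by ring. apply Rabs_triang. }
  assert (B : Rabs (y - 3 / 2) <= Rabs (x - 3 / 2) + Rabs (x - y)).
  { replace (y - 3 / 2) with ((x - 3 / 2) + - (x - y)) by ring.
    eapply Rle_trans; [apply Rabs_triang|]. rewrite Rabs_Ropp. lra. }
  assert (C := Rabs_pos (x - y)).
  apply Rabs_le. unfold Rmax. destruct Rle_dec, Rle_dec; lra.
Qed.

Lemma tent_range (x : R) : 0 <= tent x <= 1 / 2.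
Proof.
  unfold tent. assert (H := Rabs_pos (x - 3 / 2)). unfold Rmax; destruct Rle_dec; lra.
Qed.

Lemma tent_support (x : R) : x <= 1 \/ 2 <= x -> tent x = 0.
Proof.
  intros H. unfold tent. apply Rmax_left.
  destruct H; [rewrite Rabs_left1; lra|rewrite Rabs_pos_eq; lra].
Qed.

Section Bump.

Variable l : nat -> R.
Hypothesis Hl : forall k, 0 < l k.
Variable total : R.
Hypothesis Htotal : is_series l total.

Let ws := window_sum l.

Let ws_pos (m d : nat) : 0 <= ws m d.
Proof.
  revert m. induction d as [|d IH]; intros m; unfold ws; simpl; [lra|].
  specialize (IH (S m)). unfold ws in IH. specialize (Hl m). lra.
Qed.

Let ws_le_total (d : nat) : ws 0 d <= total.
Proof.
  assert (L : is_lim_seq (fun n => ws 0 (S n)) total).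
  { apply (is_lim_seq_ext (sum_n l)); [|exact Htotal].
    intros n. symmetry. apply window_sum_sum_n. }
  assert (A : ws 0 d <= ws 0 (S d)).
  { replace (S d) with (d + 1)%nat by lia. unfold ws. rewrite window_sum_add.
    assert (P := ws_pos d 1). unfold ws in P. simpl Nat.add in *. lra. }
  eapply Rle_trans; [apply A|].
  apply (is_lim_seq_incr_compare _ total L). intros n.
  replace (S (S n)) with (S n + 1)%nat by lia. unfold ws. rewrite window_sum_add.
  assert (P := ws_pos (S n) 1). unfold ws in P. simpl Nat.add in *. lra.
Qed.

(** The total length of the averages from [m] on; it bounds both the later changes of the function
    and the later spread of its support. *)
Let rest (m : nat) : R := total - ws 0 m.

Let ws_le_rest (m e : nat) : ws m e <= rest m.
Proof.
  unfold rest. assert (A := ws_le_total (m + e)). unfold ws in *.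
  rewrite window_sum_add in A. simpl in A. lra.
Qed.

Let rest_lim : forall eps, 0 < eps -> exists N, forall m, (N <= m)%nat -> rest m < eps.
Proof.
  intros eps He.
  assert (L : is_lim_seq (fun n => ws 0 (S n)) total).
  { apply (is_lim_seq_ext (sum_n l)); [|exact Htotal].
    intros n. symmetry. apply window_sum_sum_n. }
  apply is_lim_seq_spec in L. destruct (L (mkposreal _ He)) as [N HN].
  exists (S N). intros m Hm. destruct m as [|m]; [lia|].
  specialize (HN m ltac:(lia)). simpl in HN. apply Rabs_lt_between in HN. unfold rest. lra.
Qed.

(** The outermost average has length [l k]. The start index stays variable because the k-th
    derivative of the bump is built from the averages from [k] on. *)
Fixpoint partial_bump (l : nat -> R) (k d : nat) : R -> R :=
  match d with O => tent | S d => average (l k) (partial_bump l (S k) d) end.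

Let w := partial_bump l.

Let w_lipschitz (k d : nat) : lipschitz1 (w k d).
Proof.
  revert k. induction d as [|d IH]; intros k; simpl; [apply tent_lipschitz1|].
  apply average_lipschitz1, IH.
Qed.

Let w_range (k d : nat) (x : R) : 0 <= w k d x <= 1 / 2.
Proof.
  revert k x. induction d as [|d IH]; intros k x; simpl; [apply tent_range|].
  apply average_between; [apply w_lipschitz|]. intros; apply IH.
Qed.

Let w_support (k d : nat) (x : R) : x <= 1 \/ 2 + ws k d <= x -> w k d x = 0.
Proof.
  revert k x. induction d as [|d IH]; intros k x H; simpl.
  - apply tent_support. unfold ws in H; simpl in H. lra.
  - assert (B : 0 <= average (l k) (w (S k) d) x <= 0); [|apply Rle_antisym; apply B].
    apply average_between; [apply w_lipschitz|]. intros s Hs.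
    rewrite IH; [split; apply Rle_refl|]. unfold ws in *; cbn [window_sum] in H.
    assert (P := ws_pos (S k) d). unfold ws in P.
    assert (Hlk := Hl k). assert (0 <= l k * s) by (apply Rmult_le_pos; lra).
    assert (l k * s <= l k * 1) by (apply Rmult_le_compat_l; lra). lra.
Qed.

(** The new average is the innermost one, and the outer averages do not increase distances in the
    supremum norm. *)
Let w_step (k d : nat) (x : R) : Rabs (w k (S d) x - w k d x) <= l (k + d)%nat.
Proof.
  revert k x. induction d as [|d IH]; intros k x.
  - rewrite Nat.add_0_r. simpl. apply average_close; [apply tent_lipschitz1|left; apply Hl].
  - change (w k (S (S d))) with (average (l k) (w (S k) (S d))).
    change (w k (S d)) with (average (l k) (w (S k) d)).
    apply average_minus; try apply w_lipschitz. intros s _.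
    replace (k + S d)%nat with (S k + d)%nat by lia. apply IH.
Qed.

Let w_cauchy (k d e : nat) (x : R) : Rabs (w k (d + e) x - w k d x) <= rest (k + d)%nat.
Proof.
  eapply Rle_trans; [|apply (ws_le_rest (k + d) e)].
  induction e as [|e IH].
  - rewrite Nat.add_0_r, Rminus_diag, Rabs_R0. apply ws_pos.
  - replace (d + S e)%nat with (S (d + e)) by lia.
    replace (S e) with (e + 1)%nat by lia. unfold ws. rewrite window_sum_add. simpl.
    replace (w k (S (d + e)) x - w k d x) with
      ((w k (S (d + e)) x - w k (d + e) x) + (w k (d + e) x - w k d x)) by ring.
    eapply Rle_trans; [apply Rabs_triang|].
    assert (A := w_step k (d + e) x). rewrite Nat.add_assoc in A. unfold ws in IH. lra.
Qed.

Let v (k : nat) (x : R) : R := real (Lim_seq (fun d => w k d x)).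

Let v_lim (k : nat) (x : R) : is_lim_seq (fun d => w k d x) (v k x).
Proof.
  apply Lim_seq_correct', ex_lim_seq_cauchy_corr. intros eps.
  assert (He : 0 < eps / 2) by (generalize (cond_pos eps); lra).
  destruct (rest_lim (eps / 2) He) as [N HN].
  exists N. intros n m Hn Hm.
  replace n with (N + (n - N))%nat by lia. replace m with (N + (m - N))%nat by lia.
  assert (A := w_cauchy k N (n - N) x). assert (B := w_cauchy k N (m - N) x).
  assert (C := HN (k + N)%nat ltac:(lia)).
  apply Rabs_le_between in A. apply Rabs_le_between in B. apply Rabs_lt_between. lra.
Qed.

Let v_close (k d : nat) (x : R) : Rabs (v k x - w k d x) <= rest (k + d)%nat.
Proof.
  assert (L : is_lim_seq (fun e => Rabs (w k (e + d)%nat x - w k d x)) (Rabs (v k x - w k d x))).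
  { apply (is_lim_seq_abs _ (Finite (v k x - w k d x))). apply is_lim_seq_minus'.
    - apply (is_lim_seq_incr_n (fun e => w k e x)), v_lim.
    - apply is_lim_seq_const. }
  apply (is_lim_seq_le _ (fun _ => rest (k + d)%nat) _ (rest (k + d)%nat)) in L; auto.
  - intros e. rewrite Nat.add_comm. apply w_cauchy.
  - apply is_lim_seq_const.
Qed.

Let v_lipschitz (k : nat) : lipschitz1 (v k).
Proof.
  intros x y.
  assert (L : is_lim_seq (fun d => Rabs (w k d x - w k d y)) (Rabs (v k x - v k y))).
  { apply (is_lim_seq_abs _ (Finite (v k x - v k y))). apply is_lim_seq_minus'; apply v_lim. }
  apply (is_lim_seq_le _ (fun _ => Rabs (x - y)) _ (Rabs (x - y))) in L; auto.
  - intros d. apply w_lipschitz.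
  - apply is_lim_seq_const.
Qed.

Let v_range (k : nat) (x : R) : 0 <= v k x <= 1 / 2.
Proof.
  split.
  - apply (is_lim_seq_le (fun _ => 0) (fun d => w k d x) 0 (v k x)); [|apply is_lim_seq_const|apply v_lim].
    intros; apply w_range.
  - apply (is_lim_seq_le (fun d => w k d x) (fun _ => 1 / 2) (v k x) (1 / 2));
      [|apply v_lim|apply is_lim_seq_const].
    intros; apply w_range.
Qed.

Let v_support (k : nat) (x : R) : x <= 1 \/ 2 + rest k <= x -> v k x = 0.
Proof.
  intros H.
  assert (L : is_lim_seq (fun _ => 0) (v k x)).
  { apply (is_lim_seq_ext (fun d => w k d x)); [|apply v_lim].
    intros d. apply w_support. assert (A := ws_le_rest k d). lra. }
  apply is_lim_seq_unique in L. rewrite Lim_seq_const in L. congruence.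
Qed.

(** The limits satisfy the recursion exactly, so each is an average of a Lipschitz function and
    therefore differentiable by [average_derive]. *)
Let v_average (k : nat) (x : R) : v k x = average (l k) (v (S k)) x.
Proof.
  assert (L : is_lim_seq (fun d => w k d x) (average (l k) (v (S k)) x)).
  { apply is_lim_seq_spec. intros eps. destruct (rest_lim eps (cond_pos eps)) as [N HN].
    exists (S N). intros d Hd. destruct d as [|d]; [lia|].
    change (w k (S d)) with (average (l k) (w (S k) d)).
    eapply Rle_lt_trans; [|apply (HN (S k + d)%nat); lia].
    apply average_minus; [apply w_lipschitz|apply v_lipschitz|].
    intros s _. rewrite Rabs_minus_sym. apply v_close. }
  assert (L2 := v_lim k x). apply is_lim_seq_unique in L. apply is_lim_seq_unique in L2. congruence.
Qed.

(** Applied to [v k] this is the k-th derivative of the bump: the first k averages are replaced by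
    their derivatives. *)
Fixpoint difference_quotients (l : nat -> R) (k : nat) (g : R -> R) : R -> R :=
  match k with
  | O => g
  | S k => difference_quotients l k (fun x => (g x - g (x - l k)) / l k)
  end.

Let E := difference_quotients l.

Let E_derive (k : nat) (g g' : R -> R) :
  (forall x, is_derive g x (g' x)) -> forall x, is_derive (E k g) x (E k g' x).
Proof.
  revert g g'. induction k as [|k IH]; intros g g' Hg; simpl; auto.
  apply IH. intros x.
  assert (D3 := is_derive_translate g x (l k) _ (Hg (x - l k))).
  assert (D4 := is_derive_minus g (fun x => g (x - l k)) x _ _ (Hg x) D3).
  apply (is_derive_scal_l _ x _ (/ l k)) in D4. exact D4.
Qed.

Let E_bound (k : nat) (g : R -> R) (B : R) : (forall x, Rabs (g x) <= B) ->
  forall x, Rabs (E k g x) <= B * rising_product (fun j => 2 / l j) k.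
Proof.
  revert g B. induction k as [|k IH]; intros g B HB x; simpl.
  - rewrite Rmult_1_r. auto.
  - replace (B * (rising_product (fun j => 2 / l j) k * (2 / l k))) with
      (B * (2 / l k) * rising_product (fun j => 2 / l j) k) by ring.
    apply IH. intros y. unfold Rdiv. rewrite Rabs_mult, (Rabs_pos_eq (/ l k))
      by (left; apply Rinv_0_lt_compat, Hl).
    rewrite <- Rmult_assoc. apply Rmult_le_compat_r; [left; apply Rinv_0_lt_compat, Hl|].
    unfold Rminus. eapply Rle_trans; [apply Rabs_triang|]. rewrite Rabs_Ropp.
    assert (A := HB y). assert (C := HB (y - l k)). unfold Rminus in C. lra.
Qed.

(** The quotients spread the support by the first k lengths and [v k] by the remaining ones, so all
    derivatives end at 2 + [total]. *)
Let E_support (k : nat) (g : R -> R) (b : R) : (forall x, x <= 1 \/ b <= x -> g x = 0) ->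
  forall x, x <= 1 \/ b + ws 0 k <= x -> E k g x = 0.
Proof.
  revert g b. induction k as [|k IH]; intros g b Hg x Hx; simpl.
  - apply Hg. unfold ws in Hx; simpl in Hx. lra.
  - apply (IH _ (b + l k)).
    + intros y Hy. specialize (Hl k). rewrite (Hg y), (Hg (y - l k)) by lra. unfold Rdiv; ring.
    + unfold ws in *. replace (S k) with (k + 1)%nat in Hx by lia.
      rewrite window_sum_add in Hx. simpl in Hx. lra.
Qed.

(** A total length of 1/4 keeps the support below 2 + 1/4 and the value at 3/2, initially 1/2, at
    1/4 or more. *)
Lemma bump_of_lengths : total <= 1 / 4 -> exists G : nat -> R -> R,
  derivative_chain G /\ (forall k x, x <= 1 \/ 5 / 2 <= x -> G k x = 0) /\
  (forall x, 0 <= G 0%nat x) /\ 0 < G 0%nat (3 / 2) /\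
  forall k x, Rabs (G k x) <= rising_product (fun j => 2 / l j) k.
Proof.
  intros Ht. exists (fun k => E k (v k)).
  split; [|split; [|split; [|split]]].
  - intros k x.
    apply (E_derive k (v k) (fun x => (v (S k) x - v (S k) (x - l k)) / l k)).
    intros y. apply (is_derive_ext (average (l k) (v (S k)))).
    + intros t. symmetry. apply v_average.
    + apply average_derive; [apply v_lipschitz|apply Hl].
  - intros k x Hx. apply (E_support k (v k) (2 + rest k)).
    + apply v_support.
    + unfold rest. lra.
  - intros x. apply v_range.
  - assert (A : Rabs (v 0 (3 / 2) - tent (3 / 2)) <= total - 0) by exact (v_close 0 0 (3 / 2)).
    assert (T : tent (3 / 2) = 1 / 2).
    { unfold tent. rewrite Rminus_diag, Rabs_R0, Rminus_0_r. apply Rmax_right. lra. }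
    rewrite T in A. apply Rabs_le_between in A. change (0 < v 0 (3 / 2)). lra.
  - intros k x. eapply Rle_trans.
    + apply (E_bound k (v k) 1). intros y. assert (A := v_range k y). apply Rabs_le. lra.
    + rewrite Rmult_1_l. lra.
Qed.

End Bump.

Lemma bump_exists (n : nat -> R) : (forall k, 0 < n k) -> ex_series (fun k => / n k) ->
  exists (G : nat -> R -> R) (h : R), 0 < h /\
  derivative_chain G /\ (forall k x, x <= 1 \/ 5 / 2 <= x -> G k x = 0) /\
  (forall x, 0 <= G 0%nat x) /\ 0 < G 0%nat (3 / 2) /\
  forall k x, Rabs (G k x) <= h ^ k * rising_product n k.
Proof.
  intros Hn [s Hs].
  (* Scaling brings the total length below 1/4. A derivative then costs 2 / l = (2 / e) n, hence the
     parameter 2 / e. *)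
  set (e := / (4 * (Rabs s + 1))).
  assert (He : 0 < e) by (apply Rinv_0_lt_compat; generalize (Rabs_pos s); lra).
  destruct (bump_of_lengths (fun k => e * / n k)) with (total := e * s) as (G & G1 & G2 & G3 & G4 & G5).
  - intros k. apply Rmult_lt_0_compat; auto. now apply Rinv_0_lt_compat.
  - apply (is_series_scal e _ _ Hs).
  - apply Rle_trans with (e * (Rabs s + 1)).
    + apply Rmult_le_compat_l; [lra|]. generalize (Rle_abs s); lra.
    + right. unfold e. field. generalize (Rabs_pos s); lra.
  - exists G, (2 / e). split; [apply Rdiv_lt_0_compat; lra|]. split; auto. split; auto. split; auto. split; auto.
    intros k x. eapply Rle_trans; [apply G5|]. right.
    clear -He Hn. induction k as [|k IH]; simpl; [ring|]. rewrite IH. field.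
    split; [lra|]. apply Rgt_not_eq, Hn.
Qed.

(** * A function with vanishing moments *)

Lemma ex_series_bounded (u : nat -> R) (B : R) : (forall k, 0 <= u k) ->
  (forall d, window_sum u 0 d <= B) -> ex_series u.
Proof.
  intros Hu HB. destruct (ex_finite_lim_seq_incr (sum_n u) B) as [l Hl].
  - intros n. rewrite sum_Sn. unfold plus; simpl. specialize (Hu (S n)). lra.
  - intros n. rewrite <- window_sum_sum_n. apply HB.
  - now exists l.
Qed.

Lemma not_divergent_ex_series (u : nat -> R) : (forall k, 0 <= u k) ->
  ~ is_lim_seq (sum_n u) p_infty -> exists B, forall d, window_sum u 0 d <= B.
Proof.
  intros Hu Hn.
  assert (Hinc : forall n, sum_n u n <= sum_n u (S n)).
  { intros n. rewrite sum_Sn. unfold plus; simpl. specialize (Hu (S n)). lra. }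
  destruct (ex_lim_seq_incr (sum_n u) Hinc) as [l Hl].
  assert (Hpos : forall n, 0 <= sum_n u n).
  { induction n as [|n IH]; [rewrite sum_O; auto|eapply Rle_trans; [apply IH|apply Hinc]]. }
  destruct l as [l| |].
  - exists (Rmax 0 l). intros [|d]; [simpl; apply Rmax_l|].
    rewrite window_sum_sum_n. eapply Rle_trans; [|apply Rmax_r].
    now apply (is_lim_seq_incr_compare (sum_n u)).
  - contradiction.
  - exfalso. apply is_lim_seq_spec in Hl. destruct (Hl 0) as [N HN].
    specialize (HN N (le_n N)). specialize (Hpos N). lra.
Qed.

(** By (lc), M_p >= M_0 m_0^p, so geometric growth is absorbed by a weight. *)
Lemma weight_ge_pow (M : nat -> R) (r : R) : (forall p, 0 < M p) -> lc M -> 0 < r ->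
  exists k K, 0 < k /\ 0 < K /\ forall p, r ^ p <= K * weight M k p.
Proof.
  intros HM Hlc Hr. assert (Q := quotient_pos M 0 HM).
  exists (r / quotient M 0), (/ M 0%nat).
  assert (HM0 := HM 0%nat).
  split; [now apply Rdiv_lt_0_compat|]. split; [now apply Rinv_0_lt_compat|].
  intros p. unfold weight, Rdiv. rewrite Rpow_mult_distr, pow_inv.
  assert (A : M 0%nat * quotient M 0 ^ p <= M p).
  { induction p as [|p IH]; [simpl; lra|].
    assert (E : M (S p) = M p * quotient M p).
    { unfold quotient. replace (p + 1)%nat with (S p) by lia. field. apply Rgt_not_eq, HM. }
    rewrite E. simpl. replace (M 0%nat * (quotient M 0 * quotient M 0 ^ p)) with
      (M 0%nat * quotient M 0 ^ p * quotient M 0) by ring.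
    apply Rmult_le_compat; auto.
    - apply Rmult_le_pos; [lra|]. apply pow_le; lra.
    - lra.
    - apply lc_quotient_le; auto. lia. }
  assert (P := pow_lt _ p Q). assert (Pr := pow_lt _ p Hr).
  assert (F : 1 <= INR (fact p)).
  { change 1 with (INR 1). apply le_INR. apply Nat.le_succ_l, lt_O_fact. }
  apply Rmult_le_reg_l with (M 0%nat * quotient M 0 ^ p); [now apply Rmult_lt_0_compat|].
  replace (M 0%nat * quotient M 0 ^ p * (/ M 0%nat * (r ^ p * / quotient M 0 ^ p * INR (fact p) * M p)))
    with (r ^ p * (INR (fact p) * M p)) by (field; lra).
  rewrite Rmult_comm. apply Rmult_le_compat_l; [lra|].
  rewrite <- (Rmult_1_l (M 0%nat * _)). apply Rmult_le_compat; try lra.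
  apply Rmult_le_pos; lra.
Qed.

Definition half_step (M : nat -> R) (k : nat) : R :=
  sqrt ((INR (Nat.div2 k) + 1) * quotient M (Nat.div2 k)).

Lemma half_step_pos (M : nat -> R) (k : nat) : (forall p, 0 < M p) -> 0 < half_step M k.
Proof.
  intros HM. apply sqrt_lt_R0. apply Rmult_lt_0_compat; [|now apply quotient_pos].
  generalize (pos_INR (Nat.div2 k)); lra.
Qed.

Lemma half_step_even (M : nat -> R) (p : nat) :
  half_step M (2 * p) = sqrt ((INR p + 1) * quotient M p).
Proof. unfold half_step. now rewrite Nat.div2_double. Qed.

Lemma half_step_odd (M : nat -> R) (p : nat) :
  half_step M (S (2 * p)) = sqrt ((INR p + 1) * quotient M p).
Proof. unfold half_step. now rewrite Nat.div2_succ_double. Qed.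

(** Two equal consecutive factors multiply to (p + 1) m_p, and these products telescope. *)
Lemma half_step_product (M : nat -> R) (p : nat) : (forall p, 0 < M p) ->
  rising_product (half_step M) (2 * p) = INR (fact p) * M p / M 0%nat.
Proof.
  intros HM. assert (HM0 := HM 0%nat). induction p as [|p IH].
  - simpl. field. lra.
  - replace (2 * S p)%nat with (S (S (2 * p))) by lia.
    cbn [rising_product]. rewrite IH, half_step_odd, half_step_even.
    rewrite Rmult_assoc, sqrt_sqrt.
    + rewrite fact_simpl, mult_INR, S_INR. unfold quotient.
      replace (p + 1)%nat with (S p) by lia. field. split; apply Rgt_not_eq, HM.
    + apply Rmult_le_pos; [generalize (pos_INR p); lra|left; now apply quotient_pos].
Qed.

Lemma half_step_ex_series (M : nat -> R) : (forall p, 0 < M p) ->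
  ~ is_lim_seq (sum_n (fun p => 1 / sqrt ((INR p + 1) * quotient M p))) p_infty ->
  ex_series (fun k => / half_step M k).
Proof.
  intros HM Hn. set (u := fun p => 1 / sqrt ((INR p + 1) * quotient M p)) in *.
  assert (Hs : forall p, 0 < sqrt ((INR p + 1) * quotient M p)).
  { intros p. rewrite <- half_step_even. now apply half_step_pos. }
  destruct (not_divergent_ex_series u) as [B HB]; auto.
  { intros p. left. apply Rdiv_lt_0_compat; [lra|auto]. }
  assert (Hpos : forall k, 0 <= / half_step M k).
  { intros k. left. apply Rinv_0_lt_compat. now apply half_step_pos. }
  apply (ex_series_bounded _ (2 * B)); auto.
  assert (E : forall d, window_sum (fun k => / half_step M k) 0 (2 * d) = 2 * window_sum u 0 d).
  { induction d as [|e IH]; [simpl; ring|].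
    replace (2 * S e)%nat with (2 * e + 2)%nat by lia.
    replace (S e) with (e + 1)%nat by lia.
    rewrite !window_sum_add, IH. cbn [window_sum Nat.add].
    replace (e + (e + 0))%nat with (2 * e)%nat by lia.
    rewrite half_step_even, half_step_odd. unfold u, Rdiv. ring. }
  intros d.
  assert (A : window_sum (fun k => / half_step M k) 0 d <= window_sum (fun k => / half_step M k) 0 (2 * d)).
  { replace (2 * d)%nat with (d + d)%nat by lia. rewrite window_sum_add.
    assert (P : forall e m, 0 <= window_sum (fun k => / half_step M k) m e).
    { induction e as [|e IH]; intros m; simpl; [lra|]. specialize (IH (S m)). specialize (Hpos m). lra. }
    specialize (P d (0 + d)%nat). lra. }
  rewrite E in A. specialize (HB d). lra.
Qed.

Lemma is_lim_seq_div_sqrt (K : R) : is_lim_seq (fun n => K * / sqrt (INR n)) 0.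
Proof.
  replace (Finite 0) with (Rbar_mult (Finite K) (Finite 0)) by (simpl; f_equal; ring).
  apply is_lim_seq_scal_l. replace (Finite 0) with (Rbar_inv p_infty) by reflexivity.
  apply is_lim_seq_inv; [|discriminate].
  apply (filterlim_comp _ _ _ INR sqrt eventually (Rbar_locally p_infty)); [apply is_lim_seq_INR|].
  apply filterlim_sqrt_p.
Qed.

(** * The sine transform of a bump, taken at the square root *)

Section Compactly_supported.

Variable G : nat -> R -> R.
Hypothesis HG : derivative_chain G.
Hypothesis Hsupp : forall k x, x <= 1 \/ 5 / 2 <= x -> G k x = 0.
Variable N : nat -> R.
Hypothesis HN : forall k x, Rabs (G k x) <= N k.

Lemma chain_continuous (k : nat) (x : R) : continuous (G k) x.
Proof. apply (ex_derive_continuous (G k)). eexists. apply HG. Qed.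

(** On the support 1 + x^2 <= 1 + (5/2)^2 <= 8. *)
Lemma compact_decays (k : nat) (g : R -> R) (L : R) :
  (forall x, continuous g x) -> (forall x, 1 <= x <= 5 / 2 -> Rabs (g x) <= L) ->
  decays (8 * (N k * L)) (fun x => G k x * g x).
Proof.
  intros Hg HL. split.
  - intros x. apply (continuous_mult (G k)); auto. apply chain_continuous.
  - intros x. apply Rmult_le_reg_r with (1 + x ^ 2); [apply sq_pos|].
    unfold Rdiv. rewrite (Rmult_assoc (8 * _)), Rinv_l, Rmult_1_r by apply Rgt_not_eq, sq_pos.
    assert (HN0 : 0 <= N k) by (eapply Rle_trans; [apply Rabs_pos|apply (HN k 0)]).
    assert (HL0 : 0 <= L).
    { eapply Rle_trans; [apply Rabs_pos|apply (HL 1)]. lra. }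
    destruct (Rle_dec x 1) as [H1|H1].
    { rewrite Hsupp, Rmult_0_l, Rabs_R0, Rmult_0_l by auto.
      apply Rmult_le_pos; [lra|now apply Rmult_le_pos]. }
    destruct (Rle_dec (5 / 2) x) as [H2|H2].
    { rewrite Hsupp, Rmult_0_l, Rabs_R0, Rmult_0_l by auto.
      apply Rmult_le_pos; [lra|now apply Rmult_le_pos]. }
    rewrite Rabs_mult, Rmult_comm. apply Rmult_le_compat; try lra.
    + generalize (sq_pos x); lra.
    + apply Rmult_le_pos; apply Rabs_pos.
    + nra.
    + apply Rmult_le_compat; try apply Rabs_pos; auto. apply HL; lra.
Qed.

Let Sine (k : nat) (y : R) : R := integral (fun xi => G k xi * sin (xi * y)).
Let Cosine (k : nat) (y : R) : R := integral (fun xi => G k xi * cos (xi * y)).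

Let sin_cont (y x : R) : continuous (fun xi => sin (xi * y)) x.
Proof. apply (ex_derive_continuous (fun xi => sin (xi * y))). auto_derive; auto. Qed.

Let cos_cont (y x : R) : continuous (fun xi => cos (xi * y)) x.
Proof. apply (ex_derive_continuous (fun xi => cos (xi * y))). auto_derive; auto. Qed.

Let Sine_decays (k : nat) (y : R) : decays (8 * (N k * 1)) (fun xi => G k xi * sin (xi * y)).
Proof. apply compact_decays; [apply sin_cont|]. intros; apply Rabs_le, SIN_bound. Qed.

Let Cosine_decays (k : nat) (y : R) : decays (8 * (N k * 1)) (fun xi => G k xi * cos (xi * y)).
Proof. apply compact_decays; [apply cos_cont|]. intros; apply Rabs_le, COS_bound. Qed.

Let Sine_bound (k : nat) (y : R) : Rabs (Sine k y) <= 32 * N k.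
Proof. eapply Rle_trans; [apply (integral_bound _ _ (Sine_decays k y))|]. lra. Qed.

Let product_bound (k : nat) (g : R -> R) (x : R) : (forall x, Rabs (g x) <= 1) ->
  Rabs (G k x * g x) * (1 + Rabs x) <= 4 * N k.
Proof.
  intros Hg.
  assert (HN0 : 0 <= N k) by (eapply Rle_trans; [apply Rabs_pos|apply (HN k 0)]).
  destruct (Rle_dec x 1) as [H1|H1].
  { rewrite Hsupp, Rmult_0_l, Rabs_R0, Rmult_0_l by auto. lra. }
  destruct (Rle_dec (5 / 2) x) as [H2|H2].
  { rewrite Hsupp, Rmult_0_l, Rabs_R0, Rmult_0_l by auto. lra. }
  rewrite Rmult_comm, (Rabs_pos_eq x), Rabs_mult by lra.
  apply Rmult_le_compat; try lra.
  - apply Rmult_le_pos; apply Rabs_pos.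
  - rewrite <- (Rmult_1_r (N k)). apply Rmult_le_compat; auto; apply Rabs_pos.
Qed.

Let Sine_parts (k : nat) (y : R) : y * Sine k y = Cosine (S k) y.
Proof.
  assert (I1 : integrable (fun xi => G k xi * sin (xi * y))) by (eexists; apply Sine_decays).
  assert (I2 : integrable (fun xi => G (S k) xi * cos (xi * y))) by (eexists; apply Cosine_decays).
  apply Rminus_diag_uniq. unfold Sine, Cosine. rewrite <- integral_scal by auto.
  rewrite <- integral_minus by (auto; now apply integrable_scal).
  apply (integral_derive (fun xi => - (G k xi * cos (xi * y))) _ (4 * N k)).
  - apply integrable_minus; auto. now apply integrable_scal.
  - intros x.
    assert (D : is_derive (fun xi => G k xi * cos (xi * y)) x
      (G (S k) x * cos (x * y) + G k x * (- (y * sin (x * y))))).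
    { apply (is_derive_mult (K := R_AbsRing) (G k) (fun xi => cos (xi * y))); [apply HG| |apply Rmult_comm].
      auto_derive; auto; ring. }
    apply (is_derive_opp (fun xi => G k xi * cos (xi * y))) in D.
    replace (y * (G k x * sin (x * y)) - G (S k) x * cos (x * y)) with
      (opp (G (S k) x * cos (x * y) + G k x * (- (y * sin (x * y)))))
      by (unfold opp; simpl; ring). exact D.
  - intros x. rewrite Rabs_Ropp. apply (product_bound k (fun xi => cos (xi * y))).
    intros; apply Rabs_le, COS_bound.
Qed.

Let Cosine_parts (k : nat) (y : R) : y * Cosine k y = - Sine (S k) y.
Proof.
  assert (I1 : integrable (fun xi => G k xi * cos (xi * y))) by (eexists; apply Cosine_decays).
  assert (I2 : integrable (fun xi => G (S k) xi * sin (xi * y))) by (eexists; apply Sine_decays).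
  apply Rminus_diag_uniq. unfold Rminus. rewrite Ropp_involutive.
  unfold Sine, Cosine. rewrite <- integral_scal by auto.
  rewrite <- integral_plus by (auto; now apply integrable_scal).
  apply (integral_derive (fun xi => G k xi * sin (xi * y)) _ (4 * N k)).
  - apply integrable_plus; auto. now apply integrable_scal.
  - intros x.
    assert (D : is_derive (fun xi => G k xi * sin (xi * y)) x
      (G (S k) x * sin (x * y) + G k x * (y * cos (x * y)))).
    { apply (is_derive_mult (K := R_AbsRing) (G k) (fun xi => sin (xi * y))); [apply HG| |apply Rmult_comm].
      auto_derive; auto; ring. }
    replace (y * (G k x * cos (x * y)) + G (S k) x * sin (x * y)) with
      (G (S k) x * sin (x * y) + G k x * (y * cos (x * y))) by ring. exact D.
  - intros x. apply (product_bound k (fun xi => sin (xi * y))).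
    intros; apply Rabs_le, SIN_bound.
Qed.

(** Two integrations by parts for each factor y^2; this is the source of the decay with constant
    [N (2 * p)]. *)
Let Sine_even (p : nat) (y : R) : (y ^ 2) ^ p * Sine 0 y = (-1) ^ p * Sine (2 * p) y.
Proof.
  induction p as [|p IH]; [simpl; ring|].
  replace (2 * S p)%nat with (S (S (2 * p))) by lia.
  assert (A := Cosine_parts (S (2 * p)) y). assert (B := Sine_parts (2 * p) y).
  rewrite <- B in A.
  replace (Sine (S (S (2 * p))) y) with (- (y * (y * Sine (2 * p) y))) by lra.
  simpl pow in *. replace (y * (y * 1) * (y * (y * 1)) ^ p * Sine 0 y) with
    (y * y * ((y * (y * 1)) ^ p * Sine 0 y)) by ring.
  rewrite IH. ring.
Qed.

Let Sine_derive (k : nat) (y : R) :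
  is_derive (Sine k) y (integral (fun xi => G k xi * (xi * cos (xi * y)))).
Proof.
  apply (integral_param_derive_taylor (fun y xi => G k xi * sin (xi * y))
    (fun y xi => G k xi * (xi * cos (xi * y)))
    (fun y xi => G k xi * - (xi * xi * sin (xi * y))) y (8 * (N k * 9))).
  - intros r. eexists. apply Sine_decays.
  - eexists. apply (compact_decays k (fun xi => xi * cos (xi * y)) 3).
    + intros x. apply (ex_derive_continuous (fun xi => xi * cos (xi * y))). auto_derive; auto.
    + intros x Hx. rewrite Rabs_mult, Rabs_pos_eq by lra.
      assert (A : Rabs (cos (x * y)) <= 1) by apply Rabs_le, COS_bound.
      rewrite <- (Rmult_1_r 3). apply Rmult_le_compat; try lra. apply Rabs_pos.
  - intros r x. auto_derive; auto. ring.
  - intros r x. auto_derive; auto. ring.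
  - intros r x _.
    apply (compact_decays k (fun xi => - (xi * xi * sin (xi * r))) 9).
    + intros z. apply (ex_derive_continuous (fun xi => - (xi * xi * sin (xi * r)))). auto_derive; auto.
    + intros z Hz. rewrite Rabs_Ropp, Rabs_mult, (Rabs_pos_eq (z * z)) by nra.
      assert (A : Rabs (sin (z * r)) <= 1) by apply Rabs_le, SIN_bound.
      rewrite <- (Rmult_1_r 9). apply Rmult_le_compat; try nra. apply Rabs_pos.
Qed.

Let Q (k : nat) (y : R) : R := integral (fun xi => G k xi * (/ xi * sin (xi * y))).

(** Two overlapping cases for integrands with a factor 1 / xi: for x < 1 the bump vanishes, even in
    a neighbourhood, and for x > 0 the factor is differentiable. *)
Let support_cases (P : R -> Prop) : (forall x, x < 1 -> P x) -> (forall x, 0 < x -> P x) ->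
  forall x, P x.
Proof. intros H1 H2 x. destruct (Rlt_dec x 1); [auto|apply H2; lra]. Qed.

Let local_zero (k : nat) (g : R -> R) (x : R) : x < 1 -> locally x (fun t => 0 = G k t * g t).
Proof.
  intros Hx. assert (Hd : 0 < 1 - x) by lra. exists (mkposreal _ Hd). intros t Ht.
  red in Ht; simpl in Ht. unfold AbsRing_ball, abs, minus, plus, opp in Ht; simpl in Ht.
  apply Rabs_lt_between in Ht. rewrite Hsupp by (left; lra). ring.
Qed.

Let decays_quotient (k : nat) (g : R -> R) (L : R) :
  (forall x, 0 < x -> continuous g x) -> (forall x, 1 <= x <= 5 / 2 -> Rabs (g x) <= L) ->
  decays (8 * (N k * L)) (fun x => G k x * g x).
Proof.
  intros Hg HL.
  (* Clamping the argument at 1 removes the singularity of [g] and changes nothing where [G k] is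
     non-zero. *)
  assert (D : decays (8 * (N k * L)) (fun x => G k x * g (Rmax 1 x))).
  { apply compact_decays.
    - intros x. apply (continuous_comp (Rmax 1) g); [|apply Hg; generalize (Rmax_l 1 x); lra].
      apply continuous_eps. intros eps He. exists eps; split; auto. intros y Hy.
      eapply Rle_lt_trans; [|apply Hy]. apply Rabs_le. assert (A := Rle_abs (y - x)).
      assert (B := Rle_abs (- (y - x))). rewrite Rabs_Ropp in B.
      assert (C := Rabs_pos (y - x)).
      unfold Rmax. destruct Rle_dec, Rle_dec; lra.
    - intros x Hx. rewrite Rmax_right by lra. auto. }
  assert (Hx : forall x, G k x * g (Rmax 1 x) = G k x * g x).
  { intros x. destruct (Rle_dec x 1) as [H1|H1].
    - rewrite Hsupp by auto. ring.
    - rewrite Rmax_right by lra. reflexivity. }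
  exact (decays_ext _ _ _ Hx D).
Qed.

Let Q_integrand_decays (k : nat) (y : R) :
  decays (8 * (N k * 1)) (fun xi => G k xi * (/ xi * sin (xi * y))).
Proof.
  apply decays_quotient.
  - intros x Hx. apply (ex_derive_continuous (fun xi => / xi * sin (xi * y))). auto_derive. lra.
  - intros x Hx. rewrite Rabs_mult, Rabs_pos_eq by (left; apply Rinv_0_lt_compat; lra).
    replace 1 with (1 * 1) by ring. apply Rmult_le_compat; try apply Rabs_pos.
    + left; apply Rinv_0_lt_compat; lra.
    + rewrite <- Rinv_1. apply Rinv_le_contravar; lra.
    + apply Rabs_le, SIN_bound.
Qed.

Let Q_derive (k : nat) (y : R) : is_derive (Q k) y (Cosine k y).
Proof.
  apply (integral_param_derive_taylor (fun y xi => G k xi * (/ xi * sin (xi * y)))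
    (fun y xi => G k xi * cos (xi * y)) (fun y xi => G k xi * - (xi * sin (xi * y))) y (8 * (N k * 3))).
  - intros r. eexists. apply Q_integrand_decays.
  - eexists. apply Cosine_decays.
  - intros r x. revert x. apply support_cases; intros x Hx.
    + rewrite (Hsupp k x) by (left; lra). rewrite Rmult_0_l.
      apply (is_derive_ext (fun _ => 0)); [|exact (is_derive_const (V := R_NormedModule) 0 r)].
      intros t. symmetry. apply Rmult_0_l.
    + auto_derive; auto. field. lra.
  - intros r x. auto_derive; auto. ring.
  - intros r x _. apply (compact_decays k (fun xi => - (xi * sin (xi * r))) 3).
    + intros z. apply (ex_derive_continuous (fun xi => - (xi * sin (xi * r)))). auto_derive; auto.
    + intros z Hz. rewrite Rabs_Ropp, Rabs_mult, (Rabs_pos_eq z) by lra.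
      assert (A : Rabs (sin (z * r)) <= 1) by apply Rabs_le, SIN_bound.
      rewrite <- (Rmult_1_r 3). apply Rmult_le_compat; try lra. apply Rabs_pos.
Qed.

Let Q_bound (k : nat) (y : R) : 0 < y -> Rabs (Q k y) <= 32 * (N (S k) + N k) / y.
Proof.
  intros Hy.
  (* The derivative of G_k(xi) cos(xi y) / xi is [H] minus y G_k(xi) sin(xi y) / xi, so y Q is the
     integral of [H]. *)
  set (H := fun xi => G (S k) xi * (/ xi * cos (xi * y)) + - 1 * (G k xi * (/ xi * (/ xi * cos (xi * y))))).
  assert (Hinv : forall x, 1 <= x <= 5 / 2 -> 0 <= / x <= 1).
  { intros x Hx. split; [left; apply Rinv_0_lt_compat; lra|].
    rewrite <- Rinv_1. apply Rinv_le_contravar; lra. }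
  assert (D1 : decays (8 * (N (S k) * 1)) (fun xi => G (S k) xi * (/ xi * cos (xi * y)))).
  { apply decays_quotient.
    - intros x Hx. apply (ex_derive_continuous (fun xi => / xi * cos (xi * y))). auto_derive. lra.
    - intros x Hx. rewrite Rabs_mult, Rabs_pos_eq by apply Hinv, Hx.
      replace 1 with (1 * 1) by ring. apply Rmult_le_compat; try apply Rabs_pos; try apply Hinv, Hx.
      apply Rabs_le, COS_bound. }
  assert (D2 : decays (8 * (N k * 1)) (fun xi => G k xi * (/ xi * (/ xi * cos (xi * y))))).
  { apply decays_quotient.
    - intros x Hx. apply (ex_derive_continuous (fun xi => / xi * (/ xi * cos (xi * y)))). auto_derive. lra.
    - intros x Hx. rewrite !Rabs_mult, (Rabs_pos_eq (/ x)) by apply Hinv, Hx.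
      assert (A : Rabs (cos (x * y)) <= 1) by apply Rabs_le, COS_bound.
      assert (B := Hinv x Hx). generalize (Rabs_pos (cos (x * y))). intros.
      assert (/ x * Rabs (cos (x * y)) <= 1) by nra.
      assert (0 <= / x * Rabs (cos (x * y))) by (apply Rmult_le_pos; lra). nra. }
  assert (DH := decays_plus _ _ _ _ D1 (decays_scal (-1) _ _ D2)). fold H in DH.
  assert (IQ : integrable (fun xi => G k xi * (/ xi * sin (xi * y)))) by (eexists; apply Q_integrand_decays).
  assert (IH : integrable H) by (eexists; apply DH).
  assert (Z : integral (fun xi => H xi - y * (G k xi * (/ xi * sin (xi * y)))) = 0).
  { apply (integral_derive (fun xi => G k xi * (/ xi * cos (xi * y))) _ (4 * N k)).
    - apply integrable_minus; auto. now apply integrable_scal.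
    - apply support_cases; intros x Hx.
      + unfold H. rewrite !Hsupp by (left; lra).
        replace (0 * (/ x * cos (x * y)) + -1 * (0 * (/ x * (/ x * cos (x * y)))) - y * (0 * (/ x * sin (x * y))))
          with 0 by ring.
        apply (is_derive_ext_loc (fun _ => 0)).
        * now apply local_zero.
        * exact (is_derive_const (V := R_NormedModule) 0 x).
      + replace (H x - y * (G k x * (/ x * sin (x * y)))) with
          (G (S k) x * (/ x * cos (x * y)) +
           G k x * (- / x * / x * cos (x * y) + / x * (- (y * sin (x * y))))) by (unfold H; ring).
        apply (is_derive_mult (K := R_AbsRing) (G k) (fun xi => / xi * cos (xi * y))); [apply HG| |apply Rmult_comm].
        auto_derive; [lra|]. field. lra.
    - intros x. destruct (Rle_dec x 1) as [H1|H1].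
      + rewrite Hsupp by auto. rewrite Rmult_0_l, Rabs_R0, Rmult_0_l.
        assert (0 <= N k) by (eapply Rle_trans; [apply Rabs_pos|apply (HN k 0)]). lra.
      + replace (G k x * (/ x * cos (x * y))) with (/ x * (G k x * cos (x * y))) by ring.
        rewrite Rabs_mult, Rabs_pos_eq by (left; apply Rinv_0_lt_compat; lra).
        assert (A := product_bound k (fun xi => cos (xi * y)) x ltac:(intros; apply Rabs_le, COS_bound)).
        cbv beta in A. rewrite Rmult_assoc.
        assert (/ x <= 1) by (rewrite <- Rinv_1; apply Rinv_le_contravar; lra).
        assert (0 <= / x) by (left; apply Rinv_0_lt_compat; lra).
        assert (0 <= Rabs (G k x * cos (x * y)) * (1 + Rabs x)).
        { apply Rmult_le_pos; [apply Rabs_pos|generalize (Rabs_pos x); lra]. }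
        nra. }
  rewrite integral_minus, integral_scal in Z; auto; [|now apply integrable_scal].
  fold (Q k y) in Z.
  assert (B := integral_bound _ _ DH).
  replace (Q k y) with (integral H / y) by (apply Rmult_eq_reg_r with y; [field_simplify; lra|lra]).
  unfold Rdiv. rewrite Rabs_mult, (Rabs_pos_eq (/ y)) by (left; now apply Rinv_0_lt_compat).
  apply Rmult_le_compat_r; [left; now apply Rinv_0_lt_compat|].
  eapply Rle_trans; [apply B|]. replace (Rabs (-1)) with 1 by (rewrite Rabs_left1; lra). lra.
Qed.

Definition sine_transform_sqrt (x : R) : R := integral (fun xi => G 0 xi * sin (xi * sqrt x)).

(** [sqrt] is 0 on negative numbers, so the definition already contains the extension by 0. *)
Lemma sine_transform_sqrt_neg (x : R) : x <= 0 -> sine_transform_sqrt x = 0.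
Proof.
  intros Hx. unfold sine_transform_sqrt. apply integral_zero. intros xi.
  rewrite (sqrt_neg_0 x) by lra. rewrite Rmult_0_r, sin_0. ring.
Qed.

Lemma sine_transform_sqrt_continuous (x : R) : continuous sine_transform_sqrt x.
Proof.
  apply (continuous_comp sqrt (Sine 0)); [apply continuous_sqrt|].
  apply (ex_derive_continuous (Sine 0)). eexists. apply Sine_derive.
Qed.

Lemma sine_transform_sqrt_pow (p : nat) (x : R) :
  Rabs (x ^ p * sine_transform_sqrt x) <= 32 * N (2 * p).
Proof.
  destruct (Rle_dec x 0) as [Hx|Hx].
  - rewrite sine_transform_sqrt_neg, Rmult_0_r, Rabs_R0 by auto.
    assert (0 <= N (2 * p)) by (eapply Rle_trans; [apply Rabs_pos|apply (HN (2 * p)%nat 0)]). lra.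
  - replace (x ^ p) with ((sqrt x ^ 2) ^ p) by (rewrite pow2_sqrt; lra).
    change (sine_transform_sqrt x) with (Sine 0 (sqrt x)). rewrite Sine_even, Rabs_mult, pow_1_abs, Rmult_1_l.
    apply Sine_bound.
Qed.

Lemma sine_transform_sqrt_decays (p : nat) :
  decays (32 * (N (2 * p) + N (2 * (p + 2)))) (fun x => x ^ p * sine_transform_sqrt x).
Proof.
  split.
  - intros x. apply (continuous_mult (fun x => x ^ p)); [|apply sine_transform_sqrt_continuous].
    apply (ex_derive_continuous (fun x => x ^ p)). auto_derive; auto.
  - intros x. apply Rmult_le_reg_r with (1 + x ^ 2); [apply sq_pos|].
    unfold Rdiv. rewrite (Rmult_assoc (32 * _)), Rinv_l, Rmult_1_r by apply Rgt_not_eq, sq_pos.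
    assert (A := sine_transform_sqrt_pow p x). assert (B := sine_transform_sqrt_pow (p + 2) x).
    rewrite pow_add in B. rewrite !Rabs_mult in *. rewrite (Rabs_pos_eq (x ^ 2)) in B by apply pow2_ge_0.
    lra.
Qed.

(** With x = y^2 the integrand becomes 2 (-1)^p y Sine_(2p)(y) = 2 (-1)^p Cosine_(2p+1)(y), whose
    primitive Q_(2p+1) is 0 at 0 and O(1 / y) at infinity. *)
Lemma sine_transform_sqrt_moment (p : nat) :
  integral (fun x => x ^ p * sine_transform_sqrt x) = 0.
Proof.
  set (u := fun x => x ^ p * sine_transform_sqrt x).
  assert (Hu : forall x, continuous u x) by exact (proj1 (sine_transform_sqrt_decays p)).
  assert (Sub : forall Y, 0 < Y -> RInt u 0 (Y ^ 2) = 2 * (-1) ^ p * Q (S (2 * p)) Y).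
  { intros Y HY.
    assert (E : is_RInt (fun y => 2 * y * u (y ^ 2)) 0 Y (RInt u (0 ^ 2) (Y ^ 2))).
    { apply (is_RInt_comp u (fun y => y ^ 2) (fun y => 2 * y)).
      - intros; auto.
      - intros x _. split.
        + assert (D : is_derive (fun y : R => y ^ 2) x (2 * x)) by (auto_derive; auto; ring). exact D.
        + apply (ex_derive_continuous (fun y => 2 * y)). auto_derive; auto. }
    replace (0 ^ 2) with 0 in E by ring. rewrite <- (is_RInt_unique _ _ _ _ E).
    rewrite (RInt_ext _ (fun y => 2 * (-1) ^ p * Cosine (S (2 * p)) y)).
    - apply is_RInt_unique.
      replace (2 * (-1) ^ p * Q (S (2 * p)) Y) with
        (2 * (-1) ^ p * Q (S (2 * p)) Y - 2 * (-1) ^ p * Q (S (2 * p)) 0).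
      + apply (is_RInt_derive (fun y => 2 * (-1) ^ p * Q (S (2 * p)) y)).
        * intros y _. apply (is_derive_scal (Q (S (2 * p)))), Q_derive.
        * intros y _. apply (continuous_ext (fun y => 2 * (-1) ^ p * (y * Sine (2 * p) y))).
          { intros; now rewrite Sine_parts. }
          apply (continuous_scal_r (2 * (-1) ^ p) (fun y => y * Sine (2 * p) y)).
          apply (continuous_mult (K := R_AbsRing) (fun y => y)); [apply continuous_id|].
          apply (ex_derive_continuous (Sine (2 * p))). eexists. apply Sine_derive.
      + replace (Q (S (2 * p)) 0) with 0; [ring|]. symmetry. apply integral_zero.
        intros xi. rewrite Rmult_0_r, sin_0. ring.
    - rewrite Rmin_left, Rmax_right by lra. intros y Hy. unfold u.
      change (sine_transform_sqrt (y ^ 2)) with (Sine 0 (sqrt (y ^ 2))).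
      rewrite sqrt_pow2 by lra. rewrite Sine_even, <- Sine_parts.
      match goal with |- ?a = ?b => change (@eq R a b) end. ring. }
  apply integral_unique.
  apply is_lim_seq_abs_0.
  set (K := 2 * (32 * (N (S (S (2 * p))) + N (S (2 * p))))).
  apply is_lim_seq_le_le_loc with (fun _ => 0) (fun n => K * / sqrt (INR n)).
  - exists 1%nat. intros n Hn. apply le_INR in Hn. simpl in Hn. split; [apply Rabs_pos|].
    assert (Hs : 0 < sqrt (INR n)) by (apply sqrt_lt_R0; lra).
    rewrite <- (RInt_cont_Chasles u (- INR n) 0 (INR n)) by auto.
    rewrite (RInt_ext u (fun _ => 0) (- INR n) 0).
    + rewrite RInt_const. rewrite <- (pow2_sqrt (INR n)) at 2 by lra. rewrite Sub by auto.
      unfold scal; simpl; unfold mult; simpl. rewrite Rmult_0_r, Rplus_0_l.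
      rewrite !Rabs_mult, pow_1_abs, (Rabs_pos_eq 2) by lra.
      assert (B := Q_bound (S (2 * p)) (sqrt (INR n)) Hs).
      unfold K, Rdiv in *. simpl in *. lra.
    + rewrite Rmin_left, Rmax_right by lra. intros x Hx. unfold u.
      rewrite sine_transform_sqrt_neg by lra. apply Rmult_0_r.
  - apply is_lim_seq_const.
  - apply is_lim_seq_div_sqrt.
Qed.

(** On the support xi sqrt x <= (5/2) (11/10) < 3 < pi. The bound 6/5 = 11/5 - 1 is the one that
    [convolution_pos] needs. *)
Lemma sine_transform_sqrt_nonneg (x : R) : (forall xi, 0 <= G 0 xi) -> x <= 6 / 5 ->
  0 <= sine_transform_sqrt x.
Proof.
  intros HG0 Hx. destruct (Rle_dec x 0) as [H0|H0]; [rewrite sine_transform_sqrt_neg; lra|].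
  apply integral_ge0; [eexists; apply Sine_decays|].
  assert (Hs : sqrt x <= 11 / 10).
  { rewrite <- (sqrt_pow2 (11 / 10)) by lra. apply sqrt_le_1_alt. lra. }
  assert (Hs0 := sqrt_pos x).
  intros xi. destruct (Rle_dec xi 1) as [H1|H1]; [rewrite Hsupp by auto; lra|].
  destruct (Rle_dec (5 / 2) xi) as [H2|H2]; [rewrite Hsupp by auto; lra|].
  apply Rmult_le_pos; auto. apply sin_ge_0; [apply Rmult_le_pos; lra|].
  generalize PI2_3_2; intros. nra.
Qed.

Lemma sine_transform_sqrt_pos (x : R) : (forall xi, 0 <= G 0 xi) -> 0 < G 0%nat (3 / 2) ->
  0 < x <= 1 -> 0 < sine_transform_sqrt x.
Proof.
  intros HG0 HGp Hx.
  assert (Hs : 0 < sqrt x <= 1).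
  { split; [apply sqrt_lt_R0; lra|]. rewrite <- sqrt_1. apply sqrt_le_1_alt. lra. }
  generalize PI2_3_2; intros HPI.
  apply (integral_gt0 _ (3 / 2)); [eexists; apply Sine_decays| |].
  - intros xi. destruct (Rle_dec xi 1) as [H1|H1]; [rewrite Hsupp by auto; lra|].
    destruct (Rle_dec (5 / 2) xi) as [H2|H2]; [rewrite Hsupp by auto; lra|].
    apply Rmult_le_pos; auto. apply sin_ge_0; [apply Rmult_le_pos; lra|]. nra.
  - apply Rmult_lt_0_compat; auto. apply sin_gt_0; nra.
Qed.

End Compactly_supported.

(** * Smoothing the moment-free function *)

Section Convolution.

Variables (phi : R -> R) (psi : nat -> R -> R) (D B : nat -> R).
Hypothesis phi_decays : forall p, decays (D p) (fun x => x ^ p * phi x).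
Hypothesis phi_neg : forall x, x <= 0 -> phi x = 0.
Hypothesis psi_chain : derivative_chain psi.
Hypothesis psi_support : forall k x, x <= 1 \/ 5 / 2 <= x -> psi k x = 0.
Hypothesis psi_bound : forall k x, Rabs (psi k x) <= B k.

Let phi_decays_0 : decays (D 0%nat) phi.
Proof. apply (decays_ext _ (fun x => x ^ 0 * phi x)); [intros; simpl; ring|apply phi_decays]. Qed.

Let B_pos (k : nat) : 0 <= B k.
Proof. eapply Rle_trans; [apply Rabs_pos|apply (psi_bound k 0)]. Qed.

Let D_pos (p : nat) : 0 <= D p.
Proof.
  assert (H := proj2 (phi_decays p) 0). cbv beta in H. assert (P := Rabs_pos (0 ^ p * phi 0)).
  replace (D p / (1 + 0 ^ 2)) with (D p) in H by field. lra.
Qed.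

Let psi_continuous (k : nat) (x : R) : continuous (psi k) x.
Proof. apply (ex_derive_continuous (psi k)). eexists. apply psi_chain. Qed.

Let integrand_continuous (q p : nat) (x t : R) :
  continuous (fun t => x ^ p * (phi t * psi q (x - t))) t.
Proof.
  apply (continuous_scal_r (V := R_NormedModule) (x ^ p) (fun t => phi t * psi q (x - t))).
  apply (continuous_mult (K := R_AbsRing) phi (fun t => psi q (x - t))); [apply phi_decays_0|].
  apply (continuous_comp (fun t => x - t) (psi q)); [|apply psi_continuous].
  apply (ex_derive_continuous (fun t => x - t)). auto_derive; auto.
Qed.

(* Where the integrand does not vanish, [0 < x < t + 5/2 <= max (2 t) 5]. *)
Let integrand_bound (q p : nat) (x t : R) :
  Rabs (x ^ p * (phi t * psi q (x - t))) <= B q * (2 ^ p * D p + 5 ^ p * D 0%nat) / (1 + t ^ 2).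
Proof.
  assert (Pos : 0 <= B q * (2 ^ p * D p + 5 ^ p * D 0%nat) / (1 + t ^ 2)).
  { assert (P2 : 0 <= 2 ^ p) by (apply pow_le; lra). assert (P5 : 0 <= 5 ^ p) by (apply pow_le; lra).
    apply Rmult_le_pos; [|left; apply Rinv_0_lt_compat, sq_pos].
    apply Rmult_le_pos; auto. apply Rplus_le_le_0_compat; apply Rmult_le_pos; auto. }
  destruct (Rle_dec t 0) as [H0|H0].
  { rewrite phi_neg, Rmult_0_l, Rmult_0_r, Rabs_R0 by auto. auto. }
  destruct (Rle_dec (x - t) 1) as [H1|H1].
  { rewrite psi_support, !Rmult_0_r, Rabs_R0 by auto. auto. }
  destruct (Rle_dec (5 / 2) (x - t)) as [H2|H2].
  { rewrite psi_support, !Rmult_0_r, Rabs_R0 by auto. auto. }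
  assert (Hx : x ^ p <= 2 ^ p * t ^ p + 5 ^ p).
  { assert (P2 : 0 <= 2 ^ p * t ^ p) by (apply Rmult_le_pos; apply pow_le; lra).
    assert (P5 : 0 <= 5 ^ p) by (apply pow_le; lra).
    destruct (Rle_dec x 5) as [H5|H5].
    - assert (x ^ p <= 5 ^ p) by (apply pow_incr; lra). lra.
    - rewrite <- Rpow_mult_distr. rewrite <- Rpow_mult_distr in P2.
      assert (x ^ p <= (2 * t) ^ p) by (apply pow_incr; lra). lra. }
  rewrite !Rabs_mult, (Rabs_pos_eq (x ^ p)) by (apply pow_le; lra).
  assert (A0 := proj2 phi_decays_0 t). assert (Ap := proj2 (phi_decays p) t). cbv beta in Ap.
  rewrite Rabs_mult, (Rabs_pos_eq (t ^ p)) in Ap by (apply pow_le; lra).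
  assert (P2 : 0 <= 2 ^ p) by (apply pow_le; lra). assert (P5 : 0 <= 5 ^ p) by (apply pow_le; lra).
  assert (Px : 0 <= x ^ p) by (apply pow_le; lra).
  assert (Pphi := Rabs_pos (phi t)).
  apply Rle_trans with ((2 ^ p * t ^ p + 5 ^ p) * (Rabs (phi t) * B q)).
  { apply Rmult_le_compat; auto; [apply Rmult_le_pos; auto; apply Rabs_pos|].
    apply Rmult_le_compat_l; auto. }
  replace ((2 ^ p * t ^ p + 5 ^ p) * (Rabs (phi t) * B q)) with
    (B q * (2 ^ p * (t ^ p * Rabs (phi t)) + 5 ^ p * Rabs (phi t))) by ring.
  unfold Rdiv in *. rewrite (Rmult_assoc (B q)). apply Rmult_le_compat_l; auto.
  rewrite Rmult_plus_distr_r, !Rmult_assoc.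
  apply Rplus_le_compat; apply Rmult_le_compat_l; auto.
Qed.

Let integrand_decays (q p : nat) (x : R) :
  decays (B q * (2 ^ p * D p + 5 ^ p * D 0%nat)) (fun t => x ^ p * (phi t * psi q (x - t))).
Proof. split; [apply integrand_continuous|apply integrand_bound]. Qed.

Definition convolution (q : nat) (x : R) : R := integral (fun t => phi t * psi q (x - t)).

Let convolution_decays (q : nat) (x : R) :
  decays (D 0%nat * B q) (fun t => phi t * psi q (x - t)).
Proof.
  split.
  - intros t. apply (continuous_ext (fun t => x ^ 0 * (phi t * psi q (x - t)))); [intros; apply Rmult_1_l|].
    apply integrand_continuous.
  - intros t. rewrite Rabs_mult. assert (A := proj2 phi_decays_0 t).
    unfold Rdiv in *. replace (D 0%nat * B q * / (1 + t ^ 2)) with (D 0%nat * / (1 + t ^ 2) * B q) by ring.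
    apply Rmult_le_compat; auto; apply Rabs_pos.
Qed.

Lemma convolution_chain : derivative_chain convolution.
Proof.
  intros q x. unfold convolution.
  assert (Hd : forall k r t, is_derive (fun r => phi t * psi k (r - t)) r (phi t * psi (S k) (r - t))).
  { intros k r t. apply (is_derive_scal (fun r => psi k (r - t))).
    apply is_derive_translate, psi_chain. }
  apply (integral_param_derive_taylor (fun r t => phi t * psi q (r - t))
    (fun r t => phi t * psi (S q) (r - t)) (fun r t => phi t * psi (S (S q)) (r - t)) x
    (D 0%nat * B (S (S q)))).
  - intros r. eexists. apply convolution_decays.
  - eexists. apply convolution_decays.
  - intros r t. apply Hd.
  - intros r t. apply Hd.
  - intros r t _. apply convolution_decays.
Qed.

Lemma convolution_support (q : nat) (x : R) : x <= 1 -> convolution q x = 0.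
Proof.
  intros Hx. apply integral_zero. intros t. destruct (Rle_dec t 0) as [H0|H0].
  - rewrite phi_neg by auto. ring.
  - rewrite psi_support by lra. ring.
Qed.

Lemma convolution_bound (q p : nat) (x : R) :
  Rabs (x ^ p * convolution q x) <= 4 * (B q * (2 ^ p * D p + 5 ^ p * D 0%nat)).
Proof.
  unfold convolution. rewrite <- integral_scal by (eexists; apply convolution_decays).
  apply integral_bound, integrand_decays.
Qed.

(** Decay in both variables at once, as Fubini requires: the bounds for the powers p and p + 2 of x
    are added. *)
Let bound2 (p : nat) (x t : R) : Rabs (x ^ p * (phi t * psi 0%nat (x - t))) <=
  (B 0%nat * (2 ^ p * D p + 5 ^ p * D 0%nat) +
   B 0%nat * (2 ^ (p + 2) * D (p + 2)%nat + 5 ^ (p + 2) * D 0%nat)) / (1 + x ^ 2) / (1 + t ^ 2).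
Proof.
  assert (A1 := integrand_bound 0 p x t). assert (A2 := integrand_bound 0 (p + 2) x t).
  set (E1 := B 0%nat * (2 ^ p * D p + _)) in *. set (E2 := B 0%nat * (2 ^ (p + 2) * _ + _)) in *.
  replace (x ^ (p + 2) * (phi t * psi 0%nat (x - t))) with
    (x ^ 2 * (x ^ p * (phi t * psi 0%nat (x - t)))) in A2 by (rewrite pow_add; ring).
  rewrite (Rabs_mult (x ^ 2)), (Rabs_pos_eq (x ^ 2)) in A2 by apply pow2_ge_0.
  apply Rmult_le_reg_l with (1 + x ^ 2); [apply sq_pos|].
  replace ((1 + x ^ 2) * ((E1 + E2) / (1 + x ^ 2) / (1 + t ^ 2))) with
    (E1 / (1 + t ^ 2) + E2 / (1 + t ^ 2)); [lra|].
  field. split; apply Rgt_not_eq, sq_pos.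
Qed.

Let x_pow_psi_integrable (i p : nat) (t : R) : integrable (fun x => x ^ i * (x + t) ^ p * psi 0%nat x).
Proof.
  exists (8 * (B 0%nat * ((5 / 2) ^ i * (5 / 2 + Rabs t) ^ p))).
  apply (decays_ext _ (fun x => psi 0%nat x * (x ^ i * (x + t) ^ p))); [intros x; ring|].
  apply (compact_decays psi psi_chain psi_support B psi_bound 0 (fun x => x ^ i * (x + t) ^ p)).
  - intros x. apply (ex_derive_continuous (fun x => x ^ i * (x + t) ^ p)). auto_derive; auto.
  - intros x Hx. rewrite Rabs_mult, <- !RPow_abs. apply Rmult_le_compat.
    + apply pow_le, Rabs_pos.
    + apply pow_le, Rabs_pos.
    + apply pow_incr. rewrite Rabs_pos_eq; lra.
    + apply pow_incr. split; [apply Rabs_pos|]. eapply Rle_trans; [apply Rabs_triang|].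
      rewrite (Rabs_pos_eq x) by lra. lra.
Qed.

Lemma convolution_moment (p : nat) : (forall j, integral (fun x => x ^ j * phi x) = 0) ->
  integrable (fun x => x ^ p * convolution 0 x) /\ integral (fun x => x ^ p * convolution 0 x) = 0.
Proof.
  intros Hmom. split.
  { eexists. split.
    - intros x. apply (continuous_mult (K := R_AbsRing) (fun x => x ^ p)).
      + apply (ex_derive_continuous (fun x => x ^ p)). auto_derive; auto.
      + apply (ex_derive_continuous (convolution 0)). eexists. apply convolution_chain.
    - intros x. apply Rmult_le_reg_r with (1 + x ^ 2); [apply sq_pos|].
      unfold Rdiv. rewrite Rmult_assoc, Rinv_l, Rmult_1_r by apply Rgt_not_eq, sq_pos.
      assert (A1 := convolution_bound 0 p x). assert (A2 := convolution_bound 0 (p + 2) x).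
      rewrite pow_add in A2. rewrite !Rabs_mult in *. rewrite (Rabs_pos_eq (x ^ 2)) in A2 by apply pow2_ge_0.
      replace (Rabs (x ^ p) * Rabs (convolution 0 x) * (1 + x ^ 2)) with
        (Rabs (x ^ p) * Rabs (convolution 0 x) + Rabs (x ^ p) * x ^ 2 * Rabs (convolution 0 x)) by ring.
      apply Rplus_le_compat; [apply A1|apply A2]. }
  rewrite (integral_ext _ (fun x => integral (fun t => x ^ p * (phi t * psi 0%nat (x - t))))).
  2: { intros x. unfold convolution. rewrite integral_scal; auto. eexists. apply convolution_decays. }
  rewrite (integral_Fubini (B 0%nat * (2 ^ p * D p + 5 ^ p * D 0%nat) +
   B 0%nat * (2 ^ (p + 2) * D (p + 2)%nat + 5 ^ (p + 2) * D 0%nat))).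
  2: { split; [|apply bound2].
    intros x t. apply continuity_2d_pt_mult.
    - apply (continuous2_of_l (fun x => x ^ p)).
      intros y. apply (ex_derive_continuous (fun x => x ^ p)). auto_derive; auto.
    - apply continuity_2d_pt_mult; [apply (continuous2_of_r phi), phi_decays_0|].
      apply (continuity_1d_2d_pt_comp (psi 0%nat) (fun x t => x - t)).
      + apply continuity_pt_filterlim. apply psi_continuous.
      + apply continuity_2d_pt_minus; [apply continuity_2d_pt_id1|apply continuity_2d_pt_id2]. }
  (* After x is replaced by x + t, one factor x + t is split at a time; the index i collects powers
     of x and j powers of t, which replaces the binomial formula. *)
  set (J := fun i p t => integral (fun x => x ^ i * (x + t) ^ p * psi 0%nat x)).
  assert (HJ : forall k i j, integrable (fun t => t ^ j * phi t * J i k t) /\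
    integral (fun t => t ^ j * phi t * J i k t) = 0).
  { induction k as [|k IH]; intros i j.
    - assert (E : forall t, J i 0%nat 0 * (t ^ j * phi t) = t ^ j * phi t * J i 0%nat t).
      { intros t. unfold J. simpl. ring. }
      assert (I := phi_decays j).
      rewrite <- (integral_ext _ _ E), integral_scal, Hmom by now exists (D j).
      split; [|ring]. eexists. eapply decays_ext; [apply E|]. apply decays_scal, I.
    - destruct (IH (S i) j) as [[K1 I1] Z1]. destruct (IH i (S j)) as [[K2 I2] Z2].
      assert (E : forall t, t ^ j * phi t * J (S i) k t + t ^ (S j) * phi t * J i k t
                            = t ^ j * phi t * J i (S k) t).
      { intros t.
        assert (E : J i (S k) t = J (S i) k t + t * J i k t).
        { unfold J. rewrite <- integral_scal, <- integral_plus; auto using x_pow_psi_integrable.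
          - apply integral_ext. intros x. simpl. ring.
          - apply integrable_scal, x_pow_psi_integrable. }
        rewrite E. simpl. ring. }
      rewrite <- (integral_ext _ _ E), integral_plus by (eexists; eassumption).
      split; [|lra]. eexists. eapply decays_ext; [apply E|]. apply decays_plus; eassumption. }
  rewrite <- (proj2 (HJ p 0%nat 0%nat)). apply integral_ext. intros t. unfold J.
  assert (S := integral_shift (fun x => x ^ p * (phi t * psi 0%nat (x - t))) t).
  assert (I : integrable (fun x => x ^ p * (phi t * psi 0%nat (x - t)))).
  { destruct (integral_shift _ (- t) (x_pow_psi_integrable 0 p t)) as [I _].
    apply (integrable_scal (phi t)) in I. destruct I as [K I]. exists K.
    eapply decays_ext; [|apply I]. intros x. cbv beta.
    replace (x + - t + t) with x by ring. replace (x + - t) with (x - t) by ring. simpl. ring. }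
  destruct (S I) as [_ <-]. rewrite <- integral_scal by apply x_pow_psi_integrable.
  apply integral_ext. intros x. replace (x + t - t) with x by ring. simpl. ring.
Qed.

(** The factor psi(11/5 - t) is non-zero only for t < 6/5, where phi is nonnegative, and t = 7/10
    hits the point 11/5 - 7/10 = 3/2 where psi is positive. *)
Lemma convolution_pos : (forall x, x <= 6 / 5 -> 0 <= phi x) -> (forall x, 0 < x <= 1 -> 0 < phi x) ->
  (forall x, 0 <= psi 0%nat x) -> 0 < psi 0%nat (3 / 2) -> 0 < convolution 0 (11 / 5).
Proof.
  intros H1 H2 H3 H4. apply (integral_gt0 _ (7 / 10)); [eexists; apply convolution_decays| |].
  - intros t. destruct (Rle_dec t (6 / 5)) as [Ht|Ht].
    + apply Rmult_le_pos; auto.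
    + rewrite psi_support by lra. lra.
  - apply Rmult_lt_0_compat; [apply H2; lra|]. replace (11 / 5 - 7 / 10) with (3 / 2) by field. auto.
Qed.

End Convolution.

(** [moment] is computed through [even_lift], while the vanishing of the moments is proved for
    [integral]; this joins the two. *)
Lemma even_lift_integral (u : R -> R) (K : R) : (forall x, x <= 0 -> u x = 0) ->
  integrable u -> decays K (even_lift u) -> integral (even_lift u) = integral u.
Proof.
  intros H0 [L Hu] HK. symmetry. apply integral_unique.
  apply is_lim_seq_ext_loc with (fun n => integral (even_lift u) + (RInt u 0 (INR n) - integral (even_lift u))).
  - exists 0%nat. intros n _.
    rewrite <- (RInt_cont_Chasles u (- INR n) 0 (INR n)) by apply Hu.
    rewrite (RInt_ext u (fun _ => 0) (- INR n) 0).
    + rewrite RInt_const. unfold scal; simpl; unfold mult; simpl. ring.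
    + intros x Hx. apply H0. rewrite Rmin_left, Rmax_right in Hx; generalize (pos_INR n); lra.
  - replace (Finite (integral (even_lift u))) with (Finite (integral (even_lift u) + 0)) by (f_equal; ring).
    apply is_lim_seq_plus'; [apply is_lim_seq_const|]. apply is_lim_seq_abs_0.
    apply is_lim_seq_le_le_loc with (fun _ => 0) (fun n => 2 * K * / sqrt (INR n)).
    + exists 1%nat. intros n Hn. apply le_INR in Hn. simpl in Hn. split; [apply Rabs_pos|].
      apply half_line_integral; auto; [|lra].
      intros x. apply (continuous_comp Rabs u); [apply continuous_Rabs|apply Hu].
    + apply is_lim_seq_const.
    + apply is_lim_seq_div_sqrt.
Qed.

Lemma rising_product_pos (n : nat -> R) (k : nat) : (forall k, 0 < n k) -> 0 < rising_product n k.
Proof. intros Hn. induction k as [|k IH]; simpl; [lra|]. now apply Rmult_lt_0_compat. Qed.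

Lemma rising_product_quotient (A : nat -> R) (k : nat) : (forall p, 0 < A p) ->
  rising_product (fun p => (INR p + 1) * quotient A p) k = INR (fact k) * A k / A 0%nat.
Proof.
  intros HA. induction k as [|k IH]; simpl rising_product.
  - simpl. field. apply Rgt_not_eq, HA.
  - rewrite IH, fact_simpl, mult_INR, S_INR. unfold quotient. rewrite Nat.add_1_r.
    field. split; apply Rgt_not_eq, HA.
Qed.

Lemma half_step_weight (M : nat -> R) (h : R) (p : nat) : (forall p, 0 < M p) -> M 0%nat = 1 ->
  h ^ (2 * p) * rising_product (half_step M) (2 * p) = weight M (h ^ 2) p.
Proof. intros HM HM0. rewrite half_step_product, HM0, pow_mult by auto. unfold weight. field. Qed.

Lemma weight_scal (M : nat -> R) (r h : R) (p : nat) : r ^ p * weight M h p = weight M (r * h) p.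
Proof. unfold weight. rewrite Rpow_mult_distr. ring. Qed.

Section Real_chain.

Variable G : nat -> R -> R.
Hypothesis HG : derivative_chain G.

Lemma real_chain_smooth : smooth (fun x => RtoC (G 0%nat x)).
Proof.
  intros q x. simpl. split.
  - assert (H := derivative_chain_Derive_n G 0 q x HG).
    destruct q as [|q]; [exact I|]. eexists. exact H.
  - assert (H := derivative_chain_Derive_n (fun _ _ => 0) 0 q x
      ltac:(intros k y; exact (is_derive_const (V := R_NormedModule) 0 y))).
    destruct q as [|q]; [exact I|]. eexists. exact H.
Qed.

Lemma real_chain_RC_derive_n (q : nat) (x : R) :
  RC_derive_n (fun x => RtoC (G 0%nat x)) q x = RtoC (G q x).
Proof.
  unfold RC_derive_n, RtoC. simpl. f_equal.
  - apply is_derive_n_unique, (derivative_chain_Derive_n G 0 q x HG).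
  - apply is_derive_n_unique, (derivative_chain_Derive_n (fun _ _ => 0) 0 q x).
    intros k y. exact (is_derive_const (V := R_NormedModule) 0 y).
Qed.

Lemma real_chain_SA_space (M A : nat -> R) (h k K : R) : (forall p, 0 < M p) -> (forall p, 0 < A p) ->
  0 < h -> 0 < k -> 0 <= K -> (forall q x, x <= 1 -> G q x = 0) ->
  (forall p q x, Rabs (x ^ p * G q x) <= K * weight M h p * weight A k q) ->
  SA_space M A (fun x => RtoC (G 0%nat x)).
Proof.
  intros HM HA Hh Hk HK Hsupp Hb. split; [apply real_chain_smooth|]. split.
  { intros x Hx. apply Rnot_lt_le. intros Hx0. destruct (Hx (- x)) as (y & Hy & Hn); [lra|].
    apply Hn. rewrite Hsupp; auto. apply Rabs_lt_between in Hy. lra. }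
  set (m := Rmax h k). assert (h <= m) by apply Rmax_l. assert (k <= m) by apply Rmax_r.
  exists m. split; [lra|]. exists K. intros p q x.
  rewrite real_chain_RC_derive_n, <- RtoC_mult, Cmod_R.
  replace (m ^ (p + q) * INR (fact p) * M p * INR (fact q) * A q) with (weight M m p * weight A m q)
    by (unfold weight; rewrite pow_add; ring).
  apply ratio_le_iff; [apply Rmult_lt_0_compat; apply weight_pos; auto; lra|].
  eapply Rle_trans; [apply Hb|]. rewrite Rmult_assoc. apply Rmult_le_compat_l; auto.
  apply Rmult_le_compat; try (left; apply weight_pos; auto); apply weight_le; auto.
Qed.

End Real_chain.

Lemma SA_space_not_injective (M A : nat -> R) : (forall p, 0 < M p) -> M 0%nat = 1 -> lc M -> dc M ->
  (forall p, 0 < A p) -> A 0%nat = 1 -> nq A ->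
  ~ is_lim_seq (sum_n (fun p => 1 / sqrt ((INR p + 1) * quotient M p))) p_infty ->
  ~ injective_map (fun x => 0 <= x) (SA_space M A) (Lambda M) moment.
Proof.
  intros HM HM0 Hlc Hdc HA HA0 Hnq Hn [_ Hinj].
  assert (Hhs : forall k, 0 < half_step M k) by (intros; now apply half_step_pos).
  destruct (bump_exists _ Hhs (half_step_ex_series M HM Hn)) as (G & h1 & Hh1 & G1 & G2 & G3 & G4 & G5).
  set (N := fun k => h1 ^ k * rising_product (half_step M) k) in G5.
  set (n := fun p => (INR p + 1) * quotient A p).
  assert (Hn0 : forall p, 0 < n p).
  { intros p. apply Rmult_lt_0_compat; [generalize (pos_INR p); lra|now apply quotient_pos]. }
  destruct (bump_exists n) as (psi & h2 & Hh2 & P1 & P2 & P3 & P4 & P5); auto.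
  { apply (ex_series_ext (fun p => 1 / n p)); [|exact Hnq]. intros. apply Rmult_1_l. }
  set (B := fun k => h2 ^ k * rising_product n k) in P5.
  set (phi := sine_transform_sqrt G).
  set (D := fun p => 32 * (N (2 * p)%nat + N (2 * (p + 2))%nat)).
  assert (HD : forall p, decays (D p) (fun x => x ^ p * phi x)).
  { intros p. exact (sine_transform_sqrt_decays G G1 G2 N G5 p). }
  assert (Hphi0 : forall x, x <= 0 -> phi x = 0) by (intros; now apply sine_transform_sqrt_neg).
  assert (Hmom : forall j, integral (fun x => x ^ j * phi x) = 0).
  { intros j. exact (sine_transform_sqrt_moment G G1 G2 N G5 j). }
  set (Phi := convolution phi psi).
  assert (Hch : derivative_chain Phi) by exact (convolution_chain phi psi D B HD P1 P5).
  assert (HS : forall q x, x <= 1 -> Phi q x = 0).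
  { intros q x. exact (convolution_support phi psi Hphi0 P2 q x). }
  assert (HN : forall p, N (2 * p)%nat = weight M (h1 ^ 2) p) by (intros; now apply half_step_weight).
  assert (HB : forall q, B q = weight A h2 q).
  { intros q. unfold B, n, weight. rewrite rising_product_quotient, HA0 by auto. field. }
  assert (Hh12 : 0 < h1 ^ 2) by now apply pow_lt.
  destruct (weight_shift M (h1 ^ 2) 2 HM Hdc Hh12) as (K1 & k1 & HK1 & Hk1 & W1).
  destruct (weight_ge_pow M 5 HM Hlc ltac:(lra)) as (k2 & K2 & Hk2 & HK2 & W2).
  (* The convolution bound brings factors 2^p and 5^p: 2 k1 absorbs the first one and the index
     shift inside [D p], and k2 absorbs the second. *)
  set (m := Rmax (2 * k1) k2).
  assert (Hm1 : 2 * k1 <= m) by apply Rmax_l. assert (Hm2 : k2 <= m) by apply Rmax_r.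
  assert (HD0 : 0 <= D 0%nat).
  { unfold D. rewrite !HN. generalize (weight_pos M (h1 ^ 2) 0 HM Hh12).
    generalize (weight_pos M (h1 ^ 2) (0 + 2) HM Hh12). lra. }
  assert (HSA : SA_space M A (fun x => RtoC (Phi 0%nat x))).
  { apply (real_chain_SA_space Phi Hch M A m h2 (4 * (32 * (1 + K1) + K2 * D 0%nat))); auto; [lra| |].
    { assert (0 <= K2 * D 0%nat) by (apply Rmult_le_pos; lra). lra. }
    intros p q x. eapply Rle_trans; [exact (convolution_bound phi psi D B HD Hphi0 P1 P2 P5 q p x)|].
    rewrite HB.
    assert (A1 : 2 ^ p * D p <= 32 * (1 + K1) * weight M m p).
    { unfold D. rewrite !HN.
      assert (E1 : weight M (h1 ^ 2) p <= weight M k1 p) by (apply weight_le; auto).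
      assert (E2 := W1 p).
      assert (E3 : 2 ^ p * weight M k1 p <= weight M m p).
      { rewrite weight_scal. apply weight_le; auto. lra. }
      assert (Pp : 0 < 2 ^ p) by (apply pow_lt; lra).
      apply Rle_trans with (32 * (1 + K1) * (2 ^ p * weight M k1 p)).
      - replace (32 * (1 + K1) * (2 ^ p * weight M k1 p)) with
          (2 ^ p * (32 * (weight M k1 p + K1 * weight M k1 p))) by ring.
        apply Rmult_le_compat_l; lra.
      - apply Rmult_le_compat_l; lra. }
    assert (A2 : 5 ^ p * D 0%nat <= K2 * D 0%nat * weight M m p).
    { replace (K2 * D 0%nat * weight M m p) with (K2 * weight M m p * D 0%nat) by ring.
      apply Rmult_le_compat_r; auto. eapply Rle_trans; [apply W2|].
      apply Rmult_le_compat_l; [lra|]. apply weight_le; auto. }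
    replace (4 * (32 * (1 + K1) + K2 * D 0%nat) * weight M m p * weight A h2 q) with
      (4 * (weight A h2 q * (32 * (1 + K1) * weight M m p + K2 * D 0%nat * weight M m p))) by ring.
    apply Rmult_le_compat_l; [lra|]. apply Rmult_le_compat_l; [|lra].
    left; now apply weight_pos. }
  (* The zero function, written as a chain so that [real_chain_SA_space] applies to it as well. *)
  assert (HZ : SA_space M A (fun x => RtoC ((fun _ _ => 0) 0%nat x))).
  { apply (real_chain_SA_space (fun _ _ => 0)) with 1 1 0; auto; try lra.
    - intros k y. exact (is_derive_const (V := R_NormedModule) 0 y).
    - intros. rewrite Rmult_0_r, Rabs_R0. lra. }
  assert (Hcl : forall f, SA_space M A f ->
    moment_class M (fun x => Re (f x)) /\ moment_class M (fun x => Im (f x))).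
  { intros f Hf. apply C_space_moment_class; auto.
    apply S_space_C_space, (SA_space_S_space M A); auto. }
  assert (Hmu : forall p, moment (fun x => RtoC (Phi 0%nat x)) p = moment (fun x => RtoC 0) p).
  { intros p. destruct (Hcl _ HSA) as [C1 C2]. destruct (Hcl _ HZ) as [C3 C4].
    rewrite (moment_even_lift M _ p HM Hdc C1 C2), (moment_even_lift M _ p HM Hdc C3 C4).
    simpl. f_equal. cbn [Re RtoC fst] in C1.
    rewrite (integral_zero (fun y => even_lift (fun _ => 0) y * y ^ (p + (p + 0))))
      by (intros; unfold even_lift; ring).
    destruct (convolution_moment phi psi D B HD Hphi0 P1 P2 P5 p Hmom) as [I1 I2].
    fold Phi in I1, I2. destruct (even_lift_rapid M _ (2 * p) HM Hdc C1) as [K HK].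
    rewrite <- I2. change (p + (p + 0))%nat with (2 * p)%nat.
    transitivity (integral (even_lift (fun x => x ^ p * Phi 0%nat x))).
    { apply integral_ext. intros y. symmetry. apply (even_lift_pow (Phi 0%nat)). }
    apply even_lift_integral with K; auto.
    - intros x Hx. rewrite HS by lra. ring.
    - eapply decays_ext; [|apply HK]. intros; symmetry; apply even_lift_pow. }
  assert (E := Hinj _ _ HSA HZ Hmu (11 / 5) ltac:(lra)). apply RtoC_inj in E.
  assert (Pos : 0 < Phi 0%nat (11 / 5)); [|lra].
  apply (convolution_pos phi psi D B HD P1 P2 P5); auto.
  - intros x Hx. exact (sine_transform_sqrt_nonneg G G1 G2 N G5 x G3 Hx).
  - intros x Hx. exact (sine_transform_sqrt_pos G G1 G2 N G5 x G3 G4 Hx).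
Qed.

(** * A function with vanishing boundary derivatives *)

Definition test_function (N : R) (g : R -> R) : Prop :=
  (forall x, continuous g x) /\ (forall x, x <= 1 \/ 5 / 2 <= x -> g x = 0) /\
  forall x, Rabs (g x) <= N.

Lemma test_function_pos (N : R) (g : R -> R) : test_function N g -> 0 <= N.
Proof. intros (_ & _ & H). eapply Rle_trans; [apply Rabs_pos|apply (H 0)]. Qed.

Lemma test_function_plus (N L : R) (f g : R -> R) : test_function N f -> test_function L g ->
  test_function (N + L) (fun x => f x + g x).
Proof.
  intros (F1 & F2 & F3) (G1 & G2 & G3). split; [|split]; intros x.
  - now apply (continuous_plus f g).
  - intros Hx. rewrite F2, G2 by auto. ring.
  - eapply Rle_trans; [apply Rabs_triang|]. specialize (F3 x). specialize (G3 x). lra.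
Qed.

Lemma test_function_mult (N L : R) (f g : R -> R) : test_function N g ->
  (forall x, continuous f x) -> (forall x, 1 <= x <= 5 / 2 -> Rabs (f x) <= L) ->
  test_function (L * N) (fun x => f x * g x).
Proof.
  intros HG F1 F3. assert (HN := test_function_pos N g HG). destruct HG as (G1 & G2 & G3).
  assert (HL : 0 <= L) by (eapply Rle_trans; [apply Rabs_pos|apply (F3 1); lra]).
  split; [|split]; intros x.
  - now apply (continuous_mult f g).
  - intros Hx. rewrite G2 by auto. ring.
  - rewrite Rabs_mult. destruct (Rle_dec x 1) as [H1|H1].
    { rewrite G2, Rabs_R0, Rmult_0_r by auto. now apply Rmult_le_pos. }
    destruct (Rle_dec (5 / 2) x) as [H2|H2].
    { rewrite G2, Rabs_R0, Rmult_0_r by auto. now apply Rmult_le_pos. }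
    apply Rmult_le_compat; try apply Rabs_pos; auto. apply F3; lra.
Qed.

(** The Laplace transform with the sign convention exp(u s), used for Re s <= 0. *)
Definition laplace (g : R -> R) (s : C) : C :=
  Cintegral (fun u => RtoC (g u) * Cexp (RtoC u * s))%C.

Lemma test_function_Cdecays (N L : R) (g : R -> R) (F : R -> C) : test_function N g ->
  (forall u, continuous_RC (fun u => RtoC (g u) * F u)%C u) ->
  (forall u, 1 <= u <= 5 / 2 -> Cmod (F u) <= L) ->
  Cdecays (8 * (N * L)) (fun u => RtoC (g u) * F u)%C.
Proof.
  intros HG HC HL. assert (HN := test_function_pos N g HG). destruct HG as (G1 & G2 & G3).
  split; auto. intros u.
  assert (HL0 : 0 <= L) by (eapply Rle_trans; [apply Cmod_ge_0|apply (HL 1); lra]).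
  assert (Z : g u = 0 -> Cmod (RtoC (g u) * F u)%C <= 8 * (N * L) / (1 + u ^ 2)).
  { intros Z. rewrite Z, Cmult_0_l, Cmod_0. apply Rmult_le_pos.
    - apply Rmult_le_pos; [lra|now apply Rmult_le_pos].
    - left. apply Rinv_0_lt_compat, sq_pos. }
  destruct (Rle_dec u 1) as [H1|H1]; [apply Z; auto|].
  destruct (Rle_dec (5 / 2) u) as [H2|H2]; [apply Z; auto|].
  rewrite Cmod_mult, Cmod_R.
  apply Rmult_le_reg_r with (1 + u ^ 2); [apply sq_pos|].
  unfold Rdiv. rewrite (Rmult_assoc (8 * _)), Rinv_l, Rmult_1_r by apply Rgt_not_eq, sq_pos.
  rewrite (Rmult_comm 8). apply Rmult_le_compat.
  - apply Rmult_le_pos; [apply Rabs_pos|apply Cmod_ge_0].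
  - left; apply sq_pos.
  - apply Rmult_le_compat; auto; [apply Rabs_pos|apply Cmod_ge_0|]. apply HL; lra.
  - nra.
Qed.

Lemma Re_RtoC_mult (r : R) (z : C) : Re (RtoC r * z)%C = r * Re z.
Proof. unfold Re, RtoC, Cmult; simpl. ring. Qed.

Lemma Im_RtoC_mult (r : R) (z : C) : Im (RtoC r * z)%C = r * Im z.
Proof. unfold Re, Im, RtoC, Cmult; simpl. ring. Qed.

Lemma complex_derivative_Cexp_linear (c z : C) :
  complex_derivative (fun z => Cexp (c * z)) z (Cexp (c * z) * c)%C.
Proof.
  apply complex_derivative_Cexp_comp.
  replace c with (c * RtoC 1)%C at 2 by ring.
  apply complex_derivative_scal, complex_derivative_id.
Qed.

Lemma Cexp_line_continuous (s : C) (u : R) : continuous_RC (fun u => Cexp (RtoC u * s)) u.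
Proof.
  apply (continuous_RC_comp (fun z => Cexp (z * s)) RtoC).
  - apply (continuous_RC_RtoC (fun u => u)), continuous_id.
  - eapply complex_derivative_continuous. apply complex_derivative_Cexp_comp.
    apply complex_derivative_mult; [apply complex_derivative_id|apply complex_derivative_const].
Qed.

Lemma Cmod_Cexp_line (s : C) (u : R) : Re s <= 0 -> 0 <= u -> Cmod (Cexp (RtoC u * s)) <= 1.
Proof.
  intros Hs Hu. rewrite Cmod_Cexp, Re_RtoC_mult, <- exp_0.
  apply Rnot_lt_le. intros H. apply exp_lt_inv in H.
  assert (u * Re s <= u * 0) by now apply Rmult_le_compat_l. lra.
Qed.

Lemma laplace_decays (N : R) (g : R -> R) (s : C) : test_function N g -> Re s <= 0 ->
  Cdecays (8 * (N * 1)) (fun u => RtoC (g u) * Cexp (RtoC u * s))%C.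
Proof.
  intros HG Hs. apply test_function_Cdecays; auto.
  - intros u. apply continuous_RC_mult; [|apply Cexp_line_continuous].
    apply continuous_RC_RtoC, HG.
  - intros u Hu. apply Cmod_Cexp_line; auto; lra.
Qed.

Lemma laplace_bound (N : R) (g : R -> R) (s : C) : test_function N g -> Re s <= 0 ->
  Cmod (laplace g s) <= 64 * N.
Proof.
  intros HG Hs. eapply Rle_trans; [apply Cintegral_bound, (laplace_decays N g s HG Hs)|]. lra.
Qed.

Lemma test_function_id_mult (N : R) (g : R -> R) : test_function N g ->
  test_function (5 / 2 * N) (fun u => u * g u).
Proof.
  intros HG. apply (test_function_mult N (5 / 2) (fun u => u)); auto.
  - intros x. apply continuous_id.
  - intros x Hx. rewrite Rabs_pos_eq; lra.
Qed.

Lemma laplace_derivative (N : R) (g : R -> R) (s : C) : test_function N g -> Re s < 0 ->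
  complex_derivative (laplace g) s (laplace (fun u => u * g u) s).
Proof.
  intros HG Hs.
  (* The radius - Re s keeps the segment from s to w where the real part is at most 0, so that the
     exponentials have modulus at most 1. In the constant, 36 = 4 * 9 with u^2 <= 9 on the
     support. *)
  apply (complex_derivative_quadratic _ _ _ (- Re s) (8 * (8 * (N * 36)))); [lra|].
  intros w Hw.
  assert (Hseg : forall t, 0 <= t <= 1 -> Re (s + RtoC t * (w - s))%C <= 0).
  { intros t Ht. assert (R1 := re_le_Cmod (w - s)%C). apply Rabs_le_between in R1.
    replace (Re (s + RtoC t * (w - s))%C) with (Re s + t * Re (w - s)%C)
      by (unfold Re, RtoC, Cmult, Cplus; simpl; ring).
    destruct (Rle_dec (Re (w - s)%C) 0) as [H|H].
    - assert (t * Re (w - s)%C <= t * 0) by (apply Rmult_le_compat_l; lra). lra.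
    - assert (t * Re (w - s)%C <= 1 * Re (w - s)%C) by (apply Rmult_le_compat_r; lra). lra. }
  assert (Hw0 : Re w <= 0).
  { replace w with (s + RtoC 1 * (w - s))%C by ring. apply Hseg; lra. }
  assert (D1 := laplace_decays N g w HG Hw0).
  assert (D2 := laplace_decays N g s HG (Rlt_le _ _ Hs)).
  assert (D3 := laplace_decays _ _ s (test_function_id_mult N g HG) (Rlt_le _ _ Hs)).
  assert (D := Cdecays_plus _ _ _ _ (Cdecays_plus _ _ _ _ D1 (Cdecays_scal _ (RtoC (-1)) _ D2))
    (Cdecays_scal _ (- (w - s))%C _ D3)).
  replace (laplace g w - laplace g s - (w - s) * laplace (fun u => (u * g u)%R) s)%C with
    (laplace g w + RtoC (-1) * laplace g s + (- (w - s)) * laplace (fun u => (u * g u)%R) s)%C by ring.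
  unfold laplace. rewrite <- (Cintegral_scal _ (RtoC (-1)) _ D2), <- (Cintegral_scal _ (- (w - s))%C _ D3).
  rewrite <- (Cintegral_plus _ _ _ _ D1 (Cdecays_scal _ (RtoC (-1)) _ D2)).
  rewrite <- (Cintegral_plus _ _ _ _ (Cdecays_plus _ _ _ _ D1 (Cdecays_scal _ (RtoC (-1)) _ D2))
    (Cdecays_scal _ (- (w - s))%C _ D3)).
  set (F := fun u => (Cexp (RtoC u * w) - Cexp (RtoC u * s) - (w - s) * (Cexp (RtoC u * s) * RtoC u))%C).
  assert (E : forall u, (RtoC (g u) * Cexp (RtoC u * w) + RtoC (-1) * (RtoC (g u) * Cexp (RtoC u * s)) +
     - (w - s) * (RtoC (u * g u)%R * Cexp (RtoC u * s)))%C = (RtoC (g u) * F u)%C).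
  { intros u. unfold F. rewrite RtoC_mult. ring. }
  rewrite (Cintegral_ext _ _ E).
  replace (8 * (8 * (N * 36)) * Cmod (w - s)%C ^ 2) with (8 * (8 * (N * (36 * Cmod (w - s)%C ^ 2)))) by ring.
  apply Cintegral_bound. apply test_function_Cdecays; auto.
  - intros u. apply (proj1 (Cdecays_ext _ _ _ E D)).
  - intros u Hu. unfold F. replace 36 with (4 * 9) by ring.
    apply (complex_taylor_order2 (fun z => Cexp (RtoC u * z)) (fun z => Cexp (RtoC u * z) * RtoC u)%C
      (fun z => Cexp (RtoC u * z) * RtoC u * RtoC u)%C).
    + intros t _. apply complex_derivative_Cexp_linear.
    + intros t _.
      assert (A := complex_derivative_scal (RtoC u) _ _ _
        (complex_derivative_Cexp_linear (RtoC u) (s + RtoC t * (w - s))%C)).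
      replace (Cexp (RtoC u * (s + RtoC t * (w - s))) * RtoC u * RtoC u)%C with
        (RtoC u * (Cexp (RtoC u * (s + RtoC t * (w - s))) * RtoC u))%C by ring.
      refine (complex_derivative_ext _ _ _ _ _ A). intros; ring.
    + intros t Ht. rewrite !Cmod_mult, Cmod_R, (Rabs_pos_eq u) by lra.
      assert (B := Cmod_Cexp_line _ u (Hseg t Ht) ltac:(lra)). rewrite Rmult_assoc.
      rewrite <- (Rmult_1_l 9). apply Rmult_le_compat; try nra. apply Cmod_ge_0.
Qed.

Lemma laplace_parts (N L : R) (g dg : R -> R) (s : C) : test_function N g -> test_function L dg ->
  (forall x, is_derive g x (dg x)) -> Re s <= 0 -> (s * laplace g s)%C = (- laplace dg s)%C.
Proof.
  intros HG HD Hd Hs.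
  assert (D1 := laplace_decays N g s HG Hs). assert (D2 := laplace_decays L dg s HD Hs).
  assert (Z : Cintegral (fun u => RtoC (dg u) * Cexp (RtoC u * s) +
     s * (RtoC (g u) * Cexp (RtoC u * s)))%C = 0).
  { apply (Cintegral_derive _ (4 * N) _ (fun u => RtoC (g u) * Cexp (RtoC u * s))%C
      (Cdecays_plus _ _ _ _ D2 (Cdecays_scal _ s _ D1))).
    - intros u.
      assert (A : complex_derivative (fun z => Cexp (z * s)) (RtoC u) (Cexp (RtoC u * s) * s)%C).
      { refine (complex_derivative_ext _ _ _ _ (fun z => f_equal Cexp (Cmult_comm s z)) _).
        rewrite (Cmult_comm (RtoC u) s). apply complex_derivative_Cexp_linear. }
      apply complex_derivative_real in A. destruct A as [A1 A2].
      assert (E : (RtoC (dg u) * Cexp (RtoC u * s) + s * (RtoC (g u) * Cexp (RtoC u * s)))%C =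
        (RtoC (dg u) * Cexp (RtoC u * s) + RtoC (g u) * (Cexp (RtoC u * s) * s))%C) by ring.
      rewrite E. split.
      + apply (is_derive_ext (fun u => g u * Re (Cexp (RtoC u * s)))).
        { intros t. symmetry. apply Re_RtoC_mult. }
        replace (Re _) with (dg u * Re (Cexp (RtoC u * s)) + g u * Re (Cexp (RtoC u * s) * s)%C)
          by (rewrite <- !Re_RtoC_mult; reflexivity).
        apply (is_derive_mult (K := R_AbsRing) g (fun u => Re (Cexp (RtoC u * s)))); auto.
        apply Rmult_comm.
      + apply (is_derive_ext (fun u => g u * Im (Cexp (RtoC u * s)))).
        { intros t. symmetry. apply Im_RtoC_mult. }
        replace (Im _) with (dg u * Im (Cexp (RtoC u * s)) + g u * Im (Cexp (RtoC u * s) * s)%C)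
          by (rewrite <- !Im_RtoC_mult; reflexivity).
        apply (is_derive_mult (K := R_AbsRing) g (fun u => Im (Cexp (RtoC u * s)))); auto.
        apply Rmult_comm.
    - intros u. assert (HN := test_function_pos N g HG). destruct HG as (G1 & G2 & G3).
      destruct (Rle_dec u 1) as [H1|H1].
      { rewrite G2, Cmult_0_l, Cmod_0, Rmult_0_l by auto. lra. }
      destruct (Rle_dec (5 / 2) u) as [H2|H2].
      { rewrite G2, Cmult_0_l, Cmod_0, Rmult_0_l by auto. lra. }
      rewrite Cmod_mult, Cmod_R, Rmult_comm. rewrite (Rabs_pos_eq u) by lra.
      assert (B := Cmod_Cexp_line s u Hs ltac:(lra)).
      apply Rmult_le_compat; try lra.
      + apply Rmult_le_pos; [apply Rabs_pos|apply Cmod_ge_0].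
      + rewrite <- (Rmult_1_r N). apply Rmult_le_compat; auto; [apply Rabs_pos|apply Cmod_ge_0]. }
  rewrite (Cintegral_plus _ _ _ _ D2 (Cdecays_scal _ s _ D1)), (Cintegral_scal _ s _ D1) in Z.
  fold (laplace g s) in Z. fold (laplace dg s) in Z.
  replace (s * laplace g s)%C with (laplace dg s + s * laplace g s - laplace dg s)%C by ring.
  rewrite Z. ring.
Qed.

(** * Iterating the operator that sends g to the second derivative of u g *)

Definition test_chain (N : nat -> R) (G : nat -> R -> R) : Prop :=
  derivative_chain G /\ forall k, test_function (N k) (G k).

(* [second_derivative_id_mult G k] is the [k]-th derivative of [(u G)'']. *)
Definition second_derivative_id_mult (G : nat -> R -> R) (k : nat) (u : R) : R :=
  u * G (S (S k)) u + (INR k + 2) * G (S k) u.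

Lemma second_derivative_id_mult_chain (N : nat -> R) (G : nat -> R -> R) : test_chain N G ->
  test_chain (fun k => 5 / 2 * N (S (S k)) + (INR k + 2) * N (S k)) (second_derivative_id_mult G).
Proof.
  intros [HG HN]. split.
  - intros k x. unfold second_derivative_id_mult.
    assert (D := is_derive_plus (fun u => u * G (S (S k)) u) (fun u => (INR k + 2) * G (S k) u) x _ _
      (is_derive_mult (K := R_AbsRing) (fun u => u) (G (S (S k))) x _ _ (is_derive_id x) (HG _ x) Rmult_comm)
      (is_derive_scal (G (S k)) x (INR k + 2) _ (HG _ x))).
    refine (eq_rect _ (fun l => is_derive _ x l) D _ _).
    rewrite S_INR. unfold plus, mult, one; simpl. ring.
  - intros k. apply test_function_plus; [now apply test_function_id_mult|].
    apply (test_function_mult _ _ (fun _ => INR k + 2)); auto.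
    + intros x. apply continuous_const.
    + intros x _. rewrite Rabs_pos_eq; generalize (pos_INR k); lra.
Qed.

Lemma Ci_div_Re (z : C) : upper_half_plane z -> Re (- Ci * / z)%C < 0.
Proof.
  unfold upper_half_plane. intros Hz. destruct z as [x y]. simpl in *.
  assert (P : 0 < x ^ 2 + y ^ 2) by (generalize (pow2_ge_0 x) (pow_lt y 2 Hz); lra).
  simpl in P.
  replace (- 0 * (x / (x * (x * 1) + y * (y * 1))) - - (1) * (- y / (x * (x * 1) + y * (y * 1))))
    with (- (y / (x * (x * 1) + y * (y * 1)))) by (field; lra).
  assert (0 < y / (x * (x * 1) + y * (y * 1))) by now apply Rdiv_lt_0_compat. lra.
Qed.

(* [d/dz exp(- i u / z) = - i d^2/du^2 (exp(- i u / z)) * u], integrated by parts twice. *)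
Lemma laplace_inverse_derivative (N : nat -> R) (G : nat -> R -> R) (z : C) : test_chain N G ->
  upper_half_plane z ->
  complex_derivative (fun z => laplace (G 0%nat) (- Ci * / z)%C) z
    (- Ci * laplace (second_derivative_id_mult G 0%nat) (- Ci * / z))%C.
Proof.
  intros HG Hz. assert (HG2 := second_derivative_id_mult_chain N G HG). destruct HG as [HG HN].
  assert (Hz0 : z <> RtoC 0) by (intros E; rewrite E in Hz; red in Hz; simpl in Hz; lra).
  set (s := (- Ci * / z)%C).
  assert (Hs : Re s < 0) by now apply Ci_div_Re.
  assert (A := complex_derivative_comp (laplace (G 0%nat)) (fun z => - Ci * / z)%C z _ _
    (laplace_derivative _ _ s (HN 0%nat) Hs)
    (complex_derivative_scal (- Ci)%C Cinv z _ (complex_derivative_inv z Hz0))).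
  fold s in A.
  assert (T1 : test_function (5 / 2 * N 1%nat + 1 * N 0%nat) (fun u => u * G 1%nat u + 1 * G 0%nat u)).
  { apply test_function_plus; [now apply test_function_id_mult|].
    apply (test_function_mult _ _ (fun _ => 1)); auto.
    - intros x. apply continuous_const.
    - intros x _. rewrite Rabs_R1; lra. }
  assert (P1 : (s * laplace (fun u => (u * G 0%nat u)%R) s)%C = (- laplace (fun u => (u * G 1%nat u + 1 * G 0%nat u)%R) s)%C).
  { apply (laplace_parts _ _ _ _ s (test_function_id_mult _ _ (HN 0%nat)) T1); [|lra].
    intros x.
    assert (D := is_derive_mult (K := R_AbsRing) (fun u => u) (G 0%nat) x _ _ (is_derive_id x) (HG 0%nat x) Rmult_comm).
    refine (eq_rect _ (fun l => is_derive _ x l) D _ _). unfold plus, mult, one; simpl. ring. }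
  assert (P2 : (s * laplace (fun u => (u * G 1%nat u + 1 * G 0%nat u)%R) s)%C =
    (- laplace (second_derivative_id_mult G 0%nat) s)%C).
  { apply (laplace_parts _ _ _ _ s T1 (proj2 HG2 0%nat)); [|lra].
    intros x.
    assert (D := is_derive_plus (fun u => u * G 1%nat u) (fun u => 1 * G 0%nat u) x _ _
      (is_derive_mult (K := R_AbsRing) (fun u => u) (G 1%nat) x _ _ (is_derive_id x) (HG 1%nat x) Rmult_comm)
      (is_derive_scal (G 0%nat) x 1 _ (HG 0%nat x))).
    refine (eq_rect _ (fun l => is_derive _ x l) D _ _).
    unfold second_derivative_id_mult, plus, mult, one; simpl. ring. }
  replace (- Ci * laplace (second_derivative_id_mult G 0%nat) s)%C with
    (laplace (fun u => (u * G 0%nat u)%R) s * (- Ci * - / (z * z)))%C; [exact A|].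
  (* The chain rule gives ds/dz = - i s^2, and each factor s is moved onto the function by one
     integration by parts ([P1], [P2]). *)
  replace (laplace (second_derivative_id_mult G 0%nat) s) with
    (s * (s * laplace (fun u => (u * G 0%nat u)%R) s))%C.
  2: { rewrite P1. replace (s * - laplace (fun u => (u * G 1%nat u + 1 * G 0%nat u)%R) s)%C with
         (- (s * laplace (fun u => (u * G 1%nat u + 1 * G 0%nat u)%R) s))%C by ring. rewrite P2. ring. }
  set (l := laplace _ s). unfold s.
  replace (- Ci * (- Ci * / z * (- Ci * / z * l)))%C with ((Ci * Ci) * - Ci * (/ z * / z) * l)%C by ring.
  replace (Ci * Ci)%C with (- (1))%C by (apply Ceq_components; simpl; ring).
  field. auto.
Qed.

Lemma test_function_le (N L : R) (g : R -> R) : N <= L -> test_function N g -> test_function L g.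
Proof. intros H (G1 & G2 & G3). split; [|split]; auto. intros x. specialize (G3 x). lra. Qed.

(** The terms decrease, so (k + 1) / n_k is at most the sum of the first k + 1 of them. *)
Lemma nondecreasing_series_linear (n : nat -> R) (S0 : R) (k : nat) : (forall k, 0 < n k) ->
  (forall k, n k <= n (S k)) -> is_series (fun k => / n k) S0 -> INR k + 1 <= S0 * n k.
Proof.
  intros Hn Hmono HS.
  assert (Hle : forall i j, (i <= j)%nat -> n i <= n j).
  { intros i j H. induction H; [lra|]. eapply Rle_trans; [apply IHle|apply Hmono]. }
  assert (Hpos : forall j, 0 < / n j) by (intros; now apply Rinv_0_lt_compat).
  assert (A : sum_n (fun k => / n k) k <= S0).
  { apply (is_lim_seq_incr_compare (sum_n (fun k => / n k)) S0); auto.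
    intros m. rewrite sum_Sn. unfold plus; simpl. specialize (Hpos (S m)). lra. }
  assert (B : forall m, (m <= k)%nat -> (INR m + 1) * / n k <= sum_n (fun k => / n k) m).
  { induction m as [|m IH]; intros Hm.
    - rewrite sum_O. simpl. rewrite Rplus_0_l, Rmult_1_l. apply Rinv_le_contravar; auto.
    - rewrite sum_Sn, S_INR. unfold plus; simpl. specialize (IH ltac:(lia)).
      assert (/ n k <= / n (S m)) by (apply Rinv_le_contravar; auto). lra. }
  specialize (B k (le_n k)). apply Rmult_le_reg_r with (/ n k); auto.
  rewrite (Rmult_assoc S0), Rinv_r, Rmult_1_r by apply Rgt_not_eq, Hn. lra.
Qed.

Lemma half_step_mono (M : nat -> R) (k : nat) : (forall p, 0 < M p) -> lc M ->
  half_step M k <= half_step M (S k).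
Proof.
  intros HM Hlc. destruct (Nat.Even_or_Odd k) as [[p ->]|[p ->]].
  - rewrite half_step_odd, half_step_even. lra.
  - replace (S (2 * p + 1)) with (2 * S p)%nat by lia.
    replace (2 * p + 1)%nat with (S (2 * p)) by lia.
    rewrite half_step_odd, half_step_even, S_INR. apply sqrt_le_1_alt.
    assert (A := lc_quotient_mono M p HM Hlc). assert (B := quotient_pos M p HM).
    apply Rmult_le_compat; try lra; generalize (pos_INR p); lra.
Qed.

(* [k + 2 <= S0 n_{2 p + k + 1}] absorbs the lower-order term of [(u G)'']. *)
Lemma second_derivative_id_mult_iter (n : nat -> R) (h S0 : R) (G : nat -> R -> R) (p : nat) :
  (forall k, 0 < n k) -> (forall k, INR k + 1 <= S0 * n k) -> 0 < h ->
  test_chain (fun k => h ^ k * rising_product n k) G ->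
  test_chain (fun k => (5 / 2 + S0 / h) ^ p * (h ^ (2 * p + k) * rising_product n (2 * p + k)))
    (Nat.iter p second_derivative_id_mult G).
Proof.
  (* Besides two derivatives, one application of the operator costs 5/2 for the factor u on the
     support and S0 / h for the lower-order term. *)
  intros Hn HS Hh HG. set (Q := 5 / 2 + S0 / h).
  assert (HS0 : 0 <= S0).
  { apply Rmult_le_reg_r with (n 0%nat); auto. specialize (HS 0%nat). simpl in HS. lra. }
  assert (HQ : 0 <= Q).
  { assert (0 <= S0 / h) by (apply Rmult_le_pos; [lra|left; now apply Rinv_0_lt_compat]). unfold Q; lra. }
  induction p as [|p [IH1 IH2]].
  - split; [apply HG|]. intros k. eapply test_function_le; [|apply HG]. simpl. lra.
  - destruct (second_derivative_id_mult_chain _ _ (conj IH1 IH2)) as [C1 C2].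
    split; [exact C1|]. intros k. eapply test_function_le; [|exact (C2 k)]. cbv beta.
    replace (2 * S p + k)%nat with (S (S (2 * p + k))) by lia.
    replace (2 * p + S (S k))%nat with (S (S (2 * p + k))) by lia.
    replace (2 * p + S k)%nat with (S (2 * p + k)) by lia.
    set (m := (2 * p + k)%nat).
    assert (Hm : INR k + 2 <= S0 * n (S m)).
    { specialize (HS (S m)). rewrite S_INR in HS. assert (INR k <= INR m) by (apply le_INR; unfold m; lia). lra. }
    assert (P : 0 <= Q ^ p * (h ^ S m * rising_product n (S m))).
    { apply Rmult_le_pos; [now apply pow_le|]. apply Rmult_le_pos; [left; now apply pow_lt|].
      left. now apply rising_product_pos. }
    apply Rle_trans with (5 / 2 * (Q ^ p * (h ^ S (S m) * rising_product n (S (S m)))) +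
      S0 * n (S m) * (Q ^ p * (h ^ S m * rising_product n (S m)))).
    + apply Rplus_le_compat_l. now apply Rmult_le_compat_r.
    + right. simpl rising_product. simpl pow. unfold Q at 3. field. lra.
Qed.

Section Laplace_family.

Variables (N : nat -> nat -> R) (G : nat -> R -> R).
Hypothesis HG : forall p, test_chain (N p) (Nat.iter p second_derivative_id_mult G).

Let f (z : C) : C := laplace (G 0%nat) (- Ci * / z)%C.

Let f_p (p : nat) (z : C) : C :=
  ((- Ci) ^ p * laplace (Nat.iter p second_derivative_id_mult G 0%nat) (- Ci * / z))%C.

Let f_p_derivative (p : nat) (z : C) : upper_half_plane z -> complex_derivative (f_p p) z (f_p (S p) z).
Proof.
  intros Hz. unfold f_p. rewrite Cpow_S, (Cmult_comm (- Ci)), <- Cmult_assoc.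
  apply complex_derivative_scal. apply (laplace_inverse_derivative (N p)); auto.
Qed.

Let C_derive_n_f (p : nat) (z : C) : upper_half_plane z -> C_derive_n f p z = f_p p z.
Proof.
  revert z. induction p as [|p IH]; intros z Hz.
  - unfold f_p. simpl. unfold f. ring.
  - simpl. apply complex_derivative_unique.
    (* The induction hypothesis holds only in the upper half-plane, which contains the disc of
       radius Im z around z. *)
    apply (complex_derivative_ext_loc (f_p p) _ _ _ (Im z)); auto.
    intros w Hw. symmetry. apply IH. assert (A := im_le_Cmod (w - z)%C).
    replace (Im (w - z)%C) with (Im w - Im z) in A by (unfold Im, Cminus, Cplus, Copp; simpl; ring).
    apply Rabs_le_between in A. unfold upper_half_plane in *. lra.
Qed.

Let Cmod_f_p (p : nat) (z : C) :
  Cmod (f_p p z) = Cmod (laplace (Nat.iter p second_derivative_id_mult G 0%nat) (- Ci * / z)).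
Proof. unfold f_p. rewrite Cmod_mult, Cmod_pow, Cmod_opp, Cmod_Ci, pow1. ring. Qed.

Lemma laplace_inverse_A_space (M : nat -> R) (h K : R) : (forall p, 0 < M p) -> 0 < h ->
  (forall p, N p 0%nat <= K * weight M h p) -> A_space M (fun z => laplace (G 0%nat) (- Ci * / z)%C).
Proof.
  intros HM Hh HK. split.
  - intros z Hz. eexists. apply complex_derivative_is_derive.
    exact (laplace_inverse_derivative (N 0%nat) G z (HG 0%nat) Hz).
  - exists h. split; auto. exists (64 * K). intros p z Hz.
    apply (ratio_le_iff _ _ (weight M h p)); [now apply weight_pos|].
    fold f. rewrite C_derive_n_f, Cmod_f_p by auto.
    eapply Rle_trans.
    + apply (laplace_bound (N p 0%nat)); [apply HG|]. left. now apply Ci_div_Re.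
    + rewrite Rmult_assoc. apply Rmult_le_compat_l; [lra|apply HK].
Qed.

(** At s = - i / z, one integration by parts turns the transform of a test function into - i z times
    the transform of its derivative, which is bounded; so every derivative is O(|z|). *)
Lemma laplace_inverse_Borel (p : nat) : Borel (fun z => laplace (G 0%nat) (- Ci * / z)%C) p = 0.
Proof.
  apply boundary_limit_value. fold f. intros eps He.
  set (B := 64 * N p 1%nat).
  assert (HB : 0 <= B).
  { assert (A := test_function_pos _ _ (proj2 (HG p) 1%nat)). unfold B. lra. }
  exists (eps / (B + 1)). split; [apply Rdiv_lt_0_compat; lra|]. intros z Hz Hs.
  replace (C_derive_n f p z - 0)%C with (f_p p z) by (rewrite C_derive_n_f by auto; ring).
  rewrite Cmod_f_p. set (H := Nat.iter p second_derivative_id_mult G).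
  assert (Hz0 : z <> RtoC 0) by (intros E; rewrite E in Hz; red in Hz; simpl in Hz; lra).
  assert (Hs0 := Rlt_le _ _ (Ci_div_Re z Hz)).
  assert (P := laplace_parts _ _ _ _ _ (proj2 (HG p) 0%nat) (proj2 (HG p) 1%nat) (proj1 (HG p) 0%nat) Hs0).
  fold H in P.
  replace (laplace (H 0%nat) (- Ci * / z)) with (z * (- Ci) * laplace (H 1%nat) (- Ci * / z))%C.
  - rewrite !Cmod_mult, Cmod_opp, Cmod_Ci, Rmult_1_r.
    assert (A := laplace_bound _ _ _ (proj2 (HG p) 1%nat) Hs0). fold H in A. fold B in A.
    apply Rle_lt_trans with (Cmod z * B).
    + apply Rmult_le_compat_l; [apply Cmod_ge_0|auto].
    + apply Rmult_lt_compat_r with (r := B + 1) in Hs; [|lra].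
      replace (eps / (B + 1) * (B + 1)) with eps in Hs by (field; lra).
      generalize (Cmod_ge_0 z). lra.
  - replace (z * - Ci * laplace (H 1%nat) (- Ci * / z))%C with
      (z * Ci * (- laplace (H 1%nat) (- Ci * / z)))%C by ring.
    rewrite <- P.
    replace (z * Ci * (- Ci * / z * laplace (H 0%nat) (- Ci * / z)))%C with
      (- (Ci * Ci) * (z * / z) * laplace (H 0%nat) (- Ci * / z))%C by ring.
    rewrite Cinv_r by auto.
    replace (Ci * Ci)%C with (- (1))%C by (apply Ceq_components; simpl; ring). ring.
Qed.

(** At z = i the exponential is exp(- u), so the integrand is real and nonnegative. *)
Lemma laplace_inverse_Ci_pos : (forall u, 0 <= G 0%nat u) -> 0 < G 0%nat (3 / 2) ->
  0 < Re (laplace (G 0%nat) (- Ci * / Ci)%C).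
Proof.
  intros H1 H2.
  assert (E : (- Ci * / Ci)%C = RtoC (-1)).
  { replace (RtoC (-1)) with (- (1))%C by (apply Ceq_components; simpl; ring).
    field. intros E. apply (f_equal Im) in E. simpl in E. lra. }
  rewrite E.
  assert (D := laplace_decays _ _ (RtoC (-1)) (proj2 (HG 0%nat) 0%nat) ltac:(simpl; lra)).
  assert (Ex : forall u, Re (RtoC (G 0%nat u) * Cexp (RtoC u * RtoC (-1)))%C = G 0%nat u * exp (- u)).
  { intros u. rewrite Re_RtoC_mult, <- RtoC_mult. unfold Cexp. simpl. rewrite cos_0. f_equal.
    rewrite Rmult_1_r. f_equal. ring. }
  apply (integral_gt0 _ (3 / 2)).
  - exact (proj1 (Cdecays_integrable _ _ D)).
  - intros u. rewrite Ex. apply Rmult_le_pos; auto. left; apply exp_pos.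
  - rewrite Ex. apply Rmult_lt_0_compat; auto. apply exp_pos.
Qed.

End Laplace_family.

Lemma A_space_zero (M : nat -> R) : (forall p, 0 < M p) ->
  A_space M (fun _ => RtoC 0) /\ forall p, Borel (fun _ => RtoC 0) p = 0.
Proof.
  intros HM.
  assert (E : forall p z, C_derive_n (fun _ => RtoC 0) p z = 0).
  { induction p as [|p IH]; intros z; [reflexivity|]. simpl. apply complex_derivative_unique.
    refine (complex_derivative_ext (fun _ => RtoC 0) _ _ _ (fun w => eq_sym (IH w)) _).
    apply complex_derivative_const. }
  split; [split|].
  - intros z _. eexists. apply complex_derivative_is_derive, complex_derivative_const.
  - exists 1. split; [lra|]. exists 0. intros p z _. rewrite E, Cmod_0. unfold Rdiv. lra.
  - intros p. apply boundary_limit_value. intros eps He. exists 1. split; [lra|].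
    intros z _ _. rewrite E. replace (0 - 0)%C with (RtoC 0) by ring. now rewrite Cmod_0.
Qed.

Lemma A_space_not_injective (M : nat -> R) : (forall p, 0 < M p) -> M 0%nat = 1 -> lc M ->
  ~ is_lim_seq (sum_n (fun p => 1 / sqrt ((INR p + 1) * quotient M p))) p_infty ->
  ~ injective_map upper_half_plane (A_space M) (Lambda M) Borel.
Proof.
  intros HM HM0 Hlc Hn [_ Hinj].
  assert (Hhs : forall k, 0 < half_step M k) by (intros; now apply half_step_pos).
  assert (Hser := half_step_ex_series M HM Hn).
  destruct (bump_exists _ Hhs Hser) as (G & h & Hh & G1 & G2 & G3 & G4 & G5).
  destruct Hser as [S0 HS].
  assert (HS0 := fun k => nondecreasing_series_linear _ S0 k Hhs (fun k => half_step_mono M k HM Hlc) HS).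
  assert (HG : test_chain (fun k => h ^ k * rising_product (half_step M) k) G).
  { split; auto. intros k. split; [|split; auto]. intros x. now apply chain_continuous. }
  assert (HGp := fun p => second_derivative_id_mult_iter _ h S0 G p Hhs HS0 Hh HG).
  assert (HS1 : 0 < S0).
  { apply Rmult_lt_reg_r with (half_step M 0); auto. specialize (HS0 0%nat). simpl in HS0. lra. }
  assert (HQ : 0 < 5 / 2 + S0 / h) by (assert (0 < S0 / h) by (now apply Rdiv_lt_0_compat); lra).
  assert (Hh2 : 0 < h ^ 2) by now apply pow_lt.
  destruct (A_space_zero M HM) as [Z1 Z2].
  set (F := fun z => laplace (G 0%nat) (- Ci * / z)%C).
  assert (E : F Ci = RtoC 0).
  { apply (Hinj F (fun _ => RtoC 0)); auto.
    - apply (laplace_inverse_A_space _ G HGp M ((5 / 2 + S0 / h) * h ^ 2) 1); auto.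
      + now apply Rmult_lt_0_compat.
      + intros p. cbv beta. rewrite Nat.add_0_r, half_step_weight, weight_scal by auto. lra.
    - intros p. rewrite Z2. exact (laplace_inverse_Borel _ G HGp p).
    - unfold upper_half_plane. simpl. lra. }
  assert (P := laplace_inverse_Ci_pos _ G HGp G3 G4). fold (F Ci) in P. rewrite E in P. simpl in P. lra.
Qed.

Theorem theorem3p4 (M A : nat -> R)
    (hM : weight_sequence M) (hM_lc : lc M) (hM_dc : dc M)
    (hA : weight_sequence A) (hA_wlc : wlc A) (hA_nq : nq A) :
  let i := is_lim_seq
    (sum_n (fun p => 1 / sqrt ((INR p + 1) * quotient M p))) p_infty in
  let ii := injective_map upper_half_plane (A_space M) (Lambda M) Borel in
  let iii := injective_map (fun x => 0 <= x) (C_space M) (Lambda M) moment in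
  let iv := injective_map (fun x => 0 <= x) (S_space M) (Lambda M) moment in
  let v := injective_map (fun x => 0 <= x) (SA_space M A) (Lambda M) moment in
  (i <-> ii) /\ (i <-> iii) /\ (i <-> iv) /\ (i <-> v).
Proof.
  intros i ii iii iv v.
  destruct hM as (hM0 & hM_pos & _). destruct hA as (hA0 & hA_pos & _).
  assert (H12 : i -> ii) by now apply A_space_injective.
  assert (H13 : i -> iii) by now apply C_space_injective.
  assert (H34 : iii -> iv) by (apply injective_map_sub, S_space_C_space).
  assert (H45 : iv -> v).
  { apply injective_map_sub. intros phi. now apply SA_space_S_space. }
  (* A convergent series yields a counterexample to each kind of injectivity, so the converses go by
     contraposition. *)
  assert (H21 : ii -> i).
  { intros H. apply NNPP. intros Hn. now apply (A_space_not_injective M). }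
  assert (H51 : v -> i).
  { intros H. apply NNPP. intros Hn. now apply (SA_space_not_injective M A). }
  tauto.
Qed.
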